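(* Let $\Omega\subset\mathbb{R}^2$, $(A,b,c)$, $f\in L^2(\Omega)$, $V=H^2(\Omega)\cap H^1_0(\Omega)$, $a$, $F$, the triangulation $\mathcal{T}_H$, the quantities of interest $q_1,\dots,q_N$, the fine-scale space $W$, the projectors $\mathcal{C},\mathcal{C}^*:V\to W$, the spaces $\tilde U_H=(1-\mathcal{C})V$, $\tilde V_H=(1-\mathcal{C}^* )V$, and the constants $\alpha,C_a,\mu>0$ be as defined in the context. Then there exists a unique $\tilde u_H\in\tilde U_H$ such that $$a(\tilde u_H,\tilde v_H)=\langle F,\tilde v_H\rangle\qquad\forall\,\tilde v_H\in\tilde V_H.$$ Further, denoting by $u\in V$ the unique strong solution of $A:D^2u+b\cdot\nabla u-c\,u=f$ in $\Omega$, $u=0$ on $\partial\Omega$, the following hold: (i) $\|\tilde u_H\|_V\le\alpha^{-2}C_a\|F\|_{(\tilde V_H)^*}\le\alpha^{-2}\mu\,C_a\|f\|_{L^2(\Omega)}$. (ii) $u-\tilde u_H=\mathcal{C}u\in W$, and hence $\langle q_i,\tilde u_H\rangle=\langle q_i,u\rangle$ for all $i\in\{1,\dots,N\}$. (iii) There is a constant $C>0$, depending only on $\Omega$, $\rho$, $\zeta_1,\zeta_2,\delta,\lambda,\|b\|_{L^\infty(\Omega)},\|c\|_{L^\infty(\Omega)}$ (in particular independent of $H$ and $f$), such that $$\|u-\tilde u_H\|_{L^2(\Omega)}+H\|\nabla(u-\tilde u_H)\|_{L^2(\Omega)}\le C\,H^2\|f\|_{L^2(\Omega)}.$$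
   Context: **PDE setting.** $\Omega\subset\mathbb{R}^2$ is a bounded convex polygon, $f\in L^2(\Omega)$, $A\in L^\infty(\Omega;\mathbb{R}^{2\times2}_{\mathrm{sym}})$, $b\in L^\infty(\Omega;\mathbb{R}^2)$, $c\in L^\infty(\Omega)$ with $c\ge0$ a.e. There are $\zeta_1,\zeta_2>0$ with $\zeta_1|\xi|^2\le A\xi\cdot\xi\le\zeta_2|\xi|^2$ a.e. in $\Omega$ for all $\xi\in\mathbb{R}^2$. The Cordes condition holds ($|M|=\sqrt{M:M}$ is the Frobenius norm): - (C1) if $|b|=c=0$ a.e.: there is $\delta\in(0,1)$ with $\frac{|A|^2}{(\mathrm{tr}A)^2}\le\frac1{1+\delta}$ a.e.; set $\gamma:=\frac{\mathrm{tr}A}{|A|^2}$, $\lambda:=0$. - (C2) otherwise: there are $\delta\in(0,1)$, $\lambda\in(0,\infty)$ with $\frac{|A|^2+\frac1{2\lambda}|b|^2+\frac1{\lambda^2}c^2}{(\mathrm{tr}A+\frac1\lambda c)^2}\le\frac1{2+\delta}$ a.e.; set $\gamma:=\frac{\mathrm{tr}A+\frac1\lambda c}{|A|^2+\frac1{2\lambda}|b|^2+\frac1{\lambda^2}c^2}$. Let $V:=H^2(\Omega)\cap H^1_0(\Omega)$ with $\|\cdot\|_V:=\|\cdot\|_{H^2(\Omega)}$, $\|\cdot\|_{V,\omega}:=\|\cdot\|_{H^2(\omega)}$, $Lv:=A:D^2v+b\cdot\nabla v-c\,v$, $a(v_1,v_2):=(\gamma Lv_1,\Delta v_2-\lambda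 v_2)_{L^2(\Omega)}$ and $\langle F,v\rangle:=(\gamma f,\Delta v-\lambda v)_{L^2(\Omega)}$. It is known that the strong solution $u\in V$ is the unique $u\in V$ with $a(u,v)=\langle F,v\rangle$ for all $v\in V$. **Constants.** The following known estimates define $C_a,\alpha,\mu>0$: - $|a(v_1,v_2)|\le C_a\|v_1\|_{V,\omega_1\cap\omega_2}\|v_2\|_{V,\omega_1\cap\omega_2}$ for all subdomains $\omega_1,\omega_2\subset\Omega$ and $v_1,v_2\in V$ with $\mathrm{supp}(v_j)\subset\omega_j$ ($C_a$ depends only on $\zeta_1,\zeta_2,\lambda,\|b\|_{L^\infty},\|c\|_{L^\infty}$); in particular $|a(v_1,v_2)|\le C_a\|v_1\|_V\|v_2\|_V$. - $a(v,v)\ge\alpha\|v\|_V^2$ for all $v\in V$ ($\alpha$ depends only on $\mathrm{diam}(\Omega),\delta$). - $|\langle F,v\rangle|\le\mu\|f\|_{L^2(\Omega)}\|v\|_V$ for all $v\in V$ ($\mu$ depends only on $\zeta_1,\zeta_2,\lambda,\|b\|_{L^\infty},\|c\|_{L^\infty}$). **Mesh.** $\mathcal{T}_H$ is a regular (conforming) quasi-uniform triangulation of $\Omega$ into closed triangles, $H:=\max_T\mathrm{diam}(T)$, $\rho:=H^{-1}\min_T\rho_T>0$ with $\rho_T$ the diameter of the largest ball inscribed in $T$. $F_1,\dots,F_{N_1}$ are all edges (including boundary edges), each with a fixed unit normal $\nu$; $z_1,\dots,z_{N_2}$ are the interior vertices; $N:=N_1+N_2$. **Quantities of interest and spaces.**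 For $1\le i\le N_1$, $\langle q_i,v\rangle:=|F_i|^{-1}\int_{F_i}\nabla v\cdot\nu$; for $N_1<i\le N$, $\langle q_i,v\rangle:=v(z_{i-N_1})$ (well-defined on $V\subset C(\bar\Omega)$). $W:=\{v\in V:\langle q_i,v\rangle=0\ \forall i\in\{1,\dots,N\}\}$. For $v\in V$, $\mathcal{C}v,\mathcal{C}^*v\in W$ are the unique elements with $a(\mathcal{C}v,w)=a(v,w)$ and $a(w,\mathcal{C}^*v)=a(w,v)$ for all $w\in W$. $\tilde U_H:=(1-\mathcal{C})V$, $\tilde V_H:=(1-\mathcal{C}^* )V$ (with the norm $\|\cdot\|_V$). *)

(* Defs.v *)
From HB Require Import structures.
From mathcomp Require Import all_boot all_order all_algebra.
From mathcomp Require Import all_classical all_reals all_analysis.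

Set Implicit Arguments.
Unset Strict Implicit.
Unset Printing Implicit Defensive.

Import Order.TTheory GRing.Theory Num.Theory.
Import numFieldNormedType.Exports.

Local Open Scope classical_set_scope.
Local Open Scope ring_scope.

(* Elements of Lebesgue and Sobolev spaces on a domain Om are represented by
   total functions on R * R, of which only the values on Om matter, and only up
   to almost-everywhere equality there.  Measurability is with respect to the
   Borel sets: every class has a Borel representative. *)

Section Lebesgue_spaces.
Context {d : measure_display} {T : measurableType d} {R : realType}.
Implicit Types (mu : {measure set T -> \bar R}) (D : set T) (g : T -> R).

Definition inLp mu (p : \bar R) D g : Prop :=
  measurable_fun D g /\ ('N[mu]_p[EFin \o (g \_ D)] < +oo)%E.

Definition Lpnorm mu (p : \bar R) D g : R :=
  fine 'N[mu]_p[EFin \o (g \_ D)]%E.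

End Lebesgue_spaces.

Section Plane.
Context {R : realType}.
Local Notation pt := (R * R)%type.
Implicit Types (x y : pt) (M N : 'M[R]_2) (s : seq pt).

Definition coord x (i : 'I_2) : R := if i == ord0 then x.1 else x.2.
Definition basis (i : 'I_2) : pt := if i == ord0 then (1, 0) else (0, 1).
Definition dot x y : R := x.1 * y.1 + x.2 * y.2.

(* The library's own norm on R * R is the maximum norm. *)
Definition enorm x : R := Num.sqrt (dot x x).

Definition mdot M N : R := \sum_(i < 2) \sum_(j < 2) M i j * N i j.
Definition frob M : R := Num.sqrt (mdot M M).

Definition diam (S : set pt) : R :=
  sup [set r | exists x y, [/\ S x, S y & r = enorm (x - y)]].

Definition hull s : set pt :=
  [set x | exists w : 'I_(size s) -> R,
     [/\ forall i, 0 <= w i, \sum_i w i = 1 & x = \sum_i w i *: s`_i]].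

Definition convex_polygon (Om : set pt) : Prop :=
  Om !=set0 /\ exists s, Om = (hull s)°.

End Plane.

Section Sobolev.
Context {R : realType}.
Local Notation pt := (R * R)%type.
Implicit Types (Om om : set pt) (v g phi : pt -> R).

Definition leb2 := (@lebesgue_measure R \x @lebesgue_measure R)%E.

Definition L2 Om g : Prop := inLp leb2 2%:E Om g.
Definition L2norm Om g : R := Lpnorm leb2 2%:E Om g.
Definition L2ip Om g1 g2 : R := \int[leb2]_(x in Om) (g1 x * g2 x).
Definition Linf Om g : Prop := inLp leb2 +oo%E Om g.
Definition Linfnorm Om g : R := Lpnorm leb2 +oo%E Om g.

Fixpoint Ck (k : nat) phi : Prop :=
  continuous phi /\
  if k is k'.+1 then
    forall i, (forall x, derivable phi x (basis i)) /\ Ck k' ('D_(basis i) phi)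
  else True.

Definition smooth phi : Prop := forall k, Ck k phi.

Definition test_fun Om phi : Prop :=
  smooth phi /\
  let K := closure [set x | phi x != 0] in compact K /\ K `<=` Om.

Definition is_wD Om (i : 'I_2) v g : Prop :=
  L2 Om g /\
  forall phi, test_fun Om phi ->
    L2ip Om v ('D_(basis i) phi) = - L2ip Om g phi.

(* Some representative of the weak partial derivative (unique a.e. on Om) when
   it exists in L^2, and 0 otherwise; H1 and H2 below require existence. *)
Definition wD Om (i : 'I_2) v : pt -> R := xget (cst 0) [set g | is_wD Om i v g].

Definition grad Om v (x : pt) : pt := (wD Om ord0 v x, wD Om ord_max v x).

Definition hess Om v (x : pt) : 'M[R]_2 :=
  \matrix_(i, j) wD Om j (wD Om i v) x.

Definition lapl Om v (x : pt) : R := \tr (hess Om v x).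

Definition H1 Om v : Prop := L2 Om v /\ forall i, exists g, is_wD Om i v g.
Definition H2 Om v : Prop := H1 Om v /\ forall i, H1 Om (wD Om i v).

Definition H1norm Om v : R :=
  Num.sqrt (L2norm Om v ^+ 2 + L2norm Om (enorm \o grad Om v) ^+ 2).

(* H^2 norm over a part om of Om.  For open om the weak derivatives on om are
   the restrictions of those on Om, so this is the norm of H^2(om). *)
Definition H2norm_on Om om v : R :=
  Num.sqrt (L2norm om v ^+ 2 + L2norm om (enorm \o grad Om v) ^+ 2
            + L2norm om (frob \o hess Om v) ^+ 2).

Definition H10 Om v : Prop :=
  H1 Om v /\
  forall e : R, 0 < e -> exists2 phi, test_fun Om phi & H1norm Om (v \- phi) < e.

Definition V Om v : Prop := H2 Om v /\ H10 Om v.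
Definition Vnorm Om v : R := H2norm_on Om Om v.

(* Inclusion in om of the support of v, i.e. of the complement in Om of the
   largest relatively open set on which v vanishes a.e. *)
Definition supp_in Om v om : Prop :=
  forall x, Om x -> ~ om x ->
    exists2 U : set pt, open U /\ U x & v = cst 0 %[ae leb2 in U `&` Om].

Definition subdomain Om om : Prop := [/\ open om, connected om & om `<=` Om].

(* Value at z of the representative of v that is continuous on the closure of
   Om; such a representative exists and is unique there for v in H^2(Om). *)
Definition ptval Om v (z : pt) : R :=
  xget (cst 0) [set w : pt -> R | {within closure Om, continuous w} /\
                                  w = v %[ae leb2 in Om]] z.

(* A segment F is given by its endpoints and parametrized over [0, 1]. *)
Definition seg_at (F : pt * pt) (t : R) : pt := F.1 + t *: (F.2 - F.1).
Definition seg_len (F : pt * pt) : R := enorm (F.2 - F.1).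

(* The trace of g in H^1(Om) on a segment F of the closure of Om, as a function
   of the parameter: the L^2 limit of the restrictions to F of functions smooth
   up to the boundary that converge to g in H^1(Om). *)
Definition is_trace Om (F : pt * pt) g (tau : R -> R) : Prop :=
  inLp (@lebesgue_measure R) 2%:E `[0, 1]%classic tau /\
  exists phi : nat -> pt -> R,
    [/\ forall n, smooth (phi n),
        H1norm Om (phi n \- g) @[n --> \oo] --> (0 : R) &
        Lpnorm (@lebesgue_measure R) 2%:E `[0, 1]%classic
          ((phi n \o seg_at F) \- tau) @[n --> \oo] --> (0 : R)].

Definition trace Om F g : R -> R := xget (cst 0) [set tau | is_trace Om F g tau].

(* |F|^-1 times the arclength integral over F of (grad v).nu *)
Definition mean_flux Om (F : pt * pt) (nu : pt) v : R :=
  (seg_len F)^-1 *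
  (seg_len F *
   \int[@lebesgue_measure R]_(t in `[0, 1]%classic)
      dot (trace Om F (wD Om ord0 v) t, trace Om F (wD Om ord_max v) t) nu).

End Sobolev.

Section Operator.
Context {R : realType}.
Local Notation pt := (R * R)%type.

Record coeffs := Coeffs {
  cA : pt -> 'M[R]_2;
  cb : pt -> pt;
  cc : pt -> R
}.

Implicit Types (Om : set pt) (D : coeffs) (v f : pt -> R) (lam : R).

Definition no_lower_order Om D : Prop :=
  {ae leb2, forall x, Om x -> cb D x = 0 /\ cc D x = 0}.

Definition cordes Om D (delta lam : R) : Prop :=
  0 < delta < 1 /\
  ( [/\ no_lower_order Om D,
        lam = 0 &
        {ae leb2, forall x, Om x ->
           frob (cA D x) ^+ 2 / (\tr (cA D x)) ^+ 2 <= (1 + delta)^-1}]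
  \/
    [/\ ~ no_lower_order Om D,
        0 < lam &
        {ae leb2, forall x, Om x ->
           (frob (cA D x) ^+ 2 + (2 * lam)^-1 * enorm (cb D x) ^+ 2
              + (lam ^+ 2)^-1 * cc D x ^+ 2)
           / (\tr (cA D x) + lam^-1 * cc D x) ^+ 2 <= (2 + delta)^-1}]).

Record admissible Om D (zeta1 zeta2 delta lam : R) : Prop := {
  adm_A : forall i j, Linf Om (fun x => cA D x i j);
  adm_sym : {ae leb2, forall x, Om x -> (cA D x)^T = cA D x};
  adm_b : forall i, Linf Om (fun x => coord (cb D x) i);
  adm_c : Linf Om (cc D);
  adm_c_ge0 : {ae leb2, forall x, Om x -> 0 <= cc D x};
  adm_zeta : 0 < zeta1 /\ 0 < zeta2;
  adm_elliptic : {ae leb2, forall x, Om x -> forall xi : pt,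
    let q := \sum_(i < 2) \sum_(j < 2) cA D x i j * coord xi j * coord xi i in
    zeta1 * enorm xi ^+ 2 <= q <= zeta2 * enorm xi ^+ 2};
  adm_cordes : cordes Om D delta lam
}.

(* By [cordes], lam = 0 exactly when the lower order terms vanish. *)
Definition gamma D lam (x : pt) : R :=
  if lam == 0 then \tr (cA D x) / frob (cA D x) ^+ 2
  else (\tr (cA D x) + lam^-1 * cc D x)
       / (frob (cA D x) ^+ 2 + (2 * lam)^-1 * enorm (cb D x) ^+ 2
          + (lam ^+ 2)^-1 * cc D x ^+ 2).

Definition Lop Om D v (x : pt) : R :=
  mdot (cA D x) (hess Om v x) + dot (cb D x) (grad Om v x) - cc D x * v x.

Definition a_form Om D lam v1 v2 : R :=
  L2ip Om (fun x => gamma D lam x * Lop Om D v1 x)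
          (fun x => lapl Om v2 x - lam * v2 x).

Definition F_form Om D lam f v : R :=
  L2ip Om (fun x => gamma D lam x * f x) (fun x => lapl Om v x - lam * v x).

Definition strong_solution Om D f u : Prop :=
  V Om u /\ Lop Om D u = f %[ae leb2 in Om].

Definition normb Om D : R := Linfnorm Om (enorm \o cb D).
Definition normc Om D : R := Linfnorm Om (cc D).

(* The constants are functions of exactly the parameters on which the known
   estimates let them depend: alpha of diam(Om) and delta; Ca and mu of zeta1,
   zeta2, lambda and the L^oo norms of b and c. *)
Record known_estimates Om (alpha : R -> R -> R)
    (Ca mu : R -> R -> R -> R -> R -> R) : Prop := {
  estimates_pos : forall D zeta1 zeta2 delta lam,
    admissible Om D zeta1 zeta2 delta lam ->
    [/\ 0 < alpha (diam Om) delta,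
        0 < Ca zeta1 zeta2 lam (normb Om D) (normc Om D) &
        0 < mu zeta1 zeta2 lam (normb Om D) (normc Om D)];
  estimate_bounded : forall D zeta1 zeta2 delta lam,
    admissible Om D zeta1 zeta2 delta lam ->
    forall (om1 om2 : set pt) v1 v2,
      subdomain Om om1 -> subdomain Om om2 -> V Om v1 -> V Om v2 ->
      supp_in Om v1 om1 -> supp_in Om v2 om2 ->
      `|a_form Om D lam v1 v2|
        <= Ca zeta1 zeta2 lam (normb Om D) (normc Om D)
           * H2norm_on Om (om1 `&` om2) v1 * H2norm_on Om (om1 `&` om2) v2;
  estimate_coercive : forall D zeta1 zeta2 delta lam,
    admissible Om D zeta1 zeta2 delta lam ->
    forall v, V Om v ->
      alpha (diam Om) delta * Vnorm Om v ^+ 2 <= a_form Om D lam v v;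
  estimate_F : forall D zeta1 zeta2 delta lam,
    admissible Om D zeta1 zeta2 delta lam ->
    forall f v, L2 Om f -> V Om v ->
      `|F_form Om D lam f v|
        <= mu zeta1 zeta2 lam (normb Om D) (normc Om D)
           * L2norm Om f * Vnorm Om v
}.

End Operator.

Section Mesh.
Context {R : realType}.
Local Notation pt := (R * R)%type.
Implicit Types (Om : set pt).

Definition is_edge (ts : seq (3.-tuple pt)) (p q : pt) : Prop :=
  exists2 T, T \in ts & [/\ p \in T, q \in T & p != q].

(* Triangles are given by their vertices.  Conformity: any two triangles meet
   exactly in the hull of their common vertices (nothing, a vertex, an edge or
   the whole triangle).  Edges are unordered pairs of endpoints, each listed
   once and in one orientation. *)
Record mesh Om := Mesh {
  tris : seq (3.-tuple pt);
  nedges : nat;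
  nnodes : nat;
  edge : 'I_nedges -> pt * pt;
  normal : 'I_nedges -> pt;
  node : 'I_nnodes -> pt;
  mesh_nondeg : forall T, T \in tris -> (hull T)° !=set0;
  mesh_cover : closure Om = [set x | exists2 T, T \in tris & hull T x];
  mesh_conforming : forall T T', T \in tris -> T' \in tris ->
    hull T `&` hull T' = hull [seq p <- T | p \in T'];
  mesh_edges : forall p q,
    is_edge tris p q <-> exists i, edge i = (p, q) \/ edge i = (q, p);
  mesh_edges_uniq : forall i j,
    edge i = edge j \/ edge i = ((edge j).2, (edge j).1) -> i = j;
  mesh_normal : forall i,
    enorm (normal i) = 1 /\ dot (normal i) ((edge i).2 - (edge i).1) = 0;
  mesh_nodes : forall z,
    (Om z /\ exists2 T, T \in tris & z \in T) <-> exists k, node k = z;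
  mesh_nodes_uniq : injective node
}.

Definition meshsize Om (M : mesh Om) : R :=
  sup [set h | exists2 T, T \in tris M & h = diam (hull T)].

Definition inball_diam (T : set pt) : R :=
  sup [set r | exists s x, [/\ 0 <= s, forall y, enorm (y - x) <= s -> T y
                             & r = 2 * s]].

Definition meshrho Om (M : mesh Om) : R :=
  (meshsize M)^-1 * inf [set r | exists2 T, T \in tris M & r = inball_diam (hull T)].

Definition nqoi Om (M : mesh Om) : nat := nedges M + nnodes M.

Definition qoi Om (M : mesh Om) (i : 'I_(nqoi M)) (v : pt -> R) : R :=
  match fintype.split i with
  | inl e => mean_flux Om (edge e) (normal e) v
  | inr k => ptval Om v (node k)
  end.

End Mesh.

Section Multiscale.
Context {R : realType}.
Local Notation pt := (R * R)%type.
Implicit Types (Om : set pt) (D : @coeffs R) (v w f : pt -> R) (lam : R).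

Definition W Om (M : mesh Om) v : Prop := V Om v /\ forall i, qoi (M := M) i v = 0.

(* The a.e. unique solution of the corrector problem; it exists by Lax-Milgram,
   so the default value 0 is not used when v is in V. *)
Definition corr Om (M : mesh Om) D lam v : pt -> R :=
  xget (cst 0) [set c | W M c /\
    forall w, W M w -> a_form Om D lam c w = a_form Om D lam v w].

Definition corr_adj Om (M : mesh Om) D lam v : pt -> R :=
  xget (cst 0) [set c | W M c /\
    forall w, W M w -> a_form Om D lam w c = a_form Om D lam w v].

Definition UH Om (M : mesh Om) D lam w : Prop :=
  V Om w /\ exists2 v, V Om v & w = v \- corr M D lam v %[ae leb2 in Om].

Definition VH Om (M : mesh Om) D lam w : Prop :=
  V Om w /\ exists2 v, V Om v & w = v \- corr_adj M D lam v %[ae leb2 in Om].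

Definition multiscale_solution Om (M : mesh Om) D lam f uH : Prop :=
  UH M D lam uH /\
  forall vH, VH M D lam vH -> a_form Om D lam uH vH = F_form Om D lam f vH.

Definition F_dual_norm Om (M : mesh Om) D lam f : R :=
  sup [set r | exists v, [/\ VH M D lam v, Vnorm Om v <= 1
                           & r = `|F_form Om D lam f v|]].

End Multiscale.

(* Main.v *)
Require Import Defs.
From HB Require Import structures.
From mathcomp Require Import all_boot all_order all_algebra.
From mathcomp Require Import all_classical all_reals all_analysis.
From mathcomp Require Import ring lra zify measurable_realfun.

Set Implicit Arguments.
Unset Strict Implicit.
Unset Printing Implicit Defensive.

Import Order.TTheory GRing.Theory Num.Theory.
Import numFieldNormedType.Exports.

Local Open Scope classical_set_scope.
Local Open Scope ring_scope.

(** A Petrov-Galerkin argument: the trial and test spaces are the left and right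
    orthogonal complements of W for the form a.  Testing with (1 - C^* ) uH gives
    existence, uniqueness and (i), and u - uH is the corrector of u.  It lies in
    W, so it vanishes at all vertices of the triangulation: at the interior ones
    by the definition of W, at the others because it is in H^1_0 and continuous.
    Expanding a smooth function to first order at the three vertices of a
    triangle bounds its L^2 norm by H^2 times that of its Hessian, plus its
    vertex values; [|grad w|^2 = - (w, lapl w)] then bounds the gradient, and
    coercivity bounds the H^2 norm of u - uH by (mu / alpha) |f|.

    All inequalities are proved for smooth functions and extended by density:
    on the convex domain Om, the mollification of v is composed with a
    contraction towards an interior point x0, so that it is smooth up to the
    boundary. *)

(** * The space L^2 *)

(** Functions are representatives, known up to null sets, and weak derivatives are chosen by [xget];
    no quotient is formed. Hilbert space theory is therefore developed with vectors of norm zero,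
    and identities between weak derivatives hold almost everywhere only. Coercivity controls a(v,
    v), while the trial function uH need not be a test function. As a(uH, w) = 0 for w in W,
    subtracting the adjoint corrector leaves a(uH, uH) unchanged, and the corrected function has
    norm at most Ca / alpha times that of uH. This costs one factor 1 / alpha in (i); coercivity at
    uH costs the other. Lax-Milgram on W needs W closed, so point values and edge fluxes must be
    shown linear and bounded on H^2, although both are defined through a chosen representative. For
    the fluxes this requires traces on segments inside Om as well as on its boundary. The expansion
    at a vertex is integrated along the homotheties towards that vertex: their Jacobian determinant
    is exactly the weight in the square of the Taylor remainder, so only the diameter of the
    triangle enters the bound. *)

Section L2_theory.
Context {d : measure_display} {T : measurableType d} {R : realType}.
Variables (mu : {measure set T -> \bar R}) (D : set T).
Hypothesis mD : measurable D.
Implicit Types f g h : T -> R.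

Lemma Lnorm2_sqr f :
  ('N[mu]_2%:E[EFin \o (f \_ D)] `^ 2 = \int[mu]_(x in D) ((f x ^+ 2)%:E))%E.
Proof.
rewrite poweR_Lnorm // [RHS]integral_mkcond; apply: eq_integral => x _ /=.
rewrite -[2]/(2%:R) powR_mulrn // real_normK ?num_real //.
by rewrite !patchE; case: ifP => // _; rewrite expr0n.
Qed.

Lemma measurable_sqr f : measurable_fun D f ->
  measurable_fun D (fun x => (f x ^+ 2)%:E : \bar R).
Proof. by move=> mf; apply/measurable_EFinP; exact: measurable_funX. Qed.

Lemma inLp2P f : inLp mu 2%:E D f <->
  measurable_fun D f /\ mu.-integrable D (EFin \o (fun x => f x ^+ 2)).
Proof.
have sq0 x : D x -> (0 <= (f x ^+ 2)%:E)%E by rewrite lee_fin sqr_ge0.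
split=> -[mf]; last first.
  move=> /integrableP[_]; under eq_integral do rewrite /= ger0_norm ?sqr_ge0 //.
  move=> fin; split=> //.
  have := Lnorm2_sqr f; case: ('N[_]_2%:E[_])%E => [r _||] /=.
  - by rewrite ltry.
  - by rewrite pnatr_eq0 /= => e; move: fin; rewrite -e.
  - by rewrite ltNye.
move=> fin; split=> //; apply/integrableP; split; first exact: measurable_sqr.
under eq_integral do rewrite /= ger0_norm ?sqr_ge0 //.
by rewrite -Lnorm2_sqr poweR_lty.
Qed.

Lemma Lpnorm_ge0 f p : 0 <= Lpnorm mu p D f.
Proof. exact/fine_ge0/Lnorm_ge0. Qed.

Lemma Lpnorm2_sqr f : Lpnorm mu 2%:E D f ^+ 2 = \int[mu]_(x in D) (f x ^+ 2).
Proof.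
rewrite /Rintegral -Lnorm2_sqr /Lpnorm.
move: (Lnorm_ge0 mu 2%:E (EFin \o (f \_ D))).
move: ('N[_]_2%:E[_])%E => [r|_|//] /=; last by rewrite pnatr_eq0 expr0n.
by rewrite lee_fin => r0; rewrite -[2]/(2%:R) powR_mulrn.
Qed.

Lemma inLp2_measurable f : inLp mu 2%:E D f -> measurable_fun D f.
Proof. by case. Qed.

Lemma integrable_mulL2 f g : inLp mu 2%:E D f -> inLp mu 2%:E D g ->
  mu.-integrable D (EFin \o (fun x => f x * g x)).
Proof.
move=> /inLp2P[mf f2] /inLp2P[mg g2].
apply: (@le_integrable _ _ _ mu D mD _ (fun x => ((f x ^+ 2)%:E + (g x ^+ 2)%:E)%E)).
- by apply/measurable_EFinP; exact: measurable_funM.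
- move=> x _; rewrite /= lee_fin [leRHS]ger0_norm ?addr_ge0 ?sqr_ge0 //.
  rewrite ler_norml; apply/andP; split.
    by have := sqr_ge0 (f x + g x); have := sqr_ge0 (f x); have := sqr_ge0 (g x); nra.
  by have := sqr_ge0 (f x - g x); have := sqr_ge0 (f x); have := sqr_ge0 (g x); nra.
- exact: integrableD.
Qed.

Lemma inLp2Z c f : inLp mu 2%:E D f -> inLp mu 2%:E D (fun x => c * f x).
Proof.
move=> /inLp2P[mf f2]; apply/inLp2P; split; first exact: measurable_funM.
apply: eq_integrable (integrableZl mD (c ^+ 2) f2) => // x _.
by rewrite /= exprMn.
Qed.

Lemma inLp2D f g : inLp mu 2%:E D f -> inLp mu 2%:E D g ->
  inLp mu 2%:E D (fun x => f x + g x).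
Proof.
move=> hf hg; have fg := integrable_mulL2 hf hg.
move: hf hg => /inLp2P[mf f2] /inLp2P[mg g2].
apply/inLp2P; split; first exact: measurable_funD.
have := integrableD mD (integrableD mD f2 g2) (integrableZl mD 2 fg).
apply: eq_integrable => // x _; rewrite /= -!EFinD; congr EFin; ring.
Qed.

Lemma inLp2_lin c f g : inLp mu 2%:E D f -> inLp mu 2%:E D g ->
  inLp mu 2%:E D (fun x => c * f x + g x).
Proof. by move=> hf hg; apply: inLp2D => //; exact: inLp2Z. Qed.

Lemma inLp2B f g : inLp mu 2%:E D f -> inLp mu 2%:E D g ->
  inLp mu 2%:E D (fun x => f x - g x).
Proof.
move=> hf hg; have := inLp2_lin (-1) hg hf.
by congr inLp; apply/funext => x; rewrite mulN1r addrC.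
Qed.

Lemma inLp20 : inLp mu 2%:E D (cst 0).
Proof.
apply/inLp2P; split; first exact: measurable_cst.
by apply: eq_integrable (integrable0 mu D) => // x _; rewrite /= expr0n.
Qed.

Lemma RintegralM_linl c f g h : inLp mu 2%:E D f -> inLp mu 2%:E D g ->
  inLp mu 2%:E D h ->
  \int[mu]_(x in D) ((c * f x + g x) * h x)
   = c * (\int[mu]_(x in D) (f x * h x)) + \int[mu]_(x in D) (g x * h x).
Proof.
move=> hf hg hh; have fh := integrable_mulL2 hf hh.
rewrite -RintegralZl //.
under eq_Rintegral do rewrite mulrDl -mulrA.
apply: RintegralD => //; last exact: integrable_mulL2.
by have := integrableZl mD c fh.
Qed.

Lemma Rintegral_mulC f g :
  \int[mu]_(x in D) (f x * g x) = \int[mu]_(x in D) (g x * f x).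
Proof. by apply: eq_Rintegral => x _; rewrite mulrC. Qed.

Lemma RintegralM_linr c f g h : inLp mu 2%:E D f -> inLp mu 2%:E D g ->
  inLp mu 2%:E D h ->
  \int[mu]_(x in D) (h x * (c * f x + g x))
   = c * (\int[mu]_(x in D) (h x * f x)) + \int[mu]_(x in D) (h x * g x).
Proof.
move=> hf hg hh; rewrite Rintegral_mulC RintegralM_linl //.
by rewrite (Rintegral_mulC h f) (Rintegral_mulC h g).
Qed.

Lemma ae_eq_Rintegral f g : measurable_fun D f -> measurable_fun D g ->
  {ae mu, forall x, D x -> f x = g x} ->
  \int[mu]_(x in D) f x = \int[mu]_(x in D) g x.
Proof.
move=> mf mg fg; rewrite /Rintegral; congr fine.
apply: ae_eq_integral => //; try exact/measurable_EFinP.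
by apply: filterS fg => x /[apply] ->.
Qed.

Lemma ae_le_Rintegral f g : mu.-integrable D (EFin \o f) ->
  mu.-integrable D (EFin \o g) ->
  {ae mu, forall x, D x -> f x <= g x} ->
  \int[mu]_(x in D) f x <= \int[mu]_(x in D) g x.
Proof.
move=> hf hg fg.
have mf : measurable_fun D f by apply/measurable_EFinP; exact: measurable_int hf.
have mg : measurable_fun D g by apply/measurable_EFinP; exact: measurable_int hg.
(* Monotonicity is available for pointwise inequalities, so [g] is replaced by the a.e. equal
   function [max f g]. *)
have -> : \int[mu]_(x in D) g x = \int[mu]_(x in D) Num.max (f x) (g x).
  apply: ae_eq_Rintegral => //; first exact: measurable_maxr.
  by apply: filterS fg => x /[apply] fg; rewrite max_r.
apply: le_Rintegral => //; last by move=> x _; rewrite le_max lexx.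
apply: (@le_integrable _ _ _ mu D mD _ (fun x => `|(f x)%:E| + `|(g x)%:E|)%E).
- by apply/measurable_EFinP; exact: measurable_maxr.
- move=> x _; rewrite /= lee_fin [leRHS]ger0_norm ?addr_ge0 //.
  by rewrite /Num.max; case: ifP; rewrite ?lerDl ?lerDr.
- by apply: integrableD => //; exact: integrable_norm.
Qed.

(* The discriminant of [c |-> \int (c f + g)^2 >= 0]. *)
Lemma cauchy_schwarz_L2 f g : inLp mu 2%:E D f -> inLp mu 2%:E D g ->
  `|\int[mu]_(x in D) (f x * g x)| <= Lpnorm mu 2%:E D f * Lpnorm mu 2%:E D g.
Proof.
move=> hf hg.
set b := \int[mu]_(x in D) (f x * g x).
set F := Lpnorm _ _ _ f; set G := Lpnorm _ _ _ g.
have F0 : 0 <= F := Lpnorm_ge0 _ _; have G0 : 0 <= G := Lpnorm_ge0 _ _.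
have q c : 0 <= c ^+ 2 * F ^+ 2 + 2 * c * b + G ^+ 2.
  have hc := inLp2_lin c hf hg.
  have : 0 <= \int[mu]_(x in D) ((c * f x + g x) * (c * f x + g x)).
    by apply: Rintegral_ge0 => x _; rewrite -expr2 sqr_ge0.
  rewrite RintegralM_linl // RintegralM_linr // RintegralM_linr //.
  rewrite (Rintegral_mulC g f) -/b !Lpnorm2_sqr.
  by under eq_Rintegral do rewrite -expr2; under [X in _ + (_ + X)]eq_Rintegral do rewrite -expr2;
    move=> /le_trans; apply; rewrite le_eqVlt; apply/orP; left; apply/eqP; ring.
have F2 : (b ^+ 2 <= F ^+ 2 * G ^+ 2).
  have [F00|Fn0] := eqVneq F 0.
    have h := q (- (G ^+ 2 + 1) / (2 * b)).
    have [->|bn0] := eqVneq b 0; first by rewrite expr0n /= mulr_ge0 ?sqr_ge0.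
    suff : False by []. move: h; rewrite F00 expr0n /= mulr0 add0r.
    have -> : 2 * (- (G ^+ 2 + 1) / (2 * b)) * b = - (G ^+ 2 + 1) by field; lra.
    by lra.
  have h := q (- b / F ^+ 2).
  have Fp : 0 < F ^+ 2 by rewrite exprn_gt0 // lt_neqAle eq_sym Fn0.
  have : 0 <= (- b / F ^+ 2) ^+ 2 * F ^+ 2 + 2 * (- b / F ^+ 2) * b + G ^+ 2 by [].
  have -> : (- b / F ^+ 2) ^+ 2 * F ^+ 2 + 2 * (- b / F ^+ 2) * b + G ^+ 2
     = (F ^+ 2 * G ^+ 2 - b ^+ 2) / F ^+ 2 by field; lra.
  by rewrite pmulr_lge0 ?invr_gt0 // subr_ge0.
rewrite -ler_sqr ?nnegrE ?mulr_ge0 // real_normK ?num_real //.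
by rewrite exprMn.
Qed.

Lemma Lpnorm2_eq f g : measurable_fun D f -> measurable_fun D g ->
  {ae mu, forall x, D x -> f x ^+ 2 = g x ^+ 2} ->
  Lpnorm mu 2%:E D f = Lpnorm mu 2%:E D g.
Proof.
move=> mf mg fg; apply/eqP; rewrite -(@eqrXn2 _ 2) ?Lpnorm_ge0 //.
by rewrite !Lpnorm2_sqr; apply/eqP/ae_eq_Rintegral => //; exact: measurable_funX.
Qed.

Lemma Lpnorm2_le f g : inLp mu 2%:E D f -> inLp mu 2%:E D g ->
  {ae mu, forall x, D x -> f x ^+ 2 <= g x ^+ 2} ->
  Lpnorm mu 2%:E D f <= Lpnorm mu 2%:E D g.
Proof.
move=> /inLp2P[mf f2] /inLp2P[mg g2] fg.
rewrite -ler_sqr ?nnegrE ?Lpnorm_ge0 // !Lpnorm2_sqr.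
exact: ae_le_Rintegral.
Qed.

Lemma inLp2_le f g : measurable_fun D f -> inLp mu 2%:E D g ->
  (forall x, D x -> f x ^+ 2 <= g x ^+ 2) -> inLp mu 2%:E D f.
Proof.
move=> mf /inLp2P[mg g2] fg; apply/inLp2P; split=> //.
apply: le_integrable g2 => //; first exact: measurable_sqr.
by move=> x Dx; rewrite /= lee_fin !ger0_norm ?sqr_ge0 ?fg.
Qed.

Lemma inLp2_ae f g : measurable_fun D f -> inLp mu 2%:E D g ->
  {ae mu, forall x, D x -> f x = g x} -> inLp mu 2%:E D f.
Proof.
move=> mf /inLp2P[mg g2] fg; apply/inLp2P; split=> //.
apply/integrableP; split; first exact: measurable_sqr.
have /integrableP[_] := g2; rewrite (@ae_eq_integral _ _ _ mu D (EFin \o (fun x => `|f x ^+ 2|))) //.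
- by apply/measurable_EFinP; apply: measurableT_comp => //; exact: measurable_funX.
- by apply/measurable_EFinP; apply: measurableT_comp => //; exact: measurable_funX.
- by apply: filterS fg => x /[apply] /= ->.
Qed.

Lemma Lpnorm2_eq0 f : inLp mu 2%:E D f -> Lpnorm mu 2%:E D f = 0 ->
  {ae mu, forall x, D x -> f x = 0}.
Proof.
move=> /inLp2P[mf f2] f0.
have : \int[mu]_(x in D) (f x ^+ 2) = 0 by rewrite -Lpnorm2_sqr f0 expr0n.
rewrite /Rintegral => /eqP; rewrite fine_eq0; last exact: integrable_fin_num.
move=> /eqP h.
have : (\int[mu]_(x in D) `|(f x ^+ 2)%:E| = 0)%E.
  by rewrite -h; apply: eq_integral => x _; rewrite /= ger0_norm ?sqr_ge0.
move=> /ae_eq_integral_abs h'.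
have /h' : measurable_fun D (fun x => (f x ^+ 2)%:E : \bar R) by exact: measurable_sqr.
move=> /(_ mD); apply: filterS => x /[apply] /= -[] /eqP.
by rewrite sqrf_eq0 => /eqP.
Qed.

Lemma Lpnorm2Z c f : inLp mu 2%:E D f ->
  Lpnorm mu 2%:E D (fun x => c * f x) = `|c| * Lpnorm mu 2%:E D f.
Proof.
move=> /inLp2P[mf f2].
apply/eqP; rewrite -(@eqrXn2 _ 2) ?mulr_ge0 ?Lpnorm_ge0 //.
rewrite exprMn !Lpnorm2_sqr real_normK ?num_real //; apply/eqP.
by under eq_Rintegral do rewrite exprMn; rewrite RintegralZl.
Qed.

Lemma Lpnorm2D f g : inLp mu 2%:E D f -> inLp mu 2%:E D g ->
  Lpnorm mu 2%:E D (fun x => f x + g x)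
    <= Lpnorm mu 2%:E D f + Lpnorm mu 2%:E D g.
Proof.
move=> hf hg; rewrite -ler_sqr ?nnegrE ?addr_ge0 ?Lpnorm_ge0 //.
have := cauchy_schwarz_L2 hf hg; rewrite ler_norml => /andP[_ cs].
rewrite Lpnorm2_sqr sqrrD !Lpnorm2_sqr.
have /inLp2P[mf f2] := hf; have /inLp2P[mg g2] := hg.
have fg := integrable_mulL2 hf hg.
have -> : \int[mu]_(x in D) ((f x + g x) ^+ 2) = \int[mu]_(x in D) (f x ^+ 2)
   + (\int[mu]_(x in D) (f x * g x) + \int[mu]_(x in D) (f x * g x))
   + \int[mu]_(x in D) (g x ^+ 2).
  have fgfg : mu.-integrable D (EFin \o (fun x => f x * g x + f x * g x)).
    by have := integrableD mD fg fg.
  have ffgfg : mu.-integrable D (EFin \o (fun x => f x ^+2 + (f x * g x + f x * g x))).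
    by have := integrableD mD f2 fgfg.
  rewrite -RintegralD // -addrA -RintegralD //.
  rewrite -RintegralD //; last by have := integrableD mD fgfg g2.
  by apply: eq_Rintegral => x _; ring.
by rewrite lerD2r lerD2l mulr2n lerD.
Qed.

Lemma cvg_geometric_increments (u : nat -> R) C :
  (forall k, `|u k.+1 - u k| <= C / 2 ^+ k) -> cvgn u.
Proof.
move=> h; have -> : u = (fun n => u 0%N + series (telescope u) n).
  by apply/funext => n; exact: eq_sum_telescope.
apply: is_cvgD; first exact: is_cvg_cst.
apply: normed_cvg.
apply: (@series_le_cvg _ _ (geometric C 2^-1)) => [n|n|n|] //=.
- by rewrite exprVn; exact: le_trans (normr_ge0 _) (h n).
- by rewrite /telescope /= exprVn; exact: h.
- by apply: is_cvg_geometric_series; rewrite ger0_norm ?invr_ge0 // invf_lt1 // ltr1n.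
Qed.

Lemma integral_sqrE f : inLp mu 2%:E D f ->
  (\int[mu]_(x in D) (f x ^+ 2)%:E)%E = (Lpnorm mu 2%:E D f ^+ 2)%:E.
Proof.
move=> /inLp2P[_ f2]; rewrite Lpnorm2_sqr /Rintegral fineK //.
exact: integrable_fin_num.
Qed.

Lemma inLp2_bound f C : measurable_fun D f ->
  (\int[mu]_(x in D) (f x ^+ 2)%:E <= (C ^+ 2)%:E)%E -> 0 <= C ->
  inLp mu 2%:E D f /\ Lpnorm mu 2%:E D f <= C.
Proof.
move=> mf fC C0; have hf : inLp mu 2%:E D f.
  apply/inLp2P; split=> //; apply/integrableP; split; first exact: measurable_sqr.
  under eq_integral do rewrite /= ger0_norm ?sqr_ge0 //.
  exact: le_lt_trans fC (ltry _).
split=> //; rewrite -ler_sqr ?nnegrE ?Lpnorm_ge0 //.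
by rewrite -lee_fin -integral_sqrE.
Qed.

(** Fatou's lemma for the squares; it yields membership of the limit in L^2 and the bound on its
    norm at once. *)
Lemma fatou_L2 (g : nat -> T -> R) h C : measurable_fun D h -> 0 <= C ->
  (forall k, inLp mu 2%:E D (g k)) ->
  (\forall k \near \oo, Lpnorm mu 2%:E D (g k) <= C) ->
  {ae mu, forall x, D x -> g k x @[k --> \oo] --> h x} ->
  inLp mu 2%:E D h /\ Lpnorm mu 2%:E D h <= C.
Proof.
move=> mh C0 hg bnd gh.
have mgk k : measurable_fun D (fun x => (g k x ^+ 2)%:E : \bar R).
  by apply: measurable_sqr; case: (hg k).
apply: inLp2_bound => //.
have -> : (\int[mu]_(x in D) (h x ^+ 2)%:E
   = \int[mu]_(x in D) limn_einf (fun k => (g k x ^+ 2)%:E))%E.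
  apply: ae_eq_integral => //.
  - exact: measurable_sqr.
  - by apply: measurableT_comp => //; apply: measurable_fun_limn_esup => n;
      apply: measurableT_comp.
  - apply: filterS gh => x /[apply] gx.
    have : (fun k => (g k x ^+ 2)%:E) @ \oo --> (h x ^+ 2)%:E.
      by apply/cvg_EFin; [exact: nearW|exact: cvgM].
    by move=> /cvg_limn_einf_sup[-> _].
apply: (le_trans (fatou mu mD mgk _)); first by move=> n x _; rewrite lee_fin sqr_ge0.
rewrite limn_einf_lim; apply: lime_le; first exact: is_cvg_einfs.
apply: nearW => n; have [N _ hN] := bnd.
apply: le_trans (ereal_inf_lbound _) _; first by exists (maxn n N) => //=; rewrite leq_maxl.
rewrite integral_sqrE // lee_fin ler_sqr ?nnegrE ?Lpnorm_ge0 //.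
by apply: hN; rewrite /= leq_maxr.
Qed.

(* Riesz--Fischer: along a fast subsequence the weighted sum of the squared
   increments is integrable, hence the increments decay geometrically a.e. *)
Lemma complete_L2 (f : nat -> T -> R) : (forall n, inLp mu 2%:E D (f n)) ->
  (forall e, 0 < e -> exists N, forall m n, (N <= m)%N -> (N <= n)%N ->
     Lpnorm mu 2%:E D (fun x => f m x - f n x) <= e) ->
  exists2 h, inLp mu 2%:E D h &
    Lpnorm mu 2%:E D (fun x => f n x - h x) @[n --> \oo] --> 0.
Proof.
move=> hf cauchy.
have /choice[N hN] k : exists N, forall m n, (N <= m)%N -> (N <= n)%N ->
    Lpnorm mu 2%:E D (fun x => f m x - f n x) <= 4%:R ^- k.+1.
  by apply: cauchy; rewrite invr_gt0 exprn_gt0.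
(* The thresholds [N] need not be monotone; the partial sums of [(N i).+1] are strictly increasing
   and satisfy [N k <= p k]. *)
pose p k := (\sum_(i < k.+1) (N i).+1)%N.
have Np k : (N k <= p k)%N by rewrite /p big_ord_recr /=; lia.
have pS k : (p k < p k.+1)%N by rewrite /p [in ltnRHS]big_ord_recr /=; lia.
have kp k : (k <= p k)%N by elim: k => // k IH; exact: leq_ltn_trans IH (pS k).
have hd k : inLp mu 2%:E D (fun x => f (p k.+1) x - f (p k) x) by exact: inLp2B.
(* The weight [4 ^ k] is small enough for the integral of [s k] to be at most [1 / 2 ^ k.+1], and
   large enough that a finite sum [S x] bounds the k-th increment at [x] by [sqrt (S x) / 2 ^ k]. *)
pose s k x : R := 4%:R ^+ k * (f (p k.+1) x - f (p k) x) ^+ 2.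
have ms k : measurable_fun D (fun x => (s k x)%:E : \bar R).
  apply/measurable_EFinP; apply: measurable_funM => //.
  by apply: measurable_funX; case: (hd k).
have s0 k x : D x -> (0 <= (s k x)%:E)%E.
  by move=> _; rewrite lee_fin mulr_ge0 ?sqr_ge0 ?exprn_ge0.
pose S x := (\sum_(0 <= k <oo) (s k x)%:E)%E.
have intS : mu.-integrable D S.
  apply/integrableP; split.
    by apply: ge0_emeasurable_sum => [k x Dx _|k _]; [exact: s0|exact: ms].
  under eq_integral => x /set_mem Dx.
    rewrite gee0_abs; first over.
    by apply: nneseries_ge0 => k _ _; exact: s0.
  rewrite integral_nneseries //.
  apply: (@le_lt_trans _ _ (\sum_(0 <= k <oo) (1 / (2 ^ k.+1)%:R)%:E)%E); last first.
    by apply: le_lt_trans (epsilon_trick0 xpredT _) (ltry _); rewrite ler01.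
  apply: lee_nneseries => [k _ _|k _]; first by apply: integral_ge0 => x; exact: s0.
  rewrite (_ : (\int[mu]_(x in D) _ = (4%:R ^+ k * Lpnorm mu 2%:E D
     (fun x => f (p k.+1) x - f (p k) x) ^+ 2)%:E)%E); last first.
    rewrite EFinM -integral_sqrE // -ge0_integralZl //.
    - by apply: measurable_sqr; case: (hd k).
    - by move=> x _; rewrite lee_fin sqr_ge0.
  rewrite lee_fin.
  have := hN k (p k.+1) (p k) (leq_trans (Np k) (ltnW (pS k))) (Np k).
  set L := Lpnorm _ _ _ _ => hL.
  have L0 : 0 <= L := Lpnorm_ge0 _ _.
  apply: (@le_trans _ _ (4%:R ^+ k * (4%:R ^- k.+1) ^+ 2)).
    by rewrite ler_wpM2l ?exprn_ge0 // ler_sqr // nnegrE (le_trans L0).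
  have := exprn_gt0 k (ltr0n R 2); rewrite natrX [2 ^+ k.+1]exprS [4%:R ^+ k.+1]exprS mul1r => k0.
  have -> : 4%:R ^+ k = 2 ^+ k * 2 ^+ k :> R by rewrite -exprMn; congr (_ ^+ _); lra.
  move: k0; set t := 2 ^+ k => t0.
  have t1 : 1 <= t by rewrite exprn_ege1 // ler1n.
  rewrite -subr_ge0.
  have -> : (2 * t)^-1 - t * t * (4%:R * (t * t))^-1 ^+ 2 = (8 * t - 1) / (16 * t * t).
    by field; lra.
  by rewrite divr_ge0 ?mulr_ge0 //; lra.
have cv : {ae mu, forall x, D x -> cvgn (fun k => f (p k) x)}.
  apply: filterS (integrable_ae mD intS) => x h Dx; have {h}Sfin := h Dx.
  apply: (@cvg_geometric_increments _ (Num.sqrt (fine (S x)))) => k.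
  have : ((s k x)%:E <= S x)%E.
    have h := @nneseries_lim_ge R (fun k => (s k x)%:E) xpredT 0 k.+1 (fun n _ _ => s0 n x Dx).
    apply: le_trans h; rewrite big_nat_recr //= leeDr //.
    by apply: sume_ge0 => i _; exact: s0.
  rewrite -(fineK Sfin) lee_fin /s => h.
  rewrite -ler_sqr ?nnegrE ?divr_ge0 ?exprn_ge0 // real_normK ?num_real //.
  rewrite /= expr_div_n sqr_sqrtr; last first.
    by apply: le_trans h; rewrite mulr_ge0 ?sqr_ge0 ?exprn_ge0.
  rewrite ler_pdivlMr ?exprn_gt0 // mulrC -exprM mulnC exprM.
  by rewrite (_ : 2 ^+ 2 = 4%:R) //; lra.
(* The upper limit is measurable everywhere and equals the limit wherever the latter exists. *)
pose h x := fine (limn_esup (fun k => (f (p k) x)%:E)).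
have mh : measurable_fun D h.
  apply: (measurableT_comp (fine_measurable measurableT)).
  by apply: measurable_fun_limn_esup => k; apply/measurable_EFinP; case: (hf (p k)).
have cvh : {ae mu, forall x, D x -> (f (p k) x) @[k --> \oo] --> h x}.
  apply: filterS cv => x /[apply] /cvg_ex[l fl].
  suff -> : h x = l by [].
  rewrite /h; have : (fun k => (f (p k) x)%:E) @ \oo --> l%:E.
    by apply/cvg_EFin; [exact: nearW|exact: fl].
  by move=> /cvg_limn_einf_sup[_ ->].
(* Fatou in [k] with [n] fixed passes the Cauchy bound from [f n - f (p k)] to [f n - h]. *)
have close e : 0 < e -> exists N, forall n, (N <= n)%N ->
    inLp mu 2%:E D (fun x => f n x - h x) /\
    Lpnorm mu 2%:E D (fun x => f n x - h x) <= e.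
  move=> e0; have [M hM] := cauchy e e0; exists M => n Mn.
  apply: (@fatou_L2 (fun k x => f n x - f (p k) x)) => //.
  - by apply: measurable_funB => //; case: (hf n).
  - exact: ltW.
  - by move=> k; exact: inLp2B.
  - by exists M => // k /= Mk; apply: hM => //; exact: leq_trans Mk (kp k).
  - by apply: filterS cvh => x /[apply] fx; apply: cvgB => //; exact: cvg_cst.
exists h.
  have [M hM] := close 1 ltr01; have [hl _] := hM M (leqnn M).
  have := inLp2B (hf M) hl.
  by congr inLp; apply/funext => x; ring.
apply/cvgrPdist_le => e /close[M hM]; exists M => // n /= /hM[_ ?].
by rewrite sub0r normrN ger0_norm ?Lpnorm_ge0.
Qed.

End L2_theory.

(** * Semi-Hilbert spaces *)

Section semi_hilbert_spaces.
Context {R : realType} {E : lmodType R}.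
Variable ip : E -> E -> R.
Implicit Types (P Q : set E) (x y z : E).

Definition ipnorm x : R := Num.sqrt (ip x x).

Definition ipcauchy (u : nat -> E) := forall e : R, 0 < e ->
  exists N, forall m n, (N <= m)%N -> (N <= n)%N -> ipnorm (u m - u n) <= e.

(* Vectors of norm zero are allowed: for function spaces, [P] is a set of
   representatives rather than of classes. *)
Record semi_hilbert P : Prop := SemiHilbert {
  semi_hilbert0 : P 0;
  semi_hilbert_lin : forall c x y, P x -> P y -> P (c *: x + y);
  semi_hilbert_sym : forall x y, ip x y = ip y x;
  semi_hilbert_linl : forall c x y z, P x -> P y -> P z ->
    ip (c *: x + y) z = c * ip x z + ip y z;
  semi_hilbert_ge0 : forall x, 0 <= ip x x;
  semi_hilbert_complete : forall u : nat -> E, (forall n, P (u n)) ->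
    ipcauchy u -> exists2 l, P l & ipnorm (u n - l) @[n --> \oo] --> 0
}.

Lemma ipnorm_ge0 x : 0 <= ipnorm x. Proof. exact: sqrtr_ge0. Qed.

Section fixed_space.
Variable P : set E.
Hypothesis HP : semi_hilbert P.

Lemma semi_hilbertZ c x : P x -> P (c *: x).
Proof.
by move=> Px; have := semi_hilbert_lin HP c Px (semi_hilbert0 HP); rewrite addr0.
Qed.

Lemma semi_hilbertB x y : P x -> P y -> P (x - y).
Proof.
move=> Px Py; have := semi_hilbert_lin HP (-1) Py Px.
by rewrite scaleN1r addrC.
Qed.

Lemma ip_linr c x y z : P x -> P y -> P z ->
  ip z (c *: x + y) = c * ip z x + ip z y.
Proof.
move=> Px Py Pz; rewrite (semi_hilbert_sym HP) (semi_hilbert_linl HP) //.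
by rewrite !(semi_hilbert_sym HP z).
Qed.

Lemma ipBl x y z : P x -> P y -> P z -> ip (x - y) z = ip x z - ip y z.
Proof.
move=> Px Py Pz; rewrite addrC -scaleN1r (semi_hilbert_linl HP) //.
by rewrite mulN1r addrC.
Qed.

Lemma ipBr x y z : P x -> P y -> P z -> ip z (x - y) = ip z x - ip z y.
Proof.
move=> Px Py Pz; rewrite addrC -scaleN1r ip_linr //.
by rewrite mulN1r addrC.
Qed.

Lemma ipnorm_sqr x : ipnorm x ^+ 2 = ip x x.
Proof. by rewrite sqr_sqrtr ?(semi_hilbert_ge0 HP). Qed.

Lemma ip_lin_sqr c x y : P x -> P y ->
  ip (c *: x + y) (c *: x + y) = c ^+ 2 * ip x x + 2 * c * ip x y + ip y y.
Proof.
move=> Px Py.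
have Pxy := semi_hilbert_lin HP c Px Py.
rewrite (semi_hilbert_linl HP) // !ip_linr // (semi_hilbert_sym HP y x); ring.
Qed.

Lemma ip_cauchy_schwarz x y : P x -> P y -> `|ip x y| <= ipnorm x * ipnorm y.
Proof.
move=> Px Py; set b := ip x y; set F := ipnorm x; set G := ipnorm y.
have F0 : 0 <= F := ipnorm_ge0 _; have G0 : 0 <= G := ipnorm_ge0 _.
have q c : 0 <= c ^+ 2 * F ^+ 2 + 2 * c * b + G ^+ 2.
  have := semi_hilbert_ge0 HP (c *: x + y).
  by rewrite ip_lin_sqr // !ipnorm_sqr.
suff F2 : (b ^+ 2 <= F ^+ 2 * G ^+ 2).
  rewrite -ler_sqr ?nnegrE ?mulr_ge0 // real_normK ?num_real //.
  by rewrite exprMn.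
have [F00|Fn0] := eqVneq F 0.
  (* When [F = 0] the quadratic is affine in [c]; at this point it equals -1, unless [b = 0]. *)
  have h := q (- (G ^+ 2 + 1) / (2 * b)).
  have [->|bn0] := eqVneq b 0; first by rewrite expr0n /= mulr_ge0 ?sqr_ge0.
  suff : False by []. move: h; rewrite F00 expr0n /= mulr0 add0r.
  have -> : 2 * (- (G ^+ 2 + 1) / (2 * b)) * b = - (G ^+ 2 + 1) by field; lra.
  by lra.
have h := q (- b / F ^+ 2).
have Fp : 0 < F ^+ 2 by rewrite exprn_gt0 // lt_neqAle eq_sym Fn0.
move: h; have -> : (- b / F ^+ 2) ^+ 2 * F ^+ 2 + 2 * (- b / F ^+ 2) * b + G ^+ 2
   = (F ^+ 2 * G ^+ 2 - b ^+ 2) / F ^+ 2 by field; lra.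
by rewrite pmulr_lge0 ?invr_gt0 // subr_ge0.
Qed.

Lemma ipnormZ c x : P x -> ipnorm (c *: x) = `|c| * ipnorm x.
Proof.
move=> Px; apply/eqP; rewrite -(@eqrXn2 _ 2) ?mulr_ge0 ?ipnorm_ge0 //.
have := ip_lin_sqr c Px (semi_hilbert0 HP).
rewrite addr0 exprMn !ipnorm_sqr real_normK ?num_real // => ->.
have -> : ip x 0 = 0.
  have := ip_linr 0 (semi_hilbert0 HP) (semi_hilbert0 HP) Px.
  by rewrite scale0r addr0 mul0r add0r => _;
     have := ipBr (semi_hilbert0 HP) (semi_hilbert0 HP) Px; rewrite !subrr.
have -> : ip 0 0 = 0.
  by have := ipBr (semi_hilbert0 HP) (semi_hilbert0 HP) (semi_hilbert0 HP); rewrite !subrr.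
by rewrite mulr0 !addr0.
Qed.

Lemma ipnorm0 : ipnorm 0 = 0.
Proof.
by have := ipnormZ 0 (semi_hilbert0 HP); rewrite scale0r normr0 mul0r.
Qed.

Lemma ipnormD x y : P x -> P y -> ipnorm (x + y) <= ipnorm x + ipnorm y.
Proof.
move=> Px Py; rewrite -ler_sqr ?nnegrE ?addr_ge0 ?ipnorm_ge0 //.
have := ip_lin_sqr 1 Px Py; rewrite scale1r ipnorm_sqr => ->.
have := ip_cauchy_schwarz Px Py; rewrite ler_norml => /andP[_ h].
by rewrite sqrrD !ipnorm_sqr; lra.
Qed.

Lemma ipnormN x : P x -> ipnorm (- x) = ipnorm x.
Proof. by move=> Px; rewrite -scaleN1r ipnormZ // normrN1 mul1r. Qed.

Lemma ipnormB x y : P x -> P y -> ipnorm (x - y) = ipnorm (y - x).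
Proof. by move=> Px Py; rewrite -(ipnormN (semi_hilbertB Px Py)) opprB. Qed.

Lemma ipnorm_dist x y z : P x -> P y -> P z ->
  ipnorm (x - z) <= ipnorm (x - y) + ipnorm (y - z).
Proof.
move=> Px Py Pz; have := ipnormD (semi_hilbertB Px Py) (semi_hilbertB Py Pz).
by rewrite addrA subrK.
Qed.

Lemma semi_hilbert_closed Q : Q `<=` P -> Q 0 ->
  (forall c x y, Q x -> Q y -> Q (c *: x + y)) ->
  (forall u l, (forall n, Q (u n)) -> P l ->
    ipnorm (u n - l) @[n --> \oo] --> 0 -> Q l) ->
  semi_hilbert Q.
Proof.
move=> QP Q0 Qlin Qcl; split => //.
- exact: semi_hilbert_sym HP.
- by move=> c x y z /QP Px /QP Py /QP; exact: (semi_hilbert_linl HP).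
- exact: semi_hilbert_ge0 HP.
- move=> u Qu /(semi_hilbert_complete HP (fun n => QP _ (Qu n)))[l Pl ul].
  by exists l => //; exact: (Qcl u).
Qed.

Definition linear_on (F : E -> R) := forall c x y, P x -> P y ->
  F (c *: x + y) = c * F x + F y.

(* The minimizer of [v |-> |v|^2 - 2 F v]; by the parallelogram law every
   minimizing sequence is Cauchy. *)
Lemma riesz F K : linear_on F -> (forall x, P x -> `|F x| <= K * ipnorm x) ->
  exists2 r, P r & forall x, P x -> ip r x = F x.
Proof.
move=> Flin Fbnd; pose J v := ip v v - 2 * F v.
have Jlb v : P v -> - K ^+ 2 <= J v.
  move=> Pv; have := Fbnd v Pv; rewrite /J -ipnorm_sqr ler_norml => /andP[_ h].
  have := sqr_ge0 (ipnorm v - K); nra.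
pose S := [set J v | v in P].
have S0 : S !=set0 by exists (J 0); exists 0 => //; exact: semi_hilbert0 HP.
have Slb : has_lbound S by exists (- K ^+ 2) => _ [v Pv <-]; exact: Jlb.
have hS : has_inf S by [].
pose m := inf S.
have mJ v : P v -> m <= J v by move=> Pv; apply: ge_inf => //; exists v.
have /choice[v hv] n : exists v, P v /\ J v <= m + n.+1%:R^-1.
  have n0 : 0 < n.+1%:R^-1 :> R by rewrite invr_gt0.
  have [_ [v Pv <-] hv] := inf_adherent n0 hS.
  by exists v; split => //; exact: ltW.
have Pv n : P (v n) by case: (hv n).
have Jv n : J (v n) <= m + n.+1%:R^-1 by case: (hv n).
have Jlin c x y : P x -> P y ->
    J (c *: x + y) = J y + c ^+ 2 * ip x x + 2 * c * (ip x y - F x).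
  by move=> Px Py; rewrite /J ip_lin_sqr // Flin //; ring.
have para p q : ip (v p - v q) (v p - v q) <= 2 * (p.+1%:R^-1 + q.+1%:R^-1).
  pose d := v p - v q; have Pd : P d by exact: semi_hilbertB.
  (* [J] at the midpoint of [v p] and [v q] is at least the infimum [m]; compared with [h2] this
     gives the parallelogram estimate. *)
  have h1 := mJ _ (semi_hilbert_lin HP 2^-1 Pd (Pv q)); rewrite Jlin // in h1.
  have h2 : J (v p) = J (v q) + ip d d + 2 * (ip d (v q) - F d).
    by have := Jlin 1 d (v q) Pd (Pv q); rewrite scale1r /d subrK => ->; ring.
  have := Jv p; have := Jv q; rewrite -/d.
  move: h1 h2; set a := J (v p); set b := J (v q); set e := ip d _ - _.
  set k1 := p.+1%:R^-1; set k2 := q.+1%:R^-1; set dd := ip d d.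
  by move=> h1 h2 h3 h4; lra.
have cau : ipcauchy v.
  move=> e e0; pose N := Num.truncn (4 / e ^+ 2).
  exists N => p q Np Nq; rewrite -ler_sqr ?nnegrE ?ipnorm_ge0 ?(ltW e0) //.
  rewrite ipnorm_sqr; apply: le_trans (para p q) _.
  have e2 : 0 < e ^+ 2 by rewrite exprn_gt0.
  have hN : forall p, (N <= p)%N -> p.+1%:R^-1 <= e ^+ 2 / 4.
    move=> {p Np} p Np; rewrite -[leRHS]invrK lef_pV2 ?posrE ?invr_gt0 ?divr_gt0 //.
    rewrite invf_div; apply: le_trans (ltW (truncnS_gt _)) _.
    by rewrite ler_nat ltnS.
  by apply: le_trans (ler_wpM2l _ (lerD (hN _ Np) (hN _ Nq))) _; lra.
have [l Pl vl] := semi_hilbert_complete HP Pv cau.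
exists l => // x Px; pose b := ip l x - F x; pose q := ip x x.
have q0 : 0 <= q := semi_hilbert_ge0 HP x.
(* The first variation of [J] at [l] in the direction [x]. It is derived along the sequence [v n],
   up to an arbitrary [e], because [J (v n)] is only known to be close to [m]. *)
have key t : 0 <= t ^+ 2 * q + 2 * t * b.
  apply/ler_addgt0Pr => e e0.
  have : 0 < e / (2 * (1 + `|2 * t| * ipnorm x)).
    by rewrite divr_gt0 // mulr_gt0 // ltr_wpDr // mulr_ge0 ?ipnorm_ge0.
  set e' := e / _ => e'0.
  have /cvgrPdist_le /(_ _ e'0)[n1 _ h1] := vl.
  pose n := maxn n1 (Num.truncn (2 / e)).
  have {}h1 : ipnorm (v n - l) <= e'.
    by have := h1 n (leq_maxl _ _); rewrite sub0r normrN ger0_norm ?ipnorm_ge0.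
  have h2 : n.+1%:R^-1 <= e / 2.
    rewrite -[leRHS]invrK lef_pV2 ?posrE ?invr_gt0 ?divr_gt0 // invf_div.
    by apply: le_trans (ltW (truncnS_gt _)) _; rewrite ler_nat ltnS leq_maxr.
  have := mJ _ (semi_hilbert_lin HP t Px (Pv n)); rewrite Jlin //.
  have := Jv n; rewrite -/q (semi_hilbert_sym HP x).
  have := ip_cauchy_schwarz (semi_hilbertB (Pv n) Pl) Px; rewrite ipBl //.
  have -> : ip l x = b + F x by rewrite /b; ring.
  set c := ip (v n) x => h3 h4 h5.
  have h6 : `|2 * t * (c - (b + F x))| <= e / 2.
    rewrite normrM; apply: le_trans (ler_wpM2l (normr_ge0 _) h3) _.
    apply: (@le_trans _ _ (`|2 * t| * (e' * ipnorm x))).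
      by rewrite ler_wpM2l // ler_wpM2r ?ipnorm_ge0.
    rewrite /e'; set k := `|2 * t|; set X := ipnorm x.
    have k0 : 0 <= k * X by apply: mulr_ge0; [exact: normr_ge0|exact: ipnorm_ge0].
    have -> : k * (e / (2 * (1 + k * X)) * X) = (e / 2) * (k * X / (1 + k * X)) by field; lra.
    by rewrite ler_piMr ?divr_ge0 ?ltW // ltr_pdivrMr ?mul1r; lra.
  move: h6 h2 h4; rewrite ler_norml => /andP[_ h6].
  by move: (n.+1%:R^-1) => k1 h2 h4; lra.
have qp : 0 < q + 1 by lra.
(* The minimizer would be [- b / q]; [q + 1] also covers [x] of norm zero, and the value is still a
   negative multiple of [b ^ 2]. *)
have := key (- b / (q + 1)).
have -> : (- b / (q + 1)) ^+ 2 * q + 2 * (- b / (q + 1)) * b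
   = - (b ^+ 2 * ((q + 2) / (q + 1) ^+ 2)) by field; lra.
rewrite oppr_ge0 pmulr_lle0 ?divr_gt0 ?exprn_gt0 ?ltr_wpDl // => b2.
have /eqP : b ^+ 2 = 0 by apply/eqP; rewrite eq_le b2 sqr_ge0.
by rewrite sqrf_eq0 subr_eq0 => /eqP.
Qed.

Lemma ipcauchy_geometric (u : nat -> E) c k : (forall n, P (u n)) ->
  0 <= k < 1 -> (forall n, ipnorm (u n.+1 - u n) <= c * k ^+ n) -> ipcauchy u.
Proof.
move=> Pu /andP[k0 k1] hu e e0.
have c0 : 0 <= c by have := le_trans (ipnorm_ge0 _) (hu 0%N); rewrite expr0 mulr1.
have step n j : ipnorm (u (n + j)%N - u n) <= c * k ^+ n * (1 - k ^+ j) / (1 - k).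
  elim: j => [|j IH].
    rewrite addn0 subrr expr0 subrr mulr0 mul0r.
    by rewrite ipnorm0.
  rewrite addnS; apply: le_trans (ipnorm_dist (Pu _) (Pu (n + j)%N) (Pu _)) _.
  apply: le_trans (lerD (hu _) IH) _.
  rewrite le_eqVlt; apply/orP; left; apply/eqP.
  by rewrite exprD exprS; field; lra.
have : (fun n => c / (1 - k) * k ^+ n) @ \oo --> c / (1 - k) * 0.
  by apply: cvgMr; apply: cvg_expr; rewrite ger0_norm.
rewrite mulr0 => /cvgrPdist_le /(_ (e / 2)).
rewrite divr_gt0 // => /(_ isT)[N _ hN].
have tail m : (N <= m)%N -> ipnorm (u m - u N) <= e / 2.
  move=> /subnKC <-; apply: le_trans (step N (m - N)%N) _.
  have := hN N (leqnn N); rewrite /= sub0r normrN ger0_norm; last first.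
    by rewrite mulr_ge0 ?exprn_ge0 ?divr_ge0 // subr_ge0 ltW.
  apply: le_trans; rewrite [leRHS]mulrAC ler_wpM2r ?invr_ge0 ?subr_ge0 ?(ltW k1) //.
  by rewrite ler_piMr ?mulr_ge0 ?exprn_ge0 // gerBl exprn_ge0.
exists N => m n /tail hm /tail hn.
apply: le_trans (ipnorm_dist (Pu m) (Pu N) (Pu n)) _.
by rewrite (ipnormB (Pu N)) // [leRHS]splitr lerD.
Qed.

Definition bilinear_on (a : E -> E -> R) :=
  (forall z, P z -> linear_on (a z)) /\ (forall z, P z -> linear_on (a^~ z)).

Lemma linear_onB F x y : linear_on F -> P x -> P y -> F (x - y) = F x - F y.
Proof.
by move=> Flin Px Py; rewrite addrC -scaleN1r Flin // mulN1r addrC.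
Qed.

(* The fixed point of [u |-> u - t (A u)], where [A u] represents
   [a(u, .) - F] and [t = alpha / M^2]. *)
Lemma lax_milgram a F M al K : bilinear_on a -> linear_on F -> 0 < al ->
  (forall x y, P x -> P y -> `|a x y| <= M * ipnorm x * ipnorm y) ->
  (forall x, P x -> al * ipnorm x ^+ 2 <= a x x) ->
  (forall x, P x -> `|F x| <= K * ipnorm x) ->
  exists2 u, P u & forall v, P v -> a u v = F v.
Proof.
move=> [alr all] Flin al0 ab ac Fb.
(* Enlarging [M] beyond [al] makes [s = al ^ 2 / M ^ 2] less than 1. *)
wlog M0 : M ab / al < M.
  move=> W; apply: (W (`|M| + al + 1)); last by have := normr_ge0 M; lra.
  move=> x y Px Py; apply: le_trans (ab x y Px Py) _.
  rewrite -!mulrA ler_wpM2r ?mulr_ge0 ?ipnorm_ge0 //.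
  by have := ler_norm M; lra.
have /choice[A hA] u : exists r, P u -> P r /\ forall v, P v -> ip r v = a u v - F v.
  have [Pu|] := pselect (P u); last by exists 0.
  have := @riesz (fun v => a u v - F v) (M * ipnorm u + K).
  case.
  - by move=> c x y Px Py; rewrite Flin // alr //; ring.
  - move=> x Px; apply: le_trans (ler_normB _ _) _.
    by rewrite mulrDl; apply: lerD; [exact: ab|exact: Fb].
  - by move=> r Pr hr; exists r.
have PA u : P u -> P (A u) by move=> /hA[].
have AE u v : P u -> P v -> ip (A u) v = a u v - F v by move=> /hA[_ h] /h.
have dA u v w : P u -> P v -> P w -> ip (A u - A v) w = a (u - v) w.
  move=> Pu Pv Pw; rewrite ipBl ?AE //; try exact: PA.
  by rewrite (linear_onB (all w Pw)) //; ring.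
have nA u v : P u -> P v -> ipnorm (A u - A v) <= M * ipnorm (u - v).
  move=> Pu Pv; have Pd := semi_hilbertB (PA _ Pu) (PA _ Pv).
  have : ipnorm (A u - A v) ^+ 2 <= M * ipnorm (u - v) * ipnorm (A u - A v).
    rewrite ipnorm_sqr dA //; apply: le_trans (ler_norm _) _.
    by apply: ab => //; exact: semi_hilbertB.
  rewrite expr2; have [->|n0] := eqVneq (ipnorm (A u - A v)) 0.
    by rewrite mulr_ge0 ?ipnorm_ge0 //; lra.
  by rewrite ler_pM2r // lt_neqAle eq_sym n0 ipnorm_ge0.
pose t := al / M ^+ 2; pose T u := - t *: A u + u.
have Mp : 0 < M by lra.
have t0 : 0 < t by rewrite divr_gt0 // exprn_gt0.
have PT u : P u -> P (T u) by move=> Pu; apply: (semi_hilbert_lin HP) => //; exact: PA.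
pose s := al ^+ 2 / M ^+ 2.
have s0 : 0 < s by rewrite divr_gt0 // exprn_gt0.
have s1 : s < 1 by rewrite ltr_pdivrMr ?exprn_gt0 // mul1r ltr_sqr ?nnegrE ?(ltW al0) ?(ltW Mp).
(* The squared Lipschitz constant is [1 - 2 * t * al + t ^ 2 * M ^ 2 = 1 - s], and
   [1 - s <= (1 - s / 2) ^ 2] avoids a square root. *)
have contr u v : P u -> P v -> ipnorm (T u - T v) <= (1 - s / 2) * ipnorm (u - v).
  move=> Pu Pv; rewrite -ler_sqr ?nnegrE ?mulr_ge0 ?ipnorm_ge0 //; last by lra.
  have -> : T u - T v = - t *: (A u - A v) + (u - v).
    by rewrite /T scalerBr opprD addrACA.
  have Pd := semi_hilbertB (PA _ Pu) (PA _ Pv); have Puv := semi_hilbertB Pu Pv.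
  rewrite ipnorm_sqr ip_lin_sqr // (dA _ _ (u - v)) // -!ipnorm_sqr.
  have h1 := ac _ Puv; have h2 := nA _ _ Pu Pv.
  set X := ipnorm (u - v) in h1 h2 *; set Y := ipnorm (A u - A v) in h2 *.
  have X0 : 0 <= X := ipnorm_ge0 _; have Y0 : 0 <= Y := ipnorm_ge0 _.
  have h3 : Y ^+ 2 <= (M * X) ^+ 2 by rewrite ler_sqr ?nnegrE ?mulr_ge0 // ltW.
  apply: (@le_trans _ _ (t ^+ 2 * (M * X) ^+ 2 - 2 * t * (al * X ^+ 2) + X ^+ 2)).
    rewrite sqrrN lerD2r lerD ?ler_wpM2l ?sqr_ge0 // mulrN mulNr lerN2.
    by rewrite ler_wpM2l // mulr_ge0 // ltW.
  have -> : t ^+ 2 * (M * X) ^+ 2 - 2 * t * (al * X ^+ 2) + X ^+ 2 = (1 - s) * X ^+ 2.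
    by rewrite /t /s; field; lra.
  by rewrite exprMn ler_wpM2r ?sqr_ge0 //; nra.
pose u n := iter n T 0.
have Pu n : P (u n) by elim: n => [|n IH]; [exact: semi_hilbert0 HP|exact: PT].
have incr n : ipnorm (u n.+1 - u n) <= ipnorm (u 1%N - u 0%N) * (1 - s / 2) ^+ n.
  elim: n => [|n IH]; first by rewrite expr0 mulr1.
  apply: le_trans (contr _ _ (Pu n.+1) (Pu n)) _.
  by rewrite exprS mulrCA ler_wpM2l //; lra.
have k01 : 0 <= 1 - s / 2 < 1 by lra.
have [l Pl ul] := semi_hilbert_complete HP Pu (ipcauchy_geometric Pu k01 incr).
exists l => // v Pv.
have Al : (a (u n) v - F v) @[n --> \oo] --> 0.
  apply/norm_cvg0P.
  apply: (@squeeze_cvgr _ _ _ _ (cst 0) (fun n => (t^-1 * ipnorm v * ipnorm (u 1%N - u 0%N)) * (1 - s / 2) ^+ n)).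
  - apply: nearW => n; rewrite /= normr_ge0 /= -AE //.
    apply: le_trans (ip_cauchy_schwarz (PA _ (Pu n)) Pv) _.
    have nAu : ipnorm (A (u n)) <= t^-1 * (ipnorm (u 1%N - u 0%N) * (1 - s / 2) ^+ n).
      rewrite ler_pdivlMl //; have := incr n.
      by rewrite [u n.+1]/= -/(u n) /T addrK ipnormZ ?normrN ?gtr0_norm //; exact: PA.
    apply: le_trans (ler_wpM2r (ipnorm_ge0 v) nAu) _.
    by rewrite le_eqVlt; apply/orP; left; apply/eqP; ring.
  - exact: cvg_cst.
  - rewrite -[X in _ --> X](mulr0 (t^-1 * ipnorm v * ipnorm (u 1%N - u 0%N))).
    by apply: cvgMr; apply: cvg_expr; rewrite ger0_norm; lra.
have : (a (u n) v - F v) @[n --> \oo] --> a l v - F v.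
  apply: cvgB; last exact: cvg_cst.
  apply/cvgrPdist_le => e e0.
  have e1 : 0 < e / (M * (ipnorm v + 1)).
    by rewrite divr_gt0 // mulr_gt0 // ltr_wpDl ?ipnorm_ge0.
  have /cvgrPdist_le /(_ _ e1)[N _ hN] := ul.
  exists N => // n /= /hN; rewrite /= sub0r normrN ger0_norm ?ipnorm_ge0 // => h.
  rewrite -(linear_onB (all v Pv)) //; apply: le_trans (ab _ _ (semi_hilbertB Pl (Pu n)) Pv) _.
  rewrite (ipnormB Pl) //.
  have V0 := ipnorm_ge0 v.
  apply: (@le_trans _ _ (M * (e / (M * (ipnorm v + 1))) * ipnorm v)).
    by rewrite ler_wpM2r // ler_wpM2l // ltW.
  have -> : M * (e / (M * (ipnorm v + 1))) * ipnorm v = e * (ipnorm v / (ipnorm v + 1)).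
    by field; lra.
  by rewrite ler_piMr ?ltW // ltr_pdivrMr; lra.
move=> /(cvg_unique _ Al) => /(_ (@norm_hausdorff _ _)) h.
by apply/eqP; rewrite -subr_eq0 -h.
Qed.

End fixed_space.

(** [y] is the Riesz representative in [Q] of the functional [ip x], that is, the orthogonal
    projection of [x]; then [x - y] is orthogonal to [Q]. *)
Lemma density_of_orthogonal P Q : semi_hilbert P -> semi_hilbert Q -> Q `<=` P ->
  (forall x, P x -> (forall y, Q y -> ip x y = 0) -> ipnorm x = 0) ->
  forall x, P x -> exists2 y, Q y & ipnorm (x - y) = 0.
Proof.
move=> HP HQ QP orth x Px.
have [y Qy hy] : exists2 y, Q y & forall z, Q z -> ip y z = ip x z.
  apply: (riesz HQ (F := ip x) (K := ipnorm x)).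
  - by move=> c y z /QP Py /QP Pz; exact: (ip_linr HP).
  - by move=> y /QP Py; exact: (ip_cauchy_schwarz HP).
exists y => //; apply: orth; first exact: (semi_hilbertB HP) (QP _ Qy).
by move=> z Qz; rewrite (ipBl HP) ?hy ?subrr //; exact: QP.
Qed.

End semi_hilbert_spaces.

(** * Smooth functions *)

Section smooth_functions_line.
Context {R : realType}.
Implicit Types (f g : R -> R).

(** The derivative is a witness rather than the term ['D_1 f], so closure properties follow by
    exhibiting it. *)
Fixpoint Ck1 (k : nat) f : Prop :=
  if k is k'.+1 then
    exists2 g, forall t : R, is_derive t 1 f (g t) & Ck1 k' g
  else continuous f.

Lemma is_derive_continuous f g : (forall t : R, is_derive t 1 f (g t)) -> continuous f.
Proof.
by move=> fg t; apply/differentiable_continuous/derivable1_diffP; case: (fg t).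
Qed.

Lemma Ck1_continuous k f : Ck1 k f -> continuous f.
Proof. by case: k => // k [g fg _]; exact: is_derive_continuous fg. Qed.

Lemma Ck1S k f : Ck1 k.+1 f -> Ck1 k f.
Proof.
elim: k f => [|k IH] f [g fg hg]; first exact: is_derive_continuous fg.
by exists g => //; exact: IH.
Qed.

Lemma Ck1D k f g : Ck1 k f -> Ck1 k g -> Ck1 k (fun t => f t + g t).
Proof.
elim: k f g => [|k IH] f g /=; first by move=> cf cg t; apply: cvgD; [exact: cf|exact: cg].
move=> [f' ff' hf] [g' gg' hg]; exists (fun t => f' t + g' t) => [t|]; last exact: IH.
exact: is_deriveD.
Qed.

Lemma Ck1M k f g : Ck1 k f -> Ck1 k g -> Ck1 k (fun t => f t * g t).
Proof.
elim: k f g => [|k IH] f g; first by move=> cf cg t; apply: cvgM; [exact: cf|exact: cg].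
move=> hf0 hg0; have [f' ff' hf] := hf0; have [g' gg' hg] := hg0.
exists (fun t => f t * g' t + g t * f' t) => [t|].
  exact: is_deriveM.
by apply: Ck1D; apply: IH => //; exact: Ck1S.
Qed.

Lemma Ck1_cst k (c : R) : Ck1 k (fun=> c).
Proof.
elim: k c => [|k IH] c /=; first exact: cst_continuous.
by exists (fun=> 0) => // t; exact: is_derive_cst.
Qed.

Lemma is_derive_affine f g (a b t : R) : is_derive (a * t + b) 1 f (g (a * t + b)) ->
  is_derive t 1 (fun s => f (a * s + b)) (g (a * t + b) * a).
Proof.
move=> fg; apply: (@is_derive1_comp _ f (fun s => a * s + b)) => //.
have h : is_derive t 1 (fun s : R => a *: id s + b) (a *: 1 + 0).
  by apply: is_deriveD.
by move: h; rewrite addr0 /GRing.scale /= mulr1.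
Qed.

Lemma Ck1_affine k f a b : Ck1 k f -> Ck1 k (fun t => f (a * t + b)).
Proof.
elim: k f => [|k IH] f.
  move=> cf t; apply: continuous_comp; last exact: cf.
  by apply: cvgD; [apply: cvgM; [exact: cvg_cst|exact: cvg_id]|exact: cvg_cst].
move=> [g fg hg]; exists (fun t => g (a * t + b) * a) => [t|].
  exact: is_derive_affine.
by apply: Ck1M; [exact: IH|exact: Ck1_cst].
Qed.

(** The span of the functions t^-m exp(-1/t), extended by 0 to t <= 0, is stable under
    differentiation. This gives smoothness of exp(-1/t) by induction, with [m] generalized. *)
Definition flat m (t : R) : R := if 0 < t then t^-1 ^+ m * expR (- t^-1) else 0.

(** With s = 1/t, the exponential series gives s^(m+2) <= (m+2)! exp(s). Two powers of t are kept so
    that the difference quotient at 0 tends to 0. *)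
Lemma flat_bound m t : 0 < t -> flat m t <= m.+2`!%:R * t ^+ 2.
Proof.
move=> t0; rewrite /flat t0 expRN.
have := expR_ge1Dxn m.+1 (ltW (divr_gt0 ltr01 t0)).
rewrite div1r; set s := t^-1 => h.
have s0 : 0 < s by rewrite invr_gt0.
have e0 := expR_gt0 s.
have -> : s ^+ m * (expR s)^-1 = s ^+ m.+2 / expR s * t ^+ 2.
  by rewrite -addn2 exprD mulrAC -(mulrA (s ^+ m)) -exprMn mulVf ?expr1n ?mulr1 // gt_eqF.
rewrite ler_wpM2r ?sqr_ge0 // ler_pdivrMr //.
move: h; set F : R := m.+2`!%:R => h.
have F0 : 0 < F by rewrite ltr0n fact_gt0.
by rewrite mulrC -ler_pdivrMr //; lra.
Qed.

Lemma flat_ge0 m t : 0 <= flat m t.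
Proof.
rewrite /flat; case: ifP => // t0.
by rewrite mulr_ge0 ?expR_ge0 // exprn_ge0 // invr_ge0 ltW.
Qed.

Lemma is_derive_flat m (t : R) : is_derive t 1 (flat m) (flat m.+2 t - m%:R * flat m.+1 t).
Proof.
have [t0|t0|->] := ltgtP t 0.
- have -> : flat m.+2 t - m%:R * flat m.+1 t = 0.
    by rewrite /flat ltNge ltW // mulr0 subr0.
  apply: (@near_eq_is_derive _ _ _ (cst 0)) => //.
  by near=> s; rewrite /flat ltNge ltW //; near: s; exact: lt_nbhsl.
- apply: (@near_eq_is_derive _ _ _ (fun s : R => s^-1 ^+ m * expR (- s^-1))) => //.
    by near=> s; rewrite /flat ifT //; near: s; exact: lt_nbhsr.
  have d1 : is_derive t 1 (fun s : R => s^-1) (- t ^- 2 *: 1).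
    by apply: is_deriveV => //; rewrite gt_eqF.
  have d2 : is_derive t 1 (fun s : R => - s^-1) (- (- t ^- 2 *: 1)) by apply: is_deriveN.
  have d3 := @is_derive1_comp _ expR (fun s : R => - s^-1) t _ _
    (is_derive_expR (- t^-1)) d2.
  have d4 : is_derive t 1 (fun s : R => s^-1 ^+ m) (m%:R * t^-1 ^+ m.-1 *: (- t ^- 2 *: 1)).
    rewrite (_ : (fun s : R => s^-1 ^+ m) = (@GRing.inv R : R -> R) ^+ m); last first.
      by rewrite exprfctE.
    by have := is_deriveX m d1.
  apply: (is_derive_eq (is_deriveM d4 d3)).
  rewrite /flat t0 /GRing.scale /= !mulr1 opprK -exprVn.
  case: m d4 => [|m] _ /=; first by rewrite !mul0r mulr0 subr0 expr0; ring.
  rewrite !exprS; ring.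
- have -> : flat m.+2 0 - m%:R * flat m.+1 0 = 0 by rewrite /flat ltxx mulr0 subr0.
  have lim0 : (fun h => h^-1 *: (flat m (h *: 1 + 0) - flat m 0)) @ (0 : R)^' --> (0 : R).
    apply/cvgrPdist_le => e e0.
    near=> h; rewrite sub0r normrN addr0 [flat m 0]/flat ltxx subr0.
    rewrite /GRing.scale /= mulr1.
    have [h0|h0] := ltP 0 h; last by rewrite /flat ltNge h0 mulr0 normr0 ltW.
    rewrite ger0_norm ?mulr_ge0 ?flat_ge0 ?invr_ge0 1?ltW //.
    apply: le_lt_trans (_ : _ <= h * m.+2`!%:R) _.
      rewrite mulrC ler_pdivrMr // mulrAC mulrC -expr2; exact: flat_bound.
    rewrite -ltr_pdivlMr ?ltr0n ?fact_gt0 //.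
    apply: le_lt_trans (ler_norm _) _; near: h.
    apply: dnbhs0_lt; by rewrite divr_gt0 // ltr0n fact_gt0.
  by split; [apply/cvg_ex; exists 0|exact: cvg_lim lim0].
Unshelve. all: by end_near. Qed.

Lemma Ck1_flat k m : Ck1 k (flat m).
Proof.
elim: k m => [|k IH] m; first exact: is_derive_continuous (is_derive_flat m).
exists (fun t => flat m.+2 t - m%:R * flat m.+1 t); first exact: is_derive_flat.
have -> : (fun t => flat m.+2 t - m%:R * flat m.+1 t)
    = (fun t => flat m.+2 t + (- m%:R) * flat m.+1 t).
  by apply/funext => t; rewrite mulNr.
by apply: Ck1D => //; apply: Ck1M => //; exact: Ck1_cst.
Qed.

Definition sigma (t : R) : R := flat 0 t.

Lemma sigmaE t : 0 < t -> sigma t = expR (- t^-1).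
Proof. by rewrite /sigma /flat => ->; rewrite expr0 mul1r. Qed.

Lemma sigma_le0 t : t <= 0 -> sigma t = 0.
Proof. by rewrite /sigma /flat ltNge => ->. Qed.

Lemma sigma_ge0 t : 0 <= sigma t. Proof. exact: flat_ge0. Qed.

Lemma sigma_gt0 t : 0 < t -> 0 < sigma t.
Proof. by move=> t0; rewrite sigmaE // expR_gt0. Qed.

Lemma sigma_le1 t : sigma t <= 1.
Proof.
have [t0|t0] := ltP 0 t; last by rewrite sigma_le0.
by rewrite sigmaE // -expR0 ler_expR oppr_le0 invr_ge0 ltW.
Qed.

(** A smooth function supported in [a, b] that tends to the indicator of the open interval as [n]
    grows, since [sigma (n * s)] tends to 1 for [s > 0]. Products of two such functions serve as
    test functions and as the mollifier. *)
Definition hat (a b : R) n t : R := sigma (n%:R * (t - a)) * sigma (n%:R * (b - t)).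

Lemma Ck1_hat k a b n : Ck1 k (hat a b n).
Proof.
rewrite /hat; apply: Ck1M.
- have := @Ck1_affine k sigma n%:R (- n%:R * a) (Ck1_flat k 0).
  by congr Ck1; apply/funext => t; congr sigma; ring.
- have := @Ck1_affine k sigma (- n%:R) (n%:R * b) (Ck1_flat k 0).
  by congr Ck1; apply/funext => t; congr sigma; ring.
Qed.

Lemma hat_ge0 a b n t : 0 <= hat a b n t.
Proof. by rewrite mulr_ge0 ?sigma_ge0. Qed.

Lemma hat_le1 a b n t : hat a b n t <= 1.
Proof. by rewrite mulr_ile1 ?sigma_ge0 ?sigma_le1. Qed.

Lemma hat_support a b n t : hat a b n t != 0 -> a < t < b.
Proof.
apply: contra_neqT; rewrite negb_and -!leNgt => /orP[h|h]; rewrite /hat.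
  by rewrite (sigma_le0 (t := _ * (t - a))) ?mul0r // mulr_ge0_le0 // subr_le0.
by rewrite (sigma_le0 (t := _ * (b - t))) ?mulr0 // mulr_ge0_le0 // subr_le0.
Qed.

Lemma hat_gt0 a b n t : a < t < b -> 0 < hat a b n.+1 t.
Proof. by move=> /andP[at_ tb]; rewrite mulr_gt0 // sigma_gt0 // mulr_gt0 // subr_gt0. Qed.

Lemma cvg_sigma t : 0 < t -> sigma (n%:R * t) @[n --> \oo] --> (1 : R).
Proof.
move=> t0; rewrite -[X in _ --> X]expR0.
have h : expR (- (n%:R^-1 * t^-1)) @[n --> \oo] --> expR (- (0 * t^-1)).
  apply: continuous_cvg; first exact: continuous_expR.
  apply: cvgN; apply: cvgMl.
    apply/gtr0_cvgV0; last exact: cvgr_idn.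
    by near=> n; rewrite ltr0n; near: n; exists 1%N.
rewrite mul0r oppr0 in h.
apply: cvg_trans h; apply: near_eq_cvg; near=> n.
by rewrite sigmaE ?invfM // mulr_gt0 // ltr0n; near: n; exists 1%N.
Unshelve. all: by end_near. Qed.

Lemma cvg_hat a b t :
  hat a b n t @[n --> \oo] --> (\1_(`]a, b[%classic) t : R).
Proof.
rewrite indicE; have [] := boolP (t \in `]a, b[%classic).
  rewrite inE /= in_itv /= => /andP[at_ tb]; rewrite -[X in _ --> X]mulr1.
  by apply: cvgM; apply: cvg_sigma; rewrite subr_gt0.
move=> /negP nt; rewrite (_ : (fun n => hat a b n t) = cst 0); first exact: cvg_cst.
apply/funext => n; apply: contra_notP nt => /eqP /hat_support.
by rewrite inE /= in_itv.
Qed.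

End smooth_functions_line.

(** * Smooth functions and test functions on the plane *)

Section smooth_functions_plane.
Context {R : realType}.
Local Notation pt := (R * R)%type.
Implicit Types (phi psi : pt -> R) (x p e v : pt) (i : 'I_2) (Om : set pt).

Lemma basis_scale i (h : R) : h *: Defs.basis i = (if i == ord0 then (h, 0) else (0, h)) :> pt.
Proof.
rewrite /Defs.basis; case: ifP => _; congr pair => /=; rewrite ?scaler0 //;
  by rewrite /GRing.scale /= mulr1.
Qed.

Lemma line_quotientE phi x v t :
  (fun h : R => h^-1 *: (phi (x + (h *: 1 + t) *: v) - phi (x + t *: v)))
   = (fun h : R => h^-1 *: (phi (h *: v + (x + t *: v)) - phi (x + t *: v))).
Proof.
apply/funext => h; congr (_ *: (phi _ - _)).
by rewrite /GRing.scale /= mulr1 -/(GRing.scale _ _) scalerDl addrCA.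
Qed.

Lemma derivable_line phi x v t : derivable phi (x + t *: v) v <->
  derivable (fun s : R => phi (x + s *: v)) t 1.
Proof. by rewrite /derivable line_quotientE. Qed.

Lemma derive_line phi x v t :
  'D_1 (fun s : R => phi (x + s *: v)) t = 'D_v phi (x + t *: v).
Proof. by rewrite /derive line_quotientE. Qed.

Lemma is_derive_line phi x v t : derivable phi (x + t *: v) v ->
  is_derive t 1 (fun s : R => phi (x + s *: v)) ('D_v phi (x + t *: v)).
Proof. by move=> h; split; [exact/derivable_line|exact: derive_line]. Qed.

Lemma is_derive_of_line phi x v (d : R) :
  is_derive (0 : R) 1 (fun s : R => phi (x + s *: v)) d -> is_derive x v phi d.
Proof.
move=> [h1 h2]; split.
  by have := (derivable_line phi x v 0).2 h1; rewrite scale0r addr0.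
by rewrite -h2 derive_line scale0r addr0.
Qed.

Lemma mean_value (f df : R -> R) : (forall t : R, is_derive t 1 f (df t)) ->
  forall a h, exists2 s, 0 <= s <= 1 & f (a + h) - f a = h * df (a + s * h).
Proof.
move=> fdf a h.
have cf A : {within A, continuous f}.
  by apply: continuous_subspaceT; exact: is_derive_continuous fdf.
have [h0|h0|->] := ltgtP h 0; last first.
- by exists 0; rewrite ?lexx ?ler01 // addr0 subrr mul0r.
- have [|c] := @MVT _ f df a (a + h) _ (fun t _ => fdf t) (cf _).
    by rewrite ltrDl.
  rewrite in_itv /= => /andP[c1 c2] ->; exists ((c - a) / h).
    by rewrite ler_pdivrMr // divr_ge0 ?ltW //; lra.
  by rewrite mulrC; congr (_ * df _); [ring|field; rewrite gt_eqF].
- have [|c] := @MVT _ f df (a + h) a _ (fun t _ => fdf t) (cf _).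
    by rewrite gtrDl.
  rewrite in_itv /= => /andP[c1 c2] E; exists ((a - c) / - h).
    by rewrite ler_pdivrMr ?oppr_gt0 // divr_ge0 ?oppr_ge0 ?ltW //; lra.
  rewrite -opprB E.
  have -> : a + (a - c) / - h * h = c by field; rewrite lt_eqF.
  ring.
Qed.

Lemma Ck_continuous k phi : Ck k phi -> continuous phi.
Proof. by case: k => [|k] []. Qed.

Lemma smooth_continuous phi : smooth phi -> continuous phi.
Proof. by move=> /(_ 0%N) /Ck_continuous. Qed.

Lemma smoothD_i phi i : smooth phi -> smooth ('D_(Defs.basis i) phi).
Proof. by move=> h k; have [_ /(_ i)[]] := h k.+1. Qed.

Lemma smooth_derivable phi i x : smooth phi -> derivable phi x (Defs.basis i).
Proof. by move=> /(_ 1%N)[_ /(_ i)[]]. Qed.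

Lemma smooth_is_derive phi i x : smooth phi ->
  is_derive x (Defs.basis i) phi ('D_(Defs.basis i) phi x).
Proof. by move=> h; split=> //; exact: smooth_derivable. Qed.

Lemma Ck_lin k (c : R) phi psi : Ck k phi -> Ck k psi ->
  Ck k (fun x => c * phi x + psi x).
Proof.
elim: k phi psi => [|k IH] phi psi [c1 h1] [c2 h2].
  by split=> // x; apply: cvgD; [apply: cvgM; [exact: cvg_cst|exact: c1]|exact: c2].
split=> [x|i].
  by apply: cvgD; [apply: cvgM; [exact: cvg_cst|exact: c1]|exact: c2].
have [d1 k1] := h1 i; have [d2 k2] := h2 i.
have D x : is_derive x (Defs.basis i) (fun x => c * phi x + psi x)
    (c * 'D_(Defs.basis i) phi x + 'D_(Defs.basis i) psi x).
  have e1 : is_derive x (Defs.basis i) phi ('D_(Defs.basis i) phi x) by split.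
  have e2 : is_derive x (Defs.basis i) psi ('D_(Defs.basis i) psi x) by split.
  exact: is_deriveD (is_deriveZ c e1) e2.
split=> [x|]; first by case: (D x).
rewrite (_ : 'D_(Defs.basis i) _ = fun x => c * 'D_(Defs.basis i) phi x + 'D_(Defs.basis i) psi x).
  exact: IH.
by apply/funext => x; apply: derive_val.
Qed.

Lemma affine_continuous (a : R) p : continuous (fun x : pt => a *: x + p).
Proof. by move=> x; apply: cvgD; [exact: scaler_continuous|exact: cvg_cst]. Qed.

Lemma Ck_affine k (a : R) p phi : Ck k phi -> Ck k (fun x => phi (a *: x + p)).
Proof.
elim: k phi => [|k IH] phi [c h].
  by split=> // x; apply: continuous_comp; [exact: affine_continuous|exact: c].
split=> [x|i].
  by apply: continuous_comp; [exact: affine_continuous|exact: c].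
have [d kd] := h i.
have D x : is_derive x (Defs.basis i) (fun x => phi (a *: x + p))
    ('D_(Defs.basis i) phi (a *: x + p) * a).
  apply: is_derive_of_line.
  have -> : (fun s : R => phi (a *: (x + s *: Defs.basis i) + p))
      = (fun s : R => phi (a *: x + p + (a * s + 0) *: Defs.basis i)).
    by apply/funext => s; rewrite addr0 scalerDr scalerA addrAC.
  have := @is_derive_affine R (fun s => phi (a *: x + p + s *: Defs.basis i))
    (fun s => 'D_(Defs.basis i) phi (a *: x + p + s *: Defs.basis i)) a 0 0.
  rewrite mulr0 addr0 scale0r addr0; apply.
  have := @is_derive_line phi (a *: x + p) (Defs.basis i) 0.
  by rewrite scale0r addr0; apply; exact: d.
split=> [x|]; first by case: (D x).
rewrite (_ : 'D_(Defs.basis i) _ =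
    fun x => (a - 1) * 'D_(Defs.basis i) phi (a *: x + p) + 'D_(Defs.basis i) phi (a *: x + p)).
  by apply: Ck_lin; exact: (IH ('D_(Defs.basis i) phi)).
by apply/funext => x; rewrite derive_val; ring.
Qed.

Lemma smooth_lin (c : R) phi psi : smooth phi -> smooth psi ->
  smooth (fun x => c * phi x + psi x).
Proof. by move=> h1 h2 k; exact: Ck_lin. Qed.

Lemma smooth_affine (a : R) p phi : smooth phi -> smooth (fun x => phi (a *: x + p)).
Proof. by move=> h k; exact: Ck_affine. Qed.

Lemma derive_affine (a : R) p phi i x : smooth phi ->
  'D_(Defs.basis i) (fun x => phi (a *: x + p)) x = a * 'D_(Defs.basis i) phi (a *: x + p).
Proof.
move=> hphi.
have D : is_derive x (Defs.basis i) (fun x => phi (a *: x + p))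
    ('D_(Defs.basis i) phi (a *: x + p) * a).
  apply: is_derive_of_line.
  have -> : (fun s : R => phi (a *: (x + s *: Defs.basis i) + p))
      = (fun s : R => phi (a *: x + p + (a * s + 0) *: Defs.basis i)).
    by apply/funext => s; rewrite addr0 scalerDr scalerA addrAC.
  have := @is_derive_affine R (fun s => phi (a *: x + p + s *: Defs.basis i))
    (fun s => 'D_(Defs.basis i) phi (a *: x + p + s *: Defs.basis i)) a 0 0.
  rewrite mulr0 addr0 scale0r addr0; apply.
  have := @is_derive_line phi (a *: x + p) (Defs.basis i) 0.
  by rewrite scale0r addr0; apply; exact: smooth_derivable.
by rewrite derive_val mulrC.
Qed.

Lemma line_continuous p e : continuous (fun s : R => p + s *: e).
Proof. by move=> s; apply: cvgD; [exact: cvg_cst|apply: cvgZr_tmp; exact: cvg_id]. Qed.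

Lemma fst_continuous : continuous (fst : pt -> R).
Proof. by move=> x; exact: cvg_fst. Qed.

Lemma snd_continuous : continuous (snd : pt -> R).
Proof. by move=> x; exact: cvg_snd. Qed.

Lemma Ck_separable k (f g : R -> R) : Ck1 k f -> Ck1 k g ->
  Ck k (fun x : pt => f x.1 * g x.2).
Proof.
elim: k f g => [|k IH] f g hf hg.
  split=> // x; apply: cvgM.
    by apply: continuous_comp; [exact: fst_continuous|exact: hf].
  by apply: continuous_comp; [exact: snd_continuous|exact: hg].
split=> [x|i].
  apply: cvgM.
    by apply: continuous_comp; [exact: fst_continuous|exact: Ck1_continuous hf _].
  by apply: continuous_comp; [exact: snd_continuous|exact: Ck1_continuous hg _].
have [f' ff' hf'] := hf; have [g' gg' hg'] := hg.
pose d (x : pt) := if i == ord0 then f' x.1 * g x.2 else f x.1 * g' x.2.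
have D x : is_derive x (Defs.basis i) (fun x : pt => f x.1 * g x.2) (d x).
  apply: is_derive_of_line; rewrite /d.
  have [->|i0] := eqVneq i ord0.
    have -> : (fun s : R => f (x + s *: Defs.basis ord0).1 * g (x + s *: Defs.basis ord0).2)
        = (fun s : R => (fun t => f (1 * t + x.1)) s * g x.2).
      apply/funext => s; rewrite basis_scale eqxx /= addr0 mul1r; congr (f _ * _).
      by rewrite addrC.
    have h := @is_derive_affine R f f' 1 x.1 0 (ff' _).
    rewrite mul1r add0r mulr1 in h.
    apply: (is_derive_eq (@is_deriveM R R (fun s => f (1 * s + x.1)) (fun=> g x.2) 0 1 _ _
      h (is_derive_cst _ _ _))).
    by rewrite scaler0 add0r /GRing.scale /= mulrC.
  have -> : (fun s : R => f (x + s *: Defs.basis i).1 * g (x + s *: Defs.basis i).2)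
      = (fun s : R => f x.1 * (fun t => g (1 * t + x.2)) s).
    apply/funext => s; rewrite basis_scale (negbTE i0) /= addr0 mul1r; congr (_ * g _).
    by rewrite addrC.
  have h := @is_derive_affine R g g' 1 x.2 0 (gg' _).
  rewrite mul1r add0r mulr1 in h.
  apply: (is_derive_eq (@is_deriveM R R (fun=> f x.1) (fun s => g (1 * s + x.2)) 0 1 _ _
    (is_derive_cst _ _ _) h)).
  by rewrite scaler0 addr0.
split=> [x|]; first by case: (D x).
rewrite (_ : 'D_(Defs.basis i) _ = d); last by apply/funext => x; apply: derive_val.
rewrite /d; case: (i == ord0); apply: IH => //; exact: Ck1S.
Qed.

Definition box (a b c d : R) : set pt := `[a, b]%classic `*` `[c, d]%classic.

Lemma compact_box a b c d : compact (box a b c d).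
Proof. by apply: compact_setX; exact: segment_compact. Qed.

Lemma test_fun_of_compact Om phi K : smooth phi -> closed K -> compact K -> K `<=` Om ->
  (forall x, phi x != 0 -> K x) -> test_fun Om phi.
Proof.
move=> sphi clK cK KOm phiK; split=> //=.
have sub : closure [set x | phi x != 0] `<=` K.
  have -> : K = closure K by rewrite -closure_id.
  exact: closure_subset.
split; last exact: subset_trans sub KOm.
by apply: subclosed_compact sub => //; exact: closed_closure.
Qed.

Lemma test_fun_box Om phi a b c d : smooth phi -> box a b c d `<=` Om ->
  (forall x, phi x != 0 -> box a b c d x) -> test_fun Om phi.
Proof.
move=> sphi bOm phib; apply: (@test_fun_of_compact _ _ (box a b c d)) => //.
  by apply: compact_closed; [exact: norm_hausdorff|exact: compact_box].
exact: compact_box.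
Qed.

Lemma test_fun_smooth Om phi : test_fun Om phi -> smooth phi.
Proof. by case. Qed.

Lemma test_funD_i Om phi i : test_fun Om phi -> test_fun Om ('D_(Defs.basis i) phi).
Proof.
move=> [sphi [cK KOm]]; apply: (@test_fun_of_compact _ _ (closure [set x | phi x != 0])) => //.
- exact: smoothD_i.
- exact: closed_closure.
- move=> x; apply: contra_neqP => nx.
  have : \near x, phi x = 0.
    have : nbhs x (~` closure [set x | phi x != 0]).
      by apply: open_nbhs_nbhs; split=> //; exact/closed_openC/closed_closure.
    apply: filterS => y ny; apply/eqP; apply: contra_notT ny => ny.
    exact: subset_closure.
  move=> /(@near_eq_derive _ _ _ _ (cst 0) x (Defs.basis i)) ->.
  exact: derive_cst.
Qed.

Lemma test_fun_out Om phi x : test_fun Om phi -> ~ Om x -> phi x = 0.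
Proof.
move=> [_ [_ sub]] nx; apply/eqP; apply: contra_notT nx => nx.
by apply: sub; exact: subset_closure.
Qed.

Lemma test_fun_support Om phi : test_fun Om phi ->
  exists2 L : R, 0 < L & forall x, phi x != 0 -> `|x.1| < L /\ `|x.2| < L.
Proof.
move=> [_ [cK _]]; have [M [_ hM]] := compact_bounded cK.
exists (`|M| + 1) => [|x nx]; first by rewrite ltr_wpDl.
have h := hM (`|M| + 1 / 2) _ x (@subset_closure _ [set x | phi x != 0] x nx).
have {}h : `|x| <= `|M| + 1 / 2.
  by apply: h; apply: le_lt_trans (ler_norm M) _; rewrite ltrDl.
have : `|x.1| <= `|x| /\ `|x.2| <= `|x|.
  by rewrite [`|x|]prod_normE !le_max !lexx orbT.
by move=> [h1 h2]; split; lra.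
Qed.

Lemma test_fun_bounded Om phi : test_fun Om phi -> exists C : R, forall x, `|phi x| <= C.
Proof.
move=> tphi; have [sphi [cK _]] := tphi.
have cphi := smooth_continuous sphi.
have : compact (phi @` closure [set x | phi x != 0]).
  by apply: continuous_compact => //; exact: continuous_subspaceT.
move=> /compact_bounded[M [_ hM]].
exists (`|M| + 1) => x.
have [->|nx] := eqVneq (phi x) 0; first by rewrite normr0 addr_ge0.
apply: (hM (`|M| + 1)); first by apply: le_lt_trans (ler_norm M) _; rewrite ltrDl.
by exists x => //; exact: subset_closure.
Qed.

(** [Ck] speaks of derivatives along the axes only. The increment along [e] is split into two
    axis-parallel increments; the mean value theorem expresses each by a partial derivative at a
    nearby point, and continuity of the partial derivatives concludes. *)
Lemma derive_chain_line phi p e (t : R) : Ck 1 phi ->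
  is_derive t 1 (fun s : R => phi (p + s *: e))
   (e.1 * 'D_(Defs.basis ord0) phi (p + t *: e)
    + e.2 * 'D_(Defs.basis ord_max) phi (p + t *: e)).
Proof.
move=> [_ h1].
have [dx [cx _]] := h1 ord0; have [dy [cy _]] := h1 ord_max.
set q := p + t *: e.
set D0 := 'D_(Defs.basis ord0) phi; set D1 := 'D_(Defs.basis ord_max) phi.
have m0 y2 : forall s : R, is_derive s 1 (fun s => phi (s, y2)) (D0 (s, y2)).
  move=> s; have := @is_derive_line phi (0, y2) (Defs.basis ord0) s (dx _).
  have E r : (0, y2) + r *: Defs.basis ord0 = (r, y2) :> pt.
    by rewrite basis_scale eqxx; congr pair; rewrite /= ?add0r ?addr0.
  by rewrite E (_ : (fun r : R => _) = (fun r => phi (r, y2))) //; apply/funext => r; rewrite E.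
have m1 y1 : forall s : R, is_derive s 1 (fun s => phi (y1, s)) (D1 (y1, s)).
  move=> s; have := @is_derive_line phi (y1, 0) (Defs.basis ord_max) s (dy _).
  have E r : (y1, 0) + r *: Defs.basis ord_max = (y1, r) :> pt.
    by rewrite basis_scale /=; congr pair; rewrite /= ?add0r ?addr0.
  by rewrite E (_ : (fun r : R => _) = (fun r => phi (y1, r))) //; apply/funext => r; rewrite E.
have lim : (fun h : R => h^-1 *: (phi (p + (h *: 1 + t) *: e) - phi q)) @ (0 : R)^'
    --> e.1 * D0 q + e.2 * D1 q.
  apply/cvgrPdist_le => eps eps0.
  pose k := `|e.1| + `|e.2| + 1.
  have k0 : 0 < k by rewrite ltr_wpDl // addr_ge0.
  have ek : 0 < eps / k by rewrite divr_gt0.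
  have /cvgrPdist_le /(_ _ ek) := cx q; have /cvgrPdist_le /(_ _ ek) := cy q.
  move=> /nbhs_ballP[r1 /= r10 hr1] /nbhs_ballP[r2 /= r20 hr2].
  have rk : 0 < Num.min r1 r2 / k by rewrite divr_gt0 // lt_min r10.
  near=> h.
  have hn0 : h != 0 by near: h; exact: nbhs_dnbhs_neq.
  have hk : `|h| < Num.min r1 r2 / k by near: h; exact: dnbhs0_lt.
  rewrite ltr_pdivlMr // in hk.
  have -> : p + (h *: 1 + t) *: e = (q.1 + h * e.1, q.2 + h * e.2).
    rewrite /q; case: (p) => p1 p2; case: (e) => e1 e2; congr pair => /=;
      rewrite /GRing.scale /=; ring.
  have [s1 s1i E1] := mean_value (m0 (q.2 + h * e.2)) q.1 (h * e.1).
  have [s2 s2i E2] := mean_value (m1 q.1) q.2 (h * e.2).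
  set A := D0 _ in E1; set B := D1 _ in E2.
  have -> : phi (q.1 + h * e.1, q.2 + h * e.2) - phi q = h * (e.1 * A + e.2 * B).
    have -> : phi q = phi (q.1, q.2) by case: (q).
    move: E1 E2 => /eqP; rewrite subr_eq => /eqP -> /eqP; rewrite subr_eq => /eqP ->; ring.
  have bd s (c : R) : 0 <= s <= 1 -> `|c| <= k -> `|s * (h * c)| < Num.min r1 r2.
    move=> /andP[s0 s1'] ck; apply: le_lt_trans hk.
    rewrite !normrM (ger0_norm s0) mulrCA ler_wpM2l //.
    by apply: le_trans ck; rewrite ler_piMl.
  have e1k : `|e.1| <= k by rewrite /k -addrA lerDl addr_ge0.
  have e2k : `|e.2| <= k by rewrite /k addrAC lerDr addr_ge0.
  have one : 0 <= (1 : R) <= 1 by rewrite ler01 lexx.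
  have zero : 0 <= (0 : R) <= 1 by rewrite ler01 lexx.
  have hA : `|D0 q - A| <= eps / k.
    apply: hr2; split=> /=; rewrite /ball /= opprD addrA subrr sub0r normrN.
      by apply: lt_le_trans (bd _ _ s1i e1k) _; rewrite ge_min lexx orbT.
    rewrite -[h * _]mul1r; apply: lt_le_trans (bd _ _ one e2k) _.
    by rewrite ge_min lexx orbT.
  have hB : `|D1 q - B| <= eps / k.
    apply: hr1; split=> /=; rewrite /ball /=; last first.
      rewrite opprD addrA subrr sub0r normrN.
      by apply: lt_le_trans (bd _ _ s2i e2k) _; rewrite ge_min lexx.
    by rewrite subrr normr0.
  rewrite /GRing.scale /= mulrA mulVf // mul1r.
  have -> : e.1 * D0 q + e.2 * D1 q - (e.1 * A + e.2 * B)
     = e.1 * (D0 q - A) + e.2 * (D1 q - B) by ring.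
  apply: le_trans (ler_normD _ _) _; rewrite !normrM.
  apply: (@le_trans _ _ (`|e.1| * (eps / k) + `|e.2| * (eps / k))).
    by apply: lerD; rewrite ler_wpM2l.
  rewrite -mulrDl mulrA ler_pdivrMr // mulrC ler_wpM2l ?ltW //.
  by rewrite /k; lra.
by split; [apply/cvg_ex; eexists; exact: lim|exact: cvg_lim lim].
Unshelve. all: by end_near. Qed.

Lemma smooth_hat2 (a b c d : R) n : smooth (fun x : pt => hat a b n x.1 * hat c d n x.2).
Proof. by move=> k; apply: Ck_separable; exact: Ck1_hat. Qed.

(** Measurability refers to the product sigma-algebra; an open set is the countable union of the
    open squares with rational centre and rational radius that it contains. *)
Lemma open_measurable2 (U : set pt) : open U ->
  measurable (U : set (measurableTypeR R * measurableTypeR R)).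
Proof.
move=> oU.
pose B (q : rat * rat * rat) : set pt :=
  ball (ratr q.1.1 : R) (ratr q.2) `*` ball (ratr q.1.2 : R) (ratr q.2).
have -> : U = \bigcup_(q in [set q | B q `<=` U]) B q.
  apply/seteqP; split=> [x Ux|x [q /= h /h //]].
  have /nbhs_ballP[r /= r0 rU] : nbhs x U by exact: open_nbhs_nbhs.
  have [d /andP[d0 dr]] : exists d : rat, 0 < (ratr d : R) < r / 2.
    have r2 : 0 < r / 2 by rewrite divr_gt0.
    have [d] := rat_in_itvoo r2.
    by rewrite in_itv /=; exists d.
  have near_rat (t : R) : exists q : rat, `|ratr q - t| < ratr d.
    have [|q] := @rat_in_itvoo R (t - ratr d) (t + ratr d); first by lra.
    by rewrite in_itv /= => /andP[h1 h2]; exists q; rewrite ltr_norml; lra.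
  have [q1 h1] := near_rat x.1; have [q2 h2] := near_rat x.2.
  exists (q1, q2, d); last by [].
  move=> y [/= b1 b2]; apply: rU; split; rewrite /ball /= in b1 b2 *.
    by apply: le_lt_trans (ler_distD (ratr q1) _ _) _; 
      rewrite (splitr r) (distrC x.1) ltrD // ?(lt_trans _ dr).
  by apply: le_lt_trans (ler_distD (ratr q2) _ _) _; 
    rewrite (splitr r) (distrC x.2) ltrD // ?(lt_trans _ dr).
rewrite bigcup_mkcond; apply: countable_bigcupT_measurable => [|q].
  exact: countableP.
case: ifP => _ //; apply: measurableX; exact: measurable_ball.
Qed.

Lemma closed_measurable2 (U : set pt) : closed U ->
  measurable (U : set (measurableTypeR R * measurableTypeR R)).
Proof. move=> cU; rewrite -(setCK U); apply: measurableC.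
by apply: open_measurable2; exact: closed_openC. Qed.

(* The carriers of [leb2] and of Lebesgue measure: [R] with the sigma-algebra
   generated by the half-open intervals. *)
Local Notation mR := (measurableTypeR R).
Local Notation pl := (mR * mR)%type.

Lemma continuous_measurable2 phi : continuous phi ->
  measurable_fun (setT : set pl) (phi : pl -> R).
Proof.
move=> cphi; apply: (measurability _ (RGenOpens.measurableE R)).
move=> _ [_ [a [b ->] <-]]; rewrite setTI; apply: open_measurable2.
by apply: open_comp => [x _|]; [exact: cphi|exact: interval_open].
Qed.

Lemma continuous_measurable1 (f : R -> R) : continuous f ->
  measurable_fun (setT : set mR) (f : mR -> R).
Proof. exact: continuous_measurable_fun. Qed.

Lemma measurable_map2 (h1 h2 : pt -> R) : continuous h1 -> continuous h2 ->
  measurable_fun (setT : set pl) ((fun q : pt => (h1 q, h2 q)) : pl -> pl).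
Proof.
by move=> c1 c2; apply/measurable_fun_pairP; split; exact: continuous_measurable2.
Qed.

End smooth_functions_plane.

(** * Lebesgue measure on the plane *)

Section plane_measure.
Context {R : realType}.
Local Notation pt := (R * R)%type.
Local Notation leb := (@lebesgue_measure R).
Local Notation mR := (measurableTypeR R).
Local Notation pl := (mR * mR)%type.
Implicit Types (p a e x : pt) (f : pt -> \bar R).

Lemma affine1_continuous (a b : R) : continuous (fun x : R => a * x + b).
Proof.
by move=> x; apply: cvgD; [apply: cvgM; [exact: cvg_cst|exact: cvg_id]|exact: cvg_cst].
Qed.

Section affine_line.
Variables (a b : R).
Hypothesis a0 : a != 0.
Let phi : mR -> mR := fun x : R => a * x + b.
Let mphi : measurable_fun setT phi.
Proof.
rewrite /phi; have h := continuous_measurable1 (@affine1_continuous a b); exact: h.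
Qed.
(** The pushforward scaled by [|a|] agrees with Lebesgue measure on half-open intervals. For [a < 0]
    the preimage is closed at the opposite end, with the same length. *)
Lemma lebesgue_measure_affine (A : set mR) : measurable A ->
  leb A = (`|a|%:E * leb (phi @^-1` A))%E.
Proof.
pose m : {measure set mR -> \bar R} :=
  mscale (NngNum (normr_ge0 a)) (pushforward leb phi).
move=> mA; rewrite (@lebesgue_measure_unique R (m mphi)) // => _ [[c d]] _ <-.
change (leb `]c, d]%classic = (`|a|%:E * leb (phi @^-1` `]c, d]%classic))%E).
have [cd|dc] := ltP c d; last first.
  rewrite set_itv_ge ?bnd_simp -?leNgt // preimage_set0 !measure0.
  by rewrite mule0.
have [a_lt0|a_gt0|/eqP] := ltgtP a 0; last by rewrite (negbTE a0).
- have -> : phi @^-1` `]c, d] = `[(d - b) / a, (c - b) / a[%classic.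
    apply/seteqP; split=> x /=; rewrite !in_itv /= /phi.
      by rewrite ler_ndivrMr // ltr_ndivlMr // [x * _]mulrC => /andP[]; lra.
    by rewrite ler_ndivrMr // ltr_ndivlMr // [x * _]mulrC => /andP[]; lra.
  rewrite !lebesgue_measure_itv /= !lte_fin cd ltr_ndivrMr // divfK // ltrD2r cd -EFinD -EFinM ltr0_norm //.
  by congr EFin; field.
- have -> : phi @^-1` `]c, d] = `](c - b) / a, (d - b) / a]%classic.
    apply/seteqP; split=> x /=; rewrite !in_itv /= /phi.
      by rewrite ler_pdivlMr // ltr_pdivrMr // [x * _]mulrC => /andP[]; lra.
    by rewrite ler_pdivlMr // ltr_pdivrMr // [x * _]mulrC => /andP[]; lra.
  rewrite !lebesgue_measure_itv /= !lte_fin cd ltr_pdivrMr // divfK // ltrD2r cd -EFinD -EFinM gtr0_norm //.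
  by congr EFin; field.
Qed.

Lemma ge0_integral_affine1 (f : mR -> \bar R) : measurable_fun setT f ->
  (forall x : R, 0 <= f x)%E ->
  (\int[leb]_x f (a * x + b)%R = (`|a|^-1)%:E * \int[leb]_x f x)%E.
Proof.
move=> mf f0.
pose m : {measure set mR -> \bar R} :=
  mscale (NngNum (normr_ge0 a)) (pushforward leb phi).
have -> : (\int[leb]_x f x = \int[m mphi]_x f x)%E.
  apply: eq_measure_integral => A mA _.
  exact: (lebesgue_measure_affine mA).
rewrite ge0_integral_mscale // muleA -EFinM mulVf ?normr_eq0 // mul1e.
by rewrite (ge0_integral_pushforward mphi) // => x _; exact: f0.
Qed.
End affine_line.

Lemma measurable_pair_affine a e p :
  measurable_fun (setT : set pl) ((fun x : pt => p + x.1 *: a + x.2 *: e) : pl -> pl).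
Proof.
have -> : (fun x : pt => p + x.1 *: a + x.2 *: e)
  = (fun x : pt => (p.1 + x.1 * a.1 + x.2 * e.1, p.2 + x.1 * a.2 + x.2 * e.2)).
  by apply/funext => x; case: (p) (a) (e) => p1 p2 [a1 a2] [e1 e2].
apply: measurable_map2 => x;
  apply: cvgD; try (apply: cvgD; first exact: cvg_cst);
  apply: cvgM; try exact: cvg_cst; (exact: fst_continuous || exact: snd_continuous).
Qed.

Definition det2 a e : R := a.1 * e.2 - a.2 * e.1.

(** The area formula for the linear map with columns [a] and [e], by Fubini and two substitutions on
    the line: first in [t] with slope [a.1], then in [s] with the slope [k] left by eliminating the
    first coordinate, where [a.1 * k = det2 a e]. If [a.1 = 0], the two vectors are exchanged. *)
Lemma ge0_integral_parallelogram f p a e :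
  measurable_fun setT (f : pl -> \bar R) ->
  (forall x, 0 <= f x)%E -> det2 a e != 0 ->
  (\int[leb]_t \int[leb]_s f (p + t *: a + s *: e)%R
    = (`|det2 a e|^-1)%:E * \int[leb2]_x f x)%E.
Proof.
move=> mf f0.
wlog a1 : a e / a.1 != 0 => [W|].
  have [a10 d0|a1 d0] := eqVneq a.1 0; last exact: W.
  have e1 : e.1 != 0.
    by apply: contra_neq d0 => e10; rewrite /det2 a10 e10 mulr0 mul0r subrr.
  have -> : `|det2 a e| = `|det2 e a|.
    by rewrite -normrN; congr (`|_|); rewrite /det2; ring.
  have d0' : det2 e a != 0.
    by apply: contra_neq d0; rewrite /det2 => h; rewrite -[RHS]oppr0 -h; ring.
  rewrite -(W e a e1 d0').
  have := @fubini_tonelli _ _ _ _ _ leb leb (fun x : pl => f (p + x.1 *: a + x.2 *: e))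
    (measurableT_comp mf (measurable_pair_affine a e p)) (fun x => f0 _).
  rewrite /= => ->.
  by apply: eq_integral => s _; apply: eq_integral => t _; rewrite addrAC.
move=> d0; pose k := e.2 - e.1 * a.2 / a.1.
have dk : det2 a e = a.1 * k by rewrite /det2 /k; field.
have k0 : k != 0 by apply: contra_neq d0 => k0; rewrite dk k0 mulr0.
pose g (x : pt) := f (x.1, p.2 + (x.1 - p.1) * a.2 / a.1 + x.2 * k).
have mg : measurable_fun setT (g : pl -> \bar R).
  apply: (measurableT_comp mf); apply: measurable_map2 => x; first exact: fst_continuous.
  apply: cvgD; last by apply: cvgM; [exact: snd_continuous|exact: cvg_cst].
  apply: cvgD; first exact: cvg_cst.
  apply: cvgM; last exact: cvg_cst; apply: cvgM; last exact: cvg_cst.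
  by apply: cvgB; [exact: fst_continuous|exact: cvg_cst].
have mgs s : measurable_fun setT (fun t : mR => g (t, s)).
  by apply: measurableT_comp => //; exact: measurable_pair2.
have mgt t : measurable_fun setT (fun s : mR => g (t, s)).
  by apply: measurableT_comp => //; exact: measurable_pair1.
have := @fubini_tonelli _ _ _ _ _ leb leb (fun x : pl => f (p + x.1 *: a + x.2 *: e))
  (measurableT_comp mf (measurable_pair_affine a e p)) (fun x => f0 _).
rewrite /= => ->.
have step s : (\int[leb]_t f (p + t *: a + s *: e)%R
    = (`|a.1|^-1)%:E * \int[leb]_t g (t, s))%E.
  rewrite -(@ge0_integral_affine1 _ (p.1 + s * e.1) a1 (fun t => g (t, s))) //; last by move=> t; exact: f0.
  apply: eq_integral => t _; rewrite /g; congr f.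
  case: (p) (a) (e) a1 @k {dk k0 g mg mgs mgt} => p1 p2 [a1 a2] [e1 e2] /= h.
  by congr pair => /=; rewrite /GRing.scale /=; [ring|field].
under eq_integral do rewrite step.
have hmG := measurable_fun_fubini_tonelli_G (m1 := leb) (g : pl -> \bar R) mg (fun x => f0 _).
rewrite (ge0_integralZl leb measurableT hmG); last 2 first.
- by move=> s _; apply: integral_ge0 => r _; exact: f0.
- by rewrite lee_fin invr_ge0.
have := @fubini_tonelli _ _ _ _ _ leb leb g mg (fun x => f0 _).
move=> <-.
have step2 t : (\int[leb]_s g (t, s) = (`|k|^-1)%:E * \int[leb]_s f (t, s))%E.
  rewrite -(@ge0_integral_affine1 _ (p.2 + (t - p.1) * a.2 / a.1) k0 (fun s => f (t, s))) //.
    by apply: eq_integral => s _; rewrite /g /=; congr (f (_, _)); ring.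
  by apply: measurableT_comp => //; exact: measurable_pair1.
under eq_integral do rewrite step2.
have hmF := measurable_fun_fubini_tonelli_F (m2 := leb) (f : pl -> \bar R) mf (fun x => f0 _).
rewrite (ge0_integralZl leb measurableT hmF); last 2 first.
- by move=> s _; apply: integral_ge0 => r _; exact: f0.
- by rewrite lee_fin invr_ge0.
have -> : (\int[leb2]_x f x = \int[leb]_x fubini_F leb (f : pl -> \bar R) x)%E.
  exact: (fubini_tonelli1 (m1 := leb) (m2 := leb) (f : pl -> \bar R) mf f0).
by rewrite muleA -EFinM -invfM -normrM -dk.
Qed.

Lemma ge0_integral_homothety f (c : R) p :
  measurable_fun setT (f : pl -> \bar R) ->
  (forall x, 0 <= f x)%E -> c != 0 ->
  (\int[leb2]_x f (c *: x + p)%R = (c ^- 2)%:E * \int[leb2]_x f x)%E.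
Proof.
move=> mf f0 c0.
have d0 : det2 (c, 0) (0, c) = c ^+ 2 by rewrite /det2 /=; ring.
have E (x : pt) : c *: x + p = p + x.1 *: (c, 0) + x.2 *: (0, c).
  by case: x (p) => x1 x2 [p1 p2]; congr pair => /=; rewrite /GRing.scale /=; ring.
rewrite /leb2 (fubini_tonelli1 (fun x : pl => f (c *: (x : pt) + p)%R)) //; last first.
  by under eq_fun do rewrite E; apply: measurableT_comp => //; exact: measurable_pair_affine.
have := @ge0_integral_parallelogram f p (c, 0) (0, c) mf f0.
rewrite d0 (expf_neq0 _ c0) ger0_norm ?sqr_ge0 // => /(_ isT) <-.
by apply: eq_integral => t _; apply: eq_integral => s _; rewrite E.
Qed.

Lemma leb2_box (a b c d : R) : a <= b -> c <= d ->
  leb2 (box a b c d) = ((b - a) * (d - c))%:E.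
Proof.
move=> ab cd; rewrite /leb2 /box product_measure1E //=.
have len (u v : R) : u <= v -> leb `[u, v]%classic = (v - u)%:E.
  rewrite le_eqVlt lebesgue_measure_itv /= lte_fin => /predU1P[->|->//].
  by rewrite ltxx subrr.
by rewrite EFinM; congr (_ * _)%E; exact: len.
Qed.

Lemma leb2_bounded_fin (A : set pl) (L : R) : measurable A ->
  (forall x, A x -> `|x.1| <= L /\ `|x.2| <= L) -> (leb2 A < +oo)%E.
Proof.
move=> mA hA; have [->|/set0P[x Ax]] := eqVneq A set0; first by rewrite /leb2 measure0.
have L0 : 0 <= L by have [h _] := hA x Ax; exact: le_trans h.
have sub : A `<=` box (- L) L (- L) L.
  by move=> y /hA[]; rewrite !ler_norml => h1 h2; split; rewrite /= in_itv.
apply: (@le_lt_trans _ _ (leb2 (box (- L) L (- L) L))).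
  apply: le_measure => //; rewrite inE //.
  by apply: measurableX; exact: measurable_itv.
by rewrite leb2_box ?ltry //; lra.
Qed.

End plane_measure.

(** * The fundamental lemma of the calculus of variations *)

Section fundamental_lemma.
Context {R : realType}.
Local Notation pt := (R * R)%type.
Local Notation mR := (measurableTypeR R).
Local Notation pl := (mR * mR)%type.
Implicit Types (Om : set pt) (g phi : pt -> R).

Definition ocbox (a b c d : R) : set pt := `]a, b]%classic `*` `]c, d]%classic.

Lemma measurable_ocbox a b c d : measurable (ocbox a b c d : set pl).
Proof. by apply: measurableX; exact: measurable_itv. Qed.

Section charge_plane.
Variable nu : {charge set pl -> \bar R}.
Variable L : R.
Hypothesis nuL : forall A : set pl, measurable A -> nu A = nu (A `&` ocbox (- L) L (- L) L).
Hypothesis nu0 : forall a b c d, nu (ocbox a b c d) = 0%E.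

Let nuC (A B : set pl) : measurable A -> measurable B -> A `<=` B ->
  nu A = 0%E -> nu B = 0%E -> nu (B `\` A) = 0%E.
Proof.
by move=> mA mB AB A0 B0; rewrite chargeD // setIidr // A0 B0 sube0.
Qed.

Let nuU (F : (set pl)^nat) : (forall n, measurable (F n)) -> trivIset setT F ->
  (forall n, nu (F n) = 0%E) -> nu (\bigcup_n F n) = 0%E.
Proof.
move=> mF tF F0; have := @charge_semi_sigma_additive _ _ _ nu F mF tF.
move=> /(_ (bigcupT_measurable _ mF)).
have -> : (fun n => \sum_(0 <= i < n) nu (F i))%E = (fun=> 0%E).
  by apply/funext => n; rewrite big1.
by move=> /(cvg_unique _ (@cvg_cst _ _ _ _ _)) h; rewrite -h.
Qed.

Let oc_setI : setI_closed (@ocitv R).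
Proof. by move=> A B mA mB; exact: (@measurableI _ (ocitv_type R)). Qed.

Let step1 (c d : R) (A : set mR) : measurable A -> nu (A `*` `]c, d]%classic) = 0%E.
Proof.
move=> mA; apply: (@dynkin_induction _ mR (@ocitv R) (fun A => nu (A `*` `]c, d]%classic) = 0%E)) mA => //.
- rewrite nuL; last by apply: measurableX => //; exact: measurable_itv.
  rewrite -(nu0 (- L) L (Num.max c (- L)) (Num.min d L)); congr (nu _).
  apply/seteqP; split=> x /=; rewrite /ocbox /= !in_itv /= gt_max le_min.
    by move=> [[_ /andP[h1 h2]] [h3 /andP[h4 h5]]]; rewrite h1 h2 h4 h5.
  by move=> [h3 /andP[/andP[h1 h4] /andP[h2 h5]]]; rewrite h1 h2 h4 h5.
- by move=> _ [[a b] _ <-]; exact: nu0.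
- move=> S mS S0.
  have -> : ~` S `*` `]c, d]%classic = (setT `*` `]c, d]%classic) `\` (S `*` `]c, d]%classic).
    apply/seteqP; split=> [x [/= h1 h2]|x [/= [_ h1] h2]].
      by split=> //= -[/h1].
    by split=> //= h3; apply: h2; split.
  have mI : measurable (`]c, d]%classic : set mR) by exact: measurable_itv.
  apply: nuC => //; try exact: measurableX; first by move=> x [].
  rewrite nuL; last exact: measurableX.
  rewrite -(nu0 (- L) L (Num.max c (- L)) (Num.min d L)); congr (nu _).
  apply/seteqP; split=> x /=; rewrite /ocbox /= !in_itv /= gt_max le_min.
    by move=> [[_ /andP[h1 h2]] [h3 /andP[h4 h5]]]; rewrite h1 h2 h4 h5.
  by move=> [h3 /andP[/andP[h1 h4] /andP[h2 h5]]]; rewrite h1 h2 h4 h5.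
- move=> F mF tF F0; rewrite setX_bigcupl; apply: nuU => //.
    by move=> n; apply: measurableX => //; exact: measurable_itv.
  apply/trivIsetP => i j _ _ ij; rewrite -setXI.
  by move/trivIsetP : tF => -> //; rewrite set0X.
Qed.

Let step2 (A B : set mR) : measurable A -> measurable B -> nu (A `*` B) = 0%E.
Proof.
move=> mA mB.
have nuT : nu (A `*` setT) = 0%E.
  rewrite nuL; last exact: measurableX.
  have -> : A `*` setT `&` ocbox (- L) L (- L) L = (A `&` `]- L, L]%classic) `*` `]- L, L]%classic.
    by apply/seteqP; split=> x /= => [[[? ?] [? ?]]|[[? ?] ?]].
  by apply: step1; apply: measurableI => //; exact: measurable_itv.
apply: (@dynkin_induction _ mR (@ocitv R) (fun B => nu (A `*` B) = 0%E)) mB => //.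
- by move=> _ [[a b] _ <-]; exact: step1.
- move=> S mS S0.
  have -> : A `*` ~` S = (A `*` setT) `\` (A `*` S).
    apply/seteqP; split=> [x [/= h1 h2]|x [/= [h1 _] h2]].
      by split=> //= -[_ /h2].
    by split=> //= h3; apply: h2; split.
  by apply: nuC => //; try exact: measurableX; move=> x [].
- move=> F mF tF F0; rewrite setX_bigcupr; apply: nuU => //.
    by move=> n; exact: measurableX.
  apply/trivIsetP => i j _ _ ij; rewrite -setXI.
  by move/trivIsetP : tF => -> //; rewrite setX0.
Qed.

(** Dynkin induction three times: in the first coordinate, in the second, and over the rectangles
    that generate the product sigma-algebra. Confinement to a bounded square turns the whole line,
    needed for complements, into an interval. *)
Lemma charge_ocbox_eq0 (A : set pl) : measurable A -> nu A = 0%E.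
Proof.
have E := @measurable_prod_measurableType _ _ mR mR.
move=> mA; apply: (@dynkin_induction _ pl [set A `*` B | A in measurable & B in measurable]
   (fun A => nu A = 0%E)) => //.
- move=> _ _ [A1 mA1 [B1 mB1 <-]] [A2 mA2 [B2 mB2 <-]].
  by rewrite -setXI; exists (A1 `&` A2); [exact: measurableI|exists (B1 `&` B2) => //; exact: measurableI].
- by rewrite -setXTT; exact: step2.
- by move=> _ [A1 mA1 [B1 mB1 <-]]; exact: step2.
- move=> S mS S0; rewrite -setTD; apply: nuC => //.
  by rewrite -setXTT; exact: step2.
- by rewrite -E.
Qed.
End charge_plane.

Lemma leb2_vline (a : R) : leb2 ([set a] `*` setT : set pl) = 0%E.
Proof. by rewrite /leb2 product_measure1E //= lebesgue_measure_set1 mul0e. Qed.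

Lemma leb2_hline (a : R) : leb2 (setT `*` [set a] : set pl) = 0%E.
Proof. by rewrite /leb2 product_measure1E //= lebesgue_measure_set1 mule0. Qed.

Lemma ae_fst_neq (a : R) : {ae leb2, forall x : pl, x.1 <> a}.
Proof.
exists ([set a] `*` setT); split.
- exact: measurableX.
- exact: leb2_vline.
- by move=> x /= /contrapT h; split.
Qed.

Lemma ae_snd_neq (a : R) : {ae leb2, forall x : pl, x.2 <> a}.
Proof.
exists (setT `*` [set a]); split.
- exact: measurableX.
- exact: leb2_hline.
- by move=> x /= /contrapT h; split.
Qed.

Lemma open_rat_box (U : set pt) x : open U -> U x ->
  exists q : rat * rat * rat, let c := (ratr q.1.1 : R) in let d := (ratr q.1.2 : R) in
    let r := (ratr q.2 : R) in
    [/\ 0 < r, box (c - r) (c + r) (d - r) (d + r) `<=` U &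
        ocbox (c - r) (c + r) (d - r) (d + r) x].
Proof.
move=> oU Ux.
have /nbhs_ballP[r /= r0 rU] : nbhs x U by exact: open_nbhs_nbhs.
have r2 : 0 < r / 2 by rewrite divr_gt0.
have [d] := rat_in_itvoo r2; rewrite in_itv /= => /andP[d0 dr].
have near_rat (t : R) : exists q : rat, `|t - ratr q| < ratr d.
  have [|q] := @rat_in_itvoo R (t - ratr d) (t + ratr d); first by lra.
  by rewrite in_itv /= => /andP[h1 h2]; exists q; rewrite ltr_norml; lra.
have [q1 h1] := near_rat x.1; have [q2 h2] := near_rat x.2.
exists (q1, q2, d); split=> //=.
- have close (t u : R) (q : rat) : `|t - ratr q| < ratr d ->
      ratr q - ratr d <= u <= ratr q + ratr d -> `|t - u| < r.
    move=> h1' /andP[b1 b2]; apply: le_lt_trans (ler_distD (ratr q) _ _) _.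
    rewrite (splitr r) ltrD ?(lt_trans h1') // (le_lt_trans _ dr) //.
    by rewrite ler_norml; apply/andP; split; lra.
  move=> y [/=]; rewrite !in_itv /= => b1 b2; apply: rU.
  by split; [exact: close h1 b1|exact: close h2 b2].
- by move: h1 h2; rewrite !ltr_norml => h1 h2; split; rewrite /= in_itv /=; apply/andP; split; lra.
Qed.

(** Every point of [U] lies in one of countably many rational half-open squares whose closed
    versions are contained in [U], so the exceptional sets add up to a null set. *)
Lemma ae_open_local (U : set pt) (P : pt -> Prop) : open U ->
  (forall a b c d : R, box a b c d `<=` U -> {ae leb2, forall x : pl, ocbox a b c d x -> P x}) ->
  {ae leb2, forall x : pl, U x -> P x}.
Proof.
move=> oU hP.
pose F k : set pl := if unpickle k is Some q then
   let c := (ratr (q : rat * rat * rat).1.1 : R) in let d := (ratr q.1.2 : R) in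
   let r := (ratr q.2 : R) in
   [set x : pl | box (c - r) (c + r) (d - r) (d + r) `<=` U /\
     ~ (ocbox (c - r) (c + r) (d - r) (d + r) x -> P x)] else set0.
have nF k : leb2.-negligible (F k).
  rewrite /F; case: unpickle => [q|]; last exact: negligible_set0.
  have [sub|nsub] := pselect (box (ratr q.1.1 - ratr q.2) (ratr q.1.1 + ratr q.2)
     (ratr q.1.2 - ratr q.2) (ratr q.1.2 + ratr q.2) `<=` U).
    by apply: negligibleS (hP _ _ _ _ sub) => x [].
  by apply: negligibleS (@negligible_set0 _ _ _ leb2) => x [].
have := negligible_bigcup nF; apply: negligibleS => x /= h.
have [Ux nPx] : U x /\ ~ P x by apply: contrapT => h'; apply: h => Ux; apply: contrapT => nP; exact: h'.
have [q /= [r0 sub xq]] := open_rat_box oU Ux.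
exists (pickle q); first by [].
rewrite /F pickleK /=; split; first exact: sub.
by move=> /(_ xq).
Qed.

Section box_integrals.
Variables (Om : set pt) (g : pt -> R).
Hypothesis oOm : open Om.
Hypothesis ig : leb2.-integrable (Om : set pl) (EFin \o g).
Hypothesis g0 : forall phi, test_fun Om phi -> L2ip Om g phi = 0.

Let mOm : measurable (Om : set pl). Proof. exact: open_measurable2. Qed.

Let mg : measurable_fun (Om : set pl) (g : pl -> R).
Proof. by apply/measurable_EFinP; exact: measurable_int ig. Qed.

Let int_box0 a b c d : box a b c d `<=` Om ->
  (\int[leb2]_(x in ocbox a b c d) (g x)%:E = 0)%E.
Proof.
move=> sub.
have oc_sub : ocbox a b c d `<=` Om.
  apply: subset_trans sub => x [] /=; rewrite !in_itv /= => /andP[h1 h2] /andP[h3 h4].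
  by split; rewrite /= in_itv /= ltW.
pose phi n (x : pt) := hat a b n x.1 * hat c d n x.2.
have tphi n : test_fun Om (phi n).
  apply: (@test_fun_box _ _ _ a b c d) => //; first exact: smooth_hat2.
  move=> x; rewrite mulf_eq0 negb_or => /andP[/hat_support h1 /hat_support h2].
  by move: h1 h2 => /andP[? ?] /andP[? ?]; split; rewrite /= in_itv /= !ltW.
have phi1 n x : `|phi n x| <= 1.
  by rewrite normrM mulr_ile1 // ger0_norm ?hat_ge0 ?hat_le1.
have mphi n : measurable_fun (Om : set pl) (phi n : pl -> R).
  apply: (@measurable_funS _ _ _ _ setT) => //.
  by apply: continuous_measurable2; exact: smooth_continuous (test_fun_smooth (tphi n)).
have mgphi n : measurable_fun (Om : set pl) (fun x : pl => (g x * phi n x)%:E).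
  by apply/measurable_EFinP; exact: measurable_funM.
have dom n (x : pl) : (`|(g x * phi n x)%:E| <= `|(g x)%:E|)%E.
  by rewrite lee_fin normrM ler_piMr.
have int0 n : (\int[leb2]_(x in Om) (g x * phi n x)%:E = 0)%E.
  have := g0 (tphi n); rewrite /L2ip /Rintegral => /eqP; rewrite fine_eq0.
    by move=> /eqP.
  apply: integrable_fin_num => //; apply: (le_integrable mOm _ _ ig) => [|x _].
    exact: mgphi.
  exact: (dom n x).
pose chi (x : pt) : R := \1_(ocbox a b c d) x.
have mchi : measurable_fun (Om : set pl) (chi : pl -> R).
  by apply: measurable_indic; exact: measurable_ocbox.
have [||||_ _] := @dominated_convergence _ pl R leb2 Om mOm
  (fun n (x : pl) => (g x * phi n x)%:E) (fun x : pl => (g x * chi x)%:E)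
  (abse \o (EFin \o g)) mgphi.
- by apply/measurable_EFinP; exact: measurable_funM.
(* The products of hats converge to the indicator of the open box; it differs from [chi], the
   indicator of the half-open box, only on two null lines. *)
- apply: filterS2 (ae_fst_neq b) (ae_snd_neq d) => x xb xd _.
  apply/cvg_EFin; first exact: nearW.
  apply: cvgM; first exact: cvg_cst.
  have -> : chi x = \1_(`]a, b[%classic) x.1 * \1_(`]c, d[%classic) x.2.
    rewrite /chi !indicE -natrM mulnb; congr (_ %:R); congr nat_of_bool.
    apply/idP/andP; rewrite !inE /ocbox /= !in_itv /=.
      move=> [/andP[-> h1] /andP[-> h2]]; rewrite !lt_neqAle h1 h2 !andbT.
      by split; apply/eqP.
    by move=> [/andP[-> /ltW ->] /andP[-> /ltW ->]].
  by apply: cvgM; exact: cvg_hat.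
- exact: integrable_abse.
- by apply: aeW => x n _; exact: dom.
move=> h; have {h} : (fun=> 0%E) @ \oo --> (\int[leb2]_(x in Om) (g x * chi x)%:E)%E.
  by move: h; rewrite (_ : (fun n => _) = fun=> 0%E) //; apply/funext => n; exact: int0.
move=> /(cvg_unique _ (@cvg_cst _ _ _ _ _)) h.
have -> : ocbox a b c d = Om `&` ocbox a b c d by rewrite setIidr.
rewrite integral_mkcondr (h (@ereal_hausdorff R)); apply: eq_integral => x _.
rewrite patchE /chi indicE; case: (x \in _); last by rewrite mulr0.
by rewrite mulr1.
Qed.

(** Indicators of boxes are limits of test functions. Hence the charge with density [g], confined to
    one box, vanishes on all half-open boxes, therefore on all measurable sets, and its density is 0
    a.e. *)
Lemma fundamental_lemma : {ae leb2, forall x : pl, Om x -> g x = 0}.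
Proof.
apply: ae_open_local => // a b c d sub.
set Q := ocbox a b c d.
have mQ : measurable (Q : set pl) by exact: measurable_ocbox.
have oc_sub : Q `<=` Om.
  apply: subset_trans sub => x [] /=; rewrite !in_itv /= => /andP[h1 h2] /andP[h3 h4].
  by split; rewrite /= in_itv /= ltW.
have iQ : leb2.-integrable (Q : set pl) (EFin \o g) by exact: integrableS ig.
have if0 : leb2.-integrable (setT : set pl) ((EFin \o g) \_ Q).
  by rewrite -integrable_mkcond.
pose nu : {charge set pl -> \bar R} := induced_charge if0.
have nuE (A : set pl) : nu A = (\int[leb2]_(x in A `&` Q) (g x)%:E)%E.
  by rewrite /nu /= /induced_charge integral_mkcondr.
pose L := `|a| + `|b| + `|c| + `|d| + 1.
have QL : Q `<=` ocbox (- L) L (- L) L.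
  have [h1 h2 h3 h4] : [/\ `|a| <= L - 1, `|b| <= L - 1, `|c| <= L - 1 & `|d| <= L - 1].
    have := normr_ge0 a; have := normr_ge0 b; have := normr_ge0 c; have := normr_ge0 d.
    by rewrite /L => *; split; lra.
  move: h1 h2 h3 h4; rewrite !ler_norml => /andP[? ?] /andP[? ?] /andP[? ?] /andP[? ?].
  by move=> x [/=]; rewrite !in_itv /= => /andP[? ?] /andP[? ?]; split;
    rewrite /= in_itv /=; apply/andP; split; lra.
have nuz (A : set pl) : measurable A -> nu A = 0%E.
  apply: (@charge_ocbox_eq0 nu L) => [{}A mA|a1 b1 c1 d1].
    by rewrite !nuE; congr (integral _ _ _); rewrite -setIA (setIidr QL).
  rewrite nuE.
  have -> : ocbox a1 b1 c1 d1 `&` Q = ocbox (Num.max a1 a) (Num.min b1 b) (Num.max c1 c) (Num.min d1 d).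
    apply/seteqP; split=> x /=; rewrite /Q /ocbox /= !in_itv /= !gt_max !le_min.
      by move=> [[/andP[-> ->] /andP[-> ->]] [/andP[-> ->] /andP[-> ->]]].
    by move=> [/andP[/andP[-> ->] /andP[-> ->]] /andP[/andP[-> ->] /andP[-> ->]]].
  apply: int_box0; apply: subset_trans sub => x /=; rewrite /box /= !in_itv /= !ge_max !le_min.
  by move=> [/andP[/andP[_ ->] /andP[_ ->]] /andP[/andP[_ ->] /andP[_ ->]]].
have : ae_eq leb2 (Q : set pl) (EFin \o g) (cst 0%E).
  apply: integral_ae_eq => // E EQ mE.
  rewrite integral0 -(nuz E mE) nuE; congr (integral _ _ _).
  by rewrite setIidl.
by apply: filterS => x /[apply] -[].
Qed.
End box_integrals.

End fundamental_lemma.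

(** * Weak derivatives and Sobolev spaces *)

Section weak_derivatives.
Context {R : realType}.
Local Notation pt := (R * R)%type.
Local Notation leb := (@lebesgue_measure R).
Local Notation mR := (measurableTypeR R).
Local Notation pl := (mR * mR)%type.
Implicit Types (f g h u v phi psi : pt -> R) (i j : 'I_2).

Lemma L2_bounded (D : set pl) g (C : R) : measurable D -> (leb2 D < +oo)%E ->
  measurable_fun D (g : pl -> R) -> (forall x, D x -> `|g x| <= C) -> L2 D g.
Proof.
move=> mD finD mg gC.
have [->|/set0P[x0 Dx0]] := eqVneq D set0.
  by apply/inLp2P => //; split; [exact: measurable_fun_set0|exact: integrable_set0].
have C0 : 0 <= C by exact: le_trans (normr_ge0 _) (gC x0 Dx0).
apply: (@inLp2_bound _ pl R leb2 D mD g (C * Num.sqrt (fine (leb2 D))) mg _ _).1.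
  rewrite exprMn sqr_sqrtr ?fine_ge0 ?measure_ge0 // EFinM fineK ?ge0_fin_numE //.
  rewrite -integral_cst //; apply: ge0_le_integral => //.
  - by move=> x _; rewrite lee_fin sqr_ge0.
  - exact: measurable_sqr.
  - move=> x Dx; rewrite /= lee_fin -[g x ^+ 2]real_normK ?num_real //.
    by rewrite ler_sqr ?nnegrE ?gC.
by rewrite mulr_ge0 ?sqrtr_ge0.
Qed.

Lemma L2_integrable (D : set pl) g : measurable D -> (leb2 D < +oo)%E ->
  L2 D g -> leb2.-integrable D (EFin \o g).
Proof.
move=> mD finD hg.
have h1 : L2 D (cst 1).
  by apply: (@L2_bounded D _ 1) => // x _; rewrite normr1.
have := integrable_mulL2 mD hg h1; apply: eq_integrable => // x _.
by rewrite /= mulr1.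
Qed.

Lemma continuous_bounded_box phi (L : R) : continuous phi ->
  exists C : R, forall x, box (- L) L (- L) L x -> `|phi x| <= C.
Proof.
move=> cphi.
have : compact (phi @` box (- L) L (- L) L).
  by apply: continuous_compact; [exact: continuous_subspaceT|exact: compact_box].
move=> /compact_bounded[M [_ hM]].
exists (`|M| + 1) => x bx.
apply: (hM (`|M| + 1)); first by apply: le_lt_trans (ler_norm M) _; rewrite ltrDl.
by exists x.
Qed.

Lemma measurable_box (a b c d : R) : measurable (box a b c d : set pl).
Proof. by apply: measurableX; exact: measurable_itv. Qed.

Lemma integral_derivative0 (F F' : R -> R) (L : R) : 0 < L ->
  (forall t : R, is_derive t 1 F (F' t)) -> continuous F' ->
  (forall t, L <= `|t| -> F t = 0 /\ F' t = 0) ->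
  (\int[leb]_t (F' t)%:E = 0)%E.
Proof.
move=> L0 dF cF' out.
have -> : (\int[leb]_t (F' t)%:E = \int[leb]_(t in `[(- L)%R, L]%classic) (F' t)%:E)%E.
  rewrite [RHS]integral_mkcond; apply: eq_integral => t _.
  rewrite patchE; case: ifPn => // /negP nt; congr EFin.
  apply: (out t _).2; rewrite leNgt; apply/negP => h; apply: nt.
  by rewrite inE /= in_itv /= -ler_norml ltW.
rewrite (continuous_FTC2 (F := F)); first last.
- by move=> t _; rewrite derive1E; case: (dF t).
- have cF := is_derive_continuous dF.
  split; first by move=> t _; case: (dF t).
    by apply: cvg_at_right_filter; exact: cF.
  by apply: cvg_at_left_filter; exact: cF.
- exact: continuous_subspaceT.
- by rewrite gtrN.
by rewrite (out L _).1 ?(out (- L) _).1 ?normrN ?gtr0_norm // subee.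
Qed.

(** Fubini reduces the integral to lines parallel to the axis [i]; on each of them the fundamental
    theorem of calculus on [-L, L] has vanishing end values. *)
Lemma integral_partial0 i (chi chi' : pt -> R) (L : R) : 0 < L ->
  (forall x, is_derive x (Defs.basis i) chi (chi' x)) -> continuous chi' ->
  (forall x, L <= `|x.1| \/ L <= `|x.2| -> chi x = 0 /\ chi' x = 0) ->
  (leb2.-integrable (setT : set pl) (EFin \o chi')) /\
  (\int[leb2]_x (chi' x)%:E = 0)%E.
Proof.
move=> L0 dchi cchi' out.
have mB := measurable_box (- L) L (- L) L.
have finB : (leb2 (box (- L) L (- L) L) < +oo)%E by rewrite leb2_box ?ltry //; lra.
have int : leb2.-integrable (setT : set pl) (EFin \o chi').
  have -> : EFin \o chi' = (EFin \o chi') \_ (box (- L) L (- L) L).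
    apply/funext => x; rewrite patchE; case: ifPn => // /negP nx /=; congr EFin.
    apply: (out x _).2; apply: contra_notP nx => /not_orP[] /negP.
    rewrite -ltNge ltr_norml => /andP[h1 h2] /negP; rewrite -ltNge ltr_norml => /andP[h3 h4].
    by rewrite inE; split; rewrite /= in_itv /= !ltW.
  rewrite -integrable_mkcond //; apply: L2_integrable => //.
  have [C hC] := continuous_bounded_box L cchi'.
  apply: (@L2_bounded _ _ C) => //.
  by apply: (@measurable_funS _ _ _ _ setT) => //; exact: continuous_measurable2.
split=> //.
have E0 (x2 r : R) : (0, x2) + r *: Defs.basis ord0 = (r, x2) :> pt.
  by rewrite basis_scale eqxx; congr pair; rewrite /= ?add0r ?addr0.
have E1 (x1 r : R) : (x1, 0) + r *: Defs.basis ord_max = (x1, r) :> pt.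
  by rewrite basis_scale /=; congr pair; rewrite /= ?add0r ?addr0.
have cs1 (x2 : R) : continuous (fun r : R => chi' (r, x2)).
  have := (fun r => continuous_comp (@line_continuous R (0, x2) (Defs.basis ord0) r) (cchi' _)).
  by move=> h r; move: (h r); rewrite (_ : _ \o _ = fun r => chi' (r, x2)) //;
    apply/funext => t; rewrite /= E0.
have cs2 (x1 : R) : continuous (fun r : R => chi' (x1, r)).
  have := (fun r => continuous_comp (@line_continuous R (x1, 0) (Defs.basis ord_max) r) (cchi' _)).
  by move=> h r; move: (h r); rewrite (_ : _ \o _ = fun r => chi' (x1, r)) //;
    apply/funext => t; rewrite /= E1.
have [i0|i1] := eqVneq i ord0.
  rewrite /leb2 -(integral21_prod_meas1 (m1 := leb) (m2 := leb) int).
  apply: integral0_eq => y _; rewrite /fubini_G.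
  apply: (@integral_derivative0 (fun r => chi (r, y)) (fun r => chi' (r, y)) L) => //.
    move=> t; have := @is_derive_line R chi (0, y) (Defs.basis ord0) t.
    rewrite E0 (_ : (fun s : R => _) = (fun r => chi (r, y))); last first.
      by apply/funext => r; rewrite E0.
    have [h1 h2] := dchi (t, y); rewrite i0 in h1 h2.
    by rewrite h2; apply.
  by move=> t tL; apply: out; left.
have {}i1 : i = ord_max by apply/val_inj; case: i i1 {dchi} => [[|[|]]].
rewrite /leb2 -(integral12_prod_meas1 (m1 := leb) (m2 := leb) int).
apply: integral0_eq => y _; rewrite /fubini_F.
apply: (@integral_derivative0 (fun r => chi (y, r)) (fun r => chi' (y, r)) L) => //.
  move=> t; have := @is_derive_line R chi (y, 0) (Defs.basis ord_max) t.
  rewrite E1 (_ : (fun s : R => _) = (fun r => chi (y, r))); last first.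
    by apply/funext => r; rewrite E1.
  have [h1 h2] := dchi (y, t); rewrite i1 in h1 h2.
  by rewrite h2; apply.
by move=> t tL; apply: out; right.
Qed.

Section domain.
Variable Om : set pt.
Hypothesis oOm : open Om.
Hypothesis bOm : exists L : R, forall x, Om x -> `|x.1| <= L /\ `|x.2| <= L.

Lemma measurable_domain : measurable (Om : set pl). Proof. exact: open_measurable2. Qed.
Local Notation mOm := measurable_domain.

Lemma domain_fin : (leb2 (Om : set pl) < +oo)%E.
Proof. by have [L hL] := bOm; exact: (leb2_bounded_fin mOm hL). Qed.

Lemma continuous_L2 phi : continuous phi -> L2 Om phi.
Proof.
move=> cphi; have [L hL] := bOm; have [C hC] := continuous_bounded_box L cphi.
apply: (@L2_bounded _ _ C) => //; [exact: mOm|exact: domain_fin| |].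
  by apply: (@measurable_funS _ _ _ _ setT) => //; exact: continuous_measurable2.
move=> x /hL[h1 h2]; apply: hC; move: h1 h2; rewrite !ler_norml => h1 h2.
by split; rewrite /= in_itv.
Qed.

Lemma smooth_L2 phi : smooth phi -> L2 Om phi.
Proof. by move=> /smooth_continuous; exact: continuous_L2. Qed.

Lemma smoothD_L2 i phi : smooth phi -> L2 Om ('D_(Defs.basis i) phi).
Proof. by move=> /(smoothD_i i)/smooth_L2. Qed.

Lemma test_L2 phi : test_fun Om phi -> L2 Om phi.
Proof. by move=> /test_fun_smooth/smooth_L2. Qed.

Lemma L2_domain_integrable g : L2 Om g -> leb2.-integrable (Om : set pl) (EFin \o g).
Proof. by apply: L2_integrable; [exact: mOm|exact: domain_fin]. Qed.

Lemma L2ipC f g : L2ip Om f g = L2ip Om g f. Proof. exact: Rintegral_mulC. Qed.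

Lemma L2ip_linl c f g h : L2 Om f -> L2 Om g -> L2 Om h ->
  L2ip Om (fun x => c * f x + g x) h = c * L2ip Om f h + L2ip Om g h.
Proof. exact: (RintegralM_linl mOm). Qed.

Lemma L2ipBl f g h : L2 Om f -> L2 Om g -> L2 Om h ->
  L2ip Om (fun x => f x - g x) h = L2ip Om f h - L2ip Om g h.
Proof.
move=> hf hg hh; have -> : (fun x => f x - g x) = (fun x => -1 * g x + f x).
  by apply/funext => x; ring.
by rewrite L2ip_linl //; ring.
Qed.

Lemma L2ip_ae f g h : L2 Om f -> L2 Om g -> L2 Om h -> ae_eq leb2 (Om : set pl) f g ->
  L2ip Om f h = L2ip Om g h.
Proof.
move=> [mf _] [mg _] [mh _] fg; apply: (ae_eq_Rintegral mOm).
- exact: measurable_funM.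
- exact: measurable_funM.
- by apply: filterS fg => x /[apply] ->.
Qed.

Lemma smooth_ibp i phi psi : smooth phi -> test_fun Om psi ->
  L2ip Om phi ('D_(Defs.basis i) psi) = - L2ip Om ('D_(Defs.basis i) phi) psi.
Proof.
move=> sphi tpsi; have spsi := test_fun_smooth tpsi.
have [L L0 hL] := test_fun_support tpsi.
have [L' L'0 hL'] := test_fun_support (test_funD_i i tpsi).
set psi' := 'D_(Defs.basis i) psi in hL' *; set phi' := 'D_(Defs.basis i) phi.
pose chi x := phi x * psi x; pose chi' x := phi x * psi' x + psi x * phi' x.
have hm (a : R) : Num.max L L' <= a -> L <= a /\ L' <= a.
  by rewrite ge_max => /andP.
have M0 : 0 < Num.max L L' by rewrite lt_max L0.
have out0 x : Num.max L L' <= `|x.1| \/ Num.max L L' <= `|x.2| -> psi x = 0 /\ psi' x = 0.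
  move=> h; split; apply/eqP; apply: contraPT h => h [] /hm[h1 h2].
  - by move: (hL x h) => [] _ _; have [h3 _] := hL x h; move: h1; rewrite leNgt h3.
  - by have [_ h3] := hL x h; move: h1; rewrite leNgt h3.
  - by have [h3 _] := hL' x h; move: h2; rewrite leNgt h3.
  - by have [_ h3] := hL' x h; move: h2; rewrite leNgt h3.
have cont : continuous chi'.
  move=> x; apply: cvgD; apply: cvgM; apply: smooth_continuous => //; exact: smoothD_i.
have dchi x : is_derive x (Defs.basis i) chi (chi' x).
  exact: (is_deriveM (smooth_is_derive i x sphi) (smooth_is_derive i x spsi)).
have out1 x : Num.max L L' <= `|x.1| \/ Num.max L L' <= `|x.2| -> chi x = 0 /\ chi' x = 0.
  by move=> /out0[p0 p0']; rewrite /chi /chi' p0 p0' !mulr0 mul0r addr0.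
have [int] := integral_partial0 M0 dchi cont out1.
have -> : (\int[leb2]_x (chi' x)%:E = \int[leb2]_(x in Om) (chi' x)%:E)%E.
  rewrite [RHS]integral_mkcond; apply: eq_integral => x _.
  rewrite patchE; case: ifPn => // /negP nx; congr EFin.
  have nOm : ~ Om x by move=> h; apply: nx; rewrite inE.
  by rewrite /chi' /psi' (test_fun_out tpsi nOm) (test_fun_out (test_funD_i i tpsi) nOm) mulr0 mul0r addr0.
move=> int0.
have : \int[leb2]_(x in Om) chi' x = 0 by rewrite /Rintegral int0.
rewrite /chi' RintegralD; [|exact: mOm| |]; last 2 first.
- by apply: (integrable_mulL2 mOm); [exact: smooth_L2|exact: smoothD_L2].
- by apply: (integrable_mulL2 mOm); [exact: smooth_L2|exact: smoothD_L2].
move=> /eqP; rewrite addr_eq0 => /eqP; rewrite /L2ip => ->.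
by congr (- _); exact: Rintegral_mulC.
Qed.

Lemma is_wD_smooth i phi : smooth phi -> is_wD Om i phi ('D_(Defs.basis i) phi).
Proof. by move=> sphi; split; [exact: smoothD_L2|move=> psi; exact: smooth_ibp]. Qed.

Lemma is_wD_lin i c f f' g g' : L2 Om f -> L2 Om g -> is_wD Om i f f' -> is_wD Om i g g' ->
  is_wD Om i (fun x => c * f x + g x) (fun x => c * f' x + g' x).
Proof.
move=> hf hg [hf' wf] [hg' wg]; split; first exact: (inLp2_lin mOm).
move=> phi tphi; have h1 := test_L2 tphi; have h2 := test_L2 (test_funD_i i tphi).
by rewrite !L2ip_linl // wf // wg //; ring.
Qed.

Lemma is_wD_unique i f g g' : is_wD Om i f g -> is_wD Om i f g' ->
  ae_eq leb2 (Om : set pl) g g'.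
Proof.
move=> [hg wg] [hg' wg'].
have hd := inLp2_lin mOm (-1) hg' hg.
have := fundamental_lemma oOm (L2_domain_integrable hd).
case=> [phi tphi|N [mN N0 sub]].
  have h1 := test_L2 tphi.
  by rewrite L2ip_linl // -[L2ip _ g' _]opprK -[L2ip _ g _]opprK -wg // -wg' //; ring.
exists N; split=> // x /= nx; apply: sub => /= h; apply: nx => Ox.
by have := h Ox; rewrite mulN1r addrC => /eqP; rewrite subr_eq0 => /eqP.
Qed.

Lemma is_wD_ae i f f' g g' : L2 Om f -> L2 Om f' -> L2 Om g' ->
  ae_eq leb2 (Om : set pl) f f' -> ae_eq leb2 (Om : set pl) g g' ->
  is_wD Om i f g -> is_wD Om i f' g'.
Proof.
move=> hf hf' hg' ff' gg' [hg wg]; split=> // phi tphi.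
rewrite -(L2ip_ae hf hf' (test_L2 (test_funD_i i tphi)) ff').
by rewrite -(L2ip_ae hg hg' (test_L2 tphi) gg') wg.
Qed.

Lemma wDP i v : (exists g, is_wD Om i v g) -> is_wD Om i v (wD Om i v).
Proof. by move=> h; exact: (xgetPex _ h). Qed.

(** [wD] is an arbitrary choice among a.e. equal functions; every computation with it passes through
    this comparison with an explicit weak derivative. *)
Lemma wD_ae i v g : is_wD Om i v g -> ae_eq leb2 (Om : set pl) (wD Om i v) g.
Proof. by move=> h; apply: is_wD_unique (h); apply: wDP; exists g. Qed.

Lemma wD_L2 i v : L2 Om (wD Om i v).
Proof.
have [h|h] := pselect (exists g, is_wD Om i v g); first by case: (wDP h).
have -> : wD Om i v = cst 0 by rewrite /wD; case: xgetP => // g _ gw; case: h; exists g.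
exact: (inLp20 _ mOm).
Qed.

Lemma L2norm_ge0 (D : set pl) g : 0 <= L2norm D g. Proof. exact: Lpnorm_ge0. Qed.

(** Both sides of the integration by parts are L^2-continuous, so the weak derivative is a closed
    operator; completeness of the Sobolev spaces rests on this. *)
Lemma is_wD_lim i (u : nat -> pt -> R) (w : nat -> pt -> R) v g :
  (forall n, L2 Om (u n)) -> (forall n, is_wD Om i (u n) (w n)) -> L2 Om v -> L2 Om g ->
  L2norm Om (fun x => u n x - v x) @[n --> \oo] --> (0 : R) ->
  L2norm Om (fun x => w n x - g x) @[n --> \oo] --> (0 : R) ->
  is_wD Om i v g.
Proof.
move=> hu hw hv hg uv wg; split=> // phi tphi.
have lim (a : nat -> pt -> R) b psi : (forall n, L2 Om (a n)) -> L2 Om b -> L2 Om psi ->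
    L2norm Om (fun x => a n x - b x) @[n --> \oo] --> (0 : R) ->
    L2ip Om (a n) psi @[n --> \oo] --> L2ip Om b psi.
  move=> ha hb hpsi ab; apply/subr_cvg0; apply/norm_cvg0P.
  apply: (@squeeze_cvgr _ _ _ _ (cst 0) (fun n => L2norm Om (fun x => a n x - b x) * L2norm Om psi)).
  - apply: nearW => n; rewrite normr_ge0 /=.
    rewrite -L2ipBl //.
    exact: (cauchy_schwarz_L2 mOm (inLp2B mOm (ha n) hb) hpsi).
  - exact: cvg_cst.
  - by rewrite -[X in _ --> X](mul0r (L2norm Om psi)); apply: cvgMl.
have l1 := lim u v _ hu hv (test_L2 (test_funD_i i tphi)) uv.
have l2 := lim w g _ (fun n => (hw n).1) hg (test_L2 tphi) wg.
have l3 : L2ip Om (u n) ('D_(Defs.basis i) phi) @[n --> \oo] --> - L2ip Om g phi.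
  have -> : (fun n => L2ip Om (u n) ('D_(Defs.basis i) phi)) = (fun n => - L2ip Om (w n) phi).
    by apply/funext => n; have [_] := hw n; apply.
  exact: cvgN.
exact: (cvg_unique _ l1 l3).
Qed.

End domain.
End weak_derivatives.

(** * Completeness of H^1, H^2 and V *)

Section sobolev_spaces.
Context {R : realType}.
Local Notation pt := (R * R)%type.
Local Notation mR := (measurableTypeR R).
Local Notation pl := (mR * mR)%type.
Variable Om : set pt.
Hypothesis oOm : open Om.
Hypothesis bOm : exists L : R, forall x, Om x -> `|x.1| <= L /\ `|x.2| <= L.
Implicit Types (f g h u v w phi psi : pt -> R) (i j : 'I_2) (B : set (pt -> R)).
Implicit Type ipB : (pt -> R) -> (pt -> R) -> R.
Local Notation mOm := (measurable_domain oOm).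
Local Notation aeq := (ae_eq leb2 (Om : set pl)).

Lemma le_of_sqr (a b : R) : 0 <= b -> a ^+ 2 <= b ^+ 2 -> a <= b.
Proof.
move=> b0 ab; case: (leP a 0) => [/le_trans->//|a0].
by rewrite -ler_sqr // nnegrE // ltW.
Qed.

Lemma sum2E (F : 'I_2 -> R) : \sum_(i < 2) F i = F ord0 + F ord_max.
Proof. by rewrite big_ord_recr big_ord1 /=; congr (F _ + _); exact: val_inj. Qed.

Lemma le_sum_of_sqr (a b c d : R) : 0 <= a -> 0 <= b -> 0 <= c -> 0 <= d ->
  a ^+ 2 = b ^+ 2 + (c ^+ 2 + d ^+ 2) -> a <= b + (c + d).
Proof.
move=> a0 b0 c0 d0 E; have s0 : 0 <= b + (c + d) by rewrite !addr_ge0.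
rewrite -(@ler_sqr _ a (b + (c + d))) ?nnegrE // E; nra.
Qed.

Lemma L2norm_sqr f : L2norm Om f ^+ 2 = \int[leb2]_(x in Om) (f x ^+ 2).
Proof. by rewrite [LHS]Lpnorm2_sqr. Qed.

Lemma L2_ipnorm f : ipnorm (L2ip Om) f = L2norm Om f.
Proof.
rewrite /ipnorm /L2ip; under eq_Rintegral do rewrite -expr2.
by rewrite -Lpnorm2_sqr sqrtr_sqr ger0_norm // Lpnorm_ge0.
Qed.

Lemma semi_hilbert_L2 : semi_hilbert (L2ip Om) (L2 Om).
Proof.
split.
- exact: (inLp20 _ mOm).
- by move=> c f g; exact: (inLp2_lin mOm).
- exact: L2ipC.
- by move=> c f g h; exact: (L2ip_linl oOm).
- by move=> f; apply: Rintegral_ge0 => x _; rewrite -expr2 sqr_ge0.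
- move=> u hu cu; have [e e0|l hl ul] := complete_L2 mOm hu.
    by have [N hN] := cu e e0; exists N => m n Nm Nn; rewrite -[leLHS]L2_ipnorm; exact: hN.
  exists l => //; have -> : (fun n => ipnorm (L2ip Om) (u n - l))
     = (fun n => Lpnorm leb2 2%:E Om (fun x => u n x - l x)).
    by apply/funext => n; rewrite L2_ipnorm.
  exact: ul.
Qed.

(* A space of functions to which the weak derivatives are required to belong;
   iterating [sobolev_step] from [L^2] yields [H^1] and then [H^2]. *)
Record sobolev_base B ipB : Prop := {
  sb_hilbert : semi_hilbert ipB B;
  sb_L2 : forall g, B g -> L2 Om g;
  sb_norm : forall g, B g -> L2norm Om g <= ipnorm ipB g;
  sb_ae : forall g h, B g -> L2 Om h -> aeq g h -> B h /\ ipnorm ipB (h - g) = 0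
}.

Definition sobolev_step B : set (pt -> R) :=
  [set v | L2 Om v /\ forall i, (exists g, is_wD Om i v g) /\ B (wD Om i v)].

Definition sobolev_ip ipB u v : R :=
  L2ip Om u v + \sum_(i < 2) ipB (wD Om i u) (wD Om i v).

Lemma aeq_sym f g : aeq f g -> aeq g f.
Proof. by apply: filterS => x /[apply] ->. Qed.

Lemma aeq_trans f g h : aeq f g -> aeq g h -> aeq f h.
Proof. by apply: filterS2 => x fg gh Ox; rewrite fg // gh. Qed.

Lemma aeqB f f' g g' : aeq f f' -> aeq g g' ->
  aeq (fun x => f x - g x) (fun x => f' x - g' x).
Proof. by apply: filterS2 => x fg gh Ox; rewrite fg // gh. Qed.

Lemma aeq_L2norm0 f : L2 Om f -> L2norm Om f = 0 -> aeq f (cst 0).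
Proof. by move=> hf f0; exact: (Lpnorm2_eq0 mOm hf f0). Qed.

Lemma L2norm0_aeq f : L2 Om f -> aeq f (cst 0) -> L2norm Om f = 0.
Proof.
move=> [mf _] f0; apply/eqP; rewrite -sqrf_eq0 [_ ^+ 2]Lpnorm2_sqr; apply/eqP.
have -> : \int[leb2]_(x in Om) (f x ^+ 2) = \int[leb2]_(x in Om) (cst 0 x).
  apply: (@ae_eq_Rintegral _ _ _ leb2 _ mOm); [exact: measurable_funX|exact: measurable_cst|].
  by apply: filterS f0 => x /[apply] ->; rewrite expr0n.
by rewrite /Rintegral integral0.
Qed.

Section step.
Variables (B : set (pt -> R)) (ipB : (pt -> R) -> (pt -> R) -> R).
Hypothesis HB : sobolev_base B ipB.
Local Notation hB := (sb_hilbert HB).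

Lemma sb_ip_ae g h k : B g -> L2 Om h -> B k -> aeq g h -> ipB h k = ipB g k.
Proof.
move=> Bg hh Bk gh; have [Bh n0] := sb_ae HB Bg hh gh.
apply/eqP; rewrite -subr_eq0 -(ipBl hB) // -normr_eq0 eq_le normr_ge0 andbT.
apply: le_trans (ip_cauchy_schwarz hB _ Bk) _; first exact: (semi_hilbertB hB).
by rewrite n0 mul0r.
Qed.

Lemma sb_norm_ae g h : B g -> L2 Om h -> aeq g h -> ipnorm ipB h = ipnorm ipB g.
Proof.
move=> Bg hh gh; have [Bh n0] := sb_ae HB Bg hh gh.
rewrite /ipnorm (sb_ip_ae Bg hh Bh gh) (semi_hilbert_sym hB) (sb_ip_ae Bg hh Bg gh) //.
Qed.

Lemma sb_B_ae g h : B g -> L2 Om h -> aeq g h -> B h.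
Proof. by move=> Bg hh gh; case: (sb_ae HB Bg hh gh). Qed.

Lemma step_wD u i : sobolev_step B u -> is_wD Om i u (wD Om i u).
Proof. by move=> [_ /(_ i)[h _]]; exact: wDP. Qed.

Lemma step_B u i : sobolev_step B u -> B (wD Om i u).
Proof. by move=> [_ /(_ i)[_]]. Qed.

Lemma step_L2 u : sobolev_step B u -> L2 Om u.
Proof. by case. Qed.

Lemma wD_lin i c u v : sobolev_step B u -> sobolev_step B v ->
  aeq (wD Om i (c *: u + v)) (fun x => c * wD Om i u x + wD Om i v x).
Proof.
move=> hu hv; apply: (wD_ae oOm bOm).
by apply: (is_wD_lin oOm bOm); [exact: step_L2|exact: step_L2|exact: step_wD|exact: step_wD].
Qed.

Lemma step_lin c u v : sobolev_step B u -> sobolev_step B v -> sobolev_step B (c *: u + v).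
Proof.
move=> hu hv; split; first by apply: (inLp2_lin mOm); exact: step_L2.
move=> i; have E := wD_lin i c hu hv.
have hB' : B (fun x => c * wD Om i u x + wD Om i v x).
  by have := semi_hilbert_lin hB c (step_B i hu) (step_B i hv).
split; last by apply: (sb_B_ae hB') => //; [exact: (wD_L2 oOm)|exact: aeq_sym].
exists (fun x => c * wD Om i u x + wD Om i v x).
by apply: (is_wD_lin oOm bOm); [exact: step_L2|exact: step_L2|exact: step_wD|exact: step_wD].
Qed.

Lemma step_mem u (w : 'I_2 -> pt -> R) : L2 Om u -> (forall i, is_wD Om i u (w i)) ->
  (forall i, B (w i)) -> sobolev_step B u.
Proof.
move=> hu hw Bw; split=> // i; split; first by exists (w i).
by apply: (sb_B_ae (Bw i)); [exact: (wD_L2 oOm)|exact/aeq_sym/(wD_ae oOm bOm)].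
Qed.

Lemma is_wD0 i : is_wD Om i (cst 0) (cst 0).
Proof.
split; first exact: (inLp20 _ mOm).
move=> phi _; rewrite /L2ip.
have z h : \int[leb2]_(x in Om) (cst 0 x * h x) = 0.
  under eq_Rintegral do rewrite mul0r.
  by rewrite /Rintegral integral0.
by rewrite !z oppr0.
Qed.

Lemma step0 : sobolev_step B 0.
Proof.
apply: (@step_mem _ (fun=> cst 0)) => [|i|i].
- exact: (inLp20 _ mOm).
- exact: is_wD0.
- exact: (semi_hilbert0 hB).
Qed.

Lemma sobolev_ipnorm_sqr u :
  ipnorm (sobolev_ip ipB) u ^+ 2 = L2norm Om u ^+ 2 + \sum_(i < 2) ipnorm ipB (wD Om i u) ^+ 2.
Proof.
rewrite [LHS]sqr_sqrtr /sobolev_ip; last first.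
  rewrite addr_ge0 ?(semi_hilbert_ge0 semi_hilbert_L2) // sumr_ge0 // => i _.
  exact: (semi_hilbert_ge0 hB).
congr (_ + _).
  by rewrite -L2_ipnorm (ipnorm_sqr semi_hilbert_L2).
by apply: eq_bigr => i _; rewrite (ipnorm_sqr hB).
Qed.

Lemma L2norm_le_sobolev u : L2norm Om u <= ipnorm (sobolev_ip ipB) u.
Proof.
rewrite -ler_sqr ?nnegrE ?L2norm_ge0 ?ipnorm_ge0 // sobolev_ipnorm_sqr lerDl sumr_ge0 // => i _.
exact: sqr_ge0.
Qed.

Lemma wD_le_sobolev u i : ipnorm ipB (wD Om i u) <= ipnorm (sobolev_ip ipB) u.
Proof.
rewrite -ler_sqr ?nnegrE ?ipnorm_ge0 // sobolev_ipnorm_sqr (bigD1 i) //= addrCA lerDl.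
by rewrite addr_ge0 ?sqr_ge0 // sumr_ge0 // => j _; exact: sqr_ge0.
Qed.

Lemma sobolev_le_sum u : ipnorm (sobolev_ip ipB) u <= L2norm Om u + \sum_(i < 2) ipnorm ipB (wD Om i u).
Proof.
rewrite sum2E; apply: le_sum_of_sqr; try exact: ipnorm_ge0; first exact: L2norm_ge0.
by have := sobolev_ipnorm_sqr u; rewrite sum2E.
Qed.

Lemma wDB_B i u v : sobolev_step B u -> sobolev_step B v ->
  aeq (wD Om i (u - v)) (fun x => wD Om i u x - wD Om i v x).
Proof.
move=> hu hv; have := wD_lin i (-1) hv hu; rewrite scaleN1r addrC => /aeq_trans; apply.
by apply: aeW => x _; rewrite mulN1r addrC.
Qed.

Lemma norm_wDB i u v : sobolev_step B u -> sobolev_step B v ->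
  ipnorm ipB (wD Om i (u - v)) = ipnorm ipB (wD Om i u - wD Om i v).
Proof.
move=> hu hv; apply: sb_norm_ae; last exact/aeq_sym/wDB_B.
  by apply: (semi_hilbertB hB); exact: step_B.
exact: (wD_L2 oOm).
Qed.

(** The functions and their derivatives converge separately, and closedness of the weak derivative
    identifies the limits. The chosen derivative of the limit agrees with [g i] only a.e., which the
    base norm does not see. *)
Lemma sobolev_complete (u : nat -> pt -> R) : (forall n, sobolev_step B (u n)) ->
  ipcauchy (sobolev_ip ipB) u ->
  exists2 l, sobolev_step B l & ipnorm (sobolev_ip ipB) (u n - l) @[n --> \oo] --> 0.
Proof.
move=> hu cu.
have [v hv uv] : exists2 v, L2 Om v & L2norm Om (u n - v) @[n --> \oo] --> 0.
  have [|e e0|l hl ul] := semi_hilbert_complete semi_hilbert_L2 (u := u).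
  - by move=> n; exact: step_L2 (hu n).
  - have [N hN] := cu e e0; exists N => m n Nm Nn; rewrite L2_ipnorm.
    exact: le_trans (L2norm_le_sobolev _) (hN _ _ Nm Nn).
  - by exists l => //; move: ul; under eq_fun do rewrite L2_ipnorm.
have /choice[g hg] i : exists g, B g /\ ipnorm ipB (wD Om i (u n) - g) @[n --> \oo] --> 0.
  have [n|e e0|l hl ul] := semi_hilbert_complete hB (u := fun n => wD Om i (u n)).
  - exact: step_B (hu n).
  - have [N hN] := cu e e0; exists N => m n Nm Nn; rewrite -norm_wDB //.
    exact: le_trans (wD_le_sobolev _ _) (hN _ _ Nm Nn).
  - by exists l.
have wg i : is_wD Om i v (g i).
  have [Bg hgi] := hg i.
  apply: (@is_wD_lim _ _ oOm bOm i u (fun n => wD Om i (u n))) => //.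
  - by move=> n; exact: step_L2 (hu n).
  - by move=> n; exact: step_wD (hu n).
  - exact: (sb_L2 HB).
  - apply: (@squeeze_cvgr _ _ _ _ (cst 0) (fun n => ipnorm ipB (wD Om i (u n) - g i))) => //.
    + apply: nearW => n; rewrite L2norm_ge0 /=; apply: (sb_norm HB).
      by apply: (semi_hilbertB hB) => //; exact: step_B (hu n).
    + exact: cvg_cst.
have sv : sobolev_step B v.
  by apply: (@step_mem v g) => // i; case: (hg i).
exists v => //.
apply: (@squeeze_cvgr _ _ _ _ (cst 0)
   (fun n => L2norm Om (u n - v) + \sum_(i < 2) ipnorm ipB (wD Om i (u n) - g i))) => //.
- apply: nearW => n; rewrite ipnorm_ge0 /=; apply: le_trans (sobolev_le_sum _) _.
  rewrite lerD2l ler_sum // => i _; rewrite norm_wDB //.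
  have [Bg _] := hg i.
  rewrite (@sb_norm_ae (wD Om i (u n) - g i)) //.
  + by apply: (semi_hilbertB hB) => //; exact: step_B (hu n).
  + by apply: (semi_hilbertB semi_hilbert_L2); exact: (wD_L2 oOm).
  + apply: aeqB; first exact: aeW.
    exact/aeq_sym/(wD_ae oOm bOm).
- exact: cvg_cst.
- rewrite -[X in _ --> X]addr0; apply: cvgD => //.
  under eq_fun do rewrite sum2E.
  by rewrite -[X in nbhs X]addr0; apply: cvgD; [case: (hg ord0)|case: (hg ord_max)].
Qed.

Lemma sobolev_base_step : sobolev_base (sobolev_step B) (sobolev_ip ipB).
Proof.
have H : semi_hilbert (sobolev_ip ipB) (sobolev_step B).
  split.
  - exact: step0.
  - exact: step_lin.
  - move=> u v; rewrite /sobolev_ip L2ipC; congr (_ + _).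
    by apply: eq_bigr => i _; rewrite (semi_hilbert_sym hB).
  - move=> c u v w hu hv hw; rewrite /sobolev_ip.
    rewrite [L2ip _ _ _](L2ip_linl oOm) //; try exact: step_L2.
    have -> : \sum_(i < 2) ipB (wD Om i (c *: u + v)) (wD Om i w)
        = c * (\sum_(i < 2) ipB (wD Om i u) (wD Om i w)) + \sum_(i < 2) ipB (wD Om i v) (wD Om i w).
      rewrite big_distrr -big_split /=; apply: eq_bigr => i _.
      rewrite -(semi_hilbert_linl hB); try exact: step_B.
      apply: sb_ip_ae.
      + by apply: (semi_hilbert_lin hB); exact: step_B.
      + exact: (wD_L2 oOm).
      + exact: step_B.
      + exact/aeq_sym/wD_lin.
    ring.
  - move=> u; rewrite /sobolev_ip addr_ge0 ?(semi_hilbert_ge0 semi_hilbert_L2) //.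
    by rewrite sumr_ge0 // => i _; exact: (semi_hilbert_ge0 hB).
  - exact: sobolev_complete.
split=> //.
- by move=> g; exact: step_L2.
- by move=> g _; exact: L2norm_le_sobolev.
- move=> g h hg hh gh.
  have wh i : is_wD Om i h (wD Om i g).
    apply: (is_wD_ae oOm bOm (step_L2 hg) hh (wD_L2 oOm i g) gh _ (step_wD i hg)).
    exact: aeW.
  have sh : sobolev_step B h by apply: (step_mem hh wh) => i; exact: step_B.
  split=> //; apply/eqP; rewrite eq_le ipnorm_ge0 andbT; apply: le_trans (sobolev_le_sum _) _.
  rewrite (L2norm0_aeq (semi_hilbertB semi_hilbert_L2 hh (step_L2 hg))); last first.
    by apply: filterS gh => x /[apply] E; rewrite /= [LHS](_ : _ = h x - g x) // E subrr.
  rewrite add0r big1 // => i _; rewrite norm_wDB //.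
  have [|//] := sb_ae HB (step_B i hg) (wD_L2 oOm i h).
  exact/aeq_sym/(wD_ae oOm bOm).
Qed.
End step.

Lemma sobolev_base_L2 : sobolev_base (L2 Om) (L2ip Om).
Proof.
split=> //; first exact: semi_hilbert_L2.
- by move=> g _; rewrite L2_ipnorm.
- move=> g h hg hh gh; split=> //; rewrite L2_ipnorm.
  apply: L2norm0_aeq; first exact: (semi_hilbertB semi_hilbert_L2).
  by apply: filterS gh => x /[apply] E; rewrite /= [LHS](_ : _ = h x - g x) // E subrr.
Qed.

Definition ipH1 := sobolev_ip (L2ip Om).
Definition ipH2 := sobolev_ip ipH1.

Lemma H1E : H1 Om = sobolev_step (L2 Om).
Proof.
apply/seteqP; split=> v [hv h]; split=> // i; last by case: (h i).
by split; [exact: h|exact: (wD_L2 oOm)].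
Qed.

Lemma H2E : H2 Om = sobolev_step (H1 Om).
Proof.
apply/seteqP; split=> v; first by move=> [[hv h1] h2]; split=> // i; split.
by move=> [hv h]; split; [split=> // i|move=> i]; case: (h i).
Qed.

Lemma sobolev_base_H1 : sobolev_base (H1 Om) ipH1.
Proof. by rewrite H1E; exact: sobolev_base_step sobolev_base_L2. Qed.

Lemma sobolev_base_H2 : sobolev_base (H2 Om) ipH2.
Proof. by rewrite H2E; exact: sobolev_base_step sobolev_base_H1. Qed.

Lemma L2norm_sqr4 (f1 f2 f3 f4 h : pt -> R) :
  L2 Om f1 -> L2 Om f2 -> L2 Om f3 -> L2 Om f4 ->
  (forall x, h x ^+ 2 = f1 x ^+ 2 + f2 x ^+ 2 + (f3 x ^+ 2 + f4 x ^+ 2)) ->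
  L2norm Om h ^+ 2 = L2norm Om f1 ^+ 2 + L2norm Om f2 ^+ 2
    + (L2norm Om f3 ^+ 2 + L2norm Om f4 ^+ 2).
Proof.
move=> h1 h2 h3 h4 E; rewrite !L2norm_sqr; under eq_Rintegral do rewrite E.
have sq f : L2 Om f -> leb2.-integrable (Om : set pl) (EFin \o (fun x => f x ^+ 2)).
  by move=> /inLp2P[].
have I12 := integrableD mOm (sq _ h1) (sq _ h2).
have I34 := integrableD mOm (sq _ h3) (sq _ h4).
rewrite (RintegralD mOm I12 I34) (RintegralD mOm (sq _ h1) (sq _ h2)).
by rewrite (RintegralD mOm (sq _ h3) (sq _ h4)).
Qed.

Lemma L2norm_sqr2 (f1 f2 h : pt -> R) : L2 Om f1 -> L2 Om f2 ->
  (forall x, h x ^+ 2 = f1 x ^+ 2 + f2 x ^+ 2) ->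
  L2norm Om h ^+ 2 = L2norm Om f1 ^+ 2 + L2norm Om f2 ^+ 2.
Proof.
move=> h1 h2 E; have z : L2 Om (cst 0) := inLp20 leb2 mOm.
rewrite (L2norm_sqr4 h1 h2 z z) => [|x]; last by rewrite E !expr0n !addr0.
by rewrite (L2norm0_aeq z) ?expr0n ?addr0 //; exact: aeW.
Qed.

Lemma enorm_sqr (x : pt) : enorm x ^+ 2 = x.1 ^+ 2 + x.2 ^+ 2.
Proof. by rewrite sqr_sqrtr /dot ?expr2 // addr_ge0 // -expr2 sqr_ge0. Qed.

Lemma frob_sqr (M : 'M[R]_2) : frob M ^+ 2
  = M ord0 ord0 ^+ 2 + M ord0 ord_max ^+ 2 + (M ord_max ord0 ^+ 2 + M ord_max ord_max ^+ 2).
Proof.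
rewrite /frob /mdot sqr_sqrtr; last first.
  by rewrite sumr_ge0 // => i _; rewrite sumr_ge0 // => j _; rewrite -expr2 sqr_ge0.
by rewrite !sum2E !expr2.
Qed.

Lemma L2norm_grad_sqr v :
  L2norm Om (enorm \o grad Om v) ^+ 2 = \sum_(i < 2) L2norm Om (wD Om i v) ^+ 2.
Proof.
rewrite sum2E; apply: L2norm_sqr2; [exact: wD_L2|exact: wD_L2|].
by move=> x; exact: enorm_sqr.
Qed.

Lemma L2norm_hess_sqr v : L2norm Om (frob \o hess Om v) ^+ 2
  = \sum_(i < 2) \sum_(j < 2) L2norm Om (wD Om j (wD Om i v)) ^+ 2.
Proof.
have S (F : 'I_2 -> 'I_2 -> R) : \sum_i \sum_j F i j
    = F ord0 ord0 + F ord0 ord_max + (F ord_max ord0 + F ord_max ord_max).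
  by rewrite !sum2E.
rewrite (S (fun i j => L2norm Om (wD Om j (wD Om i v)) ^+ 2)).
apply: L2norm_sqr4; try exact: wD_L2.
by move=> x; apply: (etrans (frob_sqr (hess Om v x))); rewrite 4!mxE.
Qed.

Lemma sobolev_ipnorm_mono B ipB B' ipB' u :
  sobolev_base B ipB -> sobolev_base B' ipB' ->
  (forall i, ipnorm ipB (wD Om i u) <= ipnorm ipB' (wD Om i u)) ->
  ipnorm (sobolev_ip ipB) u <= ipnorm (sobolev_ip ipB') u.
Proof.
move=> HB HB' le; apply: le_of_sqr; first exact: ipnorm_ge0.
rewrite (sobolev_ipnorm_sqr HB) (sobolev_ipnorm_sqr HB') lerD2l ler_sum // => i _.
by rewrite ler_sqr ?nnegrE ?ipnorm_ge0.
Qed.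

Lemma ipH1_le_ipH2 u : ipnorm ipH1 u <= ipnorm ipH2 u.
Proof.
apply: (sobolev_ipnorm_mono sobolev_base_L2 sobolev_base_H1) => i.
by rewrite L2_ipnorm; exact: (L2norm_le_sobolev sobolev_base_L2).
Qed.

Lemma H1normE v : H1norm Om v = ipnorm ipH1 v.
Proof.
rewrite /H1norm L2norm_grad_sqr -[RHS]ger0_norm ?ipnorm_ge0 // -sqrtr_sqr.
rewrite (sobolev_ipnorm_sqr sobolev_base_L2).
by congr Num.sqrt; congr (_ + _); apply: eq_bigr => i _; rewrite L2_ipnorm.
Qed.

Lemma VnormE v : Vnorm Om v = ipnorm ipH2 v.
Proof.
rewrite /Vnorm /H2norm_on L2norm_grad_sqr L2norm_hess_sqr.
rewrite -[RHS]ger0_norm ?ipnorm_ge0 // -sqrtr_sqr (sobolev_ipnorm_sqr sobolev_base_H1).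
congr Num.sqrt; rewrite -addrA -big_split /=; congr (_ + _); apply: eq_bigr => i _.
rewrite (sobolev_ipnorm_sqr sobolev_base_L2); congr (_ + _).
by apply: eq_bigr => j _; rewrite L2_ipnorm.
Qed.

(** [H10] is a closure in the H^1 norm, which the H^2 norm dominates, so it cuts out a closed
    subspace of H^2. *)
Lemma semi_hilbert_V : semi_hilbert ipH2 (V Om).
Proof.
have HH1 := sb_hilbert sobolev_base_H1; have HH2 := sb_hilbert sobolev_base_H2.
have testH1 phi : test_fun Om phi -> H1 Om phi.
  move=> /test_fun_smooth sphi; split; first exact: (smooth_L2 oOm bOm).
  by move=> i; exists ('D_(Defs.basis i) phi); exact: (is_wD_smooth oOm bOm).
have close u v e : H1 Om u -> H1 Om v -> ipnorm ipH1 (u - v) < e / 2 ->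
    H10 Om v -> 0 < e -> exists2 phi, test_fun Om phi & H1norm Om (u \- phi) < e.
  move=> hu hv uv [_ h10] e0; have e2 : 0 < e / 2 by rewrite divr_gt0.
  have [phi tphi hphi] := h10 _ e2; exists phi => //.
  rewrite H1normE in hphi; rewrite H1normE (splitr e).
  apply: le_lt_trans (ipnorm_dist HH1 hu hv (testH1 _ tphi)) _.
  have E : v \- phi = v - phi by [].
  by rewrite E in hphi; exact: (ltrD uv hphi).
apply: (semi_hilbert_closed HH2).
- by move=> v [].
- split; first exact: (semi_hilbert0 HH2).
  split; first exact: (semi_hilbert0 HH1).
  move=> e e0; exists (cst 0).
    split; first by move=> k; have := @Ck_separable R k (fun=> 0) (fun=> 0) (Ck1_cst k 0) (Ck1_cst k 0);
      congr Ck; apply/funext => x; rewrite mul0r.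
    by rewrite /=; have -> : [set x : pt | (0 : R) != 0] = set0 by [apply/seteqP; split=> x //=; rewrite eqxx];
      rewrite closure0; split; [exact: compact0|].
  rewrite H1normE [X in ipnorm _ X](_ : _ = 0) ?(ipnorm0 HH1) //.
  by apply/funext => x; exact: subr0.
- move=> c u v [hu [hu1 hu10]] [hv [hv1 hv10]].
  split; first exact: (semi_hilbert_lin HH2).
  split; first exact: (semi_hilbert_lin HH1).
  move=> e e0.
  have e1 : 0 < e / 2 / (`|c| + 1) by rewrite !divr_gt0 // ltr_wpDl.
  have e2 : 0 < e / 2 by rewrite divr_gt0.
  have [phi tphi hphi] := hu10 _ e1; have [psi tpsi hpsi] := hv10 _ e2.
  exists (c *: phi + psi).
    apply: (@test_fun_of_compact _ _ _ (closure [set x | phi x != 0] `|` closure [set x | psi x != 0])).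
    + exact: (smooth_lin c (test_fun_smooth tphi) (test_fun_smooth tpsi)).
    + by apply: closedU; exact: closed_closure.
    + by apply: compactU; [case: tphi => _ []|case: tpsi => _ []].
    + by move=> x [|]; [case: tphi => _ [_]; apply|case: tpsi => _ [_]; apply].
    + move=> x nx; have [p0|p0] := eqVneq (phi x) 0; last by left; exact: subset_closure.
      right; apply: subset_closure => /=; apply: contra_neq nx => q0.
      by rewrite [LHS](_ : _ = c * phi x + psi x) // p0 q0 mulr0 addr0.
  rewrite H1normE in hphi; rewrite H1normE in hpsi; rewrite H1normE.
  have -> : (c *: u + v) \- (c *: phi + psi) = c *: (u - phi) + (v - psi).
    apply/funext => x; rewrite [LHS](_ : _ = c * u x + v x - (c * phi x + psi x)) //.
    by rewrite [RHS](_ : _ = c * (u x - phi x) + (v x - psi x)) //; ring.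
  have h1 := testH1 _ tphi; have h2 := testH1 _ tpsi.
  have d1 := semi_hilbertB HH1 hu1 h1; have d2 := semi_hilbertB HH1 hv1 h2.
  apply: le_lt_trans (ipnormD HH1 (semi_hilbertZ HH1 c d1) d2) _.
  have E1 : u \- phi = u - phi by []. 
  have E2 : v \- psi = v - psi by [].
  rewrite E1 in hphi; rewrite E2 in hpsi.
  rewrite (splitr e) (ipnormZ HH1 c d1); apply: ltrD; last exact: hpsi.
  have [->|c0] := eqVneq c 0; first by rewrite normr0 mul0r.
  apply: lt_trans (_ : `|c| * (e / 2 / (`|c| + 1)) < _).
    by rewrite ltr_pM2l ?normr_gt0.
  by rewrite mulrCA gtr_pMr // ltr_pdivrMr ?mul1r ?ltrDl // ltr_wpDl.
- move=> u l hu hl ul.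
  have h1 n : H1 Om (u n) by case: (hu n) => [[]].
  have l1 : H1 Om l by case: hl.
  split=> //; split=> // e e0.
  have e2 : 0 < e / 2 by rewrite divr_gt0.
  have /cvgrPdist_lt /(_ _ e2)[n _ /(_ n (leqnn n))] := ul.
  rewrite sub0r normrN ger0_norm ?ipnorm_ge0 // => ln.
  apply: (close l (u n)) => //.
    apply: le_lt_trans ln; rewrite (ipnormB HH1) //.
    exact: ipH1_le_ipH2.
  by case: (hu n).
Qed.

End sobolev_spaces.

(** * Mollification *)

Section plane_integration.
Context {R : realType}.
Local Notation mR := (measurableTypeR R).
Local Notation pl := (mR * mR)%type.

Lemma leb2_sigma_finite : sigma_finite (setT : set pl) (@leb2 R).
Proof.
exists (fun n => box (- n%:R) n%:R (- n%:R) n%:R).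
  apply/seteqP; split=> // x _; exists (Num.truncn (`|x.1| + `|x.2|)).+1 => //.
  have h := truncnS_gt (`|x.1| + `|x.2|).
  have [a b] : `|x.1| < (Num.truncn (`|x.1| + `|x.2|)).+1%:R /\
      `|x.2| < (Num.truncn (`|x.1| + `|x.2|)).+1%:R.
    by split; apply: le_lt_trans h; rewrite ?lerDl ?lerDr.
  by split; rewrite /= in_itv /= -ler_norml ltW.
move=> n; split; first exact: measurable_box.
have n0 : - n%:R <= n%:R :> R by rewrite lerNl (le_trans (_ : _ <= 0)) ?oppr_le0.
by rewrite (leb2_box n0 n0) ltry.
Qed.

(** Fubini for products with the plane as a factor asks for a bundled sigma-finite measure, so
    [leb2] is packed with its exhaustion by squares. *)
Let plane_measure : {sigma_finite_measure set pl -> \bar R} :=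
  HB.pack_for {sigma_finite_measure set pl -> \bar R} (@leb2 R : set pl -> \bar R)
    (Measure.on (@lebesgue_measure R \x @lebesgue_measure R)%E)
    (@Measure_isSigmaFinite.Build _ pl R (@lebesgue_measure R \x @lebesgue_measure R)%E leb2_sigma_finite).

Lemma measurable_inner_integral (F : pl * pl -> \bar R) : measurable_fun setT F ->
  (forall q, (0 <= F q)%E) ->
  measurable_fun (setT : set pl) (fun x : pl => \int[leb2]_y F (x, y))%E.
Proof.
by move=> mF F0; exact: (@measurable_fun_fubini_tonelli_F _ _ pl pl R plane_measure F mF F0).
Qed.

Lemma fubini_plane (F : pl * pl -> \bar R) : measurable_fun setT F ->
  (forall q, (0 <= F q)%E) ->
  (\int[leb2]_x \int[leb2]_y F (x, y) = \int[leb2]_y \int[leb2]_x F (x, y))%E.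
Proof.
by move=> mF F0; exact: (@fubini_tonelli _ _ pl pl R plane_measure plane_measure F mF F0).
Qed.

Lemma fubini_line_plane (F : mR * pl -> \bar R) : measurable_fun setT F ->
  (forall q, (0 <= F q)%E) ->
  (\int[lebesgue_measure]_t \int[leb2]_y F (t, y)
     = \int[leb2]_y \int[lebesgue_measure]_t F (t, y))%E.
Proof.
move=> mF F0.
exact: (@fubini_tonelli _ _ mR pl R (@lebesgue_measure R) plane_measure F mF F0).
Qed.

Lemma measurable_plane_integral (F : mR * pl -> \bar R) : measurable_fun setT F ->
  (forall q, (0 <= F q)%E) ->
  measurable_fun (setT : set mR) (fun t : mR => \int[leb2]_y F (t, y))%E.
Proof.
by move=> mF F0; exact: (@measurable_fun_fubini_tonelli_F _ _ mR pl R plane_measure F mF F0).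
Qed.

Lemma measurable_line_integral (F : mR * pl -> \bar R) : measurable_fun setT F ->
  (forall q, (0 <= F q)%E) ->
  measurable_fun (setT : set pl) (fun y : pl => \int[lebesgue_measure]_t F (t, y))%E.
Proof.
move=> mF F0.
exact: (@measurable_fun_fubini_tonelli_G _ _ mR pl R (@lebesgue_measure R) F mF F0).
Qed.

End plane_integration.

(** * Mollification inside a convex domain *)

Section mollification.
Context {R : realType}.
Local Notation pt := (R * R)%type.
Local Notation mR := (measurableTypeR R).
Local Notation pl := (mR * mR)%type.
Implicit Types (f g h u v w phi psi K : pt -> R) (i j : 'I_2) (x y z : pt).

Lemma is_derive_quadratic (f : R -> R) (d M : R) : (forall s, `|f s - f 0 - s * d| <= M * s ^+ 2) ->
  is_derive (0 : R) 1 f d.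
Proof.
move=> h; have M0 : 0 <= M by have := h 1; rewrite expr1n mulr1; exact: le_trans.
have lim0 : (fun s => s^-1 *: (f (s *: 1 + 0) - f 0)) @ (0 : R)^' --> d.
  apply/cvgrPdist_le => e e0.
  near=> s; have s0 : s != 0 by near: s; exact: nbhs_dnbhs_neq.
  rewrite /GRing.scale /= mulr1 addr0.
  have -> : d - s^-1 * (f s - f 0) = - (s^-1 * (f s - f 0 - s * d)) by field.
  rewrite normrN normrM normfV ler_pdivrMl ?normr_gt0 //.
  apply: le_trans (h s) _; rewrite -[s ^+ 2]real_normK ?num_real // mulrC expr2 -mulrA.
  rewrite ler_wpM2l // mulrC; apply: le_trans (_ : (M + 1) * `|s| <= _).
    by rewrite ler_wpM2r // lerDl.
  rewrite -ler_pdivlMl ?ltr_wpDl // ltW //; near: s.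
  by apply: dnbhs0_lt; rewrite mulr_gt0 // invr_gt0 ltr_wpDl.
by split; [apply/cvg_ex; exists d|exact: cvg_lim lim0].
Unshelve. all: by end_near. Qed.

Lemma mean_value_plane phi (x w : pt) : smooth phi -> exists2 s, 0 <= s <= 1 &
  phi (x + w) - phi x = w.1 * 'D_(Defs.basis ord0) phi (x + s *: w)
    + w.2 * 'D_(Defs.basis ord_max) phi (x + s *: w).
Proof.
move=> sphi; have [s s01] := mean_value (fun t => derive_chain_line x w t (sphi 1%N)) 0 1.
by rewrite add0r mulr1 scale1r scale0r addr0 mul1r => E; exists s; rewrite // E add0r.
Qed.

Lemma test_lipschitz (D : set pt) K : test_fun D K ->
  exists2 C, 0 <= C & forall x w : pt, `|K (x + w) - K x| <= C * (`|w.1| + `|w.2|).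
Proof.
move=> tK; have [C0 hC0] := test_fun_bounded (test_funD_i ord0 tK).
have [C1 hC1] := test_fun_bounded (test_funD_i ord_max tK).
have [C00 C10] : 0 <= C0 /\ 0 <= C1.
  by split; [exact: le_trans (normr_ge0 _) (hC0 0)|exact: le_trans (normr_ge0 _) (hC1 0)].
exists (C0 + C1); first exact: addr_ge0.
move=> x w; have [s _ ->] := mean_value_plane x w (test_fun_smooth tK).
apply: le_trans (ler_normD _ _) _; rewrite !normrM mulrDr.
apply: lerD; rewrite mulrC ler_wpM2r //.
  by apply: le_trans (hC0 _) _; rewrite lerDl.
by apply: le_trans (hC1 _) _; rewrite lerDr.
Qed.

Lemma test_taylor (D : set pt) K i : test_fun D K ->
  exists2 C, 0 <= C & forall x s,
    `|K (x + s *: Defs.basis i) - K x - s * 'D_(Defs.basis i) K x| <= C * s ^+ 2.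
Proof.
move=> tK; have [C C0 hC] := test_lipschitz (test_funD_i i tK).
exists C => // x s; have sK := test_fun_smooth tK.
have [r /andP[r0 r1]] := mean_value (fun t => is_derive_line (smooth_derivable (i := i) (x := x + t *: Defs.basis i) sK)) 0 s.
rewrite add0r scale0r addr0 add0r => ->; rewrite -mulrBr normrM.
apply: le_trans (ler_wpM2l (normr_ge0 _) (hC _ _)) _.
rewrite -[s ^+ 2]real_normK ?num_real // expr2 mulrCA ler_wpM2l // ler_wpM2l //.
rewrite basis_scale; case: ifP => _ /=; rewrite normr0 ?addr0 ?add0r normrM ger0_norm //;
  by rewrite ler_piMl.
Qed.

Variable Om : set pt.
Hypothesis oOm : open Om.
Hypothesis bOm : exists L : R, forall x, Om x -> `|x.1| <= L /\ `|x.2| <= L.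
Local Notation mOm := (measurable_domain oOm).

Lemma L2ipZl c f g : L2 Om f -> L2 Om g -> L2ip Om (fun y => c * f y) g = c * L2ip Om f g.
Proof.
move=> hf hg; have z : L2 Om (cst 0) := inLp20 leb2 mOm.
have := L2ip_linl oOm c hf z hg; rewrite [X in _ + X](_ : _ = 0) ?addr0 => [<-|].
  by apply: eq_Rintegral => y _; rewrite addr0.
have := L2ipBl oOm hf hf hg; rewrite subrr => E; rewrite -[RHS]E.
by apply: eq_Rintegral => y _; rewrite subrr.
Qed.

Lemma L2ip_bound g h (C : R) : L2 Om g -> L2 Om h -> 0 <= C ->
  (forall x, Om x -> `|h x| <= C) ->
  `|L2ip Om g h| <= C * (L2norm Om g * L2norm Om (cst 1)).
Proof.
move=> hg hh C0 hC; apply: le_trans (cauchy_schwarz_L2 mOm hg hh) _.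
rewrite mulrCA ler_wpM2l ?L2norm_ge0 //.
have h1 : L2 Om (cst 1) by apply: (continuous_L2 oOm bOm); exact: cst_continuous.
rewrite -{1}(ger0_norm C0) -(Lpnorm2Z mOm C h1); apply: (Lpnorm2_le mOm) => //.
  exact: (inLp2Z mOm).
apply: aeW => x Ox; rewrite /= mulr1 -(@real_normK _ (h x)) ?num_real //.
by rewrite ler_sqr ?nnegrE // hC.
Qed.

(* The convolution of g, extended by 0 outside Om, with K, precomposed with the
   affine map x |-> th x + b. *)
Definition flip K z y : R := K ((-1) *: y + z).
Definition blur K (th : R) (b : pt) g x : R := L2ip Om g (flip K (th *: x + b)).

Section kernel.
Variables (th : R) (b : pt).

Lemma flip_smooth K z : smooth K -> smooth (flip K z).
Proof. exact: smooth_affine. Qed.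

Lemma flip_L2 K z : smooth K -> L2 Om (flip K z).
Proof. by move=> /(flip_smooth z); exact: (smooth_L2 oOm bOm). Qed.

Lemma blur_bounded (D : set pt) K g : test_fun D K -> L2 Om g -> continuous (blur K th b g).
Proof.
move=> tK hg x; have [C C0 hC] := test_lipschitz tK; have sK := test_fun_smooth tK.
pose A := L2norm Om g * L2norm Om (cst 1).
have A0 : 0 <= A by rewrite mulr_ge0 ?L2norm_ge0.
have B y : `|blur K th b g x - blur K th b g y|
    <= (C * `|th| * A) * (`|y.1 - x.1| + `|y.2 - x.2|).
  rewrite distrC /blur !(L2ipC _ g) -(L2ipBl oOm) //; try exact: flip_L2.
  have hL : L2 Om (fun z => flip K (th *: y + b) z - flip K (th *: x + b) z).
    by apply: (inLp2B mOm); exact: flip_L2.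
  rewrite L2ipC; apply: le_trans (L2ip_bound (C := C * (`|th| * (`|y.1 - x.1| + `|y.2 - x.2|))) hg hL _ _) _.
  - by rewrite !mulr_ge0 // addr_ge0.
  - move=> z _; rewrite /flip.
    have -> : (-1) *: z + (th *: y + b) = ((-1) *: z + (th *: x + b)) + th *: (y - x).
      rewrite scalerBr -[RHS]addrA; congr (_ + _).
      by rewrite [th *: x + b]addrC -addrA [th *: x + _]addrC subrK addrC.
    apply: le_trans (hC _ _) _; rewrite ler_wpM2l //= /GRing.scale /= !normrM -mulrDr //.
  - rewrite -/A; rewrite le_eqVlt; apply/orP; left; apply/eqP; ring.
apply/cvgrPdist_le => e e0.
pose k := C * `|th| * A * 2 + 1.
have k0 : 0 < k by rewrite /k ltr_wpDl // mulr_ge0 // mulr_ge0 // mulr_ge0.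
have ek : 0 < e / k by rewrite divr_gt0.
have /cvgrPdist_le /(_ _ ek) F1 := @fst_continuous R x.
have /cvgrPdist_le /(_ _ ek) F2 := @snd_continuous R x.
near=> y; apply: le_trans (B y) _.
have h1 : `|x.1 - y.1| <= e / k by near: y; exact: F1.
have h2 : `|x.2 - y.2| <= e / k by near: y; exact: F2.
apply: le_trans (_ : (C * `|th| * A) * (e / k + e / k) <= _).
  apply: ler_wpM2l; first by rewrite mulr_ge0 // mulr_ge0.
  by rewrite [X in X + _]distrC [X in _ + X]distrC; exact: lerD.
have -> : C * `|th| * A * (e / k + e / k) = e * ((C * `|th| * A * 2) / k) by ring.
by rewrite ler_piMr ?(ltW e0) // ler_pdivrMr // mul1r /k lerDl.
Unshelve. all: by end_near. Qed.

(** The second-order Taylor bound of the kernel is uniform in the point, so pairing it with [g]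
    leaves a remainder of order [s ^ 2]. The factor [th] comes from the chain rule. *)
Lemma blur_is_derive (D : set pt) K g i x : test_fun D K -> L2 Om g ->
  is_derive x (Defs.basis i) (blur K th b g) (th * blur ('D_(Defs.basis i) K) th b g x).
Proof.
move=> tK hg; have [C C0 hC] := test_taylor i tK; have sK := test_fun_smooth tK.
have sDK := smoothD_i i sK.
pose A := L2norm Om g * L2norm Om (cst 1).
have A0 : 0 <= A by rewrite mulr_ge0 ?L2norm_ge0.
apply: is_derive_of_line; apply: (is_derive_quadratic (M := C * th ^+ 2 * A)) => s.
rewrite scale0r addr0 /blur.
set z := th *: x + b.
have -> : th *: (x + s *: Defs.basis i) + b = z + (th * s) *: Defs.basis i.
  by rewrite scalerDr scalerA addrAC.
rewrite mulrA [s * th]mulrC.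
set z' := z + _.
have hL : L2 Om (fun y => flip K z' y - flip K z y - th * s * flip ('D_(Defs.basis i) K) z y).
  apply: (inLp2B mOm); first by apply: (inLp2B mOm); exact: flip_L2.
  by apply: (inLp2Z mOm); exact: flip_L2.
have -> : L2ip Om g (flip K z') - L2ip Om g (flip K z) - th * s * L2ip Om g (flip ('D_(Defs.basis i) K) z)
   = L2ip Om g (fun y => flip K z' y - flip K z y - th * s * flip ('D_(Defs.basis i) K) z y).
  rewrite [RHS]L2ipC (L2ipBl oOm) //.
  - rewrite (L2ipBl oOm) //; try exact: flip_L2.
    by rewrite L2ipZl // ?(L2ipC _ g) //; exact: flip_L2.
  - by apply: (inLp2B mOm); exact: flip_L2.
  - by apply: (inLp2Z mOm); exact: flip_L2.
apply: le_trans (L2ip_bound (C := C * (th * s) ^+ 2) hg hL _ _) _.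
- by rewrite mulr_ge0 // sqr_ge0.
- move=> y _; rewrite /flip /z' addrA; exact: hC.
- rewrite -/A exprMn; rewrite le_eqVlt; apply/orP; left; apply/eqP; ring.
Qed.

Lemma blur_smooth (D : set pt) K g : test_fun D K -> L2 Om g -> smooth (blur K th b g).
Proof.
move=> tK hg k; elim: k K tK => [|k IH] K tK; first by split=> //; exact: blur_bounded tK hg.
split=> [|i]; first exact: blur_bounded tK hg.
split=> [x|]; first by case: (blur_is_derive i x tK hg).
rewrite (_ : 'D_(Defs.basis i) _ = (fun x => th * blur ('D_(Defs.basis i) K) th b g x + (fun=> 0) x)).
  apply: Ck_lin; first exact: IH (test_funD_i i tK).
  have := Ck_separable (Ck1_cst k 0) (Ck1_cst k (0 : R)).
  by congr Ck; apply/funext => x; rewrite mul0r.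
by apply/funext => x; rewrite addr0; apply: derive_val; exact: blur_is_derive tK hg.
Qed.

(** The flipped kernel is itself a test function in y, and its derivative is minus the flipped
    derivative; this sign cancels the one from the integration by parts. *)
Lemma blur_wD (D : set pt) K i v w x : test_fun D K -> L2 Om v -> is_wD Om i v w ->
  test_fun Om (flip K (th *: x + b)) ->
  blur ('D_(Defs.basis i) K) th b v x = blur K th b w x.
Proof.
move=> tK hv [hw ibp] tf; have := ibp _ tf; rewrite /blur.
have -> : 'D_(Defs.basis i) (flip K (th *: x + b)) = (fun y => -1 * flip ('D_(Defs.basis i) K) (th *: x + b) y).
  by apply/funext => y; rewrite /flip (derive_affine (-1)) //; exact: test_fun_smooth tK.
have sDK := flip_L2 (th *: x + b) (smoothD_i i (test_fun_smooth tK)).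
rewrite L2ipC L2ipZl // mulN1r L2ipC.
exact: oppr_inj.
Qed.

Lemma blur_lin K c f g x : smooth K -> L2 Om f -> L2 Om g ->
  blur K th b (fun y => c * f y + g y) x = c * blur K th b f x + blur K th b g x.
Proof. by move=> sK hf hg; apply: (L2ip_linl oOm) => //; exact: flip_L2. Qed.

End kernel.

Section averaging.
Variables (K : pt -> R) (th : R) (b : pt).
Hypothesis tK : test_fun setT K.
Hypothesis K0 : forall x, 0 <= K x.
Hypothesis K1 : (\int[leb2]_x (K x)%:E = 1)%E.
Hypothesis th0 : 0 < th.
Hypothesis supp : forall x, Om x -> forall y, flip K (th *: x + b) y != 0 -> Om y.
Let sK := test_fun_smooth tK.

Lemma flip_setT z : (\int[leb2]_y (flip K z y)%:E = 1)%E.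
Proof.
have cK : continuous K by exact: smooth_continuous.
have mK : measurable_fun (setT : set pl) (EFin \o (K : pl -> R)).
  by apply/measurable_EFinP; exact: continuous_measurable2 cK.
rewrite /flip (ge0_integral_homothety (f := EFin \o K)) //.
by rewrite [X in (_ * X)%E]K1 mule1 sqrrN expr1n invr1.
Qed.

Lemma flip_int1 x : Om x -> \int[leb2]_(y in Om) flip K (th *: x + b) y = 1.
Proof.
move=> Ox; rewrite /Rintegral integral_mkcond.
rewrite -[RHS]/(fine 1%E) -(flip_setT (th *: x + b)); congr fine.
apply: eq_integral => y _; rewrite patchE; case: ifPn => // /negP ny.
have [->//|n0] := eqVneq (flip K (th *: x + b) y) 0.
by case: ny; rewrite inE; exact: supp Ox _ n0.
Qed.

(** Jensen's inequality, as Cauchy-Schwarz for [g * sqrt k] and [sqrt k]: the kernel [k] has total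
    mass 1 inside [Om]. *)
Lemma blur_sqr_le g x : Om x -> L2 Om g ->
  ((blur K th b g x ^+ 2)%:E <= \int[leb2]_(y in Om) (g y ^+ 2 * flip K (th *: x + b) y)%:E)%E.
Proof.
move=> Ox hg; set k := flip K _.
have ck : continuous k by apply: smooth_continuous; exact: flip_smooth.
have k0 y : 0 <= k y by exact: K0.
have [C hC] := test_fun_bounded tK.
have C0 : 0 <= C by exact: le_trans (normr_ge0 _) (hC 0).
have msk : measurable_fun (Om : set pl) ((Num.sqrt \o k) : pl -> R).
  apply: measurable_funTS; apply: continuous_measurable2 => y.
  by apply: continuous_comp; [exact: ck|exact: sqrt_continuous].
have L1 : L2 Om (Num.sqrt \o k).
  apply: (L2_bounded (C := Num.sqrt C) mOm (domain_fin oOm bOm) msk) => y _ /=.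
  rewrite ger0_norm ?sqrtr_ge0 // ler_wsqrtr //.
  by apply: le_trans (ler_norm _) _; exact: hC.
have L3 : L2 Om (fun y => g y * Num.sqrt (k y)).
  apply: (inLp2_le mOm _ (inLp2Z mOm (Num.sqrt C) hg)).
    by apply: measurable_funM => //; exact: inLp2_measurable hg.
  move=> y _; rewrite !exprMn !sqr_sqrtr // mulrC ler_wpM2r ?sqr_ge0 //.
  by apply: le_trans (ler_norm _) _; exact: hC.
have E : blur K th b g x = \int[leb2]_(y in Om) ((g y * Num.sqrt (k y)) * Num.sqrt (k y)).
  by apply: eq_Rintegral => y _; rewrite -mulrA -expr2 sqr_sqrtr.
have := cauchy_schwarz_L2 mOm L3 L1; rewrite -E => le.
have n1 : Lpnorm leb2 2%:E Om (Num.sqrt \o k) ^+ 2 = 1.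
  rewrite Lpnorm2_sqr -[RHS](flip_int1 Ox); apply: eq_Rintegral => y _.
  by rewrite /= sqr_sqrtr.
have n1' : Lpnorm leb2 2%:E Om (Num.sqrt \o k) = 1.
  by apply/eqP; rewrite -(@eqrXn2 _ 2) ?Lpnorm_ge0 // n1 expr1n.
rewrite n1' mulr1 in le.
have -> : (\int[leb2]_(y in Om) (g y ^+ 2 * k y)%:E =
    \int[leb2]_(y in Om) ((g y * Num.sqrt (k y)) ^+ 2)%:E)%E.
  by apply: eq_integral => y _; rewrite exprMn sqr_sqrtr.
rewrite (integral_sqrE mOm L3) lee_fin -real_normK ?num_real //.
by rewrite ler_sqr ?nnegrE ?Lpnorm_ge0.
Qed.

(** Integrating Jensen's inequality over x and exchanging the integrals, the substitution
    [th *: x + b] contributes [th ^- 2] to the squared norm. *)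
Lemma blur_L2norm g : L2 Om g -> L2norm Om (blur K th b g) <= th^-1 * L2norm Om g.
Proof.
move=> hg.
have cK : continuous K by exact: smooth_continuous.
have mg : measurable_fun (setT : set pl) ((g \_ Om) : pl -> R).
  by apply/(measurable_restrictT _ mOm); exact: inLp2_measurable hg.
have mb : measurable_fun (Om : set pl) (blur K th b g : pl -> R).
  apply: measurable_funTS; apply: continuous_measurable2.
  by apply: smooth_continuous; exact: blur_smooth tK hg.
have thn : th != 0 by rewrite gt_eqF.
apply: (inLp2_bound mOm mb _ _).2; last by rewrite mulr_ge0 ?L2norm_ge0 // invr_ge0 ltW.
pose F (q : pl * pl) : \bar R := ((g \_ Om) q.2 ^+ 2 * K ((-1) *: (q.2 : pt) + (th *: (q.1 : pt) + b)))%:E.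
have F0 q : (0 <= F q)%E by rewrite lee_fin mulr_ge0 ?sqr_ge0.
have mF : measurable_fun setT F.
  apply/measurable_EFinP; apply: measurable_funM.
    by apply: measurable_funX; apply: measurableT_comp => //; exact: measurable_snd.
  apply: (@measurableT_comp _ _ _ _ _ _ (K : pl -> R)); first exact: continuous_measurable2.
  have c1 (q : pl * pl) : (-1) *: (q.2 : pt) + (th *: (q.1 : pt) + b)
     = (- q.2.1 + (th * q.1.1 + b.1), - q.2.2 + (th * q.1.2 + b.2)).
    by congr pair; rewrite /= /GRing.scale /= mulN1r.
  under eq_fun do rewrite c1.
  apply/measurable_fun_pairP; split => /=.
  - apply: measurable_funD.
      apply: measurableT_comp => //; apply: (measurableT_comp measurable_fst measurable_snd).
    apply: measurable_funD => //; apply: measurable_funM => //.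
    exact: (measurableT_comp measurable_fst measurable_fst).
  - apply: measurable_funD.
      apply: measurableT_comp => //; apply: (measurableT_comp measurable_snd measurable_snd).
    apply: measurable_funD => //; apply: measurable_funM => //.
    exact: (measurableT_comp measurable_snd measurable_fst).
apply: (@le_trans _ _ (\int[leb2]_x \int[leb2]_y F (x, y))%E).
  rewrite integral_mkcond; apply: ge0_le_integral => //.
  - by move=> x _; rewrite patchE; case: ifP => _ //; rewrite lee_fin sqr_ge0.
  - apply/(measurable_restrictT _ mOm); exact: measurable_sqr.
  - exact: (measurable_inner_integral mF F0).
  move=> x _; rewrite patchE; case: ifPn => [|_]; last by apply: integral_ge0.
  rewrite inE => Ox; apply: le_trans (blur_sqr_le Ox hg) _.
  rewrite integral_mkcond le_eqVlt; apply/orP; left; apply/eqP.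
  apply: eq_integral => y _; rewrite /F /= !patchE.
  by case: ifP => _ //; rewrite expr0n mul0r.
rewrite (fubini_plane mF F0).
have mK : measurable_fun (setT : set pl) (EFin \o (K : pl -> R)).
  by apply/measurable_EFinP; exact: continuous_measurable2 cK.
have E y : (\int[leb2]_x F (x, y) = ((g \_ Om) y ^+ 2 / th ^+ 2)%:E)%E.
  rewrite /F /=; under eq_integral do rewrite EFinM.
  rewrite ge0_integralZl //; last 3 first.
  - apply/measurable_EFinP; apply: continuous_measurable2 => x.
    apply: continuous_comp; last exact: cK.
    by apply: cvgD; [exact: cvg_cst|exact: affine_continuous].
  - by move=> x _; rewrite lee_fin.
  - by rewrite lee_fin sqr_ge0.
  under eq_integral do rewrite addrCA.
  by rewrite (ge0_integral_homothety (f := EFin \o K)) //= ?K1 ?mule1 ?EFinM // => x; rewrite lee_fin.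
under eq_integral do rewrite E mulrC EFinM.
rewrite ge0_integralZl //; last 3 first.
- by apply/measurable_EFinP; exact: measurable_funX.
- by move=> x _; rewrite lee_fin sqr_ge0.
- by rewrite lee_fin invr_ge0 sqr_ge0.
have -> : (\int[leb2]_y ((g \_ Om) y ^+ 2)%:E = \int[leb2]_(y in Om) (g y ^+ 2)%:E)%E.
  rewrite [RHS]integral_mkcond; apply: eq_integral => y _; rewrite !patchE.
  by case: ifP => _ //; rewrite expr0n.
by rewrite (integral_sqrE mOm hg) -EFinM exprMn exprVn.
Qed.

Lemma blur_dist phi (C r : R) x : Om x -> continuous phi -> 0 <= C ->
  (forall x w : pt, `|phi (x + w) - phi x| <= C * (`|w.1| + `|w.2|)) ->
  (forall y, flip K (th *: x + b) y != 0 -> `|y.1 - x.1| <= r /\ `|y.2 - x.2| <= r) ->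
  `|blur K th b phi x - phi x| <= C * (r + r).
Proof.
move=> Ox cphi C0 lip near; pose k := flip K (th *: x + b).
have hk : L2 Om k by exact: flip_L2.
have h1 : L2 Om (cst 1) by apply: (continuous_L2 oOm bOm); exact: cst_continuous.
have hphi : L2 Om phi by exact: (continuous_L2 oOm bOm).
have ik : leb2.-integrable (Om : set pl) (EFin \o k) by exact: (L2_domain_integrable oOm bOm).
have k0 y : 0 <= k y by exact: K0.
have ek : L2ip Om (cst 1) k = 1.
  by rewrite -[RHS](flip_int1 Ox); apply: eq_Rintegral => y _; rewrite mul1r.
have E : blur K th b phi x - phi x = L2ip Om (fun y => phi y - phi x * cst 1 y) k.
  by rewrite (L2ipBl oOm) ?(L2ipZl _ h1) ?ek ?mulr1 //; exact: (inLp2Z mOm).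
have hd : L2 Om (fun y => phi y - phi x * cst 1 y).
  by apply: (inLp2B mOm) => //; exact: (inLp2Z mOm).
have ip := integrable_mulL2 mOm hd hk.
rewrite E; apply: le_trans (le_normr_Rintegral mOm ip) _.
apply: (@le_trans _ _ (\int[leb2]_(y in Om) ((C * (r + r)) * k y))).
  apply: (le_Rintegral mOm (integrable_norm ip) (integrableZl mOm _ ik)).
  move=> y Oy; rewrite /= normrM (ger0_norm (k0 y)) mulr1.
  have [->|n0] := eqVneq (k y) 0; first by rewrite !mulr0.
  rewrite ler_wpM2r //; have [h2 h3] := near y n0.
  have -> : y = x + (y - x) by rewrite addrC subrK.
  apply: le_trans (lip _ _) _; rewrite ler_wpM2l //.
  exact: lerD.
rewrite (RintegralZl (C * (r + r)) mOm ik) [X in _ * X](flip_int1 Ox) mulr1 //.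
Qed.

End averaging.

Hypothesis cOm : forall x y (t : R), Om x -> Om y -> 0 <= t <= 1 -> Om ((1 - t) *: x + t *: y).
Variables (x0 : pt) (r : R).
Hypothesis r0 : 0 < r.
Hypothesis boxr : box (x0.1 - r) (x0.1 + r) (x0.2 - r) (x0.2 + r) `<=` Om.

Definition bump (e : R) x : R := hat (- e) e 1 x.1 * hat (- e) e 1 x.2.

Lemma bump_smooth e : smooth (bump e). Proof. exact: smooth_hat2. Qed.

Lemma bump_ge0 e x : 0 <= bump e x.
Proof. by rewrite mulr_ge0 // hat_ge0. Qed.

Lemma bump_support e x : bump e x != 0 -> `|x.1| < e /\ `|x.2| < e.
Proof.
rewrite mulf_eq0 negb_or => /andP[/hat_support h1 /hat_support h2].
by rewrite !ltr_norml.
Qed.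

Lemma bump_integral e : 0 < e ->
  (0 < \int[leb2]_x (bump e x)%:E)%E /\ (\int[leb2]_x (bump e x)%:E < +oo)%E.
Proof.
move=> e0.
have cb : continuous (bump e) by apply: smooth_continuous; exact: bump_smooth.
have mb : measurable_fun (setT : set pl) (EFin \o (bump e : pl -> R)).
  by apply/measurable_EFinP; exact: continuous_measurable2 cb.
split; last first.
  apply: (@le_lt_trans _ _ (\int[leb2]_x (\1_(box (- e) e (- e) e : set pl) x)%:E)%E).
    apply: ge0_le_integral => //.
    - by move=> x _; rewrite lee_fin bump_ge0.
    - by apply/measurable_EFinP/measurable_indic; exact: measurable_box.
    move=> x _; rewrite lee_fin indicE.
    have [->|/bump_support[h1 h2]] := eqVneq (bump e x) 0; first by rewrite ler0n.
    rewrite mem_set; first by rewrite mulr_ile1 // ?hat_ge0 ?hat_le1.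
    by split; rewrite /= in_itv /= -ler_norml ltW.
  rewrite integral_indic //; last exact: measurable_box.
  rewrite setIT [X in (X < _)%E](_ : _ = ((e - - e) * (e - - e))%:E) ?ltry //.
  by apply: leb2_box; lra.
rewrite lt_neqAle integral_ge0 ?andbT; last by move=> x _; rewrite lee_fin bump_ge0.
apply/eqP => I0.
have /(ae_eq_integral_abs _ measurableT mb) : (\int[leb2]_x `|(EFin \o bump e) x| = 0)%E.
  rewrite [RHS]I0; apply: eq_integral => x _ /=; rewrite ger0_norm ?bump_ge0 //.
move=> [N [mN N0 sub]].
have h : (box (- (e / 2)) (e / 2) (- (e / 2)) (e / 2) : set pl) `<=` N.
  move=> x [/= ]; rewrite !in_itv /= => /andP[a1 a2] /andP[b1 b2]; apply: sub => /= /(_ I) [] /eqP.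
  rewrite gt_eqF // /bump mulr_gt0 //; apply: (hat_gt0 0); lra.
have : (leb2 (box (- (e / 2)) (e / 2) (- (e / 2)) (e / 2) : set pl) <= 0)%E.
  by rewrite -N0; apply: le_measure => //; rewrite inE //; exact: measurable_box.
by rewrite leb2_box ?lee_fin ?leNgt ?mulr_gt0 //; lra.
Qed.

Definition mollifier (e : R) x : R := (fine (\int[leb2]_x (bump e x)%:E)%E)^-1 * bump e x.

Lemma mollifier_ge0 e x : 0 <= mollifier e x.
Proof.
rewrite mulr_ge0 ?bump_ge0 // invr_ge0 fine_ge0 // integral_ge0 // => y _.
by rewrite lee_fin bump_ge0.
Qed.

Lemma mollifier_int e : 0 < e -> (\int[leb2]_x (mollifier e x)%:E = 1)%E.
Proof.
move=> e0; have [h1 h2] := bump_integral e0.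
have cb : continuous (bump e) by apply: smooth_continuous; exact: bump_smooth.
under eq_integral do rewrite EFinM.
have fi : (\int[leb2]_x (bump e x)%:E)%E \is a fin_num by rewrite ge0_fin_numE // ltW.
rewrite ge0_integralZl //; last 3 first.
- by apply/measurable_EFinP; exact: continuous_measurable2 cb.
- by move=> x _; rewrite lee_fin bump_ge0.
- by rewrite lee_fin invr_ge0 fine_ge0 // ltW.
rewrite -{2}(fineK fi) -EFinM mulVf // gt_eqF // -lte_fin fineK //.
Qed.

Lemma mollifier_smooth e : smooth (mollifier e).
Proof.
have h : smooth (fun=> 0 : R).
  move=> k; have := Ck_separable (Ck1_cst k 0) (Ck1_cst k (0 : R)).
  by congr Ck; apply/funext => x; rewrite mul0r.
have := smooth_lin (fine (\int[leb2]_x (bump e x)%:E)%E)^-1 (bump_smooth e) h.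
by congr smooth; apply/funext => x; rewrite addr0.
Qed.

Lemma mollifier_support e x : mollifier e x != 0 -> `|x.1| < e /\ `|x.2| < e.
Proof. by rewrite mulf_eq0 negb_or => /andP[_]; exact: bump_support. Qed.

Lemma test_mollifier e : test_fun setT (mollifier e).
Proof.
apply: (@test_fun_box _ _ _ (- e) e (- e) e) => //; first exact: mollifier_smooth.
move=> x /mollifier_support[h1 h2]; split; rewrite /= in_itv /= -ler_norml ltW //.
Qed.

Section scale.
Variable e : R.
Hypothesis e01 : 0 < e < 1.
Local Notation K := (mollifier (e * r)).
Let e0 : 0 < e. Proof. by case/andP: e01. Qed.

Lemma flip_box x y : Om x -> `|((-1) *: y + ((1 - e) *: x + e *: x0)).1| <= e * r ->
  `|((-1) *: y + ((1 - e) *: x + e *: x0)).2| <= e * r -> Om y.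
Proof.
move=> Ox h1 h2; set z := (-1) *: y + _ in h1 h2.
(* [y] is a convex combination of [x] and a point of the box around [x0], because [z] has
   coordinates of size at most [e * r]. *)
have -> : y = (1 - e) *: x + e *: (x0 - e^-1 *: z).
  rewrite scalerBr scalerA divff ?gt_eqF // scale1r addrA /z.
  by rewrite opprD scaleN1r opprK addrCA subrr addr0.
apply: cOm => //; last by rewrite ltW //= ltW //; case/andP: e01.
have gen (a c : R) : `|c| <= e * r -> a - r <= a - e^-1 * c <= a + r.
  move=> hc; have : `|e^-1 * c| <= r by rewrite normrM gtr0_norm ?invr_gt0 // ler_pdivrMl.
  by rewrite ler_norml => /andP[? ?]; apply/andP; split; lra.
by apply: boxr; split; rewrite /= in_itv; exact: gen.
Qed.

Lemma flip_supp x : Om x -> forall y, flip K ((1 - e) *: x + e *: x0) y != 0 -> Om y.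
Proof. by move=> Ox y /mollifier_support[h1 h2]; apply: flip_box Ox _ _; exact: ltW. Qed.

Lemma flip_test x : Om x -> test_fun Om (flip K ((1 - e) *: x + e *: x0)).
Proof.
move=> Ox; set z := (1 - e) *: x + _.
apply: (@test_fun_box _ _ _ (z.1 - e * r) (z.1 + e * r) (z.2 - e * r) (z.2 + e * r)).
- exact/flip_smooth/mollifier_smooth.
- move=> y [/= ]; rewrite !in_itv /= => /andP[a1 a2] /andP[b1 b2].
  by apply: (flip_box Ox); rewrite -/z /= scaleN1r ler_norml /=; lra.
- move=> y /mollifier_support[]; rewrite /= scaleN1r !ltr_norml => /andP[a1 a2] /andP[b1 b2].
  by split; rewrite /= in_itv /= /GRing.scale /=; move: a1 a2 b1 b2; rewrite /GRing.scale /=; lra.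
Qed.

Lemma flip_near (L : R) x y : (forall x, Om x -> `|x.1| <= L /\ `|x.2| <= L) -> Om x ->
  flip K ((1 - e) *: x + e *: x0) y != 0 ->
  `|y.1 - x.1| <= e * (L + L + r) /\ `|y.2 - x.2| <= e * (L + L + r).
Proof.
move=> hL Ox /mollifier_support[].
have Ox0 : Om x0 by apply: boxr; split; rewrite /= in_itv /= lerBlDr !lerDl ltW.
have [l1 l2] := hL x Ox; have [m1 m2] := hL x0 Ox0.
rewrite /= /GRing.scale /= !mulN1r => h1 h2.
have gen (a b c : R) : `|a| <= L -> `|c| <= L -> `|- b + ((1 - e) * a + e * c)| < e * r ->
    `|b - a| <= e * (L + L + r).
  move=> ha hc h; have -> : b - a = e * (c - a) - (- b + ((1 - e) * a + e * c)) by ring.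
  apply: le_trans (ler_normB _ _) _; rewrite [leRHS]mulrDr; apply: lerD; last exact: ltW.
  rewrite normrM gtr0_norm // ler_pM2l //; apply: le_trans (ler_normB _ _) _.
  exact: lerD.
by split; [exact: gen l1 m1 h1|exact: gen l2 m2 h2].
Qed.

End scale.

(* Contracting towards x0 by the factor 1 - e keeps the support of the kernel
   inside Om for every x in Om. *)
Definition mollify n g : pt -> R :=
  let e : R := n.+2%:R^-1 in blur (mollifier (e * r)) (1 - e) (e *: x0) g.

Let e01 n : 0 < (n.+2%:R^-1 : R) < 1.
Proof. by rewrite invr_gt0 ltr0n /= invf_lt1 ?ltr0n // ltr1n. Qed.

Let er0 n : 0 < (n.+2%:R^-1 : R) * r.
Proof. by case/andP: (e01 n) => h _; rewrite mulr_gt0. Qed.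

Lemma cvg_scale : (n.+2%:R^-1 : R) @[n --> \oo] --> (0 : R).
Proof.
apply: (@squeeze_cvgr _ _ _ _ (cst 0) harmonic); last 2 first.
- exact: cvg_cst.
- exact: cvg_harmonic.
by apply: nearW => n; rewrite invr_ge0 ler0n /= lef_pV2 ?posrE ?ltr0n // ler_nat.
Qed.

Lemma mollify_smooth n g : L2 Om g -> smooth (mollify n g).
Proof. by move=> hg; apply: blur_smooth hg; exact: test_mollifier. Qed.

Lemma mollify_L2 n g : L2 Om g -> L2 Om (mollify n g).
Proof. by move=> /(mollify_smooth n); exact: (smooth_L2 oOm bOm). Qed.

Lemma mollify_lin n c f g : L2 Om f -> L2 Om g ->
  mollify n (c *: f + g) = c *: mollify n f + mollify n g.
Proof.
move=> hf hg; apply/funext => x; apply: blur_lin hf hg; exact: mollifier_smooth.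
Qed.

Lemma mollify_norm n g : L2 Om g -> L2norm Om (mollify n g) <= 2 * L2norm Om g.
Proof.
move=> hg; have /andP[e0 e1] := e01 n.
(* The index [n.+2] keeps the scale at most 1/2, so the dilation factor is uniformly bounded. *)
have th : (1 - n.+2%:R^-1 : R)^-1 <= 2.
  rewrite invf_ple ?posrE ?subr_gt0 // lerBrDr -lerBrDl.
  rewrite [leRHS](_ : _ = 2^-1); last by field.
  by rewrite lef_pV2 ?posrE ?ltr0n // ler_nat.
apply: le_trans (_ : _ <= (1 - n.+2%:R^-1)^-1 * L2norm Om g) _.
  apply: blur_L2norm => //.
  - exact: test_mollifier.
  - by move=> x; exact: mollifier_ge0.
  - exact: mollifier_int.
  - by rewrite subr_gt0.
  - exact: flip_supp.
by rewrite ler_wpM2r ?L2norm_ge0.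
Qed.

Lemma mollify_test phi : test_fun Om phi ->
  L2norm Om (mollify n phi - phi) @[n --> \oo] --> 0.
Proof.
move=> tphi; have [L hL] := bOm; have [C C0 lip] := test_lipschitz tphi.
have h1 : L2 Om (cst 1) by apply: (continuous_L2 oOm bOm); exact: cst_continuous.
have hphi := test_L2 oOm bOm tphi.
pose M : R := C * (L + L + r + (L + L + r)) * L2norm Om (cst 1).
apply: (@squeeze_cvgr _ _ _ _ (cst 0) (fun n => n.+2%:R^-1 * M)); last 2 first.
- exact: cvg_cst.
- by rewrite -[X in _ --> X](mul0r M); apply: cvgM; [exact: cvg_scale|exact: cvg_cst].
apply: nearW => n; rewrite L2norm_ge0 /=.
have /andP[e0 e1] := e01 n; set e : R := n.+2%:R^-1 in e0 e1 *.
have b x : Om x -> `|mollify n phi x - phi x| <= C * (e * (L + L + r) + e * (L + L + r)).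
  move=> Ox; apply: (blur_dist (th := 1 - e)) => //.
  - exact: test_mollifier.
  - by move=> y; exact: mollifier_ge0.
  - exact: mollifier_int.
  - exact: flip_supp.
  - by apply: smooth_continuous; exact: test_fun_smooth tphi.
  - by move=> y; exact: flip_near.
have Ox : Om x0 by apply: boxr; split; rewrite /= in_itv /= lerBlDr !lerDl ltW.
have c0 : 0 <= C * (e * (L + L + r) + e * (L + L + r)).
  exact: le_trans (normr_ge0 _) (b x0 Ox).
apply: (@le_trans _ _ (L2norm Om (fun x => C * (e * (L + L + r) + e * (L + L + r)) * cst 1 x))).
  apply: (Lpnorm2_le mOm).
  - by apply: (inLp2B mOm) => //; exact: mollify_L2.
  - exact: (inLp2Z mOm).
  apply: aeW => y Oy; rewrite mulr1 -[leLHS]real_normK ?num_real //.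
  by rewrite ler_sqr ?nnegrE // b.
rewrite [leLHS](Lpnorm2Z mOm) // ger0_norm // /M -/(L2norm Om (cst 1)).
by rewrite le_eqVlt; apply/orP; left; apply/eqP; ring.
Qed.

(** By the uniform bound on the mollifications, the functions for which convergence holds form a
    closed subspace. It contains the test functions, so by the fundamental lemma its orthogonal
    complement is null. *)
Lemma mollify_cvg g : L2 Om g -> L2norm Om (mollify n g - g) @[n --> \oo] --> 0.
Proof.
have H2 := semi_hilbert_L2 oOm.
pose Q := [set g | L2 Om g /\ L2norm Om (mollify n g - g) @[n --> \oo] --> 0].
(* The [3] is the bound 2 of [mollify_norm] plus 1 for the identity, both applied to [l - u]. *)
have Sd n u l : L2 Om u -> L2 Om l ->
    L2norm Om (mollify n l - l) <= L2norm Om (mollify n u - u) + 3 * L2norm Om (u - l).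
  move=> hu hl; have hd : L2 Om (l - u) := semi_hilbertB H2 hl hu.
  have E : mollify n l - l = (mollify n u - u) + (mollify n (l - u) - (l - u)).
    have -> : mollify n l = mollify n (1 *: (l - u) + u) by rewrite scale1r subrK.
    by rewrite mollify_lin // scale1r; apply/funext => x; rewrite /= !fctE; ring.
  have hNd : L2 Om (- (l - u)) by rewrite -scaleN1r; exact: (semi_hilbertZ H2).
  have hSu := semi_hilbertB H2 (mollify_L2 n hu) hu.
  have hSd := semi_hilbertB H2 (mollify_L2 n hd) hd.
  rewrite -!L2_ipnorm E; apply: le_trans (ipnormD H2 hSu hSd) _.
  rewrite lerD2l; apply: le_trans (ipnormD H2 (mollify_L2 n hd) hNd) _.
  rewrite (ipnormN H2 hd) (ipnormB H2 hu hl) [3 * _](_ : _ = 2 * ipnorm (L2ip Om) (l - u) + ipnorm (L2ip Om) (l - u)); last by ring.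
  by rewrite lerD2r !L2_ipnorm; exact: mollify_norm.
have S0 n : mollify n 0 = 0.
  have h0 := semi_hilbert0 H2; have := mollify_lin n (-1) h0 h0.
  by rewrite scaler0 addr0 scaleN1r addNr.
have HQ : semi_hilbert (L2ip Om) Q.
  apply: (semi_hilbert_closed H2).
  - by move=> v [].
  - split; first exact: (semi_hilbert0 H2).
    under eq_fun do rewrite S0 subrr -L2_ipnorm (ipnorm0 H2).
    exact: cvg_cst.
  - move=> c u v [hu cu] [hv cv]; split; first exact: (semi_hilbert_lin H2).
    apply: (@squeeze_cvgr _ _ _ _ (cst 0)
      (fun n => `|c| * L2norm Om (mollify n u - u) + L2norm Om (mollify n v - v))).
    + apply: nearW => n; rewrite L2norm_ge0 mollify_lin //=.
      have -> : c *: mollify n u + mollify n v - (c *: u + v)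
          = c *: (mollify n u - u) + (mollify n v - v).
        by rewrite scalerBr opprD addrACA.
      have hSu := semi_hilbertB H2 (mollify_L2 n hu) hu.
      have hSv := semi_hilbertB H2 (mollify_L2 n hv) hv.
      rewrite -!L2_ipnorm -(ipnormZ H2 c hSu); apply: (ipnormD H2) => //.
      exact: (semi_hilbertZ H2).
    + exact: cvg_cst.
    + rewrite -[X in _ --> X]addr0 -{1}(mulr0 `|c|); apply: cvgD => //.
      by apply: cvgM => //; exact: cvg_cst.
  - move=> u l hu hl ul; split=> //; apply/cvgrPdist_le => e ep.
    have e6 : 0 < e / 6 by rewrite divr_gt0.
    have /cvgrPdist_le /(_ _ e6)[k _ /(_ k (leqnn k))] := ul.
    rewrite sub0r normrN ger0_norm ?ipnorm_ge0 // L2_ipnorm => uk.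
    have e2 : 0 < e / 2 by rewrite divr_gt0.
    have [hk /cvgrPdist_le /(_ _ e2)] := hu k; apply: filterS => n.
    rewrite !sub0r !normrN !ger0_norm ?L2norm_ge0 // => nk.
    apply: le_trans (Sd n _ _ hk hl) _.
    by move: uk nk; move: (L2norm _ _) (L2norm _ _) => p q; lra.
move=> hg.
have [v [hv cv] gv] : exists2 v, Q v & ipnorm (L2ip Om) (g - v) = 0.
  apply: (density_of_orthogonal H2 HQ) => //; first by move=> v [].
  move=> v hv ort; rewrite L2_ipnorm; apply: (L2norm0_aeq oOm) => //.
  apply: (fundamental_lemma oOm); first exact: (L2_domain_integrable oOm bOm).
  by move=> phi tphi; apply: ort; split; [exact: test_L2|exact: mollify_test].
apply: (@squeeze_cvgr _ _ _ _ (cst 0) (fun n => L2norm Om (mollify n v - v))) => //.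
- apply: nearW => n; rewrite L2norm_ge0 /=; apply: le_trans (Sd n _ _ hv hg) _.
  by rewrite -[X in 3 * X]L2_ipnorm (ipnormB H2 hv hg) gv mulr0 addr0.
- exact: cvg_cst.
Qed.

Lemma mollify_wD n i v w : L2 Om v -> is_wD Om i v w ->
  is_wD Om i (mollify n v) ((1 - n.+2%:R^-1) *: mollify n w).
Proof.
move=> hv hw; have tK := test_mollifier (n.+2%:R^-1 * r).
have hw2 : L2 Om w by case: hw.
have sv := mollify_smooth n hv.
apply: (is_wD_ae oOm bOm (mollify_L2 n hv) (mollify_L2 n hv) _ _ _ (is_wD_smooth oOm bOm i sv)).
- exact: (inLp2Z mOm _ (mollify_L2 n hw2)).
- exact: aeW.
- apply: aeW => x Ox.
  have D := blur_is_derive (1 - n.+2%:R^-1) (n.+2%:R^-1 *: x0) i x tK hv.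
  have -> := @derive_val _ _ _ _ _ _ _ D.
  by rewrite (blur_wD tK hv hw) //; exact: flip_test.
Qed.

Definition mollifiable (B : set (pt -> R)) (ipB : (pt -> R) -> (pt -> R) -> R) :=
  forall g, B g -> (forall n, B (mollify n g)) /\
    ipnorm ipB (mollify n g - g) @[n --> \oo] --> 0.

(** The contraction multiplies the derivative of the mollification by [1 - e]; the defect, [e] times
    the norm of the derivative, tends to 0. *)
Lemma mollifiable_step B ipB : sobolev_base Om B ipB -> mollifiable B ipB ->
  mollifiable (sobolev_step Om B) (sobolev_ip Om ipB).
Proof.
move=> HB hB v hv; have H := sb_hilbert HB.
have hv2 := step_L2 hv.
have wv i := step_wD i hv.
have Bv i := step_B i hv.
have wS n i := mollify_wD n hv2 (wv i).
have BS n i : B ((1 - n.+2%:R^-1) *: mollify n (wD Om i v)).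
  by apply: (semi_hilbertZ H); case: (hB _ (Bv i)).
have sS n : sobolev_step Om B (mollify n v).
  exact: (step_mem oOm bOm HB (mollify_L2 n hv2) (wS n) (BS n)).
split=> //.
apply: (@squeeze_cvgr _ _ _ _ (cst 0) (fun n => L2norm Om (mollify n v - v)
  + \sum_(i < 2) (ipnorm ipB (mollify n (wD Om i v) - wD Om i v)
     + n.+2%:R^-1 * ipnorm ipB (wD Om i v)))).
- apply: nearW => n; rewrite ipnorm_ge0 /=; apply: le_trans (sobolev_le_sum oOm HB _) _.
  rewrite lerD2l ler_sum // => i _.
  have [hBn _] := hB _ (Bv i); have Bn := hBn n.
  have /andP[e0 e1] := e01 n; set e : R := n.+2%:R^-1 in e0 e1 *.
  rewrite (norm_wDB oOm bOm HB) //.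
  rewrite (@sb_norm_ae _ _ _ _ HB ((1 - e) *: mollify n (wD Om i v) - wD Om i v)); last 3 first.
  + by apply: (semi_hilbertB H) => //; exact: BS.
  + by apply: (semi_hilbertB (semi_hilbert_L2 oOm)); exact: (wD_L2 oOm).
  + apply: aeqB; last exact: aeW.
    exact/aeq_sym/(wD_ae oOm bOm).
  have -> : (1 - e) *: mollify n (wD Om i v) - wD Om i v
      = (1 - e) *: (mollify n (wD Om i v) - wD Om i v) + (- e) *: wD Om i v.
    rewrite scalerBr -addrA; congr (_ + _).
    by rewrite scalerBl scale1r scaleNr opprB addrAC subrr add0r.
  have hd := semi_hilbertB H Bn (Bv i).
  apply: le_trans (ipnormD H (semi_hilbertZ H _ hd) (semi_hilbertZ H _ (Bv i))) _.
  rewrite !(ipnormZ H) // normrN gtr0_norm ?subr_gt0 // (gtr0_norm e0) lerD2r.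
  by rewrite ler_piMl ?ipnorm_ge0 // lerBlDr lerDl ltW.
- exact: cvg_cst.
- have z i : ipnorm ipB (mollify n (wD Om i v) - wD Om i v)
     + n.+2%:R^-1 * ipnorm ipB (wD Om i v) @[n --> \oo] --> 0.
    rewrite -[X in _ --> X]addr0; apply: cvgD; first by case: (hB _ (Bv i)).
    rewrite -[X in _ --> X](mul0r (ipnorm ipB (wD Om i v))); apply: cvgM; last exact: cvg_cst.
    exact: cvg_scale.
  under eq_fun do rewrite sum2E.
  rewrite -[X in nbhs X]addr0; apply: cvgD; first exact: mollify_cvg.
  by rewrite -[X in _ --> X]addr0; apply: cvgD; exact: z.
Qed.

Lemma smooth_dense_H2 v : H2 Om v -> exists phi : nat -> pt -> R,
  (forall n, smooth (phi n)) /\ ipnorm (ipH2 Om) (phi n - v) @[n --> \oo] --> 0.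
Proof.
move=> hv.
have m0 : mollifiable (L2 Om) (L2ip Om).
  move=> g hg; split=> [n|]; first exact: mollify_L2.
  by under eq_fun do rewrite L2_ipnorm; exact: mollify_cvg.
have m1 := mollifiable_step (sobolev_base_L2 oOm) m0; rewrite -H1E // in m1.
have m2 := mollifiable_step (sobolev_base_H1 oOm bOm) m1; rewrite -H2E // in m2.
exists (mollify^~ v); split=> [n|]; last by case: (m2 v hv).
by apply: mollify_smooth; case: hv => [[]].
Qed.

End mollification.

(** * Inequalities for smooth functions on convex sets *)

Section local_inequalities.
Context {R : realType}.
Local Notation pt := (R * R)%type.
Local Notation leb := (@lebesgue_measure R).
Local Notation mR := (measurableTypeR R).
Local Notation pl := (mR * mR)%type.
Implicit Types (f g phi : pt -> R) (i j : 'I_2) (x y p q : pt) (K : set pl).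
Local Notation I01 := (`[0%R, 1%R]%classic : set mR).

Lemma continuous_itv_integrable (h : R -> R) (a b : R) : continuous h ->
  leb.-integrable (`[a, b]%classic : set mR) (EFin \o h).
Proof.
move=> ch; apply: continuous_compact_integrable; first exact: segment_compact.
exact: continuous_subspaceT.
Qed.

Lemma continuous_itv_L2 (h : R -> R) (a b : R) : continuous h ->
  inLp leb 2%:E (`[a, b]%classic : set mR) h.
Proof.
move=> ch; apply/inLp2P => //; split.
  by apply: measurable_funTS; exact: continuous_measurable1.
by apply: continuous_itv_integrable => t; apply: cvgM; exact: ch.
Qed.

(** Cauchy-Schwarz on [0, s] for the integral of [h'] costs a factor [s <= 1]. *)
Lemma sqr_increment_le (h h' : R -> R) (s : R) : (forall t : R, is_derive t 1 h (h' t)) ->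
  continuous h' -> 0 <= s <= 1 ->
  (((h s - h 0) ^+ 2)%:E <= \int[leb]_(t in I01) (h' t ^+ 2)%:E)%E.
Proof.
move=> dh ch' /andP[s0 s1].
have int0 : (0 <= \int[leb]_(t in I01) (h' t ^+ 2)%:E)%E.
  by apply: integral_ge0 => t _; rewrite lee_fin sqr_ge0.
move: s0; rewrite le_eqVlt => /orP[/eqP <-|s0]; first by rewrite subrr expr0n.
have mI : measurable (`[0, s]%classic : set mR) by [].
have E : \int[leb]_(t in `[0, s]%classic) (cst 1 t * h' t) = h s - h 0.
  rewrite (_ : \int[leb]_(t in _) _ = \int[leb]_(t in `[0, s]%classic) h' t); last first.
    by apply: eq_Rintegral => t _; rewrite mul1r.
  rewrite /Rintegral (continuous_FTC2 (F := h)) ?EFinB //.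
  - exact: continuous_subspaceT.
  - have cF := is_derive_continuous dh.
    split; first by move=> t _; case: (dh t).
      by apply: cvg_at_right_filter; exact: cF.
    by apply: cvg_at_left_filter; exact: cF.
  - by move=> t _; rewrite derive1E; case: (dh t).
have L1 : inLp leb 2%:E (`[0, s]%classic : set mR) (cst 1).
  by apply: continuous_itv_L2; exact: cst_continuous.
have L2h : inLp leb 2%:E (`[0, s]%classic : set mR) h' by exact: continuous_itv_L2.
have := cauchy_schwarz_L2 mI L1 L2h; rewrite E => cs.
have n1 : Lpnorm leb 2%:E (`[0, s]%classic : set mR) (cst 1) ^+ 2 = s.
  rewrite Lpnorm2_sqr; under eq_Rintegral do rewrite expr1n.
  have M : leb (`[0, s]%classic : set mR) = s%:E.
    by rewrite lebesgue_measure_itv /= lte_fin s0 oppr0 adde0.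
  by rewrite Rintegral_cst // mul1r [X in fine X]M.
apply: (@le_trans _ _ (\int[leb]_(t in (`[0%R, s]%classic : set mR)) (h' t ^+ 2)%:E)%E); last first.
  apply: ge0_subset_integral => //.
  - apply/measurable_EFinP; apply: measurable_funTS; apply: continuous_measurable1 => t.
    by apply: cvgM; exact: ch'.
  - by move=> t _; rewrite lee_fin sqr_ge0.
  - by apply: subset_itvl; rewrite bnd_simp.
rewrite (integral_sqrE mI L2h) lee_fin -real_normK ?num_real //.
apply: (@le_trans _ _ (Lpnorm leb 2%:E (`[0, s]%classic : set mR) (cst 1) ^+ 2
   * Lpnorm leb 2%:E (`[0, s]%classic : set mR) h' ^+ 2)).
  by rewrite -exprMn ler_sqr ?nnegrE ?mulr_ge0 ?Lpnorm_ge0.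
by rewrite n1 ler_piMl ?sqr_ge0.
Qed.

Lemma measurable_homothety (a : R) q :
  measurable_fun (setT : set pl) ((fun y : pt => a *: y + q) : pl -> pl).
Proof.
apply: (measurable_map2 (h1 := fun y : pt => a * y.1 + q.1) (h2 := fun y : pt => a * y.2 + q.2)).
  move=> y; apply: (@continuous_comp _ _ _ fst (fun x : R => a * x + q.1)).
    exact: fst_continuous.
  exact: affine1_continuous.
move=> y; apply: (@continuous_comp _ _ _ snd (fun x : R => a * x + q.2)).
  exact: snd_continuous.
exact: affine1_continuous.
Qed.

Section average.
Variables (G : pt -> R) (c : R) (q : pt).
Hypotheses (cG : continuous G) (G0 : forall x, 0 <= G x).

(* For c = 1 the maps contract towards q, for c = 0 they translate along q; the
   weight is the Jacobian determinant. *)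
Definition average (y : pt) : \bar R :=
  (\int[leb]_(t in I01) ((1 - c * t) ^+ 2 * G ((1 - c * t) *: y + t *: q)%R)%:E)%E.

Let F (z : mR * pl) : R :=
  \1_I01 z.1 * ((1 - c * z.1) ^+ 2 * G ((1 - c * z.1) *: (z.2 : pt) + z.1 *: q)).

Let F0 z : 0 <= F z.
Proof. by apply: mulr_ge0; [rewrite indicE ler0n|rewrite mulr_ge0 ?sqr_ge0]. Qed.

Let mF : measurable_fun setT F.
Proof.
have mc : measurable_fun setT (fun z : mR * pl => 1 - c * z.1).
  by apply: measurable_funB => //; apply: measurable_funM.
apply: measurable_funM.
  by apply: (measurableT_comp (measurable_indic _)).
apply: measurable_funM; first exact: measurable_funX.
apply: (@measurableT_comp _ _ _ _ _ _ (G : pl -> R)); first exact: continuous_measurable2.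
apply/measurable_fun_pairP; split => /=.
- apply: measurable_funD; apply: measurable_funM => //.
  exact: (measurableT_comp measurable_fst measurable_snd).
- apply: measurable_funD; apply: measurable_funM => //.
  exact: (measurableT_comp measurable_snd measurable_snd).
Qed.

Let averageE y : average y = (\int[leb]_t (F (t, y))%:E)%E.
Proof.
rewrite /average integral_mkcond; apply: eq_integral => t _; rewrite patchE /F /= !indicE.
by case: ifPn => _; rewrite ?mul1r ?mul0r.
Qed.

Lemma measurable_average : measurable_fun (setT : set pl) (average : pl -> \bar R).
Proof.
have -> : (average : pl -> \bar R) = (fun y => \int[leb]_t (F (t, y))%:E)%E.
  by apply/funext => y; exact: averageE.
apply: (@measurable_line_integral R (EFin \o F)); first exact/measurable_EFinP.
by move=> z; rewrite lee_fin.
Qed.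

(** Fubini, then for each fixed [t] the substitution x = (1 - c t) y + t q, whose Jacobian cancels
    the weight and whose image lies in [K']. Where [1 - c * t = 0] the weight vanishes as well. *)
Lemma averaging (K K' : set pl) : measurable K -> measurable K' ->
  (forall y t, K y -> 0 <= t <= 1 -> 1 - c * t != 0 ->
     K' ((1 - c * t) *: (y : pt) + t *: q)) ->
  (\int[leb2]_(y in K) average y <= \int[leb2]_(x in K') (G x)%:E)%E.
Proof.
move=> mK mK' sub.
pose FK (z : mR * pl) : \bar R := (\1_K z.2 * F z)%:E.
have FK0 z : (0 <= FK z)%E by rewrite lee_fin mulr_ge0 // indicE ler0n.
have mFK : measurable_fun setT FK.
  apply/measurable_EFinP; apply: measurable_funM => //.
  by apply: (measurableT_comp (measurable_indic _)).
have -> : (\int[leb2]_(y in K) average y = \int[leb2]_y \int[leb]_t FK (t, y))%E.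
  rewrite integral_mkcond; apply: eq_integral => y _; rewrite patchE averageE.
  case: ifPn => [yK|yK].
    by apply: eq_integral => t _; rewrite /FK /= indicE yK mul1r.
  by rewrite integral0_eq // => t _; rewrite /FK /= indicE (negbTE yK) mul0r.
rewrite -fubini_line_plane //.
set I := (\int[leb2]_(x in K') (G x)%:E)%E.
have I0 : (0 <= I)%E by apply: integral_ge0 => x _; rewrite lee_fin.
have mG : measurable_fun (setT : set pl) ((EFin \o G) \_ K').
  apply/(measurable_restrictT _ mK'); apply: measurable_funTS.
  by apply/measurable_EFinP; exact: continuous_measurable2.
have GK0 x : (0 <= ((EFin \o G) \_ K') x)%E by rewrite patchE; case: ifP; rewrite ?lee_fin.
apply: (@le_trans _ _ (\int[leb]_(t in I01) (cst I t))%E); last first.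
  rewrite integral_cst //.
  have M : leb I01 = 1%E by rewrite lebesgue_measure_itv /= lte_fin ltr01 oppr0 adde0.
  by rewrite [X in (_ * X)%E]M mule1.
rewrite [leRHS]integral_mkcond; apply: ge0_le_integral => //.
- by move=> t _; apply: integral_ge0.
- exact: measurable_plane_integral.
- have mI : measurable I01 by [].
  by apply/(measurable_restrictT _ mI); exact: measurable_cst.
move=> t _; rewrite patchE; case: ifPn => tI; last first.
  by rewrite integral0_eq // => y _; rewrite /FK /F /= [\1_I01 _]indicE (negbTE tI) mul0r mulr0.
have t01 : 0 <= t <= 1 by move: tI; rewrite inE /= in_itv.
have [c0|c0] := eqVneq (1 - c * t) 0.
  by rewrite integral0_eq // => y _; rewrite /FK /F /= c0 expr0n !mul0r !mulr0.
apply: (@le_trans _ _ (\int[leb2]_y (((1 - c * t) ^+ 2)%:E *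
    ((EFin \o G) \_ K') ((1 - c * t) *: (y : pt) + t *: q)%R))%E).
  have mm : measurable_fun (setT : set pl) (fun y : pl => ((EFin \o G) \_ K') ((1 - c * t) *: (y : pt) + t *: q)%R).
    exact: (measurableT_comp mG (measurable_homothety _ _)).
  apply: ge0_le_integral => //.
  - apply/measurable_EFinP; apply: measurable_funM; first exact: measurable_indic.
    rewrite /F /=; apply: measurable_funM; first exact: measurable_cst.
    apply: measurable_funM; first exact: measurable_cst.
    exact: (measurableT_comp (continuous_measurable2 cG) (measurable_homothety _ _)).
  - by apply: emeasurable_funM.
  move=> y _; rewrite /FK /F /= patchE [\1_I01 _]indicE tI mul1r [\1_K _]indicE.
  have [yK|yK] := boolP (y \in K); last first.
    rewrite mul0r mule_ge0 ?lee_fin ?sqr_ge0 //.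
    by case: ifP; rewrite ?lee_fin.
  by rewrite mul1r mem_set ?EFinM //; apply: sub => //; move: yK; rewrite inE.
rewrite ge0_integralZl ?lee_fin ?sqr_ge0 //; last first.
  exact: (measurableT_comp mG (measurable_homothety _ _)).
rewrite (ge0_integral_homothety _ mG GK0 c0) muleA -EFinM mulfV ?expf_neq0 // mul1e.
by rewrite /I [leRHS]integral_mkcond.
Qed.

End average.

Definition hess_sqr phi y : R :=
  \sum_(i < 2) \sum_(j < 2) 'D_(Defs.basis j) ('D_(Defs.basis i) phi) y ^+ 2.

Definition grad_sqr phi y : R := \sum_(i < 2) 'D_(Defs.basis i) phi y ^+ 2.

(** The remainder at [p] of the first-order expansion around [y]: the evaluation point is fixed, the
    centre is the variable of integration. *)
Definition taylor_rest phi p y : R := phi p - phi y -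
  ((p - y).1 * 'D_(Defs.basis ord0) phi y + (p - y).2 * 'D_(Defs.basis ord_max) phi y).

Lemma grad_sqr_continuous phi : smooth phi -> continuous (grad_sqr phi).
Proof.
move=> sphi y; 
rewrite (_ : grad_sqr phi = fun y => 'D_(Defs.basis ord0) phi y ^+ 2 + 'D_(Defs.basis ord_max) phi y ^+ 2).
  by apply: cvgD; apply: cvgM; exact: (smooth_continuous (smoothD_i _ sphi)).
by apply/funext => z; rewrite /grad_sqr sum2E.
Qed.

Lemma hess_sqr_continuous phi : smooth phi -> continuous (hess_sqr phi).
Proof.
move=> sphi y; rewrite (_ : hess_sqr phi = fun y => grad_sqr ('D_(Defs.basis ord0) phi) y
    + grad_sqr ('D_(Defs.basis ord_max) phi) y).
  by apply: cvgD; apply: grad_sqr_continuous; exact: smoothD_i.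
by apply/funext => z; rewrite /hess_sqr sum2E.
Qed.

Lemma grad_sqr_ge0 phi y : 0 <= grad_sqr phi y.
Proof. by rewrite sumr_ge0 // => i _; exact: sqr_ge0. Qed.

Lemma hess_sqr_ge0 phi y : 0 <= hess_sqr phi y.
Proof. by rewrite sumr_ge0 // => i _; exact: grad_sqr_ge0. Qed.

Lemma taylor_rest_continuous phi p : smooth phi -> continuous (taylor_rest phi p).
Proof.
move=> sphi y; rewrite /taylor_rest.
have c1 : (p - y').1 @[y' --> y] --> (p - y).1.
  by apply: cvgB; [exact: cvg_cst|exact: fst_continuous].
have c2 : (p - y').2 @[y' --> y] --> (p - y).2.
  by apply: cvgB; [exact: cvg_cst|exact: snd_continuous].
apply: cvgB.
  by apply: cvgB; [exact: cvg_cst|exact: (smooth_continuous sphi)].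
by apply: cvgD; apply: cvgM => //; exact: (smooth_continuous (smoothD_i _ sphi)).
Qed.

Lemma hess_sqrE phi y : hess_sqr phi y
  = 'D_(Defs.basis ord0) ('D_(Defs.basis ord0) phi) y ^+ 2
    + 'D_(Defs.basis ord_max) ('D_(Defs.basis ord0) phi) y ^+ 2
  + ('D_(Defs.basis ord0) ('D_(Defs.basis ord_max) phi) y ^+ 2
    + 'D_(Defs.basis ord_max) ('D_(Defs.basis ord_max) phi) y ^+ 2).
Proof. by rewrite /hess_sqr sum2E; congr (_ + _); rewrite sum2E. Qed.

(* Cauchy-Schwarz; the squares are those of Lagrange's identity. *)
Lemma hess_form_le (u v a b a' b' k : R) : u ^+ 2 + v ^+ 2 <= k ->
  (u * (u * a + v * b) + v * (u * a' + v * b')) ^+ 2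
    <= k ^+ 2 * (a ^+ 2 + b ^+ 2 + (a' ^+ 2 + b' ^+ 2)).
Proof.
move=> uvk; have n0 : 0 <= u ^+ 2 + v ^+ 2 by rewrite addr_ge0 ?sqr_ge0.
apply: (@le_trans _ _ ((u ^+ 2 + v ^+ 2) ^+ 2 * (a ^+ 2 + b ^+ 2 + (a' ^+ 2 + b' ^+ 2)))).
  rewrite -subr_ge0.
  have -> : (u ^+ 2 + v ^+ 2) ^+ 2 * (a ^+ 2 + b ^+ 2 + (a' ^+ 2 + b' ^+ 2)) -
      (u * (u * a + v * b) + v * (u * a' + v * b')) ^+ 2
    = (u * u * b - u * v * a) ^+ 2 + (u * u * a' - v * u * a) ^+ 2
      + (u * u * b' - v * v * a) ^+ 2 + (u * v * a' - v * u * b) ^+ 2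
      + (u * v * b' - v * v * b) ^+ 2 + (v * u * b' - v * v * a') ^+ 2 by ring.
  by rewrite !addr_ge0 ?sqr_ge0.
rewrite ler_wpM2r ?addr_ge0 ?sqr_ge0 // ler_sqr ?nnegrE //.
exact: le_trans uvk.
Qed.

(** The integral form of the remainder has kernel [1 - t]. After squaring, [(1 - t) ^ 2] is the
    Jacobian determinant of the homothety towards [p], so [averaging] applies without a singular
    weight. [t = 1] is left out so that [p] may lie on the boundary of [K]. *)
Lemma taylor_homothety phi K p (d : R) : smooth phi -> measurable K ->
  (forall y t, K y -> 0 <= t < 1 -> K ((1 - t) *: (y : pt) + t *: p)) ->
  (forall y, K y -> enorm (p - y) <= d) ->
  (\int[leb2]_(y in K) ((taylor_rest phi p y) ^+ 2)%:E
    <= (d ^+ 4)%:E * \int[leb2]_(y in K) (hess_sqr phi y)%:E)%E.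
Proof.
move=> sphi mK star hd.
have d4 : 0 <= d ^+ 4 by rewrite (exprM d 2 2) sqr_ge0.
pose G y := d ^+ 4 * hess_sqr phi y.
have cG : continuous G.
  by move=> y; apply: cvgM; [exact: cvg_cst|exact: hess_sqr_continuous].
have G0 y : 0 <= G y by rewrite mulr_ge0 ?hess_sqr_ge0.
have mcont g : continuous g -> measurable_fun K (EFin \o (g : pl -> R)).
  by move=> cg; apply: measurable_funTS; apply/measurable_EFinP; exact: continuous_measurable2.
have star1 y (t : R) : K y -> 0 <= t <= 1 -> 1 - 1 * t != 0 ->
    K ((1 - 1 * t) *: (y : pt) + t *: p).
  rewrite mul1r subr_eq0 => Ky /andP[t0 t1] tn; apply: star => //.
  by rewrite t0 lt_neqAle eq_sym tn.
apply: (@le_trans _ _ (\int[leb2]_(y in K) (G y)%:E)%E); last first.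
  under eq_integral do rewrite EFinM.
  rewrite ge0_integralZl //; first exact: mcont (hess_sqr_continuous sphi).
  by move=> y _; rewrite lee_fin hess_sqr_ge0.
apply: le_trans (averaging cG G0 mK mK star1); apply: ge0_le_integral => //.
- by move=> y _; rewrite lee_fin sqr_ge0.
- apply: (mcont (fun y => taylor_rest phi p y ^+ 2)) => y.
  by apply: cvgM; exact: taylor_rest_continuous.
- by apply: measurable_funTS; exact: measurable_average.
move=> y Ky; set e := p - y.
pose D i := 'D_(Defs.basis i) phi.
have sD i : smooth (D i) by exact: smoothD_i.
pose g1 (t : R) := e.1 * D ord0 (y + t *: e) + e.2 * D ord_max (y + t *: e).
pose g2 (t : R) := e.1 * (e.1 * 'D_(Defs.basis ord0) (D ord0) (y + t *: e)
                     + e.2 * 'D_(Defs.basis ord_max) (D ord0) (y + t *: e))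
             + e.2 * (e.1 * 'D_(Defs.basis ord0) (D ord_max) (y + t *: e)
                     + e.2 * 'D_(Defs.basis ord_max) (D ord_max) (y + t *: e)).
(* [h] runs from the linear prediction of [phi p] made at [y] to [phi p] itself, and the first-order
   terms of its derivative cancel. *)
pose h (t : R) := phi (y + t *: e) + (1 - t) * g1 t.
have dg (t : R) : is_derive t 1 (fun s : R => phi (y + s *: e)) (g1 t).
  exact: derive_chain_line (sphi 1%N).
have dg1 (t : R) : is_derive t 1 g1 (g2 t).
  apply: is_deriveD; apply: (is_deriveZ (V := R^o)); exact: derive_chain_line (sD _ 1%N).
have dh (t : R) : is_derive t 1 h ((1 - t) * g2 t).
  have d1 : is_derive t (1 : R) (fun s : R => 1 - s) (0 - 1) by apply: is_deriveB.
  apply: (is_derive_eq (is_deriveD (dg t) (is_deriveM d1 (dg1 t)))); rewrite /GRing.scale /=; ring.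
have cl (g : pt -> R) : continuous g -> continuous (fun t : R => g (y + t *: e)).
  by move=> cg t; apply: continuous_comp; [exact: line_continuous|exact: cg].
have cg2 : continuous g2.
  have c i j := cl _ (smooth_continuous (smoothD_i j (sD i))).
  have lin (a b : R) (f1 f2 : R -> R) : continuous f1 -> continuous f2 ->
      continuous (fun t : R => a * f1 t + b * f2 t).
    by move=> c1 c2 t; apply: cvgD; (apply: cvgM; first exact: cvg_cst); [exact: c1|exact: c2].
  exact: lin (lin _ _ _ _ (c _ _) (c _ _)) (lin _ _ _ _ (c _ _) (c _ _)).
have ch' : continuous (fun t : R => (1 - t) * g2 t).
  move=> t; apply: cvgM; last exact: cg2.
  by apply: cvgB; [exact: cvg_cst|exact: cvg_id].
have i01 : 0 <= (1 : R) <= 1 by rewrite ler01 lexx.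
have := sqr_increment_le dh ch' i01.
have -> : h 1 - h 0 = taylor_rest phi p y.
  rewrite /h /g1 subrr mul0r addr0 scale1r scale0r addr0 subr0 mul1r /taylor_rest -/e.
  have -> : (y : pt) + e = p by rewrite /e addrC subrK.
  by rewrite opprD addrA.
move/le_trans; apply; apply: ge0_le_integral => //.
- by move=> t _; rewrite lee_fin sqr_ge0.
- apply: measurable_funTS; apply/measurable_EFinP; apply: continuous_measurable1 => t.
  by apply: cvgM; exact: ch'.
- apply: measurable_funTS; apply/measurable_EFinP; apply: continuous_measurable1 => t.
  have ct : (1 - 1 * s) @[s --> t] --> 1 - 1 * t.
    by apply: cvgB; [exact: cvg_cst|apply: cvgM; [exact: cvg_cst|exact: cvg_id]].
  apply: cvgM; first exact: cvgM.
  apply: (@continuous_comp _ _ _ (fun s : R => (1 - 1 * s) *: y + s *: p) G); last exact: cG.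
  by apply: cvgD; apply: cvgZr_tmp.
move=> t _; rewrite lee_fin exprMn mul1r ler_wpM2l ?sqr_ge0 // /G.
have -> : (1 - t) *: (y : pt) + t *: p = y + t *: e.
  by rewrite /e scalerBl scale1r scalerBr -addrA [- _ + _]addrC.
have ed : enorm e ^+ 2 <= d ^+ 2.
  by rewrite ler_sqr ?nnegrE ?sqrtr_ge0 ?hd // (le_trans _ (hd _ Ky)) ?sqrtr_ge0.
rewrite hess_sqrE (exprM d 2 2); apply: hess_form_le.
by rewrite -enorm_sqr.
Qed.

End local_inequalities.

(** * Sobolev embedding and point values on convex domains *)

Section convex_domains.
Context {R : realType}.
Local Notation pt := (R * R)%type.
Local Notation mR := (measurableTypeR R).
Local Notation pl := (mR * mR)%type.
Implicit Types (f g v w phi psi : pt -> R) (i j : 'I_2) (x y p q z : pt).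

Lemma closed_box_sub (U : set pt) x : open U -> U x ->
  exists2 r : R, 0 < r & box (x.1 - r) (x.1 + r) (x.2 - r) (x.2 + r) `<=` U.
Proof.
move=> oU Ux; have /nbhs_ballP[e /= e0 he] : nbhs x U by exact: open_nbhs_nbhs.
exists (e / 2); first by rewrite divr_gt0.
move=> y [/= ]; rewrite !in_itv /= => /andP[a1 a2] /andP[b1 b2]; apply: he.
by split; rewrite /ball /= ltr_norml; lra.
Qed.

Variable Om : set pt.
Hypothesis oOm : open Om.
Hypothesis bOm : exists L : R, forall x, Om x -> `|x.1| <= L /\ `|x.2| <= L.
Hypothesis cOm : forall x y (t : R), Om x -> Om y -> 0 <= t <= 1 -> Om ((1 - t) *: x + t *: y).
Variables (x0 : pt) (r : R).
Hypothesis r0 : 0 < r.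
Hypothesis boxr : box (x0.1 - r) (x0.1 + r) (x0.2 - r) (x0.2 + r) `<=` Om.
Local Notation mOm := (measurable_domain oOm).
Local Notation normH2 := (ipnorm (ipH2 Om)).

Lemma center_in : Om x0.
Proof. by apply: boxr; split; rewrite /= in_itv /= lerBlDr !lerDl ltW. Qed.

Lemma closure_near p (e : R) : closure Om p -> 0 < e ->
  exists q, [/\ Om q, `|q.1 - p.1| < e & `|q.2 - p.2| < e].
Proof.
move=> cp e0; have [q [Oq [/= h1 h2]]] := cp (ball p e) (nbhsx_ballx p e e0).
by exists q; split; rewrite // distrC.
Qed.

(** [p] is replaced by a nearby point [q] of [Om]; the error, rescaled by [t / (1 - t)], is absorbed
    into [y], which has a box around it in [Om]. *)
Lemma closure_segment y p (t : R) : Om y -> closure Om p -> 0 <= t < 1 ->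
  Om ((1 - t) *: y + t *: p).
Proof.
move=> Oy cp /andP[t0 t1]; have [s s0 hs] := closed_box_sub oOm Oy.
have s1 : 0 < 1 - t by rewrite subr_gt0.
have [|q [Oq q1 q2]] := @closure_near p ((1 - t) * s) cp; first exact: mulr_gt0.
have -> : (1 - t) *: y + t *: p = (1 - t) *: (y + (t / (1 - t)) *: (p - q)) + t *: q.
  by rewrite scalerDr scalerA mulrCA divff ?gt_eqF // mulr1 -addrA -scalerDr subrK.
apply: cOm => //; last by rewrite t0 ltW.
have gen (a b : R) : `|a - b| < (1 - t) * s -> `|t / (1 - t) * (b - a)| <= s.
  rewrite distrC => h; rewrite normrM normrM (ger0_norm t0) normfV (gtr0_norm s1) mulrAC.
  rewrite ler_pdivrMr // [s * _]mulrC; apply: le_trans (ltW h).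
  by rewrite ler_piMl ?normr_ge0 // ltW.
have := gen _ _ q1; have := gen _ _ q2; rewrite !ler_norml => /andP[? ?] /andP[? ?].
by apply: hs; split; rewrite /= in_itv /= /GRing.scale /=; apply/andP; split; lra.
Qed.

Lemma closure_bounded (L : R) p : (forall x, Om x -> `|x.1| <= L /\ `|x.2| <= L) ->
  closure Om p -> `|p.1| <= L /\ `|p.2| <= L.
Proof.
move=> hL cp; split; apply/ler_addgt0Pr => e e0;
  have [q [/hL[l1 l2] q1 q2]] := closure_near cp e0.
- have -> : p.1 = q.1 - (q.1 - p.1) by ring.
  by apply: le_trans (ler_normB _ _) _; rewrite lerD // ltW.
- have -> : p.2 = q.2 - (q.2 - p.2) by ring.
  by apply: le_trans (ler_normB _ _) _; rewrite lerD // ltW.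
Qed.

Lemma enorm_le_sum x : enorm x <= `|x.1| + `|x.2|.
Proof.
apply: le_of_sqr; first by rewrite addr_ge0.
rewrite enorm_sqr -(@real_normK _ x.1) ?num_real // -(@real_normK _ x.2) ?num_real //.
by have := normr_ge0 x.1; have := normr_ge0 x.2; nra.
Qed.

Lemma closure_diameter : exists2 d : R, 0 < d & forall p y, closure Om p -> Om y -> enorm (p - y) <= d.
Proof.
have [L hL] := bOm; exists (4 * L + 1) => [|p y cp Oy].
  by have [h _] := hL _ center_in; have := normr_ge0 x0.1; lra.
apply: le_trans (enorm_le_sum _) _.
have [p1 p2] := closure_bounded hL cp; have [y1 y2] := hL _ Oy.
apply: le_trans (lerD (ler_normB _ _) (ler_normB _ _)) _; lra.
Qed.

Lemma smooth_H1 phi : smooth phi -> H1 Om phi.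
Proof.
move=> sphi; split; first exact: smooth_L2.
by move=> i; exists ('D_(Defs.basis i) phi); exact: is_wD_smooth.
Qed.

Lemma smooth_H2 phi : smooth phi -> H2 Om phi.
Proof.
move=> sphi; rewrite H2E //; apply: (step_mem oOm bOm (sobolev_base_H1 oOm bOm)
  (w := fun i => 'D_(Defs.basis i) phi)).
- exact: smooth_L2.
- by move=> i; exact: is_wD_smooth.
- by move=> i; exact/smooth_H1/smoothD_i.
Qed.

Lemma sobolev_norm_smooth B ipB phi : sobolev_base Om B ipB -> (forall psi, smooth psi -> B psi) ->
  smooth phi -> ipnorm (sobolev_ip Om ipB) phi ^+ 2
    = L2norm Om phi ^+ 2 + \sum_(i < 2) ipnorm ipB ('D_(Defs.basis i) phi) ^+ 2.
Proof.
move=> HB sB sphi; rewrite (sobolev_ipnorm_sqr oOm HB); congr (_ + _).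
apply: eq_bigr => i _; congr (_ ^+ 2); apply: (sb_norm_ae HB).
- exact/sB/smoothD_i.
- exact: wD_L2.
- by apply/aeq_sym/(wD_ae oOm bOm); exact: is_wD_smooth.
Qed.

Lemma normH1_smooth phi : smooth phi -> ipnorm (ipH1 Om) phi ^+ 2
  = L2norm Om phi ^+ 2 + \sum_(i < 2) L2norm Om ('D_(Defs.basis i) phi) ^+ 2.
Proof.
move=> sphi; rewrite (sobolev_norm_smooth (sobolev_base_L2 oOm) (smooth_L2 oOm bOm) sphi).
by congr (_ + _); apply: eq_bigr => i _; rewrite L2_ipnorm.
Qed.

Lemma normH2_smooth phi : smooth phi -> normH2 phi ^+ 2
  = L2norm Om phi ^+ 2 + \sum_(i < 2) L2norm Om ('D_(Defs.basis i) phi) ^+ 2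
   + \sum_(i < 2) \sum_(j < 2) L2norm Om ('D_(Defs.basis j) ('D_(Defs.basis i) phi)) ^+ 2.
Proof.
move=> sphi; rewrite (sobolev_norm_smooth (sobolev_base_H1 oOm bOm) smooth_H1 sphi).
rewrite -addrA -big_split /=; congr (_ + _); apply: eq_bigr => i _.
by apply: normH1_smooth; exact: smoothD_i.
Qed.

Lemma integral_sum_sqr f g (D : set pl) : measurable D -> L2 D f -> L2 D g ->
  (\int[leb2]_(x in D) (f x ^+ 2 + g x ^+ 2)%:E)%E
   = (L2norm D f ^+ 2 + L2norm D g ^+ 2)%:E.
Proof.
move=> mD hf hg; under eq_integral do rewrite EFinD.
rewrite ge0_integralD //; try by move=> x _; rewrite lee_fin sqr_ge0.
- by rewrite !integral_sqrE // EFinD.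
- by apply: measurable_sqr; exact: inLp2_measurable hf.
- by apply: measurable_sqr; exact: inLp2_measurable hg.
Qed.

Lemma integral_grad_sqr phi : smooth phi -> (\int[leb2]_(x in Om) (grad_sqr phi x)%:E)%E
  = (\sum_(i < 2) L2norm Om ('D_(Defs.basis i) phi) ^+ 2)%:E.
Proof.
move=> sphi; rewrite sum2E -(integral_sum_sqr mOm); try exact: smoothD_L2.
by apply: eq_integral => x _; rewrite /grad_sqr sum2E.
Qed.

Lemma integral_hess_sqr phi : smooth phi -> (\int[leb2]_(x in Om) (hess_sqr phi x)%:E)%E
  = (\sum_(i < 2) \sum_(j < 2) L2norm Om ('D_(Defs.basis j) ('D_(Defs.basis i) phi)) ^+ 2)%:E.
Proof.
move=> sphi; rewrite sum2E EFinD.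
have I i := integral_grad_sqr (smoothD_i i sphi).
transitivity (\int[leb2]_(x in Om) (grad_sqr ('D_(Defs.basis ord0) phi) x)%:E
  + \int[leb2]_(x in Om) (grad_sqr ('D_(Defs.basis ord_max) phi) x)%:E)%E; last first.
  by congr (_ + _)%E; [exact: (I ord0)|exact: (I ord_max)].
have mD : measurable (Om : set pl) := mOm.
have m i : measurable_fun (Om : set pl) (fun x : pl => (grad_sqr ('D_(Defs.basis i) phi) x)%:E).
  apply/measurable_EFinP; apply: measurable_funTS; apply: continuous_measurable2.
  by apply: grad_sqr_continuous; exact: smoothD_i.
rewrite -ge0_integralD //; try by move=> x _; rewrite lee_fin grad_sqr_ge0.
by apply: eq_integral => x _; rewrite /hess_sqr sum2E EFinD.
Qed.

Lemma leb2_domain_gt0 : 0 < fine (leb2 (Om : set pl)).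
Proof.
rewrite -lte_fin fineK ?ge0_fin_numE ?domain_fin ?measure_ge0 //.
apply: lt_le_trans (_ : (leb2 (box (x0.1 - r) (x0.1 + r) (x0.2 - r) (x0.2 + r) : set pl) <= _)%E).
  by rewrite leb2_box ?lte_fin ?mulr_gt0 //; move: r0; lra.
by apply: le_measure => //; rewrite inE //; [exact: measurable_box|exact: mOm].
Qed.

(** [phi p] is the sum of [phi y], the gradient term and the Taylor remainder at [y]. Squaring,
    which costs the factor 3, and averaging over [y] in [Om] gives the bound: the gradient
    contributes [d ^ 2] and, by [taylor_homothety], the remainder [d ^ 4]. *)
Lemma sobolev_pointwise : exists2 C : R, 0 <= C & forall p phi, closure Om p -> smooth phi ->
  `|phi p| <= C * normH2 phi.
Proof.
have mD : measurable (Om : set pl) := mOm.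
have [d d0 hd] := closure_diameter; pose m := fine (leb2 (Om : set pl)).
have m0 : 0 < m := leb2_domain_gt0.
pose k := 3 * (1 + d ^+ 2 + d ^+ 4) / m.
have k0 : 0 <= k by rewrite /k divr_ge0 ?(ltW m0) // mulr_ge0 // !addr_ge0 ?exprn_ge0 // ltW.
exists (Num.sqrt k); first exact: sqrtr_ge0.
move=> p phi cp sphi; apply: le_of_sqr; first by rewrite mulr_ge0 ?sqrtr_ge0 ?ipnorm_ge0.
rewrite real_normK ?num_real // exprMn sqr_sqrtr // /k mulrAC ler_pdivlMr // mulrC.
have mc f : continuous f -> measurable_fun (Om : set pl) (EFin \o (f : pl -> R)).
  by move=> cf; apply: measurable_funTS; apply/measurable_EFinP; exact: continuous_measurable2.
have T := taylor_homothety (p := p) (d := d) sphi mOm.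
have /T{}T : forall y t, Om y -> 0 <= t < 1 -> Om ((1 - t) *: y + t *: p).
  by move=> y t Oy t01; exact: closure_segment.
have {}T := T (fun y => hd p y cp).
rewrite integral_hess_sqr // in T.
set nphi := L2norm Om phi ^+ 2; set ng := \sum_(i < 2) L2norm Om ('D_(Defs.basis i) phi) ^+ 2.
have := normH2_smooth sphi; rewrite -/nphi -/ng.
set nh := \sum_(i < 2) \sum_(j < 2) _ in T * => ->.
have c2 : continuous (fun y => phi y ^+ 2).
  by move=> y; apply: cvgM; exact: (smooth_continuous sphi).
have cg := grad_sqr_continuous sphi.
have ct : continuous (fun y => taylor_rest phi p y ^+ 2).
  by move=> y; apply: cvgM; exact: taylor_rest_continuous.
have d2 : 0 <= d ^+ 2 by exact: sqr_ge0.
have d4 : 0 <= d ^+ 4 by rewrite exprn_ge0 // ltW.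
have pw y : Om y -> phi p ^+ 2 <= 3 * (phi y ^+ 2 + d ^+ 2 * grad_sqr phi y + taylor_rest phi p y ^+ 2).
  move=> Oy; have := hd p y cp Oy; set e := p - y => ed.
  have e2 : enorm e ^+ 2 <= d ^+ 2 by rewrite ler_sqr ?nnegrE ?sqrtr_ge0 // ltW.
  have -> : phi p = phi y + (e.1 * 'D_(Defs.basis ord0) phi y + e.2 * 'D_(Defs.basis ord_max) phi y)
      + taylor_rest phi p y by rewrite /taylor_rest -/e; ring.
  rewrite /grad_sqr sum2E; rewrite enorm_sqr in e2.
  move: ('D__ _ _) ('D__ _ _) (taylor_rest _ _ _) (phi y) => b a t q.
  have cs : (e.1 * a + e.2 * b) ^+ 2 <= d ^+ 2 * (a ^+ 2 + b ^+ 2).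
    apply: (@le_trans _ _ ((e.1 ^+ 2 + e.2 ^+ 2) * (a ^+ 2 + b ^+ 2))).
      rewrite -subr_ge0 (_ : _ - _ = (e.1 * b - e.2 * a) ^+ 2) ?sqr_ge0 //; ring.
    by rewrite ler_wpM2r ?addr_ge0 ?sqr_ge0.
  move: (e.1 * a + e.2 * b) cs => w cs.
  have h1 := sqr_ge0 (q - w); have h2 := sqr_ge0 (q - t); have h3 := sqr_ge0 (w - t).
  by move: (d ^+ 2 * (a ^+ 2 + b ^+ 2)) cs => D cs; nra.
have i0 : ((phi p ^+ 2 * m)%:E <= 3%:E * (nphi%:E + (d ^+ 2)%:E * ng%:E
    + \int[leb2]_(y in Om) ((taylor_rest phi p y) ^+ 2)%:E))%E.
  rewrite EFinM /m fineK ?ge0_fin_numE ?domain_fin ?measure_ge0 //.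
  rewrite -integral_cst //.
  have -> : nphi%:E = (\int[leb2]_(y in Om) (phi y ^+ 2)%:E)%E.
    by rewrite (integral_sqrE mOm (smooth_L2 oOm bOm sphi)).
  have -> : ng%:E = (\int[leb2]_(y in Om) (grad_sqr phi y)%:E)%E by rewrite integral_grad_sqr.
  rewrite -ge0_integralZl //; last 2 first.
  - exact: mc.
  - by move=> y _; rewrite lee_fin grad_sqr_ge0.
  rewrite -ge0_integralD //; last 4 first.
  - by move=> y _; rewrite lee_fin sqr_ge0.
  - exact: mc c2.
  - by move=> y _; rewrite -EFinM lee_fin mulr_ge0 ?grad_sqr_ge0.
  - by apply: emeasurable_funM => //; exact: mc.
  rewrite -ge0_integralD //; last 4 first.
  - by move=> y _; rewrite -EFinM -EFinD lee_fin addr_ge0 ?sqr_ge0 // mulr_ge0 ?grad_sqr_ge0.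
  - apply: emeasurable_funD; first exact: mc c2.
    by apply: emeasurable_funM => //; exact: mc.
  - by move=> y _; rewrite lee_fin sqr_ge0.
  - exact: mc ct.
  have mS : measurable_fun (Om : set pl) (fun y : pl => (phi y ^+ 2)%:E
      + (d ^+ 2)%:E * (grad_sqr phi y)%:E + (taylor_rest phi p y ^+ 2)%:E)%E.
    apply: emeasurable_funD; last exact: mc ct.
    apply: emeasurable_funD; first exact: mc c2.
    by apply: emeasurable_funM => //; exact: mc.
  rewrite -ge0_integralZl //; last first.
    by move=> y _; rewrite -EFinM -!EFinD lee_fin !addr_ge0 ?sqr_ge0 // mulr_ge0 ?grad_sqr_ge0.
  apply: ge0_le_integral => //.
  - by move=> y _; rewrite lee_fin sqr_ge0.
  - by apply: emeasurable_funM.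
rewrite -lee_fin mulrC; apply: le_trans i0 _.
apply: (@le_trans _ _ (3%:E * (nphi%:E + (d ^+ 2)%:E * ng%:E + (d ^+ 4)%:E * nh%:E))%E).
  by rewrite lee_pmul2l ?lte_fin // leeD2l.
have -> : (3%:E * (nphi%:E + (d ^+ 2)%:E * ng%:E + (d ^+ 4)%:E * nh%:E))%E
  = (3 * (nphi + d ^+ 2 * ng + d ^+ 4 * nh))%:E by [].
rewrite lee_fin -[leRHS]mulrA; apply: ler_wpM2l => //.
have n0 : 0 <= nphi by exact: sqr_ge0.
have g0 : 0 <= ng by rewrite sumr_ge0 // => i _; exact: sqr_ge0.
have h0 : 0 <= nh by rewrite sumr_ge0 // => i _; rewrite sumr_ge0 // => j _; exact: sqr_ge0.
clear T; by move: nphi ng nh n0 g0 h0 (d ^+ 2) (d ^+ 4) d2 d4 => *; nra.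
Qed.

Lemma normH2_dist u v w : H2 Om u -> H2 Om v -> H2 Om w ->
  normH2 (u - w) <= normH2 (u - v) + normH2 (v - w).
Proof. by move=> hu hv hw; exact: (ipnorm_dist (sb_hilbert (sobolev_base_H2 oOm bOm)) hu hv hw). Qed.

Lemma smoothB phi psi : smooth phi -> smooth psi -> smooth (phi - psi).
Proof.
move=> h1 h2; have := smooth_lin (-1) h2 h1; congr smooth; apply/funext => x.
by rewrite mulN1r addrC.
Qed.

Lemma L2norm_le_H2 v : L2norm Om v <= normH2 v.
Proof. exact: (L2norm_le_sobolev oOm (sobolev_base_H1 oOm bOm)). Qed.

Lemma normH2C u v : H2 Om u -> H2 Om v -> normH2 (u - v) = normH2 (v - u).
Proof. by move=> hu hv; exact: (ipnormB (sb_hilbert (sobolev_base_H2 oOm bOm)) hu hv). Qed.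

(** By [sobolev_pointwise], smooth approximations in H^2 converge uniformly on the closure. The last
    clause covers every approximating sequence, so point values can be computed along any of
    them. *)
Lemma continuous_representative v : H2 Om v -> exists w, [/\ {within closure Om, continuous w},
  w = v %[ae leb2 in Om] & forall phi : nat -> pt -> R, (forall n, smooth (phi n)) ->
   normH2 (phi n - v) @[n --> \oo] --> 0 ->
   forall p, closure Om p -> phi n p @[n --> \oo] --> w p].
Proof.
move=> hv; have [C C0 hC] := sobolev_pointwise.
have [phi [sphi cphi]] := smooth_dense_H2 oOm bOm cOm r0 boxr hv.
have HH := sb_hilbert (sobolev_base_H2 oOm bOm).
have est psi1 psi2 p : closure Om p -> smooth psi1 -> smooth psi2 ->
    `|psi1 p - psi2 p| <= C * (normH2 (psi1 - v) + normH2 (psi2 - v)).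
  move=> cp s1 s2; have := hC p _ cp (smoothB s1 s2); rewrite -[(psi1 - psi2) p]/(psi1 p - psi2 p).
  move/le_trans; apply; rewrite ler_wpM2l // (normH2C (smooth_H2 s2) hv).
  exact: (normH2_dist (smooth_H2 s1) hv (smooth_H2 s2)).
have small (u : nat -> R) (e : R) : u n @[n --> \oo] --> (0 : R) -> 0 < e ->
    \forall n \near \oo, C * u n <= e.
  move=> u0 e0; have : C * u n @[n --> \oo] --> (0 : R).
    by rewrite -[X in _ --> X](mulr0 C); apply: cvgM => //; exact: cvg_cst.
  move=> /cvgrPdist_le /(_ _ e0); apply: filterS => n.
  by rewrite sub0r normrN => /(le_trans (ler_norm _)).
pose w p := limn (fun n => phi n p).
have wE p : closure Om p -> phi n p @[n --> \oo] --> w p.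
  move=> cp; apply: cauchy_cvg; apply: cauchy_exP => e e0.
  have e4 : 0 < e / 4 by rewrite divr_gt0.
  have [N _ H] := small _ _ cphi e4.
  exists (phi N p); exists N => // n /= Nn; rewrite /ball /=.
  apply: le_lt_trans (est _ _ p cp (sphi _) (sphi _)) _; rewrite mulrDr.
  apply: (@le_lt_trans _ _ (e / 4 + e / 4)); last by lra.
  by apply: lerD; apply: H => //=.
have wd psi p : closure Om p -> smooth psi -> `|psi p - w p| <= C * normH2 (psi - v).
  move=> cp spsi; apply: (@ler_cvg_to nat \oo _ R (fun n => `|psi p - phi n p|)
     (fun n => C * (normH2 (psi - v) + normH2 (phi n - v)))).
  - by apply: cvg_norm; apply: cvgB; [exact: cvg_cst|exact: wE].
  - rewrite -[X in _ --> C * X]addr0; apply: cvgM; first exact: cvg_cst.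
    by apply: cvgD => //; exact: cvg_cst.
  - by apply: nearW => n; exact: est.
exists w; split.
- apply/subspace_continuousP => p cp; apply/cvgrPdist_le => e e0.
  have e3 : 0 < e / 3 by rewrite divr_gt0.
  have [n _ /(_ n (leqnn n)) hn] := small _ _ cphi e3.
  have := smooth_continuous (sphi n) => /(_ p) /cvgrPdist_le /(_ _ e3) hp.
  rewrite near_withinE; near=> y => cy.
  have -> : w p - w y = (phi n p - phi n y) - (phi n p - w p) + (phi n y - w y) by ring.
  apply: le_trans (ler_normD _ _) _; apply: (@le_trans _ _ (e / 3 + e / 3 + e / 3)); last by lra.
  apply: lerD; last exact: le_trans (wd _ _ cy (sphi n)) hn.
  apply: le_trans (ler_normB _ _) _; apply: lerD; last exact: le_trans (wd _ _ cp (sphi n)) hn.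
  by near: y.
- have mw : measurable_fun (Om : set pl) (w : pl -> R).
    apply: (@measurable_fun_cvg _ pl R Om phi).
      by move=> n; apply: measurable_funTS; apply: continuous_measurable2; exact: smooth_continuous.
    by move=> x Ox; apply: wE; exact: subset_closure.
  have hphi n : L2 Om (phi n) by exact: smooth_L2.
  have h1 : L2 Om (cst 1) by apply: (continuous_L2 oOm bOm); exact: cst_continuous.
  have md n : measurable_fun (Om : set pl) (fun x : pl => phi n x - w x).
    by apply: measurable_funB => //; exact: inLp2_measurable (hphi n).
  have hd n : L2 Om (fun x => phi n x - w x).
    apply: (L2_bounded mOm (domain_fin oOm bOm) (md n)) => x Ox.
    by apply: wd => //; exact: subset_closure.
  have hw : L2 Om w.
    apply: (inLp2_ae mOm mw (inLp2B mOm (hphi 0%N) (hd 0%N))).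
    by apply: aeW => x _; rewrite subKr.
  have hv2 : L2 Om v by case: hv => [[]].
  have H2L := semi_hilbert_L2 oOm.
  have hwv : L2 Om (w - v) := semi_hilbertB H2L hw hv2.
  suff : L2norm Om (w - v) = 0.
    move/(aeq_L2norm0 oOm hwv); apply: filterS => x /[apply].
    by rewrite -[(w - v) x]/(w x - v x) => /subr0_eq.
  apply/eqP; rewrite eq_le L2norm_ge0 andbT.
  pose A := C * L2norm Om (cst 1) + 1.
  apply: (@ler_cvg_to nat \oo _ R (fun=> L2norm Om (w - v)) (fun n => A * normH2 (phi n - v))).
  + exact: cvg_cst.
  + by rewrite -[X in _ --> X](mulr0 A); apply: cvgM => //; exact: cvg_cst.
  apply: nearW => n; have := ipnorm_dist H2L hw (hphi n) hv2; rewrite !L2_ipnorm.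
  move/le_trans; apply; rewrite /A mulrDl mul1r; apply: lerD; last exact: L2norm_le_H2.
  rewrite -L2_ipnorm (ipnormB H2L hw (hphi n)) L2_ipnorm.
  have N0 : 0 <= C * normH2 (phi n - v) by rewrite mulr_ge0 // ipnorm_ge0.
  rewrite mulrAC -[X in X * _](ger0_norm N0) -(Lpnorm2Z mOm _ h1).
  apply: (Lpnorm2_le mOm (hd n) (inLp2Z mOm _ h1)).
  apply: aeW => x Ox; rewrite mulr1 -[leLHS]real_normK ?num_real // ler_sqr ?nnegrE //.
  by apply: wd => //; exact: subset_closure.
- move=> psi spsi cpsi p cp; apply/cvgrPdist_le => e e0.
  have := small _ _ cpsi e0; apply: filterS => n hn; rewrite distrC.
  exact: le_trans (wd _ _ cp (spsi n)) hn.
Unshelve. all: by end_near. Qed.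

(** Near every point of the closure there is a box inside [Om], which has positive measure, so a
    strict difference at that point would persist on a non-null set. *)
Lemma within_continuous_eq w w' : {within closure Om, continuous w} ->
  {within closure Om, continuous w'} -> w = w' %[ae leb2 in Om] ->
  forall p, closure Om p -> w p = w' p.
Proof.
move=> /subspace_continuousP cw /subspace_continuousP cw' ww' p cp.
apply/eqP; rewrite -subr_eq0; apply/negPn/negP => n0.
have e0 : 0 < `|w p - w' p| by rewrite normr_gt0.
have cd : w y - w' y @[y --> within (closure Om) (nbhs p)] --> w p - w' p.
  by apply: cvgB; [exact: cw|exact: cw'].
have /cvgrPdist_lt /(_ _ e0) := cd; rewrite near_withinE => /nbhs_ballP[e /= e1 he].
have [q [Oq q1 q2]] := closure_near cp e1.
have oB : open (ball p e `&` Om) by apply: openI => //; exact: ball_open.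
have Bq : (ball p e `&` Om) q by split=> //; split; rewrite /ball /= distrC.
have [s s0 hs] := closed_box_sub oB Bq.
have [N [mN N0 sub]] := ww'.
have : (leb2 (box (q.1 - s) (q.1 + s) (q.2 - s) (q.2 + s) : set pl) <= 0)%E.
  rewrite -N0; apply: le_measure => //; rewrite ?inE //; first exact: measurable_box.
  move=> y /hs[By Oy]; apply: sub => /= /(_ Oy) E.
  have := he y By (subset_closure Oy); rewrite E subrr subr0.
  by rewrite ltxx.
by rewrite leb2_box ?lee_fin ?leNgt ?mulr_gt0 //; move: s0; lra.
Qed.

Lemma ptval_lim v (phi : nat -> pt -> R) p : H2 Om v -> (forall n, smooth (phi n)) ->
  normH2 (phi n - v) @[n --> \oo] --> 0 -> closure Om p ->
  phi n p @[n --> \oo] --> ptval Om v p.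
Proof.
move=> hv sphi cphi cp; have [w [cw wv lim]] := continuous_representative hv.
rewrite /ptval; set P := [set w : pt -> R | _].
have [P1 P2] : P (xget (cst 0) P) by apply: (@xgetPex _ (cst 0) P); exists w.
have -> : xget (cst 0) P p = w p; last exact: lim.
apply: within_continuous_eq => //.
exact: aeq_trans P2 (aeq_sym wv).
Qed.

End convex_domains.

(** * Boundary values and traces *)

Section boundary_behaviour.
Context {R : realType}.
Local Notation pt := (R * R)%type.
Local Notation mR := (measurableTypeR R).
Local Notation pl := (mR * mR)%type.
Implicit Types (f g v w phi psi : pt -> R) (i j : 'I_2) (x y p q z : pt).

Variable Om : set pt.
Hypothesis oOm : open Om.
Hypothesis bOm : exists L : R, forall x, Om x -> `|x.1| <= L /\ `|x.2| <= L.
Hypothesis cOm : forall x y (t : R), Om x -> Om y -> 0 <= t <= 1 -> Om ((1 - t) *: x + t *: y).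
Variables (x0 : pt) (r : R).
Hypothesis r0 : 0 < r.
Hypothesis boxr : box (x0.1 - r) (x0.1 + r) (x0.2 - r) (x0.2 + r) `<=` Om.
Local Notation mOm := (measurable_domain oOm).
Local Notation aeq := (ae_eq leb2 (Om : set pl)).

Local Notation sqbox z e := (box (z.1 - e) (z.1 + e) (z.2 - e) (z.2 + e) : set pl).

Lemma L2_sub (D D' : set pl) f : measurable D -> measurable D' -> D `<=` D' -> L2 D' f ->
  L2 D f /\ L2norm D f <= L2norm D' f.
Proof.
move=> mD mD' sub hf; have mf : measurable_fun D (f : pl -> R).
  exact: measurable_funS mD' sub (inLp2_measurable hf).
apply: inLp2_bound => //; last exact: L2norm_ge0.
rewrite -(integral_sqrE mD' hf); apply: ge0_subset_integral => //.
- by apply: measurable_sqr; exact: inLp2_measurable hf.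
- by move=> x _; rewrite lee_fin sqr_ge0.
Qed.

Lemma measurable_boxOm a b c e : measurable ((box a b c e : set pl) `&` (Om : set pl)).
Proof. by apply: measurableI; [exact: measurable_box|exact: mOm]. Qed.

Lemma L2norm_cst (D : set pl) (c k : R) : measurable D -> leb2 D = (k ^+ 2)%:E -> 0 <= k -> 0 <= c ->
  L2 D (cst c) /\ L2norm D (cst c) = c * k.
Proof.
move=> mD Dk k0 c0; have h : L2 D (cst c).
  by apply: (L2_bounded (C := c) mD) => //; rewrite ?Dk ?ltry // => x _; rewrite ger0_norm.
split=> //; apply/eqP; rewrite -(@eqrXn2 _ 2) ?L2norm_ge0 ?mulr_ge0 // -eqe.
rewrite -(integral_sqrE mD h) exprMn EFinM -Dk.
by apply/eqP; rewrite -[RHS](integral_cst leb2 mD); exact: eq_integral.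
Qed.

(** Absolute continuity of the integral: [g] is within [e / 2] of a smooth function in L^2, and the
    latter, being bounded near [z], has norm of the order of the side of the box. *)
Lemma small_box_L2norm g z (e : R) : L2 Om g -> 0 < e ->
  exists2 s : R, 0 < s & forall t, 0 < t <= s -> L2norm (sqbox z t `&` (Om : set pl)) g <= e.
Proof.
move=> hg e0; have e2 : 0 < e / 2 by rewrite divr_gt0.
have := mollify_cvg oOm bOm cOm r0 boxr hg.
move=> /cvgrPdist_le /(_ _ e2)[n _ /(_ n (leqnn n))].
rewrite sub0r normrN ger0_norm ?L2norm_ge0 //.
have sphi := mollify_smooth oOm bOm x0 r n hg; set phi := mollify _ _ _ _ _ in sphi * => hphi.
pose L := `|z.1| + `|z.2| + 1.
have [C hC] := continuous_bounded_box L (smooth_continuous sphi).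
exists (Num.min 1 (e / 4 / (`|C| + 1))).
  by rewrite lt_min ltr01 !divr_gt0 // ltr_wpDl.
move=> t /andP[t0]; rewrite le_min => /andP[t1 t2].
set D := sqbox z t `&` _; have mD : measurable D := measurable_boxOm _ _ _ _.
have DOm : D `<=` (Om : set pl) by move=> x [].
have hphi2 : L2 Om phi := smooth_L2 oOm bOm sphi.
have [h1 _] := L2_sub mD mOm DOm hphi2.
have [h2 _] := L2_sub mD mOm DOm hg.
have hd := inLp2B mOm hg hphi2; have [h3 h4] := L2_sub mD mOm DOm hd.
have -> : g = (fun x => (g x - phi x) + phi x) by apply/funext => x; rewrite subrK.
apply: le_trans (Lpnorm2D mD h3 h1) _; rewrite (splitr e); apply: lerD.
  apply: le_trans h4 _; apply: le_trans hphi; rewrite le_eqVlt; apply/orP; left; apply/eqP.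
  by rewrite -[RHS]L2_ipnorm (ipnormB (semi_hilbert_L2 oOm) hphi2 hg) L2_ipnorm.
have c0 : 0 <= (`|C| + 1) * (2 * t) by rewrite !mulr_ge0 ?addr_ge0 // ltW.
apply: (@le_trans _ _ ((`|C| + 1) * (2 * t))); last first.
  by move: t2; rewrite ler_pdivlMr ?ltr_wpDl // => t2; lra.
have mB : measurable (sqbox z t) by exact: measurable_box.
have finB : leb2 (sqbox z t) = ((2 * t) ^+ 2)%:E.
  by rewrite leb2_box; [congr EFin; ring|lra|lra].
have t2' : 0 <= 2 * t by rewrite mulr_ge0 // ltW.
have C1 : 0 <= `|C| + 1 by rewrite addr_ge0.
have [hc nc] := L2norm_cst mB finB t2' C1.
have DB : D `<=` sqbox z t by move=> x [].
have [hcD lD] := L2_sub mD mB DB hc; rewrite -nc; apply: le_trans lD.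
apply: (Lpnorm2_le mD h1 hcD); apply: aeW => x [[/= ]].
rewrite !in_itv /= => /andP[a1 a2] /andP[b1 b2] _.
rewrite -[leLHS]real_normK ?num_real // ler_sqr ?nnegrE //.
apply: (@le_trans _ _ C); last by apply: le_trans (ler_norm C) _; rewrite lerDl.
have z1 := ler_norm z.1; have z2 := ler_norm z.2.
have z3 := ler_norm (- z.1); have z4 := ler_norm (- z.2); rewrite !normrN in z3 z4.
have n1 := normr_ge0 z.1; have n2 := normr_ge0 z.2.
by apply: hC; split; rewrite /= in_itv /= /L; apply/andP; split; lra.
Qed.

(* Otherwise z would be a convex combination of the point reached and of a point
   of the box around x0. *)
Lemma leave_domain z y (t : R) : ~ Om z -> 0 < t -> sqbox z (t * r) y ->
  ~ Om (y + t *: (z - x0)).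
Proof.
move=> nz t0 [/= ]; rewrite !in_itv /= => /andP[a1 a2] /andP[b1 b2] Oq; apply: nz.
have t1 : 0 < 1 + t by rewrite addr_gt0.
have gen (a b c : R) : b - t * r <= a -> a <= b + t * r -> c - r <= c + t^-1 * (b - a) <= c + r.
  move=> h1 h2; have : `|t^-1 * (b - a)| <= r.
    rewrite normrM gtr0_norm ?invr_gt0 // ler_pdivrMl // ler_norml; apply/andP; split; lra.
  by rewrite ler_norml => /andP[? ?]; apply/andP; split; lra.
have Oy : Om (x0 + t^-1 *: (z - y)).
  by apply: boxr; split; rewrite /= in_itv; exact: gen.
have := cOm Oq Oy (t := t / (1 + t)).
have -> : (1 - t / (1 + t)) *: (y + t *: (z - x0)) + (t / (1 + t)) *: (x0 + t^-1 *: (z - y)) = z.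
  case: z {a1 a2 b1 b2 Oq Oy} => z1 z2; case: y => y1 y2; case: (x0) => c1 c2.
  by congr pair; rewrite /= /GRing.scale /=; field; rewrite !gt_eqF.
apply; rewrite divr_ge0 ?(ltW t0) ?(ltW t1) //= ler_pdivrMr // mul1r.
by rewrite lerDr.
Qed.

(* From every point near z, the ray in the direction z - x0 leaves Om within
   distance t M, and psi vanishes there. *)
Lemma boundary_poincare psi z (t M : R) : test_fun Om psi -> ~ Om z -> 0 < t ->
  `|z.1 - x0.1| <= M -> `|z.2 - x0.2| <= M ->
  L2norm (sqbox z (t * r) `&` (Om : set pl)) psi <= t * M *
   (L2norm (sqbox z (t * (r + M)) `&` (Om : set pl)) ('D_(Defs.basis ord0) psi)
    + L2norm (sqbox z (t * (r + M)) `&` (Om : set pl)) ('D_(Defs.basis ord_max) psi)).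
Proof.
move=> tpsi nz t0 M1 M2; have spsi := test_fun_smooth tpsi.
set K := sqbox z (t * r) `&` _; set K' := sqbox z (t * (r + M)) `&` _.
have mK : measurable K := measurable_boxOm _ _ _ _.
have mK' : measurable K' := measurable_boxOm _ _ _ _.
pose D i := 'D_(Defs.basis i) psi.
pose q : pt := t *: (z - x0).
have L2K f (A : set pl) : measurable A -> A `<=` (Om : set pl) -> continuous f -> L2 A f.
  by move=> mA sA cf; exact: (L2_sub mA mOm sA (continuous_L2 oOm bOm cf)).1.
have KO : K `<=` (Om : set pl) by move=> x [].
have KO' : K' `<=` (Om : set pl) by move=> x [].
have cpsi := smooth_continuous spsi.
have cD i : continuous (D i) := smooth_continuous (smoothD_i i spsi).
have hD i : L2 K' (D i) by exact: L2K.
pose g x := q.1 * D ord0 x + q.2 * D ord_max x.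
have cg : continuous g.
  by move=> x; apply: cvgD; (apply: cvgM; first exact: cvg_cst); exact: cD.
have hg : L2 K' g by exact: L2K.
apply: (@le_trans _ _ (L2norm K' g)); last first.
  apply: le_trans (Lpnorm2D mK' (inLp2Z mK' q.1 (hD ord0)) (inLp2Z mK' q.2 (hD ord_max))) _.
  rewrite (Lpnorm2Z mK' _ (hD ord0)) (Lpnorm2Z mK' _ (hD ord_max)) mulrDr.
  by apply: lerD; (apply: ler_wpM2r; first exact: L2norm_ge0);
    rewrite /q /= normrM gtr0_norm // ler_pM2l.
have mpsi : measurable_fun K (psi : pl -> R) := inLp2_measurable (L2K _ _ mK KO cpsi).
apply: (inLp2_bound mK mpsi _ (L2norm_ge0 _ _)).2.
rewrite -(integral_sqrE mK' hg).
pose G x := g x ^+ 2.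
have cG : continuous G by move=> x; apply: cvgM; exact: cg.
have G0 x : 0 <= G x by exact: sqr_ge0.
have mB : measurable (sqbox z (t * (r + M))) by exact: measurable_box.
(* The derivatives of [psi] vanish outside [Om], so the integral may be taken over the full box,
   into which the translated points fall even when they leave [Om]. *)
have -> : (\int[leb2]_(x in K') (g x ^+ 2)%:E = \int[leb2]_(x in sqbox z (t * (r + M))) (G x)%:E)%E.
  rewrite integral_mkcond [RHS]integral_mkcond; apply: eq_integral => x _; rewrite !patchE.
  case: ifPn => [|nx]; first by rewrite inE => -[Bx _]; rewrite mem_set.
  case: ifPn => // Bx.
  have D0 i : D i x = 0.
    apply: (test_fun_out (test_funD_i i tpsi)) => Ox.
    by move/negP: nx; apply; rewrite inE; split => //; rewrite inE in Bx.
  by rewrite /G /g !D0 !mulr0 addr0 expr0n.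
have sub y s : K y -> 0 <= s <= 1 -> 1 - 0 * s != 0 ->
    sqbox z (t * (r + M)) ((1 - 0 * s) *: (y : pt) + s *: q).
  move=> [[/= ]]; rewrite !in_itv /= => /andP[a1 a2] /andP[b1 b2] _ s01 _.
  have gen (a b c : R) : `|b - c| <= M -> b - t * r <= a -> a <= b + t * r ->
      b - t * (r + M) <= (1 - 0 * s) * a + s * (t * (b - c)) <= b + t * (r + M).
    rewrite ler_norml => /andP[h1 h2] h3 h4; case/andP: s01 => s0 s1.
    have h5 : `|s * (t * (b - c))| <= t * M.
      rewrite !normrM (ger0_norm s0) (gtr0_norm t0); apply: le_trans (ler_piMl _ s1) _.
        by rewrite mulr_ge0 // ltW.
      by rewrite ler_pM2l // ler_norml h1.
    by move: h5; rewrite ler_norml mulrDr => /andP[? ?]; apply/andP; split; lra.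
  by split; rewrite /= in_itv; apply: gen.
apply: le_trans (averaging cG G0 mK mB sub); apply: ge0_le_integral => //.
- by move=> y _; rewrite lee_fin sqr_ge0.
- exact: measurable_sqr.
- by apply: measurable_funTS; exact: measurable_average.
move=> y [By Oy].
have dh (s : R) : is_derive s 1 (fun s : R => psi (y + s *: q)) (g (y + s *: q)).
  exact: derive_chain_line (spsi 1%N).
have ch : continuous (fun s : R => g (y + s *: q)).
  move=> s; apply: (@continuous_comp _ _ _ (fun s : R => y + s *: q) g); last exact: cg.
  exact: line_continuous.
have i01 : 0 <= (1 : R) <= 1 by rewrite ler01 lexx.
have := sqr_increment_le dh ch i01.
rewrite scale1r scale0r addr0 (test_fun_out tpsi (leave_domain nz t0 By)) sub0r sqrrN.
move/le_trans; apply; rewrite /average le_eqVlt; apply/orP; left; apply/eqP.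
by apply: eq_integral => s _; rewrite mul0r subr0 scale1r expr1n mul1r.
Qed.

Lemma grad_dist_H1 v psi i : H1 Om v -> smooth psi ->
  L2norm Om (wD Om i v - 'D_(Defs.basis i) psi) <= ipnorm (ipH1 Om) (v - psi).
Proof.
move=> hv spsi; have hpsi := smooth_H1 oOm bOm spsi.
have H2L := semi_hilbert_L2 oOm.
have HL := sobolev_base_L2 oOm.
have hv' : sobolev_step Om (L2 Om) v by rewrite -H1E.
have hpsi' : sobolev_step Om (L2 Om) psi by rewrite -H1E.
have := wD_le_sobolev oOm HL (v - psi) i; rewrite (norm_wDB oOm bOm HL i hv' hpsi').
rewrite L2_ipnorm; congr (_ <= _); apply: (Lpnorm2_eq mOm).
- apply: (inLp2_measurable (mu := leb2)); apply: (semi_hilbertB H2L); exact: wD_L2.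
- apply: (inLp2_measurable (mu := leb2)); apply: (semi_hilbertB H2L).
    exact: wD_L2.
  exact: smoothD_L2.
have := wD_ae oOm bOm (is_wD_smooth oOm bOm i spsi).
apply: filterS => x /[apply] E.
by rewrite -[(wD Om i v - wD Om i psi) x]/(wD Om i v x - wD Om i psi x) E.
Qed.

(* If w z <> 0, the L^2 norm of v near z is at least of order t on boxes of side
   t, while approximation by test functions makes it o(t). *)
Lemma boundary_zero v w z : V Om v -> {within closure Om, continuous w} ->
  w = v %[ae leb2 in Om] -> closure Om z -> ~ Om z -> w z = 0.
Proof.
have half (X : R) : 0 < X -> X / 2 < X by move=> X0; lra.
have ballE (b0 u tr e : R) : b0 - tr <= u <= b0 + tr -> tr < e -> `|b0 - u| < e.
  by rewrite ltr_norml => /andP[? ?] ?; apply/andP; split; lra.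
move=> [hv2 [hv1 h10]] /subspace_continuousP cw wv cz nz; apply/eqP/negPn/negP => wz.
pose a := `|w z|; have a0 : 0 < a by rewrite normr_gt0.
have a2 : 0 < a / 2 by rewrite divr_gt0.
have hv : L2 Om v by case: hv1.
have /cvgrPdist_lt /(_ _ a2) := cw z cz; rewrite near_withinE => /nbhs_ballP[e1 /= e10 he1].
pose M := `|z.1 - x0.1| + `|z.2 - x0.2| + 1.
have M0 : 0 < M by rewrite ltr_wpDl // addr_ge0.
have M1 : `|z.1 - x0.1| <= M by rewrite /M -addrA lerDl addr_ge0.
have M2 : `|z.2 - x0.2| <= M by have := normr_ge0 (z.1 - x0.1); rewrite /M; lra.
have mvR i : L2 Om (wD Om i v) by exact: wD_L2.
have tri (D : set pl) f g : measurable D -> D `<=` (Om : set pl) -> L2 Om f -> L2 Om g ->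
    L2norm D f <= L2norm D g + L2norm Om (f - g).
  move=> mD DO hf hg; have H2L := semi_hilbert_L2 oOm.
  have hfg : L2 Om (f - g) := semi_hilbertB H2L hf hg.
  have [g1 _] := L2_sub mD mOm DO hg; have [fg1 fg2] := L2_sub mD mOm DO hfg.
  have -> : L2norm D f = L2norm D (fun x => g x + (f - g) x).
    by congr (L2norm D); apply/funext => x; rewrite -[(f - g) x]/(f x - g x) addrC subrK.
  by apply: le_trans (Lpnorm2D mD g1 fg1) _; rewrite lerD2l.
pose N i t := L2norm (sqbox z (t * (r + M)) `&` (Om : set pl)) (wD Om i v).
have upper t : 0 < t ->
    L2norm (sqbox z (t * r) `&` (Om : set pl)) v <= t * M * (N ord0 t + N ord_max t).
  move=> t0; apply/ler_addgt0Pr => e e0.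
  have tM : 0 < t * M by rewrite mulr_gt0.
  have k0 : 0 < 2 * (t * M) + 1 by rewrite ltr_wpDl // mulr_ge0 // ltW.
  have d0 : 0 < e / (2 * (t * M) + 1) by rewrite divr_gt0.
  have [psi tpsi] := h10 _ d0; have spsi := test_fun_smooth tpsi.
  have -> : v \- psi = v - psi by [].
  rewrite (H1normE oOm) => vpsi; set d := e / _ in d0 vpsi.
  have hpsi : L2 Om psi := smooth_L2 oOm bOm spsi.
  have sub s : (sqbox z s `&` (Om : set pl)) `<=` (Om : set pl) by move=> x [].
  have s1 := tri _ v psi (measurable_boxOm _ _ _ _) (sub (t * r)) hv hpsi.
  have s2 := boundary_poincare tpsi nz t0 M1 M2.
  have s3 i : L2norm (sqbox z (t * (r + M)) `&` (Om : set pl)) ('D_(Defs.basis i) psi) <= N i t + d.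
    have hD := smoothD_L2 oOm bOm i spsi.
    have H2L := semi_hilbert_L2 oOm.
    apply: le_trans (tri _ _ _ (measurable_boxOm _ _ _ _) (sub _) hD (mvR i)) _.
    rewrite lerD2l; apply: ltW; apply: le_lt_trans vpsi.
    apply: le_trans (grad_dist_H1 i hv1 spsi).
    by rewrite -!L2_ipnorm (ipnormB H2L hD (mvR i)).
  have s4 : L2norm Om (v - psi) <= d.
    apply: ltW; apply: le_lt_trans vpsi.
    exact: (L2norm_le_sobolev oOm (sobolev_base_L2 oOm)).
  have s5 : t * M * (L2norm (sqbox z (t * (r + M)) `&` (Om : set pl)) ('D_(Defs.basis ord0) psi)
    + L2norm (sqbox z (t * (r + M)) `&` (Om : set pl)) ('D_(Defs.basis ord_max) psi))
    <= t * M * (N ord0 t + d + (N ord_max t + d)).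
    by rewrite ler_pM2l //; apply: lerD; exact: s3.
  have dk : d * (2 * (t * M) + 1) = e by rewrite /d divfK // gt_eqF.
  apply: le_trans s1 _; apply: le_trans (lerD (le_trans s2 s5) s4) _.
  have ar (A B k : R) : k * (A + d + (B + d)) + d = k * (A + B) + d * (2 * k + 1) by ring.
  by rewrite -dk (ar (N ord0 t) (N ord_max t) (t * M)).
have lower t : 0 < t <= 1 -> t * r < e1 ->
    a * (t * r / (M + r)) * r <= L2norm (sqbox z (t * r) `&` (Om : set pl)) v.
  move=> /andP[t0 t1] te; have Mr : 0 < M + r by rewrite addr_gt0.
  (* The box about [c] is the image of the box about [x0] under the contraction by [s] towards [z],
     hence lies in [Om]; since [s * (M + r) = t * r] it also lies in the box about [z]. *)
  pose s := t * r / (M + r).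
  have s0 : 0 < s by rewrite divr_gt0 // mulr_gt0.
  have sMr : s * (M + r) = t * r by rewrite /s divfK // gt_eqF.
  have s1 : s <= 1.
    by rewrite /s ler_pdivrMr // mul1r; apply: (le_trans (ler_piMl (ltW r0) t1)); rewrite lerDr ltW.
  pose c : pt := (1 - s) *: z + s *: x0.
  have inB y : sqbox c (s * r) y -> sqbox z (t * r) y /\ Om y.
    move=> [/= ]; rewrite !in_itv /= /GRing.scale /= => /andP[y1 y2] /andP[y3 y4].
    have bd (u b0 b1 : R) : `|b0 - b1| <= M -> (1 - s) * b0 + s * b1 - s * r <= u ->
        u <= (1 - s) * b0 + s * b1 + s * r -> b0 - t * r <= u <= b0 + t * r.
      rewrite ler_norml => /andP[h1 h2] h3 h4; rewrite -sMr.
      have h5 : s * (b0 - b1) <= s * M by rewrite ler_pM2l.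
      have h6 : s * - M <= s * (b0 - b1) by rewrite ler_pM2l.
      by apply/andP; split; lra.
    split; first by split; rewrite /= in_itv; apply: bd; eauto.
    have -> : y = (1 - (1 - s)) *: (x0 + s^-1 *: (y - c)) + (1 - s) *: z.
      rewrite subKr scalerDr scalerA divff ?gt_eqF // scale1r /c.
      by rewrite addrAC [X in X + _]addrC addrC subrK.
    apply: closure_segment => //; last by lra.
    have bx (u c1 c0 : R) : c1 - s * r <= u -> u <= c1 + s * r ->
        c0 - r <= c0 + s^-1 * (u - c1) <= c0 + r.
      move=> h1 h2; have : `|s^-1 * (u - c1)| <= r.
        rewrite normrM gtr0_norm ?invr_gt0 // ler_pdivrMl // ler_norml; apply/andP; split; lra.
      by rewrite ler_norml => /andP[? ?]; apply/andP; split; lra.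
    by apply: boxr; split; rewrite /= in_itv; apply: bx.
  have mB : measurable (sqbox c (s * r)) by exact: measurable_box.
  have mK := measurable_boxOm (z.1 - t * r) (z.1 + t * r) (z.2 - t * r) (z.2 + t * r).
  have sr0 : 0 < s * r by rewrite mulr_gt0.
  have BK : sqbox c (s * r) `<=` (sqbox z (t * r) `&` (Om : set pl)) by move=> y /inB.
  have hK : L2 (sqbox z (t * r) `&` (Om : set pl)) v.
    by apply: (L2_sub mK mOm _ hv).1 => x [].
  have [hB le] := L2_sub mB mK BK hK; apply: le_trans le.
  have mB2 : leb2 (sqbox c (s * r)) = ((2 * (s * r)) ^+ 2)%:E.
    by rewrite leb2_box; [congr EFin; ring|lra|lra].
  have k0 : 0 <= 2 * (s * r) by rewrite mulr_ge0 // ltW.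
  have [hc nc] := L2norm_cst mB mB2 k0 (ltW a2).
  have -> : a * (t * r / (M + r)) * r = a / 2 * (2 * (s * r)) by rewrite /s; field; rewrite gt_eqF.
  rewrite -nc; apply: (Lpnorm2_le mB hc hB).
  have wv' : aeq w v := wv.
  apply: filterS wv' => y wy By; have [Ky Oy] := inB _ By.
  have zy : ball z e1 y.
    move: Ky => [/= ]; rewrite !in_itv /= => y1 y2.
    by split; [exact: (ballE _ _ _ _ y1 te)|exact: (ballE _ _ _ _ y2 te)].
  have := he1 y zy (subset_closure Oy); rewrite /from_subspace (wy Oy) => near.
  rewrite -[X in _ <= X]real_normK ?num_real // ler_sqr ?nnegrE ?(ltW a2) //.
  have := lerB_dist (w z) (w z - v y); rewrite subKr -/a; move: near.
  by move: `|w z - v y| `|v y| => *; rewrite /=; lra.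
have Mr : 0 < M + r by rewrite addr_gt0.
(* With this [d] the upper bound [t * M * (d + d)] is half of the lower bound. *)
pose d := a * r * r / (M + r) / (4 * M).
have d0 : 0 < d by rewrite !divr_gt0 ?mulr_gt0.
have [s0 s00 hs0] := small_box_L2norm z (mvR ord0) d0.
have [s1 s10 hs1] := small_box_L2norm z (mvR ord_max) d0.
have rM : 0 < r + M by rewrite addr_gt0.
pose t := Num.min (Num.min (s0 / (r + M)) (s1 / (r + M))) (Num.min 1 (e1 / (2 * r))).
have t0 : 0 < t by rewrite !lt_min !divr_gt0 ?mulr_gt0 ?ltr01.
have ts0 : t * (r + M) <= s0 by rewrite -ler_pdivlMr // !ge_min lexx.
have ts1 : t * (r + M) <= s1 by rewrite -ler_pdivlMr // !ge_min lexx orbT.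
have t1 : t <= 1 by rewrite !ge_min lexx !orbT.
have te : t * r < e1.
  have : t * (2 * r) <= e1 by rewrite -ler_pdivlMr ?mulr_gt0 // !ge_min lexx !orbT.
  by have := mulr_gt0 t0 r0; lra.
have tt : 0 < t <= 1 by rewrite t0.
have trM : 0 < t * (r + M) by rewrite mulr_gt0.
have n0 : N ord0 t <= d by apply: hs0; rewrite trM.
have n1 : N ord_max t <= d by apply: hs1; rewrite trM.
have := le_trans (lower t tt te) (upper t t0).
have tM : 0 < t * M by rewrite mulr_gt0.
have up : t * M * (N ord0 t + N ord_max t) <= t * M * (d + d).
  by apply: (ler_wpM2l (ltW tM)); exact: (lerD n0 n1).
move=> /le_trans /(_ up); rewrite leNgt => /negP; apply.
have -> : t * M * (d + d) = (a * (t * r / (M + r)) * r) / 2.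
  by rewrite /d; field; rewrite !gt_eqF.
by apply: half; rewrite !mulr_gt0 // ?invr_gt0.
Qed.

(* The contraction of the closure by t < 1 towards x0 lies in Om, whence
   t^2 |closure Om| <= |Om|. *)
Lemma closure_null : leb2 ((closure Om : set pl) `\` (Om : set pl)) = 0%E.
Proof.
have mC : measurable (closure Om : set pl) by apply: closed_measurable2; exact: closed_closure.
have [L hL] := bOm.
have finC : (leb2 (closure Om : set pl) < +oo)%E.
  by apply: (leb2_bounded_fin mC) => x cx; exact: closure_bounded hL cx.
have finO := domain_fin oOm bOm.
have OC : (Om : set pl) `<=` closure Om by exact: subset_closure.
have -> : leb2 ((closure Om : set pl) `\` (Om : set pl))
    = (leb2 (closure Om : set pl) - leb2 ((closure Om : set pl) `&` (Om : set pl)))%E.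
  by apply: measureD => //; exact: mOm.
have -> : (closure Om : set pl) `&` Om = Om by apply/setIidPr.
set mC' := leb2 _; set mO := leb2 _.
have fC : mC' \is a fin_num by rewrite ge0_fin_numE ?measure_ge0.
have fO : mO \is a fin_num by rewrite ge0_fin_numE ?measure_ge0.
have leOC : (mO <= mC')%E by apply: le_measure; rewrite ?inE //; exact: mOm.
have sc (t : R) : 0 < t < 1 -> t ^+ 2 * fine mC' <= fine mO.
  move=> /andP[t0 t1]; have tn : t != 0 by rewrite gt_eqF.
  have mI (A : set pl) : measurable A -> measurable_fun (setT : set pl) (EFin \o (\1_A : pl -> R)).
    by move=> mA; apply/measurable_EFinP; exact: measurable_indic.
  have := @ge0_integral_homothety R (EFin \o \1_(Om : set pl)) t ((1 - t) *: x0) (mI _ mOm).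
  have -> : (\int[leb2]_x (EFin \o \1_(Om : set pl)) x)%E = mO.
    by rewrite integral_indic ?setIT //; exact: mOm.
  move=> H; have {}H := H _ tn.
  have le : (mC' <= (t ^- 2)%:E * mO)%E.
    rewrite -H => [|x]; last by rewrite lee_fin indicE ler0n.
    have -> : mC' = (\int[leb2]_x (EFin \o \1_(closure Om : set pl)) x)%E.
      by rewrite integral_indic ?setIT.
    apply: ge0_le_integral => //.
    - by move=> x _; rewrite lee_fin indicE ler0n.
    - exact: mI.
    - by apply: (measurableT_comp (mI _ mOm)); exact: measurable_homothety.
    move=> x _; rewrite /= !indicE lee_fin.
    have [xC|] := boolP (x \in closure Om); last by rewrite ler0n.
    rewrite mem_set // addrC; rewrite inE in xC.
    have t01 : 0 <= t < 1 by rewrite ltW.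
    exact: (closure_segment oOm cOm (center_in r0 boxr) xC t01).
  move: le; rewrite -(fineK fC) -(fineK fO) -EFinM lee_fin => le.
  by rewrite mulrC -ler_pdivlMr ?exprn_gt0 // mulrC.
rewrite -(fineK fC) -(fineK fO) -EFinB; congr EFin; apply/eqP; rewrite subr_eq0 eq_le.
apply/andP; split; last by apply: fine_le.
have c0 : 0 <= fine mC' by apply: fine_ge0; exact: measure_ge0.
apply/ler_addgt0Pr => e e0; move: (fine mC') (fine mO) c0 sc => c o c0 sc.
(* Then [2 * c * d <= e], so the scaling by [t = 1 - d] gives [c - e <= (1 - d) ^ 2 * c <= o]. *)
pose d := Num.min (2^-1) (e / (2 * c + 1)).
have k0 : 0 < 2 * c + 1 by rewrite ltr_wpDl // mulr_ge0.
have d0 : 0 < d by rewrite lt_min invr_gt0 ltr0n divr_gt0.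
have d1 : d <= 2^-1 by rewrite ge_min lexx.
have d2 : d * (2 * c + 1) <= e by rewrite -ler_pdivlMr // ge_min lexx orbT.
have t01 : 0 < 1 - d < 1 by lra.
have := sc _ t01; nra.
Qed.
End boundary_behaviour.

(** * Traces on segments of the closure *)

Section traces.
Context {R : realType}.
Local Notation pt := (R * R)%type.
Local Notation leb := (@lebesgue_measure R).
Local Notation mR := (measurableTypeR R).
Local Notation pl := (mR * mR)%type.
Implicit Types (f g v w phi psi : pt -> R) (i j : 'I_2) (x y p q z : pt).

Variable Om : set pt.
Hypothesis oOm : open Om.
Hypothesis bOm : exists L : R, forall x, Om x -> `|x.1| <= L /\ `|x.2| <= L.
Hypothesis cOm : forall x y (t : R), Om x -> Om y -> 0 <= t <= 1 -> Om ((1 - t) *: x + t *: y).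
Variables (x0 : pt) (r : R).
Hypothesis r0 : 0 < r.
Hypothesis boxr : box (x0.1 - r) (x0.1 + r) (x0.2 - r) (x0.2 + r) `<=` Om.
Local Notation mOm := (measurable_domain oOm).

Local Notation I01 := (`[0%R, 1%R]%classic : set mR).

Lemma leb_I01 : leb I01 = 1%E.
Proof. by rewrite lebesgue_measure_itv /= lte_fin ltr01 oppr0 adde0. Qed.

Lemma closure_convex p q (t : R) : closure Om p -> closure Om q -> 0 <= t <= 1 ->
  closure Om ((1 - t) *: p + t *: q).
Proof.
move=> cp cq /andP[t0 t1] A /nbhs_ballP[e /= e0 he].
have [p' [Op p1 p2]] := closure_near cp e0; have [q' [Oq q1 q2]] := closure_near cq e0.
exists ((1 - t) *: p' + t *: q'); split; first by apply: cOm => //; rewrite t0.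
apply: he.
have gen (a b a' b' : R) : `|a' - a| < e -> `|b' - b| < e ->
    `|(1 - t) * a + t * b - ((1 - t) * a' + t * b')| < e.
  move=> h1 h2; have -> : (1 - t) * a + t * b - ((1 - t) * a' + t * b')
      = - ((1 - t) * (a' - a) + t * (b' - b)) by ring.
  rewrite normrN; apply: le_lt_trans (ler_normD _ _) _.
  rewrite !normrM (ger0_norm t0) (ger0_norm (_ : 0 <= 1 - t)); last by lra.
  move: h1 h2; move: `|a' - a| `|b' - b| => x y xe ye.
  by case: (leP t 2^-1) => [|/ltW] t2; nra.
by split; rewrite /ball /=; exact: gen.
Qed.

Lemma integral_closure (G : pt -> R) : continuous G -> (forall x, 0 <= G x) ->
  (\int[leb2]_(x in (closure Om : set pl)) (G x)%:E = \int[leb2]_(x in Om) (G x)%:E)%E.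
Proof.
move=> cG G0; have mC : measurable (closure Om : set pl).
  by apply: closed_measurable2; exact: closed_closure.
have mD : measurable (Om : set pl) := mOm.
have OC : (Om : set pl) `<=` closure Om by exact: subset_closure.
have mG (A : set pl) : measurable_fun A (EFin \o (G : pl -> R)).
  by apply: measurable_funTS; apply/measurable_EFinP; exact: continuous_measurable2.
rewrite -[X in (\int[leb2]_(x in X) _ = _)%E](setDUK OC) ge0_integral_setU //.
- rewrite [X in (_ + X)%E](_ : _ = 0)%E ?adde0 //; apply: null_set_integral.
  + exact: measurableD.
  + exact: mG.
  + exact: (closure_null oOm bOm cOm r0 boxr).
- exact: measurableD.
- by move=> x _; rewrite lee_fin.
- by apply/disj_setPS => x [? []].
Qed.

(* The fundamental theorem of calculus along e, integrated over the
   parallelogram spanned by a and e. *)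
Lemma half_trace p a e g : smooth g -> det2 a e != 0 ->
  (forall t s : R, 0 <= t <= 1 -> 0 <= s <= 1 -> closure Om (p + t *: a + s *: e)) ->
  (\int[leb]_(t in I01) (g (p + t *: a)%R ^+ 2)%:E <= (`|det2 a e|^-1)%:E * \int[leb2]_(x in Om)
     (2 * (g x ^+ 2 + (e.1 * 'D_(Defs.basis ord0) g x + e.2 * 'D_(Defs.basis ord_max) g x) ^+ 2))%:E)%E.
Proof.
move=> sg dae sub; pose D x := e.1 * 'D_(Defs.basis ord0) g x + e.2 * 'D_(Defs.basis ord_max) g x.
have cg := smooth_continuous sg.
have cD : continuous D.
  by move=> x; apply: cvgD; (apply: cvgM; first exact: cvg_cst);
    exact: (smooth_continuous (smoothD_i _ sg)).
pose G x := 2 * (g x ^+ 2 + D x ^+ 2).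
have cG : continuous G.
  by move=> x; apply: cvgM; [exact: cvg_cst|apply: cvgD; apply: cvgM; [exact: cg|exact: cg|exact: cD|exact: cD]].
have G0 x : 0 <= G x by rewrite mulr_ge0 // addr_ge0 ?sqr_ge0.
have cl (f : pt -> R) (b : pt) : continuous f -> continuous (fun s : R => f (b + s *: e)).
  move=> cf s; apply: (@continuous_comp _ _ _ (fun s : R => b + s *: e) f); last exact: cf.
  exact: line_continuous.
have m1 (f : R -> R) : continuous f -> measurable_fun I01 (EFin \o (f : mR -> R)).
  by move=> cf; apply: measurable_funTS; apply/measurable_EFinP; exact: continuous_measurable1.
have mI : measurable I01 by [].
(* [g] at the base point is its value at [p + t *: a + s *: e] minus an increment, whose square the
   integral of [D ^ 2] bounds; then average over [s]. *)
have pw t : ((g (p + t *: a) ^+ 2)%:E <= \int[leb]_(s in I01) (G (p + t *: a + s *: e)%R)%:E)%E.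
  set b := p + t *: a.
  have dh (s : R) : is_derive s 1 (fun s : R => g (b + s *: e)) (D (b + s *: e)).
    exact: derive_chain_line (sg 1%N).
  set J := (\int[leb]_(s in I01) (D (b + s *: e)%R ^+ 2)%:E)%E.
  have inc (s : R) : 0 <= s <= 1 -> (((g (b + s *: e) - g b) ^+ 2)%:E <= J)%E.
    by move=> s01; have := sqr_increment_le dh (cl _ b cD) s01; rewrite scale0r addr0.
  have J0 : (0 <= J)%E by apply: integral_ge0 => s _; rewrite lee_fin sqr_ge0.
  have c1 := cl _ b cg; have c2 := cl _ b cD.
  have mg2 : measurable_fun I01 (fun s : mR => (g (b + s *: e) ^+ 2)%:E).
    by apply: (m1 (fun s : R => g (b + s *: e) ^+ 2)) => s; apply: cvgM; exact: c1.
  have mD2 : measurable_fun I01 (fun s : mR => (D (b + s *: e) ^+ 2)%:E).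
    by apply: (m1 (fun s : R => D (b + s *: e) ^+ 2)) => s; apply: cvgM; exact: c2.
  have E : (\int[leb]_(s in I01) (G (b + s *: e)%R)%:E
      = \int[leb]_(s in I01) ((2%:E * (g (b + s *: e)%R ^+ 2)%:E) + cst (2%:E * J) s))%E.
    rewrite ge0_integralD //; last 3 first.
    - by move=> s _; rewrite -EFinM lee_fin mulr_ge0 ?sqr_ge0.
    - by apply: emeasurable_funM.
    - by move=> s _; rewrite mule_ge0.
    rewrite integral_cst // [X in (_ + _ * X)%E]leb_I01 mule1 /J -ge0_integralZl //; last first.
    - by move=> s _; rewrite lee_fin sqr_ge0.
    rewrite -ge0_integralD //; last 4 first.
    - by move=> s _; rewrite -EFinM lee_fin mulr_ge0 ?sqr_ge0.
    - by apply: emeasurable_funM.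
    - by move=> s _; rewrite -EFinM lee_fin mulr_ge0 ?sqr_ge0.
    - by apply: emeasurable_funM.
    by apply: eq_integral => s _; rewrite -!EFinM -EFinD /G mulrDr.
  rewrite E.
  have -> : ((g b ^+ 2)%:E = \int[leb]_(s in I01) (cst (g b ^+ 2)%:E s))%E.
    by rewrite integral_cst // [X in (_ * X)%E]leb_I01 mule1.
  apply: ge0_le_integral => //.
  - by move=> s _; rewrite lee_fin sqr_ge0.
  - by apply: emeasurable_funD => //; apply: emeasurable_funM.
  move=> s; rewrite /= in_itv /= => s01; have := inc s s01.
  move: (J) J0 => [j|_ _|//]; last by rewrite mulry gtr0_sg // mul1e addey // leey.
  rewrite -!EFinM -EFinD !lee_fin => j0.
  by have := sqr_ge0 (2 * g (b + s *: e) - g b); move: (g b) (g (b + s *: e)) => u v; nra.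
have mGc : measurable_fun (setT : set pl) ((EFin \o (G : pl -> R)) \_ (closure Om)).
  have mC : measurable (closure Om : set pl) by apply: closed_measurable2; exact: closed_closure.
  apply/(measurable_restrictT _ mC); apply: measurable_funTS.
  by apply/measurable_EFinP; exact: continuous_measurable2.
have Gc0 x : (0 <= ((EFin \o (G : pl -> R)) \_ (closure Om)) x)%E.
  by rewrite patchE; case: ifP; rewrite ?lee_fin.
have := ge0_integral_parallelogram p mGc Gc0 dae.
have -> : (\int[leb2]_x ((EFin \o (G : pl -> R)) \_ (closure Om)) x = \int[leb2]_(x in Om) (G x)%:E)%E.
  by rewrite -integral_mkcond integral_closure.
move=> <-; rewrite integral_mkcond; apply: ge0_le_integral => //.
- by move=> t _; rewrite patchE; case: ifP => // _; rewrite lee_fin sqr_ge0.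
- apply/(measurable_restrictT _ mI); apply: (m1 (fun t : R => g (p + t *: a) ^+ 2)) => t.
  have c (t' : R) : (g \o (fun t : R => p + t *: a)) x @[x --> t'] --> (g \o (fun t : R => p + t *: a)) t'.
    by apply: continuous_comp; [exact: line_continuous|exact: cg].
  by apply: cvgM; exact: c.
- apply: (@measurable_fun_fubini_tonelli_F _ _ mR mR R leb
     (fun z : mR * mR => ((EFin \o (G : pl -> R)) \_ (closure Om)) (p + z.1 *: a + z.2 *: e)%R)) => //.
  by apply: (measurableT_comp mGc); exact: measurable_pair_affine.
move=> t _; rewrite patchE; case: ifPn => tI; last by apply: integral_ge0.
apply: le_trans (pw t) _; rewrite integral_mkcond; apply: ge0_le_integral => //.
- by move=> s _; rewrite patchE; case: ifP => // _; rewrite lee_fin.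
- apply/(measurable_restrictT _ mI); apply: (m1 (fun s : R => G (p + t *: a + s *: e))).
  exact: cl.
- apply: (measurableT_comp mGc).
  apply: (@measurable_fun_pair _ _ _ mR mR mR (fun s : R => p.1 + t * a.1 + s * e.1)
    (fun s : R => p.2 + t * a.2 + s * e.2)); apply: continuous_measurable1 => s;
  by apply: cvgD; [exact: cvg_cst|apply: cvgM; [exact: cvg_id|exact: cvg_cst]].
move=> s _; rewrite patchE; case: ifPn => sI; last exact: Gc0.
rewrite patchE mem_set //; apply: sub.
- by move: tI; rewrite inE /= in_itv.
- by move: sI; rewrite inE /= in_itv.
Qed.

Lemma half_trace_norm p a e : det2 a e != 0 ->
  (forall t s : R, 0 <= t <= 1 -> 0 <= s <= 1 -> closure Om (p + t *: a + s *: e)) ->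
  exists2 C : R, 0 <= C & forall g, smooth g ->
    (\int[leb]_(t in I01) (g (p + t *: a)%R ^+ 2)%:E <= (C * ipnorm (ipH1 Om) g ^+ 2)%:E)%E.
Proof.
move=> dae sub; set M := 2 * (1 + 2 * e.1 ^+ 2 + 2 * e.2 ^+ 2).
have M0 : 0 <= M by have := sqr_ge0 e.1; have := sqr_ge0 e.2; rewrite /M; lra.
have d0 : 0 <= `|det2 a e|^-1 by rewrite invr_ge0.
exists (`|det2 a e|^-1 * M) => [|g sg]; first exact: mulr_ge0.
apply: le_trans (half_trace sg dae sub) _.
rewrite -mulrA EFinM lee_wpmul2l ?lee_fin //.
have mD : measurable (Om : set pl) := mOm.
have hg := smooth_L2 oOm bOm sg.
have cg := smooth_continuous sg.
have cD i : continuous ('D_(Defs.basis i) g) by exact: (smooth_continuous (smoothD_i _ sg)).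
have ms (f : pt -> R) : continuous f -> measurable_fun (Om : set pl) (fun x : pl => (f x ^+ 2)%:E).
  move=> cf; apply/measurable_EFinP; apply: measurable_funTS; apply: (@continuous_measurable2 R (fun x => f x ^+ 2)).
  by move=> x; apply: cvgM; exact: cf.
have cG : continuous (grad_sqr g) by exact: grad_sqr_continuous.
rewrite EFinM; have -> : (ipnorm (ipH1 Om) g ^+ 2)%:E
    = (\int[leb2]_(x in Om) (g x ^+ 2 + grad_sqr g x)%:E)%E.
  rewrite (normH1_smooth oOm bOm sg) EFinD -(integral_grad_sqr oOm bOm sg) -(integral_sqrE mD hg).
  rewrite -ge0_integralD //.
  - by move=> x _; rewrite lee_fin sqr_ge0.
  - exact: ms.
  - by move=> x _; rewrite lee_fin grad_sqr_ge0.
  - by apply/measurable_EFinP; apply: measurable_funTS; exact: continuous_measurable2.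
have cS : continuous (fun x => g x ^+ 2 + grad_sqr g x).
  by move=> x; apply: cvgD; [apply: cvgM; exact: cg|exact: cG].
have S0 x : 0 <= g x ^+ 2 + grad_sqr g x by rewrite addr_ge0 ?sqr_ge0 ?grad_sqr_ge0.
rewrite -ge0_integralZl //; last 2 first.
- by apply/measurable_EFinP; apply: measurable_funTS; exact: continuous_measurable2.
- by move=> x _; rewrite lee_fin.
apply: ge0_le_integral => //.
- by move=> x _; rewrite lee_fin mulr_ge0 // addr_ge0 ?sqr_ge0.
- apply/measurable_EFinP; apply: measurable_funTS; apply: continuous_measurable2 => x.
  apply: cvgM; first exact: cvg_cst.
  apply: cvgD; apply: cvgM; try exact: cg.
    by apply: cvgD; (apply: cvgM; first exact: cvg_cst); exact: cD.
  by apply: cvgD; (apply: cvgM; first exact: cvg_cst); exact: cD.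
- apply: emeasurable_funM => //.
  by apply/measurable_EFinP; apply: measurable_funTS; exact: continuous_measurable2.
move=> x _; rewrite -EFinM lee_fin /M /grad_sqr sum2E.
move: (g x) ('D_(Defs.basis ord0) g x) ('D_(Defs.basis ord_max) g x) => u v w.
have k : (e.1 * v + e.2 * w) ^+ 2 <= (2 * e.1 ^+ 2 + 2 * e.2 ^+ 2) * (v ^+ 2 + w ^+ 2).
  have := sqr_ge0 (e.1 * v - e.2 * w); have := sqr_ge0 (e.1 * w); have := sqr_ge0 (e.2 * v).
  by rewrite !exprMn !expr2 => *; lra.
have := sqr_ge0 (e.1 * u); have := sqr_ge0 (e.2 * u); have := sqr_ge0 v; have := sqr_ge0 w.
by rewrite !exprMn => *; lra.
Qed.

Lemma ge0_integral_halves (f : R -> R) : continuous f -> (forall t, 0 <= f t) ->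
  (\int[leb]_(t in I01) (f t)%:E <= 2^-1%:E * \int[leb]_(t in I01) (f (2^-1 * t)%R)%:E
    + 2^-1%:E * \int[leb]_(t in I01) (f (- 2^-1 * t + 1)%R)%:E)%E.
Proof.
move=> cf f0; have half (a b c e : R) : a != 0 -> c <= e ->
    (forall t, 0 <= t <= 1 = (c <= a * t + b <= e)) ->
    (\int[leb]_(t in (`[c, e]%classic : set mR)) (f t)%:E
     = `|a|%:E * \int[leb]_(t in I01) (f (a * t + b)%R)%:E)%E.
  move=> a0 ce E; have mf : measurable_fun (setT : set mR) ((EFin \o (f : mR -> R)) \_ `[c, e]).
    apply/(measurable_restrictT _ (measurable_itv _)); apply: measurable_funTS.
    by apply/measurable_EFinP; exact: continuous_measurable1.
  have fe0 (t : R) : (0 <= ((EFin \o (f : mR -> R)) \_ `[c, e]) t)%E.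
    by rewrite patchE; case: ifP => _ //; rewrite lee_fin.
  rewrite [in RHS]integral_mkcond.
  have -> : (((fun t : mR => (f (a * t + b)%R)%:E) \_ I01)
     = (fun t : mR => ((EFin \o (f : mR -> R)) \_ `[c, e]) (a * t + b)%R)).
    apply/funext => t; rewrite !patchE /=; congr (if _ then _ else _).
    by apply/idP/idP; rewrite !inE /= !in_itv /= E.
  rewrite (ge0_integral_affine1 _ a0 mf fe0) muleA -EFinM divff ?normr_eq0 // mul1e.
  by rewrite [LHS]integral_mkcond.
have e1 : 2^-1 = `|2^-1| :> R by rewrite gtr0_norm.
have e2 : 2^-1 = `|- 2^-1| :> R by rewrite normrN gtr0_norm.
have h1 := half 2^-1 0 0 2^-1; have h2 := half (- 2^-1) 1 2^-1 1.
have -> : (2^-1%:E * \int[leb]_(t in I01) (f (2^-1 * t)%R)%:E)%E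
    = (\int[leb]_(t in (`[0%R, 2^-1%R]%classic : set mR)) (f t)%:E)%E.
  rewrite h1 //; first by rewrite -e1; congr (_ * _)%E; apply: eq_integral => t _; rewrite addr0.
  by move=> t; apply/idP/idP => /andP[? ?]; apply/andP; split; lra.
have -> : (2^-1%:E * \int[leb]_(t in I01) (f (- 2^-1 * t + 1)%R)%:E)%E
    = (\int[leb]_(t in (`[2^-1%R, 1%R]%classic : set mR)) (f t)%:E)%E.
  rewrite h2 ?oppr_eq0 //; first by rewrite -e2.
    by lra.
  by move=> t; apply/idP/idP => /andP[? ?]; apply/andP; split; lra.
have mf (A : set mR) : measurable_fun A (EFin \o (f : mR -> R)).
  by apply: measurable_funTS; apply/measurable_EFinP; exact: continuous_measurable1.
have -> : I01 = (`[0%R, 2^-1%R[%classic : set mR) `|` (`[2^-1%R, 1%R]%classic : set mR).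
  apply/seteqP; split=> t; rewrite /= !in_itv /=.
    by move=> /andP[? ?]; case: (ltP t 2^-1) => ?; [left|right]; apply/andP; split; lra.
  by case=> /andP[? ?]; apply/andP; split; lra.
rewrite ge0_integral_setU //.
- apply: leeD => //; apply: ge0_subset_integral => //.
  + by move=> t _; rewrite lee_fin.
  + by move=> t; rewrite /= !in_itv /= => /andP[-> /ltW].
- by move=> t _; rewrite lee_fin.
- by apply/disj_setPS => t [/=]; rewrite !in_itv /= => /andP[_ h1' /andP[h2' _]]; lra.
Qed.

(** The points [x0], [x0 + (r, 0)] and [x0 + (0, r)] are not collinear, so one of them is off the
    line through [p] and [q]. *)
Lemma off_line p q : p != q -> exists2 x, Om x & det2 (q - p) (x - p) != 0.
Proof.
move=> pq; have h (y : pt) : `|y.1| <= r -> `|y.2| <= r -> Om (x0 + y).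
  rewrite !ler_norml => /andP[? ?] /andP[? ?].
  by apply: boxr; split; rewrite /= in_itv /=; apply/andP; split; lra.
have rr : `|r| <= r by rewrite gtr0_norm.
have r1 : `|0 : R| <= r by rewrite normr0 ltW.
case: (eqVneq (det2 (q - p) (x0 - p)) 0) => [d0|]; last by exists x0 => //; exact: (center_in r0 boxr).
case: (eqVneq (det2 (q - p) (x0 + (r, 0) - p)) 0) => [d1|]; last by exists (x0 + (r, 0)) => //; apply: h.
case: (eqVneq (det2 (q - p) (x0 + (0, r) - p)) 0) => [d2|]; last by exists (x0 + (0, r)) => //; apply: h.
move: d0 d1 d2; rewrite /det2 /= => d0 d1 d2; case/negP: pq; apply/eqP.
have e2 : r * (q.2 - p.2) = 0 by lra.
have e1 : r * (q.1 - p.1) = 0 by lra.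
move/eqP: e1; rewrite mulf_eq0 gt_eqF // subr_eq0 => /eqP e1.
move/eqP: e2; rewrite mulf_eq0 gt_eqF // subr_eq0 => /eqP e2.
by rewrite (surjective_pairing p) (surjective_pairing q) e1 e2.
Qed.

(* Each half of the segment is a side of a parallelogram contained in the
   closure of Om. *)
Lemma segment_trace p q : closure Om p -> closure Om q -> p != q ->
  exists2 C : R, 0 <= C & forall g, smooth g ->
    inLp leb 2%:E I01 (g \o seg_at (p, q)) /\
    Lpnorm leb 2%:E I01 (g \o seg_at (p, q)) <= C * ipnorm (ipH1 Om) g.
Proof.
move=> cp cq pq; have [x1 Ox1 dx] := off_line pq.
have cx1 : closure Om x1 by exact: subset_closure.
have side (a b : pt) : closure Om a -> closure Om b -> det2 (b - a) (x1 - a) != 0 ->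
    exists2 C : R, 0 <= C & forall g, smooth g ->
    (\int[leb]_(t in I01) (g (a + t *: (2^-1 *: (b - a)))%R ^+ 2)%:E
      <= (C * ipnorm (ipH1 Om) g ^+ 2)%:E)%E.
  move=> ca cb dd; apply: (@half_trace_norm _ _ (2^-1 *: (x1 - a))).
    have -> : det2 (2^-1 *: (b - a)) (2^-1 *: (x1 - a)) = 4^-1 * det2 (b - a) (x1 - a).
      by rewrite /det2 /= /GRing.scale /=; field.
    by rewrite mulf_neq0.
  move=> t s /andP[t0 t1] /andP[s0 s1].
  have c1 : closure Om ((1 - 2^-1) *: x1 + 2^-1 *: a) by apply: closure_convex => //; lra.
  have c2 : closure Om ((1 - 2^-1) *: b + 2^-1 *: a) by apply: closure_convex => //; lra.
  have c3 : closure Om ((1 - t) *: a + t *: b) by apply: closure_convex => //; rewrite t0.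
  have c4 : closure Om ((1 - s) *: a + s *: x1) by apply: closure_convex => //; rewrite s0.
  (* Halving both sides makes each point of the parallelogram the midpoint of a point between [a]
     and [b] and a point between [a] and [x1]. *)
  have -> : a + t *: (2^-1 *: (b - a)) + s *: (2^-1 *: (x1 - a))
      = (1 - 2^-1) *: ((1 - t) *: a + t *: b) + 2^-1 *: ((1 - s) *: a + s *: x1).
    by rewrite [LHS]surjective_pairing [RHS]surjective_pairing /= /GRing.scale /=; congr pair; field.
  by apply: closure_convex => //; lra.
have [C1 C10 h1] := side p q cp cq dx.
have dx' : det2 (p - q) (x1 - q) != 0.
  by rewrite (_ : det2 _ _ = - det2 (q - p) (x1 - p)) ?oppr_eq0 // /det2 /=; ring.
have [C2 C20 h2] := side q p cq cp dx'.
exists (Num.sqrt (2^-1 * C1 + 2^-1 * C2)) => [|g sg]; first by rewrite sqrtr_ge0.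
have cg : continuous (fun t : R => g (p + t *: (q - p))).
  move=> t; apply: (@continuous_comp _ _ _ (fun t : R => p + t *: (q - p)) g); first exact: line_continuous.
  exact: (smooth_continuous sg).
have mg : measurable_fun I01 ((g \o seg_at (p, q)) : mR -> R).
  by apply: measurable_funTS; exact: (continuous_measurable1 cg).
have n0 : 0 <= ipnorm (ipH1 Om) g by exact: ipnorm_ge0.
apply: inLp2_bound => //; last by apply: mulr_ge0; [exact: sqrtr_ge0|].
rewrite exprMn sqr_sqrtr; last by rewrite addr_ge0 ?mulr_ge0.
have := @ge0_integral_halves (fun t => g (p + t *: (q - p)) ^+ 2) _ (fun t => sqr_ge0 _).
move=> h; apply: le_trans (h _) _; first by move=> t; apply: cvgM; exact: cg.
rewrite mulrDl EFinD -!mulrA; apply: leeD; rewrite EFinM lee_wpmul2l ?lee_fin //.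
  apply: le_trans (h1 g sg); rewrite le_eqVlt; apply/orP; left; apply/eqP.
  by apply: eq_integral => t _; rewrite scalerA mulrC.
apply: le_trans (h2 g sg); rewrite le_eqVlt; apply/orP; left; apply/eqP.
apply: eq_integral => t _; congr ((g _ ^+ 2)%:E).
by rewrite [LHS]surjective_pairing [RHS]surjective_pairing /= /GRing.scale /=; congr pair; field.
Qed.
End traces.

(** * Triangulations *)

Lemma ipnorm_cvg {R : realType} {E : lmodType R} (ip : E -> E -> R) (P : set E) (u : nat -> E) (l : E) :
  semi_hilbert ip P -> (forall n, P (u n)) -> P l ->
  ipnorm ip (u n - l) @[n --> \oo] --> 0 -> ipnorm ip (u n) @[n --> \oo] --> ipnorm ip l.
Proof.
move=> HP Pu Pl ul; apply/cvgrPdist_le => e e0.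
have /cvgrPdist_le/(_ e e0) := ul; apply: filterS => n.
rewrite sub0r normrN ger0_norm ?ipnorm_ge0 // => h; apply: le_trans h.
have h1 := ipnormD HP (semi_hilbertB HP (Pu n) Pl) Pl; rewrite subrK in h1.
have h2 := ipnormD HP (semi_hilbertB HP Pl (Pu n)) (Pu n); rewrite subrK (ipnormB HP) // in h2.
by rewrite ler_norml; apply/andP; split; lra.
Qed.

Lemma cvg_sum0 {R : realType} {I : eqType} (s : seq I) (f : nat -> I -> R) :
  (forall i, i \in s -> f n i @[n --> \oo] --> 0) -> \sum_(i <- s) f n i @[n --> \oo] --> 0.
Proof.
elim: s => [_|i s IH h]; first by under eq_fun do rewrite big_nil; exact: cvg_cst.
under eq_fun do rewrite big_cons.
have hs : \sum_(j <- s) f n j @[n --> \oo] --> 0.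
  by apply: IH => j js; apply: h; rewrite inE js orbT.
have E : 0 = 0 + 0 :> R by rewrite addr0.
by have := cvgD (h i (mem_head i s)) hs; rewrite -E; apply.
Qed.

(** * Convex hulls, triangles and null sets *)

Section hulls.
Context {R : realType}.
Local Notation pt := (R * R)%type.
Local Notation leb := (@lebesgue_measure R).
Local Notation mR := (measurableTypeR R).
Local Notation pl := (mR * mR)%type.
Implicit Types (x y p q : pt) (s : seq pt).

Lemma pair_eq x y : x.1 = y.1 -> x.2 = y.2 -> x = y.
Proof. by case: x y => [x1 x2] [y1 y2] /= -> ->. Qed.

Lemma fst_sum n (F : 'I_n -> pt) : (\sum_i F i).1 = \sum_i (F i).1.
Proof. exact: big_morph. Qed.

Lemma snd_sum n (F : 'I_n -> pt) : (\sum_i F i).2 = \sum_i (F i).2.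
Proof. exact: big_morph. Qed.

Lemma hull_convex s x y (t : R) : hull s x -> hull s y -> 0 <= t <= 1 ->
  hull s ((1 - t) *: x + t *: y).
Proof.
move=> [w [w0 w1 ->]] [w' [w0' w1' ->]] /andP[t0 t1].
exists (fun i => (1 - t) * w i + t * w' i); split.
- by move=> i; rewrite addr_ge0 // mulr_ge0 // subr_ge0.
- by rewrite big_split /= -!mulr_sumr w1 w1' !mulr1 subrK.
by apply: pair_eq; rewrite /= /GRing.scale /= ?(fst_sum, snd_sum) !mulr_sumr -big_split /=;
  apply: eq_bigr => i _; rewrite /GRing.scale /=; ring.
Qed.

Lemma hull_mem s p : p \in s -> hull s p.
Proof.
move=> ps; have lt : (index p s < size s)%N by rewrite index_mem.
pose k := Ordinal lt; exists (fun i => (i == k)%:R); split.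
- by move=> i; rewrite ler0n.
- by rewrite (bigD1 k) //= eqxx big1 ?addr0 // => i /negPf->.
rewrite (bigD1 k) //= eqxx scale1r nth_index // big1 ?addr0 // => i /negPf->.
by rewrite scale0r.
Qed.

Lemma hull_bounded s : exists L : R, forall x, hull s x -> `|x.1| <= L /\ `|x.2| <= L.
Proof.
exists (\sum_(i < size s) (`|(s`_i).1| + `|(s`_i).2|)) => x [w [w0 w1 ->]].
have wl i : w i <= 1.
  by rewrite -w1 (bigD1 i) //= lerDl sumr_ge0.
rewrite fst_sum snd_sum; split; apply: le_trans (ler_norm_sum _ _ _) _; apply: ler_sum => i _;
  rewrite /= /GRing.scale /= normrM (ger0_norm (w0 i)).
  by apply: (le_trans (ler_piMl _ (wl i))); rewrite ?lerDl.
by apply: (le_trans (ler_piMl _ (wl i))); rewrite ?lerDr.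
Qed.

Lemma hull3P a b c x : hull [:: a; b; c] x <-> exists u v w : R,
  [/\ [/\ 0 <= u, 0 <= v & 0 <= w], u + v + w = 1 & x = u *: a + v *: b + w *: c].
Proof.
split=> [[w [w0 w1 ->]]|[u [v [w [[u0 v0 w0] w1 ->]]]]].
  exists (w ord0), (w (lift ord0 ord0)), (w (lift ord0 (lift ord0 ord0))).
  by split; [split|rewrite -w1 !big_ord_recl big_ord0 addr0 addrA|
    rewrite !big_ord_recl big_ord0 addr0 addrA].
exists (fun i => [:: u; v; w]`_i); split.
- by case; case=> [|[|[|]]].
- by rewrite !big_ord_recl big_ord0 /= addr0 addrA.
by rewrite !big_ord_recl big_ord0 /= addr0 addrA.
Qed.

Lemma hull3_compact (a b c : pt) : compact (hull [:: a; b; c]).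
Proof.
(* Collapsed coordinates: the unit square is mapped onto the triangle, with [y.1 = v + w] and
   [y.2 = w / (v + w)]. At the vertex [a] the division by zero yields the admissible value 0. *)
pose f (y : pt) := (1 - y.1) *: a + y.1 *: ((1 - y.2) *: b + y.2 *: c).
have -> : hull [:: a; b; c] = f @` (box 0 1 0 1).
  apply/seteqP; split=> [x /hull3P[u [v [w [[u0 v0 w0] w1 ->]]]]|x [[y z] [/=]]]; last first.
    rewrite !in_itv /= => /andP[y0 y1] /andP[z0 z1] <-; apply/hull3P.
    exists (1 - y), (y * (1 - z)), (y * z); split; first split.
    - by rewrite subr_ge0.
    - by rewrite mulr_ge0 // subr_ge0.
    - exact: mulr_ge0.
    - by ring.
    by apply: pair_eq; rewrite /= /GRing.scale /=; ring.
  have vw0 : 0 <= v + w by rewrite addr_ge0.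
  exists (v + w, w / (v + w)).
    split; rewrite /= in_itv /=; first by apply/andP; split; lra.
    rewrite divr_ge0 //=; have [->|ne] := eqVneq (v + w) 0; first by rewrite invr0 mulr0.
    by rewrite ler_pdivrMr ?lt_def ?ne // mul1r lerDr.
  have E : (v + w) * (w / (v + w)) = w.
    have [e|ne] := eqVneq (v + w) 0; last by rewrite mulrC divfK.
    by rewrite e mul0r; lra.
  have -> : u = 1 - (v + w) by lra.
  move: E; set k := w / (v + w) => E.
  have comp (A B C : R) : (1 - (v + w)) * A + (v + w) * ((1 - k) * B + k * C)
      = (1 - (v + w)) * A + v * B + w * C.
    transitivity ((1 - (v + w)) * A + (v + w - (v + w) * k) * B + ((v + w) * k) * C); first by ring.
    by rewrite E; ring.
  by apply: pair_eq; rewrite /f /= /GRing.scale /=; exact: comp.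
apply: continuous_compact; last exact: compact_box.
apply: continuous_subspaceT => y.
have c1 : y'.1 @[y' --> y] --> y.1 by exact: fst_continuous.
have c2 : y'.2 @[y' --> y] --> y.2 by exact: snd_continuous.
have cB (h : pt -> R) : h y' @[y' --> y] --> h y -> 1 - h y' @[y' --> y] --> 1 - h y.
  by move=> ch; apply: cvgB; [exact: cvg_cst|].
by apply: cvgD; [|apply: cvgZ => //; apply: cvgD]; (apply: cvgZ; [|exact: cvg_cst]) => //; exact: cB.
Qed.

Lemma triangle_closed (T : 3.-tuple pt) : closed (hull T).
Proof.
case: T => [[|a [|b [|c [|]]]] // sT] /=.
by apply: compact_closed; [exact: norm_hausdorff|exact: hull3_compact].
Qed.

Lemma triangle_measurable (T : 3.-tuple pt) : measurable (hull T : set pl).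
Proof. by apply: closed_measurable2; exact: triangle_closed. Qed.

(** In coordinates along [a = q - p] and the orthogonal vector [e], the line is the set [s = 0],
    which is null for each [t]. *)
Lemma line_null p q : p != q -> measurable ([set x | det2 (q - p) (x - p) = 0] : set pl) /\
  leb2 ([set x | det2 (q - p) (x - p) = 0] : set pl) = 0%E.
Proof.
move=> pq; set L := [set x | _].
have cd : continuous (fun x => det2 (q - p) (x - p)).
  move=> x; apply: (@cvgB _ _ _ _ _ (fun x => (q - p).1 * (x.2 - p.2)) (fun x => (q - p).2 * (x.1 - p.1)));
    (apply: cvgM; first exact: cvg_cst); (apply: cvgB; last exact: cvg_cst).
    exact: snd_continuous.
  exact: fst_continuous.
have mL : measurable (L : set pl).
  apply: closed_measurable2; have -> : L = (fun x => det2 (q - p) (x - p)) @^-1` [set 0] by [].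
  by apply: preimage_closed => //; exact: closed_eq.
split=> //; pose a : pt := q - p; pose e : pt := (- a.2, a.1).
have dae : det2 a e != 0.
  apply: contra_neq pq; rewrite /det2 /= => /eqP; rewrite mulrN opprK -!expr2.
  rewrite paddr_eq0 ?sqr_ge0 // !sqrf_eq0 /= !subr_eq0 => /andP[/eqP e1 /eqP e2].
  by apply: pair_eq.
have mI : measurable_fun (setT : set pl) (EFin \o (\1_L : pl -> R)).
  by apply/measurable_EFinP; exact: measurable_indic.
have I0 x : (0 <= (EFin \o (\1_L : pl -> R)) x)%E by rewrite lee_fin indicE ler0n.
have := ge0_integral_parallelogram p mI I0 dae.
rewrite integral_indic // setIT.
have -> : (\int[leb]_t \int[leb]_s (EFin \o \1_L) (p + t *: a + s *: e)%R)%E = 0%E.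
  apply: integral0_eq => t _.
  have -> : (\int[leb]_s (EFin \o \1_L) (p + t *: a + s *: e)%R = \int[leb]_s (\1_[set 0 : mR] s)%:E)%E.
    apply: eq_integral => s _; congr EFin; rewrite !indicE; congr ((nat_of_bool _)%:R); apply/idP/idP; rewrite !inE /L /=.
      have -> : det2 (q - p) (p + t *: a + s *: e - p) = s * det2 a e.
        by rewrite /a /det2 /= /GRing.scale /=; ring.
      by move/eqP; rewrite mulf_eq0 (negPf dae) orbF => /eqP.
    by move=> ->; rewrite scale0r addr0 /det2 /= /GRing.scale /=; ring.
  by rewrite integral_indic // setIT; exact: lebesgue_measure_set1.
move=> /esym/eqP; rewrite mule_eq0 => /orP[|/eqP//].
by rewrite eqe invr_eq0 normr_eq0 (negPf dae).
Qed.

Lemma small_hull_null s : (size s <= 2)%N -> exists2 L : set pl,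
  measurable L /\ leb2 L = 0%E & hull s `<=` L.
Proof.
have seg p q : exists2 L : set pl, measurable L /\ leb2 L = 0%E & hull [:: p; q] `<=` L.
  wlog pq : p q / p != q => [H|].
    have [<-|] := eqVneq p q; last exact: H.
    (* A degenerate segment is covered by a nondegenerate one starting at the same point. *)
    have [|L hL sub] := H p (p + (1, 0)).
      by apply/eqP => /(congr1 fst) /= /eqP; rewrite -subr_eq0 opprD addNKr oppr_eq0 oner_eq0.
    exists L => // x [w [w0 w1 ->]]; apply: sub; rewrite big_ord_recl /= big_ord_recl big_ord0 addr0.
    rewrite -scalerDl; move: w1; rewrite !big_ord_recl big_ord0 addr0 => ->; rewrite scale1r.
    by apply: hull_mem; rewrite mem_head.
  have h := line_null pq; exists [set x | det2 (q - p) (x - p) = 0] => // x [w [w0 w1 ->]] /=.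
  move: w1; rewrite !big_ord_recl !big_ord0 /= !addr0.
  move: (w _) (w _) => u v uv; have -> : u = 1 - v by lra.
  by rewrite /det2 /= /GRing.scale /=; ring.
case: s => [|p [|q [|]]] // _.
- exists set0; first by split; [exact: measurable0|exact: measure0].
  by move=> x [w [_ /eqP]]; rewrite big_ord0 eq_sym oner_eq0.
- have [L hL sub] := seg p p; exists L => // x [w [w0 w1 ->]]; apply: sub.
  move: w1; rewrite !big_ord_recl !big_ord0 /= !addr0 => ->; rewrite scale1r.
  by apply: hull_mem; rewrite mem_head.
Qed.

End hulls.

(** These are the properties of the polygon on which the sections about convex domains are
    parametrized. *)
Lemma convex_polygon_domain {R : realType} (Om : set (R * R)) : convex_polygon Om ->
  [/\ open Om,
      exists L : R, forall x, Om x -> `|x.1| <= L /\ `|x.2| <= L,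
      forall x y (t : R), Om x -> Om y -> 0 <= t <= 1 -> Om ((1 - t) *: x + t *: y) &
      exists x0 : R * R, exists2 r : R, 0 < r &
        box (x0.1 - r) (x0.1 + r) (x0.2 - r) (x0.2 + r) `<=` Om].
Proof.
move=> [[x0 Ox0] [s Os]]; have oOm : open Om by rewrite Os; exact: open_interior.
split=> //.
- by have [L hL] := hull_bounded s; exists L => x; rewrite Os => /interior_subset; exact: hL.
- move=> x y t Ox Oy t01; move: Ox Oy; rewrite Os => /nbhs_ballP[d /= d0 hd] /nbhs_ballP[e /= e0 he].
  apply/nbhs_ballP; exists (Num.min d e); first by rewrite /= lt_min d0.
  (* A point near the convex combination is the same combination of [x] and [y], both translated by
     [h]. *)
  move=> z [z1 z2]; pose h : R * R := z - ((1 - t) *: x + t *: y).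
  have -> : z = (1 - t) *: (x + h) + t *: (y + h).
    by apply: pair_eq; rewrite /h /= /GRing.scale /=; ring.
  have bl (a : R * R) (k : R) : Num.min d e <= k -> ball a k (a + h).
    move=> mk; split; rewrite /ball /=; apply: lt_le_trans mk; [have := z1|have := z2];
      rewrite /ball /=; set c := ((1 - t) * _ + _).
      by suff -> : a.1 - (a + h).1 = c - z.1 by []; rewrite /h /c /= /GRing.scale /=; ring.
    by suff -> : a.2 - (a + h).2 = c - z.2 by []; rewrite /h /c /= /GRing.scale /=; ring.
  by apply: hull_convex => //; [apply: hd|apply: he]; apply: bl; rewrite ge_min lexx ?orbT.
by exists x0; apply: closed_box_sub.
Qed.

(** * The L^2 norm in terms of vertex values and the Hessian *)

Section mesh_estimates.
Context {R : realType}.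
Local Notation pt := (R * R)%type.
Local Notation mR := (measurableTypeR R).
Local Notation pl := (mR * mR)%type.
Implicit Types (f g v w phi psi : pt -> R) (i j : 'I_2) (x y p q z : pt).

Variable Om : set pt.
Hypothesis oOm : open Om.
Hypothesis bOm : exists L : R, forall x, Om x -> `|x.1| <= L /\ `|x.2| <= L.
Hypothesis cOm : forall x y (t : R), Om x -> Om y -> 0 <= t <= 1 -> Om ((1 - t) *: x + t *: y).
Variables (x0 : pt) (r : R).
Hypothesis r0 : 0 < r.
Hypothesis boxr : box (x0.1 - r) (x0.1 + r) (x0.2 - r) (x0.2 + r) `<=` Om.
Local Notation mOm := (measurable_domain oOm).
Local Notation normH2 := (ipnorm (ipH2 Om)).
Variable M : mesh Om.

Lemma vertex_closure T p : T \in tris M -> p \in T -> closure Om p.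
Proof. by move=> hT pT; rewrite (mesh_cover M); exists T => //; exact: hull_mem. Qed.

Lemma triangle_closure T : T \in tris M -> hull T `<=` closure Om.
Proof. by move=> hT x Tx; rewrite (mesh_cover M); exists T. Qed.

Lemma closure_closure_diameter : exists d : R, forall p q,
  closure Om p -> closure Om q -> enorm (p - q) <= d.
Proof.
have [L hL] := bOm; exists (4 * L) => p q cp cq; apply: le_trans (enorm_le_sum _) _.
have [p1 p2] := closure_bounded hL cp; have [q1 q2] := closure_bounded hL cq.
by apply: le_trans (lerD (ler_normB _ _) (ler_normB _ _)) _; lra.
Qed.

Lemma le_meshsize T x y : T \in tris M -> hull T x -> hull T y -> enorm (x - y) <= meshsize M.
Proof.
move=> hT Tx Ty; have [d hd] := closure_closure_diameter.
have bd T' x' y' : T' \in tris M -> hull T' x' -> hull T' y' -> enorm (x' - y') <= d.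
  by move=> hT' Tx' Ty'; apply: hd; exact: (triangle_closure hT').
pose S T' := [set r | exists x y : pt, [/\ hull T' x, hull T' y & r = enorm (x - y)]].
have hS T' : T' \in tris M -> has_sup (S T').
  move=> hT'; split; last by exists d => _ [x' [y' [hx' hy' ->]]]; exact: (bd T').
  have [z /interior_subset Tz] := mesh_nondeg hT'.
  by exists (enorm (z - z)), z, z.
apply: (@le_trans _ _ (diam (hull T))).
  by apply: (sup_upper_bound (hS _ hT)); exists x, y.
apply: sup_upper_bound; last by exists T.
split; first by exists (diam (hull T)), T.
exists d => _ [T' hT' ->]; apply: ge_sup; first exact: (hS _ hT').1.
by move=> _ [x' [y' [hx' hy' ->]]]; exact: (bd T').
Qed.

Lemma sqr_convex3_le (u v w a b c : R) : 0 <= u -> 0 <= v -> 0 <= w -> u + v + w = 1 ->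
  (u * a + v * b + w * c) ^+ 2 <= a ^+ 2 + b ^+ 2 + c ^+ 2.
Proof.
move=> u0 v0 w0 w1; apply: (@le_trans _ _ (u * a ^+ 2 + v * b ^+ 2 + w * c ^+ 2)).
  (* The gap is the variance of [a], [b], [c] under the weights, expressed through pairwise
     differences. *)
  rewrite -subr_ge0; have -> : u * a ^+ 2 + v * b ^+ 2 + w * c ^+ 2 - (u * a + v * b + w * c) ^+ 2
     = u * v * (a - b) ^+ 2 + u * w * (a - c) ^+ 2 + v * w * (b - c) ^+ 2.
    have -> : u = 1 - v - w by lra.
    by ring.
  by rewrite !addr_ge0 // mulr_ge0 ?sqr_ge0 // mulr_ge0.
by rewrite !lerD // ler_piMl ?sqr_ge0 //; lra.
Qed.

Lemma sqrB_le (A B : R) : (A - B) ^+ 2 <= 2 * A ^+ 2 + 2 * B ^+ 2.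
Proof.
rewrite -subr_ge0; have -> : 2 * A ^+ 2 + 2 * B ^+ 2 - (A - B) ^+ 2 = (A + B) ^+ 2 by ring.
exact: sqr_ge0.
Qed.

(* In phi y = \sum_i w_i (phi p_i - r_i y), with w_i the barycentric coordinates
   of y, the first-order terms cancel since \sum_i w_i (p_i - y) = 0. *)
Lemma triangle_pointwise phi a b c y : hull [:: a; b; c] y -> phi y ^+ 2
  <= 2 * (phi a ^+ 2 + phi b ^+ 2 + phi c ^+ 2)
   + 2 * (taylor_rest phi a y ^+ 2 + taylor_rest phi b y ^+ 2 + taylor_rest phi c y ^+ 2).
Proof.
move=> /hull3P[u [v [w [[u0 v0 w0] w1 yE]]]].
have E : phi y = u * (phi a - taylor_rest phi a y) + v * (phi b - taylor_rest phi b y)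
    + w * (phi c - taylor_rest phi c y).
  rewrite /taylor_rest; move: ('D_(Defs.basis ord0) phi y) ('D_(Defs.basis ord_max) phi y) => g1 g2.
  have y1 : u * a.1 + v * b.1 + w * c.1 = y.1 by rewrite yE.
  have y2 : u * a.2 + v * b.2 + w * c.2 = y.2 by rewrite yE.
  rewrite /=; move: (phi y) (phi a) (phi b) (phi c) => f fa fb fc.
  transitivity ((u + v + w) * f + ((u * a.1 + v * b.1 + w * c.1) - (u + v + w) * y.1) * g1
     + ((u * a.2 + v * b.2 + w * c.2) - (u + v + w) * y.2) * g2); last by ring.
  by rewrite w1 y1 y2; ring.
rewrite {1}E; apply: le_trans (sqr_convex3_le _ _ _ u0 v0 w0 w1) _.
have k := sqrB_le.
have := k (phi a) (taylor_rest phi a y); have := k (phi b) (taylor_rest phi b y).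
by have := k (phi c) (taylor_rest phi c y); lra.
Qed.

(** The pointwise bound is integrated over the triangle, with one Taylor remainder for each of the
    three vertices; the factor 2 there makes [6]. The area is bounded crudely by that of the closure
    of [Om], since the vertex term is only ever used in a limit where it vanishes. *)
Lemma triangle_estimate phi T : smooth phi -> T \in tris M ->
  (\int[leb2]_(y in (hull T : set pl)) (phi y ^+ 2)%:E
   <= (2 * fine (leb2 (closure Om : set pl)) * (\sum_(p <- T) phi p ^+ 2))%:E
    + (6 * meshsize M ^+ 4)%:E * \int[leb2]_(y in (hull T : set pl)) (hess_sqr phi y)%:E)%E.
Proof.
move=> sphi hT; have mK := triangle_measurable T; set K := hull T : set pl.
have cphi := smooth_continuous sphi.
have H0 : 0 <= meshsize M.
  have [z /interior_subset Tz] := mesh_nondeg hT.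
  by apply: le_trans (le_meshsize hT Tz Tz); rewrite /enorm sqrtr_ge0.
have ms (f : pt -> R) : continuous f -> measurable_fun K (fun x : pl => (f x)%:E).
  by move=> cf; apply/measurable_EFinP; apply: measurable_funTS; exact: continuous_measurable2.
have sq (f : pt -> R) : continuous f -> continuous (fun x => f x ^+ 2).
  by move=> cf x; apply: cvgM; exact: cf.
have cr p : continuous (taylor_rest phi p) by exact: taylor_rest_continuous.
have mC : measurable (closure Om : set pl) by apply: closed_measurable2; exact: closed_closure.
have fC : leb2 (closure Om : set pl) \is a fin_num.
  have [L hL] := bOm; rewrite ge0_fin_numE ?measure_ge0 //.
  by apply: (leb2_bounded_fin mC) => x cx; exact: closure_bounded hL cx.
set S := \sum_(p <- T) phi p ^+ 2; have S0 : 0 <= S by rewrite sumr_ge0 // => p _; exact: sqr_ge0.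
pose Rs y := \sum_(p <- T) taylor_rest phi p y ^+ 2.
have Rs0 y : 0 <= Rs y by rewrite sumr_ge0 // => p _; exact: sqr_ge0.
have mr p : measurable_fun K (fun x : pl => (taylor_rest phi p x ^+ 2)%:E).
  by apply: (ms (fun x => taylor_rest phi p x ^+ 2)); exact: sq.
have RsE : (\int[leb2]_(y in K) (Rs y)%:E
    = \sum_(p <- T) \int[leb2]_(y in K) (taylor_rest phi p y ^+ 2)%:E)%E.
  under eq_integral do rewrite /Rs -sumEFin.
  by rewrite ge0_integral_sum // => p y _; rewrite lee_fin sqr_ge0.
have mRs : measurable_fun K (fun x : pl => (Rs x)%:E).
  apply: (eq_measurable_fun (fun x : pl => \sum_(p <- T) (taylor_rest phi p x ^+ 2)%:E)%E).
    by move=> x _; rewrite sumEFin.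
  by apply: emeasurable_sum.
apply: (@le_trans _ _ (\int[leb2]_(y in K) ((cst (2 * S)%:E y) + 2%:E * (Rs y)%:E)%E)%E).
  apply: ge0_le_integral => //.
  - by move=> y _; rewrite lee_fin sqr_ge0.
  - by apply: (ms (fun x => phi x ^+ 2)); exact: sq.
  - by apply: emeasurable_funD; [exact: measurable_cst|apply: emeasurable_funM => //].
  move=> y Ky; rewrite /= -EFinM -EFinD lee_fin /S /Rs.
  move: Ky; rewrite /K; case: (T) => [[|a [|b [|c [|]]]] // sT] /= Ky.
  by have := triangle_pointwise phi Ky; rewrite !big_cons !big_nil !addr0 !addrA.
rewrite ge0_integralD //; last 3 first.
- by move=> y _; rewrite lee_fin mulr_ge0.
- by move=> y _; rewrite -EFinM lee_fin mulr_ge0.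
- by apply: emeasurable_funM => //.
rewrite integral_cst // ge0_integralZl //; last by move=> y _; rewrite lee_fin.
apply: leeD.
  have -> : 2 * fine (leb2 (closure Om : set pl)) * S = 2 * S * fine (leb2 (closure Om : set pl)) by ring.
  rewrite (EFinM (2 * S)) fineK //; apply: lee_wpmul2l; first by rewrite lee_fin mulr_ge0.
  by apply: le_measure; rewrite ?inE //; exact: triangle_closure.
rewrite RsE.
have -> : ((6 * meshsize M ^+ 4)%:E = 2%:E * (3 * meshsize M ^+ 4)%:E :> \bar R)%E.
  by rewrite -EFinM; congr EFin; ring.
rewrite -muleA; apply: lee_wpmul2l => //.
have I0 : (0 <= \int[leb2]_(y in K) (hess_sqr phi y)%:E)%E.
  by apply: integral_ge0 => y _; rewrite lee_fin hess_sqr_ge0.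
have d4 : 0 <= meshsize M ^+ 4 by exact: exprn_ge0.
apply: (@le_trans _ _ (\sum_(p <- T) (meshsize M ^+ 4)%:E * \int[leb2]_(y in K) (hess_sqr phi y)%:E)%E).
  rewrite [X in (X <= _)%E]big_seq [X in (_ <= X)%E]big_seq; apply: lee_sum => p pT.
  apply: (taylor_homothety sphi mK).
    by move=> y t Ky /andP[t0 t1]; apply: hull_convex => //; [exact: hull_mem|rewrite t0 ltW].
  by move=> y Ky; apply: (le_meshsize hT) => //; exact: hull_mem.
rewrite big_const_seq count_predT size_tuple (EFinM 3 (meshsize M ^+ 4)) -muleA.
set c := (_ * \int[leb2]_(y in K) _)%E; have c0 : (0 <= c)%E by apply: mule_ge0; rewrite ?lee_fin.
rewrite /= adde0; have -> : (3%:E = 1%:E + (1%:E + 1%:E) :> \bar R)%E.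
  by rewrite -!EFinD; congr EFin; ring.
by rewrite !ge0_muleDl ?adde_ge0 // !mul1e.
Qed.

(** By conformity the intersection is the hull of the common vertices. Unless each triangle has all
    vertices of the other, at most two remain and the hull lies on a line. *)
Lemma triangles_overlap T T' : T \in tris M -> T' \in tris M ->
  hull T = hull T' \/ leb2 ((hull T `&` hull T') : set pl) = 0%E.
Proof.
move=> hT hT'; have null (A B : 3.-tuple pt) : A \in tris M -> B \in tris M ->
    ~~ all (mem B) A -> leb2 ((hull A `&` hull B) : set pl) = 0%E.
  move=> hA hB nAB; rewrite (mesh_conforming hA hB).
  have sz : (size [seq p <- A | p \in B] <= 2)%N.
    have h := count_size (mem B) A; rewrite all_count size_tuple in nAB; rewrite size_tuple in h.
    by rewrite size_filter -ltnS ltn_neqAle nAB.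
  have [L [mL L0] sub] := small_hull_null sz.
  by apply: (subset_measure0 _ mL sub L0); rewrite -(mesh_conforming hA hB);
    apply: measurableI; exact: triangle_measurable.
have [a1|n1] := boolP (all (mem T') T); last by right; exact: null.
have [a2|n2] := boolP (all (mem T) T'); last by right; rewrite setIC; exact: null.
left; have e1 := mesh_conforming hT hT'; have e2 := mesh_conforming hT' hT.
have {}e1 : hull T `&` hull T' = hull T by rewrite e1; congr hull; apply/all_filterP.
have {}e2 : hull T' `&` hull T = hull T' by rewrite e2; congr hull; apply/all_filterP.
by rewrite -{1}e1 setIC e2.
Qed.

Lemma integral_setU_null (A B : set pl) (f : pl -> \bar R) : measurable A -> measurable B ->
  leb2 (A `&` B) = 0%E -> measurable_fun (setT : set pl) f -> (forall x, 0 <= f x)%E ->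
  (\int[leb2]_(x in A `|` B) f x = \int[leb2]_(x in A) f x + \int[leb2]_(x in B) f x)%E.
Proof.
move=> mA mB AB0 mf f0; have mf' (D : set pl) : measurable_fun D f by exact: measurable_funTS.
have mD : measurable (B `\` A) by exact: measurableD.
have mI : measurable (B `&` A) by exact: measurableI.
have -> : A `|` B = A `|` (B `\` A) by rewrite setDE setUIr setUCr setIT.
rewrite ge0_integral_setU //; last by apply/disj_setPS => x [? []].
congr (_ + _)%E; rewrite -[in RHS](setUIDK B A) ge0_integral_setU //; last first.
  by apply/disj_setPS => x [[? ?] []].
by rewrite [X in (X + _)%E]null_set_integral ?add0e // setIC.
Qed.

Let union (ts : seq (3.-tuple pt)) : set pl := [set x | exists2 T, T \in ts & hull T x].

Lemma union_cons T ts : union (T :: ts) = hull T `|` union ts.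
Proof.
apply/seteqP; split=> [x [T' ]|x [Tx|[T' h Tx]]].
- by rewrite inE => /orP[/eqP-> Tx|h Tx]; [left|right; exists T'].
- by exists T; rewrite ?mem_head.
by exists T' => //; rewrite inE h orbT.
Qed.

Lemma measurable_union ts : measurable (union ts).
Proof.
elim: ts => [|T ts IH]; last first.
  by rewrite union_cons; apply: measurableU => //; exact: triangle_measurable.
by rewrite (_ : union [::] = set0) // -subset0 => x [].
Qed.

(* [tris M] may list a triangle twice; distinct triangles overlap in a null set. *)
Lemma partial_mesh_estimate phi ts : smooth phi -> {subset ts <= tris M} ->
  (\int[leb2]_(y in union ts) (phi y ^+ 2)%:E
   <= (2 * fine (leb2 (closure Om : set pl)) * (\sum_(T <- ts) \sum_(p <- T) phi p ^+ 2))%:E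
    + (6 * meshsize M ^+ 4)%:E * \int[leb2]_(y in union ts) (hess_sqr phi y)%:E)%E.
Proof.
move=> sphi; have m0 : 0 <= fine (leb2 (closure Om : set pl)) by exact: fine_ge0.
set c := 2 * _; have c0 : 0 <= c by rewrite mulr_ge0.
have d0 : (0 <= (6 * meshsize M ^+ 4)%:E :> \bar R)%E.
  by rewrite lee_fin mulr_ge0 // (exprM _ 2 2) sqr_ge0.
have mc (f : pt -> R) : continuous f -> measurable_fun (setT : set pl) (fun x : pl => (f x)%:E).
  by move=> cf; apply/measurable_EFinP; exact: continuous_measurable2.
have mphi : measurable_fun (setT : set pl) (fun x : pl => (phi x ^+ 2)%:E).
  by apply: (mc (fun x => phi x ^+ 2)) => x; apply: cvgM; exact: smooth_continuous.
have mh : measurable_fun (setT : set pl) (fun x : pl => (hess_sqr phi x)%:E).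
  by apply: mc; exact: hess_sqr_continuous.
have p0 (x : pl) : (0 <= (phi x ^+ 2)%:E)%E by rewrite lee_fin sqr_ge0.
have h0 (x : pl) : (0 <= (hess_sqr phi x)%:E)%E by rewrite lee_fin hess_sqr_ge0.
have S0 T : 0 <= \sum_(p <- T : seq pt) phi p ^+ 2 by rewrite sumr_ge0 // => p _; exact: sqr_ge0.
elim: ts => [_|T ts IH sub].
  rewrite (_ : union [::] = set0); last by rewrite -subset0 => x [].
  by rewrite !integral_set0 big_nil mulr0 mule0 adde0.
have hT : T \in tris M by apply: sub; rewrite mem_head.
have sub' : {subset ts <= tris M} by move=> T' h; apply: sub; rewrite inE h orbT.
have {}IH := IH sub'; rewrite big_cons.
have [[T' hT' TT']|disj] := pselect (exists2 T', T' \in ts & hull T = hull T').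
  have -> : union (T :: ts) = union ts.
    by rewrite union_cons; apply/setUidPr => x; rewrite TT' => ?; exists T'.
  apply: (le_trans IH); apply: leeD => //; rewrite lee_fin.
  by apply: ler_wpM2l => //; rewrite lerDr.
have null ts' : {subset ts' <= ts} -> leb2 ((hull T `&` union ts') : set pl) = 0%E.
  elim: ts' => [_|T' ts' IH' s'].
    by rewrite (_ : _ `&` _ = set0) ?measure0 // -subset0 => x [_ []].
  have hT' : T' \in ts by apply: s'; rewrite mem_head.
  have e1 : leb2 ((hull T `&` hull T') : set pl) = 0%E.
    by case: (triangles_overlap hT (sub' _ hT')) => // E; case: disj; exists T'.
  have e2 : leb2 ((hull T `&` union ts') : set pl) = 0%E.
    by apply: IH' => T'' h; apply: s'; rewrite inE h orbT.
  have mT T0 := triangle_measurable (T0 : 3.-tuple pt).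
  apply/eqP; rewrite eq_le measure_ge0 andbT union_cons setIUr.
  apply: le_trans (measureU2 _ _ _) _; try exact: measurableI.
    by apply: measurableI => //; exact: measurable_union.
  have -> : 0%E = (leb2 ((hull T `&` hull T') : set pl) + leb2 ((hull T `&` union ts') : set pl))%E.
    by rewrite e1 e2 adde0.
  exact: lexx.
have mT := triangle_measurable T; have mU := measurable_union ts.
rewrite union_cons !integral_setU_null //; try by apply: null.
rewrite mulrDr EFinD muleDr; last 2 first.
- by [].
- by rewrite ge0_adde_def // inE; apply: integral_ge0.
by apply: (le_trans (leeD (triangle_estimate sphi hT) IH)); rewrite addeACA.
Qed.

Lemma smooth_mesh_estimate phi : smooth phi ->
  L2norm Om phi ^+ 2
   <= 2 * fine (leb2 (closure Om : set pl)) * (\sum_(T <- tris M) \sum_(p <- T) phi p ^+ 2)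
    + 6 * meshsize M ^+ 4 * normH2 phi ^+ 2.
Proof.
move=> sphi; have := partial_mesh_estimate sphi (fun T h => h : T \in tris M).
have -> : union (tris M) = closure Om by rewrite (mesh_cover M).
have cp : continuous (fun x => phi x ^+ 2) by move=> x; apply: cvgM; exact: smooth_continuous.
rewrite (integral_closure oOm bOm cOm r0 boxr cp (fun x => sqr_ge0 _)).
rewrite (integral_closure oOm bOm cOm r0 boxr (hess_sqr_continuous sphi) (hess_sqr_ge0 phi)).
rewrite (integral_sqrE mOm (smooth_L2 oOm bOm sphi)) (integral_hess_sqr oOm bOm sphi).
rewrite -EFinM -EFinD lee_fin => /le_trans; apply; rewrite lerD2l; apply: ler_wpM2l.
  by rewrite mulr_ge0 // (exprM _ 2 2) sqr_ge0.
rewrite (normH2_smooth oOm bOm sphi) lerDr addr_ge0 ?sqr_ge0 //.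
by rewrite sumr_ge0 // => i _; rewrite sqr_ge0.
Qed.

(** Point evaluation is continuous in H^2, so the vertex sums of smooth approximations of [w] tend
    to 0 and only the Hessian term survives. The constant [3] bounds the square root of 6. *)
Lemma fine_scale_estimate w : H2 Om w -> (forall T p, T \in tris M -> p \in T -> ptval Om w p = 0) ->
  L2norm Om w <= 3 * meshsize M ^+ 2 * normH2 w.
Proof.
move=> hw w0; have [phi [sphi cphi]] := smooth_dense_H2 oOm bOm cOm r0 boxr hw.
have HL := semi_hilbert_L2 oOm; have HH := sb_hilbert (sobolev_base_H2 oOm bOm).
have hphi n : H2 Om (phi n) by exact: smooth_H2.
have l2 n : L2 Om (phi n) := smooth_L2 oOm bOm (sphi n).
have lw : L2 Om w := hw.1.1.
have c2 : normH2 (phi n) @[n --> \oo] --> normH2 w by exact: (ipnorm_cvg HH).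
have c1 : L2norm Om (phi n) @[n --> \oo] --> L2norm Om w.
  under eq_fun do rewrite -L2_ipnorm; rewrite -L2_ipnorm; apply: (ipnorm_cvg HL).
  - exact: l2.
  - exact: lw.
  apply: (squeeze_cvgr _ (cvg_cst 0) cphi); apply: nearW => n.
  by rewrite ipnorm_ge0 L2_ipnorm; exact: (L2norm_le_H2 oOm bOm).
have cS : \sum_(T <- tris M) \sum_(p <- T) phi n p ^+ 2 @[n --> \oo] --> (0 : R).
  apply: cvg_sum0 => T hT; apply: cvg_sum0 => p hp.
  have -> : (0 : R) = ptval Om w p ^+ 2 by rewrite (w0 T p hT hp) expr0n.
  have := ptval_lim oOm bOm cOm r0 boxr hw sphi cphi (vertex_closure hT hp).
  by move=> h; apply: cvgM.
have H4 : 0 <= meshsize M ^+ 4 by rewrite (exprM _ 2 2) sqr_ge0.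
apply: le_of_sqr; first by apply: mulr_ge0; [rewrite mulr_ge0 ?sqr_ge0|exact: ipnorm_ge0].
apply: (@le_trans _ _ (2 * fine (leb2 (closure Om : set pl)) * 0 + 6 * meshsize M ^+ 4 * normH2 w ^+ 2)).
  apply: (@ler_cvg_to nat \oo _ R (fun n => L2norm Om (phi n) ^+ 2)
    (fun n => 2 * fine (leb2 (closure Om : set pl)) * (\sum_(T <- tris M) \sum_(p <- T) phi n p ^+ 2)
    + 6 * meshsize M ^+ 4 * normH2 (phi n) ^+ 2)).
  - by apply: cvgM; exact: c1.
  - apply: cvgD; (apply: cvgM; first exact: cvg_cst) => //.
    by apply: cvgM; exact: c2.
  - by apply: nearW => n; exact: smooth_mesh_estimate.
have -> : (3 * meshsize M ^+ 2 * normH2 w) ^+ 2 = 9 * (meshsize M ^+ 4 * normH2 w ^+ 2) by ring.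
have : 0 <= meshsize M ^+ 4 * normH2 w ^+ 2 by rewrite mulr_ge0 ?sqr_ge0.
by rewrite mulr0 add0r -mulrA => h; apply: ler_wpM2r => //; rewrite ler_nat.
Qed.
End mesh_estimates.

(** * Interpolation of the gradient between L^2 and H^2 *)

Section fine_scale.
Context {R : realType}.
Local Notation pt := (R * R)%type.
Implicit Types (f g v w phi psi : pt -> R) (i j : 'I_2) (x y p q z : pt).

Variable Om : set pt.
Hypothesis oOm : open Om.
Hypothesis bOm : exists L : R, forall x, Om x -> `|x.1| <= L /\ `|x.2| <= L.
Hypothesis cOm : forall x y (t : R), Om x -> Om y -> 0 <= t <= 1 -> Om ((1 - t) *: x + t *: y).
Variables (x0 : pt) (r : R).
Hypothesis r0 : 0 < r.
Hypothesis boxr : box (x0.1 - r) (x0.1 + r) (x0.2 - r) (x0.2 + r) `<=` Om.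
Local Notation normH2 := (ipnorm (ipH2 Om)).
Variable M : mesh Om.

(** The weak derivative [g] of [d] is tested with functions approximating [w] whose derivatives
    approximate [d]. Membership in [H10] provides them, so the integration by parts has no boundary
    term. *)
Lemma test_fun_ibp_limit i w d g : L2 Om w -> is_wD Om i d g ->  L2 Om d ->
  (forall e : R, 0 < e -> exists2 phi, test_fun Om phi &
     L2norm Om (w - phi) <= e /\ L2norm Om (d - 'D_(Defs.basis i) phi) <= e) ->
  L2ip Om d d = - L2ip Om g w.
Proof.
move=> hw [hg dg] hd app; have HL := semi_hilbert_L2 oOm.
have [n1 n2] : 0 <= L2norm Om d /\ 0 <= L2norm Om g by rewrite !L2norm_ge0.
have key (e : R) : 0 < e -> `|L2ip Om d d + L2ip Om g w| <= (L2norm Om d + L2norm Om g) * e.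
  move=> e0; have [phi tphi [h1 h2]] := app e e0; have sphi := test_fun_smooth tphi.
  have hp := smooth_L2 oOm bOm sphi; have hDp := smoothD_L2 oOm bOm i sphi.
  have e1 := ipBr HL hd hDp hd; have e2 := ipBr HL hw hp hg; have e3 := dg phi tphi.
  have -> : L2ip Om d d + L2ip Om g w
      = L2ip Om d (d - 'D_(Defs.basis i) phi) + L2ip Om g (w - phi).
    by rewrite e1 e2 e3; ring.
  have b1 := ip_cauchy_schwarz HL hd (semi_hilbertB HL hd hDp).
  have b2 := ip_cauchy_schwarz HL hg (semi_hilbertB HL hw hp).
  rewrite !L2_ipnorm in b1 b2; apply: le_trans (ler_normD _ _) _.
  by rewrite mulrDl; apply: lerD; [apply: le_trans b1 _|apply: le_trans b2 _]; apply: ler_wpM2l.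
apply/eqP; rewrite -subr_eq0 opprK -normr_eq0 eq_le normr_ge0 andbT leNgt; apply/negP.
move: key; set x := `|_ + _|; set k := L2norm Om d + L2norm Om g => key y0.
have k0 : 0 < k + 1 by rewrite ltr_wpDl // addr_ge0.
have := key (x / (k + 1)) (divr_gt0 y0 k0); rewrite mulrA ler_pdivlMr // => h.
by nra.
Qed.

Lemma grad_interpolation w : V Om w ->
  \sum_(i < 2) L2norm Om (wD Om i w) ^+ 2 <= 2 * (L2norm Om w * normH2 w).
Proof.
move=> [hw2 [hw1 h10]]; have HL := semi_hilbert_L2 oOm.
have each i : L2norm Om (wD Om i w) ^+ 2 <= L2norm Om w * normH2 w.
  have hi := hw2.2 i; have := wDP (hi.2 i).
  have n2 : L2norm Om (wD Om i (wD Om i w)) <= normH2 w.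
    have h1 := wD_le_sobolev oOm (sobolev_base_H1 oOm bOm) w i.
    have h2 := wD_le_sobolev oOm (sobolev_base_L2 oOm) (wD Om i w) i.
    by rewrite L2_ipnorm in h2; exact: le_trans h2 h1.
  move: n2; set g := wD Om i (wD Om i w); set d := wD Om i w => n2 dg.
  have hd : L2 Om d := wD_L2 oOm i w.
  have E : L2ip Om d d = - L2ip Om g w.
    apply: (test_fun_ibp_limit hw1.1 dg hd) => e e0; have [phi tphi lt] := h10 e e0.
    have sphi := test_fun_smooth tphi.
    have {}lt : ipnorm (ipH1 Om) (w - phi) <= e by apply: ltW; rewrite -H1normE.
    exists phi => //; split; apply: le_trans lt.
      exact: (L2norm_le_sobolev oOm (sobolev_base_L2 oOm)).
    exact: (grad_dist_H1 oOm bOm i hw1 sphi).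
  have cs := ip_cauchy_schwarz HL dg.1 hw1.1; rewrite !L2_ipnorm in cs.
  have -> : L2norm Om d ^+ 2 = L2ip Om d d by rewrite -L2_ipnorm (ipnorm_sqr HL).
  rewrite E; apply: le_trans (ler_norm _) _; rewrite normrN; apply: le_trans cs _.
  by rewrite mulrC; apply: ler_wpM2l => //; exact: L2norm_ge0.
by rewrite sum2E mulr_natl mulr2n; apply: lerD.
Qed.

Lemma fine_scale_interpolation w : V Om w -> (forall k, ptval Om w (node (m := M) k) = 0) ->
  L2norm Om w + meshsize M * L2norm Om (enorm \o grad Om w) <= 6 * meshsize M ^+ 2 * Vnorm Om w.
Proof.
move=> hw wn; have [hw2 _] := hw.
have w0 T p : T \in tris M -> p \in T -> ptval Om w p = 0.
  move=> hT hp; have cp := vertex_closure hT hp.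
  (* Interior vertices are nodes; at the remaining vertices the value is 0 by [boundary_zero]. *)
  have [Op|nOp] := pselect (Om p).
    by have /mesh_nodes[k <-] : Om p /\ (exists2 T, T \in tris M & p \in T) by split=> //; exists T.
  have [z [cz zw _]] := continuous_representative oOm bOm cOm r0 boxr hw2.
  rewrite /ptval; case: xgetP => [z' _ [cz' zw']|//].
  exact: (boundary_zero oOm bOm cOm r0 boxr hw cz' zw' cp nOp).
have n1 := fine_scale_estimate oOm bOm cOm r0 boxr hw2 w0.
have n2 := grad_interpolation hw; rewrite -L2norm_grad_sqr // in n2.
rewrite VnormE //; have N0 : 0 <= normH2 w by exact: ipnorm_ge0.
move: n1 n2 N0; set g := L2norm Om (_ \o _); set l := L2norm Om w; set n := normH2 w; set h := meshsize M.
move=> n1 n2 N0; have g0 : 0 <= g by exact: L2norm_ge0.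
(* For a negative [h], which nothing at this point excludes, the gradient term is nonpositive. *)
have [h0|h0] := ltP h 0.
  have : h * g <= 0 by rewrite mulr_le0_ge0 // ltW.
  have : 0 <= h ^+ 2 * n by rewrite mulr_ge0 ?sqr_ge0.
  by move: n1; rewrite -!mulrA; move: (h ^+ 2 * n) (h * g) => a b *; lra.
(* [g ^ 2 <= 2 * l * n] and [l <= 3 * h ^ 2 * n] give [g ^ 2 <= 6 * (h * n) ^ 2]. The constant 6 of
   the conclusion is 3 from [l] plus 3 from [h * g]. *)
have gb : g <= 3 * (h * n).
  apply: le_of_sqr; first by rewrite !mulr_ge0.
  apply: (le_trans n2); have : l * n <= 3 * h ^+ 2 * n * n by apply: ler_wpM2r.
  have -> : (3 * (h * n)) ^+ 2 = 9 * (h ^+ 2 * n * n) by ring.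
  have : 0 <= h ^+ 2 * n * n by rewrite !mulr_ge0 ?sqr_ge0.
  have -> : 3 * h ^+ 2 * n * n = 3 * (h ^+ 2 * n * n) by ring.
  by move: (h ^+ 2 * n * n) (l * n) => a b *; lra.
have : h * g <= h * (3 * (h * n)) by apply: ler_wpM2l.
have -> : h * (3 * (h * n)) = 3 * (h ^+ 2 * n) by ring.
by move: n1; rewrite -!mulrA; move: (h ^+ 2 * n) (h * g) => a b *; lra.
Qed.
End fine_scale.

(** * The quantities of interest *)

Section quantities_of_interest.
Context {R : realType}.
Local Notation pt := (R * R)%type.
Local Notation leb := (@lebesgue_measure R).
Local Notation mR := (measurableTypeR R).
Local Notation pl := (mR * mR)%type.
Implicit Types (f g v w phi psi : pt -> R) (i j : 'I_2) (x y p q z : pt).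

Variable Om : set pt.
Hypothesis oOm : open Om.
Hypothesis bOm : exists L : R, forall x, Om x -> `|x.1| <= L /\ `|x.2| <= L.
Hypothesis cOm : forall x y (t : R), Om x -> Om y -> 0 <= t <= 1 -> Om ((1 - t) *: x + t *: y).
Variables (x0 : pt) (r : R).
Hypothesis r0 : 0 < r.
Hypothesis boxr : box (x0.1 - r) (x0.1 + r) (x0.2 - r) (x0.2 + r) `<=` Om.
Local Notation aeq := (ae_eq leb2 (Om : set pl)).
Local Notation normH2 := (ipnorm (ipH2 Om)).

Local Notation I01 := (`[0%R, 1%R]%classic : set mR).

Local Notation HH2 := (sb_hilbert (sobolev_base_H2 oOm bOm)).
Local Notation HH1 := (sb_hilbert (sobolev_base_H1 oOm bOm)).
Local Notation normH1 := (ipnorm (ipH1 Om)).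

Lemma smoothD_lin i (c : R) phi psi x : smooth phi -> smooth psi ->
  'D_(Defs.basis i) (c *: phi + psi) x = c * 'D_(Defs.basis i) phi x + 'D_(Defs.basis i) psi x.
Proof.
move=> sphi spsi; have d1 : derivable phi x (Defs.basis i) by exact: smooth_derivable.
have d2 : derivable psi x (Defs.basis i) by exact: smooth_derivable.
by rewrite (deriveD (derivableZ d1) d2) (deriveZ _ d1).
Qed.

(** Point values and fluxes are defined through chosen representatives, so their linearity is not
    visible. Both are limits of an explicit functional [l] along smooth approximations and inherit
    linearity and the bound from it. *)
Lemma bounded_functional_limit (l Q : (pt -> R) -> R) (C : R) :
  (forall c phi psi, smooth phi -> smooth psi -> l (c *: phi + psi) = c * l phi + l psi) ->
  (forall phi, smooth phi -> `|l phi| <= C * normH2 phi) ->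
  (forall v (phi : nat -> pt -> R), H2 Om v -> (forall n, smooth (phi n)) ->
    normH2 (phi n - v) @[n --> \oo] --> 0 -> l (phi n) @[n --> \oo] --> Q v) ->
  linear_on (H2 Om) Q /\ forall v, H2 Om v -> `|Q v| <= C * normH2 v.
Proof.
move=> llin lb lQ; split=> [c u v hu hv|v hv].
  have [phi [sphi cphi]] := smooth_dense_H2 oOm bOm cOm r0 boxr hu.
  have [psi [spsi cpsi]] := smooth_dense_H2 oOm bOm cOm r0 boxr hv.
  have sc n : smooth (c *: phi n + psi n) by exact: smooth_lin.
  have huv : H2 Om (c *: u + v) by exact: (semi_hilbert_lin HH2).
  have cc : normH2 (c *: phi n + psi n - (c *: u + v)) @[n --> \oo] --> 0.
    have E0 : `|c| * 0 + 0 = 0 :> R by rewrite mulr0 addr0.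
    have h : `|c| * normH2 (phi n - u) + normH2 (psi n - v) @[n --> \oo] --> 0.
      by rewrite -[X in _ --> X]E0; exact: (cvgD (cvgM (cvg_cst _) cphi) cpsi).
    apply: (squeeze_cvgr _ (cvg_cst 0) h); apply: nearW => n; rewrite ipnorm_ge0 /=.
    have h1 : H2 Om (phi n - u) := semi_hilbertB HH2 (smooth_H2 oOm bOm (sphi n)) hu.
    have h2 : H2 Om (psi n - v) := semi_hilbertB HH2 (smooth_H2 oOm bOm (spsi n)) hv.
    have -> : c *: phi n + psi n - (c *: u + v) = c *: (phi n - u) + (psi n - v).
      by rewrite scalerBr opprD addrACA.
    rewrite -(ipnormZ HH2 c h1); exact: (ipnormD HH2 (semi_hilbertZ HH2 c h1) h2).
  have L1 := lQ _ _ huv sc cc.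
  have L2 : l (c *: phi n + psi n) @[n --> \oo] --> c * Q u + Q v.
    under eq_fun do rewrite llin //.
    by apply: cvgD; [apply: cvgM; [exact: cvg_cst|exact: lQ]|exact: lQ].
  exact: (cvg_unique _ L1 L2).
have [phi [sphi cphi]] := smooth_dense_H2 oOm bOm cOm r0 boxr hv.
have L := lQ v phi hv sphi cphi.
have hp n : H2 Om (phi n) by exact: smooth_H2.
apply: (@ler_cvg_to nat \oo _ R (fun n => `|l (phi n)|) (fun n => C * normH2 (phi n))).
- exact: cvg_norm.
- by apply: cvgM; [exact: cvg_cst|exact: (ipnorm_cvg HH2)].
- by apply: nearW => n; exact: lb.
Qed.

Lemma ptval_bounded p : closure Om p ->
  exists C : R, linear_on (H2 Om) (fun v => ptval Om v p) /\
    forall v, H2 Om v -> `|ptval Om v p| <= C * normH2 v.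
Proof.
move=> cp; have [C C0 hC] := sobolev_pointwise oOm bOm cOm r0 boxr.
exists C; apply: (@bounded_functional_limit (fun phi => phi p)) => //.
- by move=> phi sphi; exact: hC.
- by move=> v phi hv sphi cphi; exact: (ptval_lim oOm bOm cOm r0 boxr hv sphi cphi cp).
Qed.

Lemma wD_dist_H2 v psi i : H2 Om v -> smooth psi ->
  normH1 ('D_(Defs.basis i) psi - wD Om i v) <= normH2 (psi - v).
Proof.
move=> hv spsi; have hpsi := smooth_H2 oOm bOm spsi.
have HB := sobolev_base_H1 oOm bOm.
have hv' : sobolev_step Om (H1 Om) v by rewrite -H2E.
have hpsi' : sobolev_step Om (H1 Om) psi by rewrite -H2E.
have h1 : H1 Om (wD Om i v) := hv.2 i.
have h2 : H1 Om (wD Om i psi) := hpsi.2 i.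
have h3 : H1 Om ('D_(Defs.basis i) psi) := smooth_H1 oOm bOm (smoothD_i i spsi).
have e1 := wD_le_sobolev oOm HB (psi - v) i; rewrite (norm_wDB oOm bOm HB i hpsi' hv') in e1.
apply: le_trans e1; rewrite le_eqVlt; apply/orP; left; apply/eqP.
have ae : aeq ('D_(Defs.basis i) psi) (wD Om i psi).
  by apply/aeq_sym/(wD_ae oOm bOm); exact: is_wD_smooth.
move: h1 h2 h3 ae; move: (wD Om i v) (wD Om i psi) ('D_(Defs.basis i) psi) => a b d h1 h2 h3 ae.
apply: (sb_norm_ae HB); first exact: (semi_hilbertB HH1).
  by apply: (semi_hilbertB (semi_hilbert_L2 oOm)); [case: h3|case: h1].
by apply/aeq_sym/aeqB => //; exact: aeW.
Qed.

Section edge.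
Variables (p q : pt).
Hypotheses (cp : closure Om p) (cq : closure Om q) (pq : p != q).
Local Notation F := (p, q).
Let mI : measurable I01 := measurable_itv _.
Local Notation norm1 := (Lpnorm leb 2%:E I01).

Lemma trace_cauchy (psi : nat -> pt -> R) g : H1 Om g -> (forall n, smooth (psi n)) ->
  normH1 (psi n - g) @[n --> \oo] --> 0 ->
  exists2 tau, inLp leb 2%:E I01 tau & norm1 ((psi n \o seg_at F) \- tau) @[n --> \oo] --> 0.
Proof.
move=> hg spsi cpsi; have [C C0 hC] := segment_trace oOm bOm cOm r0 boxr cp cq pq.
have hp n : H1 Om (psi n) by exact: smooth_H1.
have [||tau htau ltau] := @complete_L2 _ mR R leb I01 mI (fun n => psi n \o seg_at F).
- by move=> n; exact: (hC _ (spsi n)).1.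
- move=> e e0; have C1 : 0 < C + 1 by rewrite ltr_wpDl.
  have e1 : 0 < e / (C + 1) / 2 by rewrite !divr_gt0.
  have /cvgrPdist_le/(_ _ e1)[N _ hN] := cpsi; exists N => m n Nm Nn.
  have sm (k : nat) : (N <= k)%N -> normH1 (psi k - g) <= e / (C + 1) / 2.
    by move=> /hN; rewrite sub0r normrN ger0_norm ?ipnorm_ge0.
  have := (hC _ (smoothB (spsi m) (spsi n))).2; move=> /le_trans; apply.
  have b : normH1 (psi m - psi n) <= e / (C + 1).
    apply: le_trans (ipnorm_dist HH1 (hp m) hg (hp n)) _.
    by rewrite (ipnormB HH1 hg (hp n)) [leRHS]splitr; apply: lerD; exact: sm.
  apply: le_trans (ler_wpM2l C0 b) _; rewrite mulrA ler_pdivrMr // mulrC.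
  by apply: ler_wpM2l; [exact: ltW|rewrite lerDl].
by exists tau.
Qed.

(** The chosen trace comes with one approximating sequence [phi]; the bound of [segment_trace] for
    [psi n - phi n] carries its limit over to any other sequence. *)
Lemma trace_lim (psi : nat -> pt -> R) g : H1 Om g -> (forall n, smooth (psi n)) ->
  normH1 (psi n - g) @[n --> \oo] --> 0 ->
  inLp leb 2%:E I01 (trace Om F g) /\
  norm1 ((psi n \o seg_at F) \- trace Om F g) @[n --> \oo] --> 0.
Proof.
move=> hg spsi cpsi; have [tau htau ltau] := trace_cauchy hg spsi cpsi.
have tr : is_trace Om F g tau.
  split=> //; exists psi; split=> //; have -> : (fun n => H1norm Om (psi n \- g)) = (fun n => normH1 (psi n - g)).
    by apply/funext => n; rewrite -H1normE.
  exact: cpsi.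
have [h [phi [sphi cphi lphi]]] : is_trace Om F g (trace Om F g) by exact: (xgetI (cst 0) tr).
split=> //; have [C C0 hC] := segment_trace oOm bOm cOm r0 boxr cp cq pq.
have {}cphi : normH1 (phi n - g) @[n --> \oo] --> 0.
  have -> : (fun n => normH1 (phi n - g)) = (fun n => H1norm Om (phi n \- g)).
    by apply/funext => n; rewrite -H1normE.
  exact: cphi.
have E0 : C * (0 + 0) + 0 = 0 :> R by rewrite !addr0 mulr0.
have cb : C * (normH1 (psi n - g) + normH1 (phi n - g)) + norm1 ((phi n \o seg_at F) \- trace Om F g)
    @[n --> \oo] --> 0.
  rewrite -[X in _ --> X]E0; apply: cvgD; last exact: lphi.
  apply: cvgM; first exact: cvg_cst.
  exact: (cvgD cpsi cphi).
apply: (squeeze_cvgr _ (cvg_cst 0) cb); apply: nearW => n; rewrite Lpnorm_ge0 /=.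
have h1 : H1 Om (psi n) by exact: smooth_H1.
have h2 : H1 Om (phi n) by exact: smooth_H1.
have [k1 k2] := hC _ (smoothB (spsi n) (sphi n)).
have -> : (psi n \o seg_at F) \- trace Om F g
   = (fun t => ((psi n - phi n) \o seg_at F) t + ((phi n \o seg_at F) \- trace Om F g) t).
  by apply/funext => t; rewrite /= addrA; congr (_ - _); exact: esym (subrK _ _).
apply: le_trans (Lpnorm2D mI k1 _) _.
  exact: (inLp2B mI (hC _ (sphi n)).1 h).
have k3 : normH1 (psi n - phi n) <= normH1 (psi n - g) + normH1 (phi n - g).
  by rewrite -(ipnormB HH1 hg h2); exact: (ipnorm_dist HH1 h1 hg h2).
exact: (lerD (le_trans k2 (ler_wpM2l C0 k3)) (lexx _)).
Qed.

Lemma one_L2 : inLp leb 2%:E I01 (cst 1 : mR -> R) /\ norm1 (cst 1) <= 1.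
Proof.
apply: (@inLp2_bound _ mR R leb I01 mI (cst 1) 1) => //.
under eq_integral do rewrite expr1n.
by rewrite [X in (X <= _)%E](integral_cst leb mI 1%E) mul1e [X in (X <= _)%E]leb_I01 expr1n.
Qed.

Lemma integral_L2_line (f : R -> R) : inLp leb 2%:E I01 f ->
  `|\int[leb]_(t in I01) (f t * cst 1 t)| <= norm1 f.
Proof.
move=> hf; have h1 := one_L2.
apply: le_trans (cauchy_schwarz_L2 mI hf h1.1) _.
by rewrite ler_piMr ?Lpnorm_ge0 //; exact: h1.2.
Qed.

Lemma mean_flux_bounded nu : exists C : R, linear_on (H2 Om) (fun v => mean_flux Om F nu v) /\
  forall v, H2 Om v -> `|mean_flux Om F nu v| <= C * normH2 v.
Proof.
have [C C0 hC] := segment_trace oOm bOm cOm r0 boxr cp cq pq.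
have [hone _] := one_L2.
(* The factor [cst 1] makes [J] an L^2 product on [0, 1], to which the linearity and Cauchy-Schwarz
   lemmas apply. *)
pose J (f : R -> R) := \int[leb]_(t in I01) (f t * cst 1 t).
have Jlin c (f g : R -> R) : inLp leb 2%:E I01 f -> inLp leb 2%:E I01 g ->
    J (fun t => c * f t + g t) = c * J f + J g.
  by move=> hf hg; exact: (RintegralM_linl mI).
(* For smooth functions this is the mean flux: the length of the segment cancels under the
   parametrization by [0, 1]. *)
pose l phi := nu.1 * J ('D_(Defs.basis ord0) phi \o seg_at F)
            + nu.2 * J ('D_(Defs.basis ord_max) phi \o seg_at F).
have hD phi i : smooth phi -> inLp leb 2%:E I01 ('D_(Defs.basis i) phi \o seg_at F).
  by move=> sphi; exact: (hC _ (smoothD_i i sphi)).1.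
exists ((`|nu.1| + `|nu.2|) * C); apply: (@bounded_functional_limit l).
- move=> c phi psi sphi spsi; have E i : 'D_(Defs.basis i) (c *: phi + psi) \o seg_at F
      = (fun t => c * ('D_(Defs.basis i) phi \o seg_at F) t + ('D_(Defs.basis i) psi \o seg_at F) t).
    by apply/funext => t; exact: smoothD_lin.
  have E' i : J ('D_(Defs.basis i) (c *: phi + psi) \o seg_at F)
      = c * J ('D_(Defs.basis i) phi \o seg_at F) + J ('D_(Defs.basis i) psi \o seg_at F).
    by rewrite E; exact: (Jlin c _ _ (hD _ i sphi) (hD _ i spsi)).
  have alg (A B A' B' : R) : nu.1 * (c * A + B) + nu.2 * (c * A' + B')
      = c * (nu.1 * A + nu.2 * A') + (nu.1 * B + nu.2 * B') by ring.
  exact: (etrans (congr2 (fun a b => nu.1 * a + nu.2 * b) (E' ord0) (E' ord_max)) (alg _ _ _ _)).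
- move=> phi sphi; have b i : `|J ('D_(Defs.basis i) phi \o seg_at F)| <= C * normH2 phi.
    apply: le_trans (integral_L2_line (hD _ i sphi)) _.
    apply: le_trans (hC _ (smoothD_i i sphi)).2 _; apply: ler_wpM2l => //.
    have h := wD_le_sobolev oOm (sobolev_base_H1 oOm bOm) phi i.
    rewrite (sb_norm_ae (sobolev_base_H1 oOm bOm) (g := 'D_(Defs.basis i) phi)) in h => //.
    + exact: (smooth_H1 oOm bOm (smoothD_i i sphi)).
    + exact: wD_L2.
    + by apply/aeq_sym/(wD_ae oOm bOm); exact: is_wD_smooth.
  have alg (a b' K : R) : `|a| <= K -> `|b'| <= K -> `|nu.1 * a + nu.2 * b'| <= (`|nu.1| + `|nu.2|) * K.
    move=> ha hb; apply: le_trans (ler_normD _ _) _.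
    by rewrite !normrM mulrDl; apply: lerD; apply: ler_wpM2l.
  by rewrite -mulrA; exact: (alg _ _ _ (b ord0) (b ord_max)).
move=> v phi hv sphi cphi.
have T i : inLp leb 2%:E I01 (trace Om F (wD Om i v)) /\
    norm1 (('D_(Defs.basis i) (phi n) \o seg_at F) \- trace Om F (wD Om i v)) @[n --> \oo] --> 0.
  apply: trace_lim; [exact: hv.2|by move=> n; exact: smoothD_i|].
  apply: (squeeze_cvgr _ (cvg_cst 0) cphi); apply: nearW => n.
  by rewrite ipnorm_ge0 /=; exact: wD_dist_H2.
have [h0 t0] := T ord0; have [h1 t1] := T ord_max.
have JT i (tau : R -> R) : inLp leb 2%:E I01 tau ->
    norm1 (('D_(Defs.basis i) (phi n) \o seg_at F) \- tau) @[n --> \oo] --> 0 ->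
    J ('D_(Defs.basis i) (phi n) \o seg_at F) @[n --> \oo] --> J tau.
  move=> ht lt; apply/cvgrPdist_le => e e0; have /cvgrPdist_le/(_ _ e0) := lt.
  apply: filterS => n; rewrite sub0r normrN ger0_norm ?Lpnorm_ge0 // => h; apply: le_trans h.
  have hd := hD _ i (sphi n).
  have -> : J tau - J ('D_(Defs.basis i) (phi n) \o seg_at F)
      = - J (('D_(Defs.basis i) (phi n) \o seg_at F) \- tau).
    have := Jlin (-1) _ _ ht hd; rewrite mulN1r.
    have -> : (fun t => -1 * tau t + ('D_(Defs.basis i) (phi n) \o seg_at F) t)
      = ('D_(Defs.basis i) (phi n) \o seg_at F) \- tau by apply/funext => t; rewrite mulN1r addrC.
    by move=> ->; rewrite opprD opprK.
  by rewrite normrN; apply: integral_L2_line; exact: inLp2B.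
have -> : mean_flux Om F nu v = nu.1 * J (trace Om F (wD Om ord0 v)) + nu.2 * J (trace Om F (wD Om ord_max v)).
  have len : seg_len F != 0.
    rewrite /seg_len; apply: contra_neq pq => /(congr1 (fun z : R => z ^+ 2)); rewrite enorm_sqr expr0n /=.
    move=> /eqP; rewrite paddr_eq0 ?sqr_ge0 // !sqrf_eq0 !subr_eq0 => /andP[/eqP e1 /eqP e2].
    by apply/esym/pair_eq.
  rewrite /mean_flux mulrA mulVf // mul1r.
  have z : inLp leb 2%:E I01 (cst 0 : mR -> R) := inLp20 leb mI.
  have J0 : J (cst 0) = 0.
    by rewrite /J /=; under eq_Rintegral do rewrite mul0r; rewrite Rintegral_cst // mul0r.
  have alg (f g : R -> R) : inLp leb 2%:E I01 f -> inLp leb 2%:E I01 g ->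
      \int[leb]_(t in I01) dot (f t, g t) nu = nu.1 * J f + nu.2 * J g.
    move=> hf hg; have E2 : J (fun t => nu.2 * g t + cst 0 t) = nu.2 * J g.
      by rewrite Jlin // J0 addr0.
    rewrite -E2 -Jlin //; last exact: inLp2_lin.
    by apply: eq_Rintegral => t _; rewrite /dot /= mulr1 addr0 mulrC [g t * _]mulrC.
  exact: alg _ _ h0 h1.
exact: (cvgD (cvgM (cvg_cst nu.1) (JT ord0 _ h0 t0)) (cvgM (cvg_cst nu.2) (JT ord_max _ h1 t1))).
Qed.

End edge.

Lemma qoi_bounded (M : mesh Om) (i : 'I_(nqoi M)) : exists C : R, linear_on (H2 Om) (qoi i) /\
  forall v, H2 Om v -> `|qoi i v| <= C * normH2 v.
Proof.
rewrite /qoi; case: (fintype.split i) => [e|k]; last first.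
  have /mesh_nodes[_ [T hT pT]] : exists k', node (m := M) k' = node k by exists k.
  exact: (ptval_bounded (vertex_closure hT pT)).
case E : (edge e) => [p q].
have /mesh_edges[T hT [pT qT pq]] : exists i : 'I_(nedges M), edge i = (p, q) \/ edge i = (q, p).
  by exists e; left.
exact: (mean_flux_bounded (vertex_closure hT pT) (vertex_closure hT qT) pq).
Qed.

(** [W] is an intersection of kernels of bounded functionals, hence closed; this makes Lax-Milgram
    applicable to the corrector problems. *)
Lemma semi_hilbert_W (M : mesh Om) : semi_hilbert (ipH2 Om) (@W R Om M).
Proof.
have HV := semi_hilbert_V oOm bOm; apply: (semi_hilbert_closed HV).
- by move=> v [].
- split=> [|i]; first exact: (semi_hilbert0 HV).
  have [C [_ b]] := qoi_bounded i; have := b 0 (semi_hilbert0 HH2).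
  by rewrite (ipnorm0 HH2) mulr0 normr_le0 => /eqP.
- move=> c x y [hx qx] [hy qy]; split=> [|i]; first exact: (semi_hilbert_lin HV).
  have [C [lin _]] := qoi_bounded i; rewrite lin; [|exact: hx.1|exact: hy.1].
  by rewrite qx qy mulr0 addr0.
move=> u l Wu Vl ul; split=> // i; have [C [lin b]] := qoi_bounded i.
have e n : `|qoi i l| <= C * normH2 (u n - l).
  have hu : H2 Om (u n) := (Wu n).1.1; have hl : H2 Om l := Vl.1.
  have := linear_onB lin hu hl; rewrite (Wu n).2 sub0r => E.
  by rewrite -normrN -E; apply: b; exact: (semi_hilbertB HH2).
have : `|qoi i l| <= 0.
  rewrite -(mulr0 C); apply: (@ler_cvg_to nat \oo _ R (fun=> `|qoi i l|) (fun n => C * normH2 (u n - l))).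
  - exact: cvg_cst.
  - by apply: cvgM => //; exact: cvg_cst.
  - exact: nearW.
by rewrite normr_le0 => /eqP.
Qed.
End quantities_of_interest.

(** * The operator *)

Section operator.
Context {R : realType}.
Local Notation pt := (R * R)%type.
Local Notation mR := (measurableTypeR R).
Local Notation pl := (mR * mR)%type.
Implicit Types (f g v w phi psi : pt -> R) (i j : 'I_2) (x y p q z : pt).

Variable Om : set pt.
Hypothesis oOm : open Om.
Hypothesis bOm : exists L : R, forall x, Om x -> `|x.1| <= L /\ `|x.2| <= L.
Local Notation mOm := (measurable_domain oOm).
Local Notation aeq := (ae_eq leb2 (Om : set pl)).

Lemma ae_mono2 (P Q S : pt -> Prop) : {ae @leb2 R, forall x, P x} -> {ae @leb2 R, forall x, Q x} ->
  (forall x, P x -> Q x -> S x) -> {ae @leb2 R, forall x, S x}.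
Proof.
move=> h1 h2 h; exact: (@filterS2 _ _ (ae_filter_ringOfSetsType (@leb2 R)) _ _ _ h h1 h2).
Qed.

Lemma ae_mono (P S : pt -> Prop) : {ae @leb2 R, forall x, P x} ->
  (forall x, P x -> S x) -> {ae @leb2 R, forall x, S x}.
Proof. by move=> h1 h; apply: (ae_mono2 h1 h1) => x p _; exact: h. Qed.

(** An existential bound is stable under sums, products and quotients without reference to the
    essential supremum. *)
Definition ae_bounded (f : pt -> R) : Prop := measurable_fun (Om : set pl) (f : pl -> R) /\
  exists K : R, {ae leb2, forall x, Om x -> `|f x| <= K}.

Lemma Linf_ae_bounded f : Linf Om f -> ae_bounded f.
Proof.
(* The norm with exponent +oo is an essential supremum only if the whole space has positive measure;
   otherwise any bound holds a.e. *)
move=> [mf]; rewrite unlock /=; case: ifPn => [_|]; last first.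
  rewrite -leNgt => m0 _; split=> //; exists 0.
  have T0 : leb2 (setT : set pl) = 0%E by apply/eqP; rewrite eq_le m0 measure_ge0.
  by exists setT; split=> //; exact: measurableT.
move=> fin; split=> //; set g := (abse \o _) in fin.
have := ess_sup_inf.ess_sup_ge leb2 g; move: fin; move: (ess_sup_inf.ess_sup leb2 g) => [k|//|] _.
  move=> h; exists k; apply: (ae_mono h) => x {}h Ox.
  by move: h; rewrite /g /= patchE mem_set // /= lee_fin.
move=> h; exists 0; apply: (ae_mono h) => x {}h Ox.
by move: h; rewrite /g /= patchE mem_set // /= leNgt ltNyr.
Qed.

Lemma ae_bounded_cst (c : R) : ae_bounded (cst c).
Proof.
split; first exact: measurable_cst.
by exists `|c|; apply: aeW => x _.
Qed.

Lemma ae_boundedD f g : ae_bounded f -> ae_bounded g -> ae_bounded (fun x => f x + g x).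
Proof.
move=> [mf [K hf]] [mg [L hg]]; split; first exact: measurable_funD.
exists (K + L); apply: (ae_mono2 hf hg) => x {}hf {}hg Ox.
by apply: le_trans (ler_normD _ _) _; apply: lerD; [exact: hf|exact: hg].
Qed.

Lemma ae_boundedM f g : ae_bounded f -> ae_bounded g -> ae_bounded (fun x => f x * g x).
Proof.
move=> [mf [K hf]] [mg [L hg]]; split; first exact: measurable_funM.
exists (K * L); apply: (ae_mono2 hf hg) => x {}hf {}hg Ox.
by rewrite normrM; apply: ler_pM => //; [exact: hf|exact: hg].
Qed.

Lemma ae_bounded_L2 f g : ae_bounded f -> L2 Om g -> L2 Om (fun x => f x * g x).
Proof.
move=> [mf [K hf]] hg; have mD : measurable (Om : set pl) := mOm.
have /inLp2P[mg ig] := hg; apply/inLp2P.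
have mfg : measurable_fun (Om : set pl) ((fun x => f x * g x) : pl -> R) by exact: measurable_funM.
split=> //; apply/integrableP; split; first exact: (measurable_sqr mfg).
have m1 : measurable_fun (Om : set pl) (fun x : pl => ((f x * g x) ^+ 2)%:E) := measurable_sqr mfg.
have m2 : measurable_fun (Om : set pl) (fun x : pl => (g x ^+ 2)%:E) := measurable_sqr mg.
under eq_integral do rewrite /= ger0_norm ?sqr_ge0 //.
apply: (@le_lt_trans _ _ (\int[leb2]_(x in Om) ((K ^+ 2)%:E * (g x ^+ 2)%:E))%E).
  apply: ae_ge0_le_integral => //.
  - by move=> x _; rewrite lee_fin sqr_ge0.
  - by move=> x _; rewrite mule_ge0 ?lee_fin ?sqr_ge0.
  - exact: emeasurable_funM.
  apply: (ae_mono hf) => x {}hf Ox; rewrite -EFinM lee_fin exprMn.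
  apply: ler_wpM2r; first exact: sqr_ge0.
  have h := hf Ox; have K0 : 0 <= K := le_trans (normr_ge0 _) h.
  by rewrite -[f x ^+ 2]real_normK ?num_real // ler_sqr ?nnegrE.
rewrite ge0_integralZl //; last 2 first.
- by move=> x _; rewrite lee_fin sqr_ge0.
- by rewrite lee_fin sqr_ge0.
rewrite (integral_sqrE mD hg) -EFinM; exact: ltry.
Qed.

Section coefficients.
Variables (D : @coeffs R) (zeta1 zeta2 delta lam : R).
Hypothesis adm : admissible Om D zeta1 zeta2 delta lam.

Lemma ae_bounded_A i j : ae_bounded (fun x => cA D x i j).
Proof. exact/Linf_ae_bounded/(adm_A adm). Qed.

Lemma ae_bounded_c : ae_bounded (cc D).
Proof. exact/Linf_ae_bounded/(adm_c adm). Qed.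

Lemma ae_bounded_b1 : ae_bounded (fun x => (cb D x).1).
Proof. exact/Linf_ae_bounded/(adm_b adm ord0). Qed.

Lemma ae_bounded_b2 : ae_bounded (fun x => (cb D x).2).
Proof. exact/Linf_ae_bounded/(adm_b adm ord_max). Qed.

Lemma ae_bounded_sqr f : ae_bounded f -> ae_bounded (fun x => f x ^+ 2).
Proof. by move=> hf; exact: ae_boundedM. Qed.

Lemma ae_bounded_div f g (k : R) : ae_bounded f -> ae_bounded g -> (forall x, 0 <= g x) -> 0 < k ->
  {ae leb2, forall x, Om x -> k <= g x} -> ae_bounded (fun x => f x / g x).
Proof.
move=> hf [mg _] g0 k0 gk; apply: (ae_boundedM hf); split.
  (* Measurability of the inverse is drawn from that of the power -1, which agrees with it on
     nonnegative reals. *)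
  have -> : (fun x => (g x)^-1) = (fun x => (g x) `^ (-1)).
    by apply/funext => x; rewrite powR_inv1.
  exact: (measurableT_comp (measurable_powR (-1)) mg).
exists k^-1; apply: (ae_mono gk) => x {}gk Ox.
by rewrite normfV ger0_norm ?g0 // lef_pV2 ?posrE ?gk //; exact: lt_le_trans (gk Ox).
Qed.

(** Ellipticity in the direction (1, 0) bounds one diagonal entry from below by [zeta1]. This keeps
    the denominator of [gamma] away from 0. *)
Lemma elliptic_frob : {ae leb2, forall x, Om x -> zeta1 ^+ 2 <= frob (cA D x) ^+ 2}.
Proof.
have [z1 _] := adm_zeta adm; apply: (ae_mono (adm_elliptic adm)) => x ell Ox.
have /andP[h _] := ell Ox (1, 0); rewrite frob_sqr; move: h.
rewrite enorm_sqr !sum2E /coord /= !mulr0 !mulr1 !addr0 expr1n expr0n addr0 mulr1 => h.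
apply: (@le_trans _ _ (cA D x ord0 ord0 ^+ 2)).
  by rewrite ler_sqr ?nnegrE ?(ltW z1) // (le_trans (ltW z1)).
by rewrite -!addrA lerDl !addr_ge0 ?sqr_ge0.
Qed.

Lemma lam_cases : lam = 0 \/ 0 < lam.
Proof. by case: (adm_cordes adm) => _ [[_ -> _]|[_ l0 _]]; [left|right]. Qed.

Lemma ae_bounded_gamma : ae_bounded (gamma D lam).
Proof.
have [z1 _] := adm_zeta adm.
have hf : ae_bounded (fun x => frob (cA D x) ^+ 2).
  have -> : (fun x => frob (cA D x) ^+ 2) = (fun x => cA D x ord0 ord0 ^+ 2 + cA D x ord0 ord_max ^+ 2
     + (cA D x ord_max ord0 ^+ 2 + cA D x ord_max ord_max ^+ 2)).
    by apply/funext => x; rewrite frob_sqr.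
  by apply: ae_boundedD; apply: ae_boundedD; apply: ae_bounded_sqr; exact: ae_bounded_A.
have ht : ae_bounded (fun x => \tr (cA D x)).
  have -> : (fun x => \tr (cA D x)) = (fun x => cA D x ord0 ord0 + cA D x ord_max ord_max).
    by apply/funext => x; rewrite /mxtrace sum2E.
  by apply: ae_boundedD; exact: ae_bounded_A.
have z2 : 0 < zeta1 ^+ 2 by rewrite exprn_gt0.
case: lam_cases => [l0|l0].
  have -> : gamma D lam = (fun x => \tr (cA D x) / frob (cA D x) ^+ 2).
    by apply/funext => x; rewrite /gamma l0 eqxx.
  apply: (ae_bounded_div ht hf) z2 elliptic_frob => x; exact: sqr_ge0.
have l2 : 0 <= (2 * lam)^-1 by rewrite invr_ge0 mulr_ge0 // ltW.
have l3 : 0 <= (lam ^+ 2)^-1 by rewrite invr_ge0 sqr_ge0.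
have -> : gamma D lam = (fun x => (\tr (cA D x) + lam^-1 * cc D x)
       / (frob (cA D x) ^+ 2 + (2 * lam)^-1 * enorm (cb D x) ^+ 2
          + (lam ^+ 2)^-1 * cc D x ^+ 2)).
  by apply/funext => x; rewrite /gamma gt_eqF.
have mulc c g : ae_bounded g -> ae_bounded (fun x => c * g x).
  by move=> hg; apply: (ae_boundedM (ae_bounded_cst c)).
apply: (ae_bounded_div (k := zeta1 ^+ 2)) => //.
- by apply: ae_boundedD => //; apply: mulc; exact: ae_bounded_c.
- apply: ae_boundedD; last by apply/mulc/ae_bounded_sqr; exact: ae_bounded_c.
  apply: ae_boundedD => //; apply: mulc.
  have -> : (fun x => enorm (cb D x) ^+ 2) = (fun x => (cb D x).1 ^+ 2 + (cb D x).2 ^+ 2).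
    by apply/funext => x; rewrite enorm_sqr.
  by apply: ae_boundedD; apply: ae_bounded_sqr; [exact: ae_bounded_b1|exact: ae_bounded_b2].
- by move=> x; rewrite !addr_ge0 ?sqr_ge0 // mulr_ge0 ?sqr_ge0.
apply: (ae_mono elliptic_frob) => x h Ox; apply: (le_trans (h Ox)).
by rewrite -addrA lerDl addr_ge0 // mulr_ge0 ?sqr_ge0.
Qed.

Lemma hess_lin i j (c : R) u v : H2 Om u -> H2 Om v ->
  aeq (wD Om j (wD Om i (c *: u + v))) (fun x => c * wD Om j (wD Om i u) x + wD Om j (wD Om i v) x).
Proof.
move=> hu hv; have HB := sobolev_base_H1 oOm bOm.
have hu' : sobolev_step Om (H1 Om) u by rewrite -H2E.
have hv' : sobolev_step Om (H1 Om) v by rewrite -H2E.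
have hw : H2 Om (c *: u + v) := semi_hilbert_lin (sb_hilbert (sobolev_base_H2 oOm bOm)) c hu hv.
have E := wD_lin oOm bOm i c hu' hv'.
have := hw.2 i; have := hu.2 i; have := hv.2 i; move: E.
move: (wD Om i (c *: u + v)) (wD Om i u) (wD Om i v) => g a b E hb ha hg.
have da := wDP (ha.2 j); have db := wDP (hb.2 j).
have d := is_wD_lin oOm bOm c ha.1 hb.1 da db.
apply: (wD_ae oOm bOm); have hl : L2 Om (fun x => c * a x + b x) := inLp2_lin mOm c ha.1 hb.1.
exact: (is_wD_ae oOm bOm hl hg.1 d.1 (aeq_sym E) (aeW _ (fun _ _ => erefl)) d).
Qed.

Lemma lapl_lin (c : R) u v : H2 Om u -> H2 Om v ->
  aeq (lapl Om (c *: u + v)) (fun x => c * lapl Om u x + lapl Om v x).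
Proof.
move=> hu hv; have lE w x : lapl Om w x = wD Om ord0 (wD Om ord0 w) x + wD Om ord_max (wD Om ord_max w) x.
  by rewrite /lapl /mxtrace sum2E !mxE.
have h0 := hess_lin ord0 ord0 c hu hv; have h1 := hess_lin ord_max ord_max c hu hv.
apply: (ae_mono2 h0 h1) => x e0 e1 Ox; rewrite !lE (e0 Ox) (e1 Ox).
have alg (a b d e : R) : c * a + b + (c * d + e) = c * (a + d) + (b + e) by ring.
exact: alg.
Qed.

Lemma hess_L2 i j v : L2 Om (wD Om j (wD Om i v)).
Proof. exact: wD_L2. Qed.

Lemma test_side_L2 v : H2 Om v -> L2 Om (fun x => lapl Om v x - lam * v x).
Proof.
move=> hv; have lE : (fun x => lapl Om v x - lam * v x)
    = (fun x => - lam * v x + (1 * wD Om ord0 (wD Om ord0 v) x + wD Om ord_max (wD Om ord_max v) x)).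
  by apply/funext => x; rewrite /lapl /mxtrace sum2E !mxE mul1r mulNr addrC.
rewrite lE; apply: (inLp2_lin mOm); first exact: hv.1.1.
by apply: (inLp2_lin mOm); exact: hess_L2.
Qed.

Lemma test_side_lin (c : R) u v : H2 Om u -> H2 Om v ->
  aeq (fun x => lapl Om (c *: u + v) x - lam * (c *: u + v) x)
    (fun x => c * (lapl Om u x - lam * u x) + (lapl Om v x - lam * v x)).
Proof.
move=> hu hv; apply: (ae_mono (lapl_lin c hu hv)) => x E Ox; rewrite (E Ox).
have alg (a b k p q : R) : c * a + b - k * (c * p + q) = c * (a - k * p) + (b - k * q) by ring.
exact: alg.
Qed.

Let opE v x : gamma D lam x * Lop Om D v x
  = gamma D lam x * ((cA D x ord0 ord0 * wD Om ord0 (wD Om ord0 v) x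
     + cA D x ord0 ord_max * wD Om ord_max (wD Om ord0 v) x
     + (cA D x ord_max ord0 * wD Om ord0 (wD Om ord_max v) x
     + cA D x ord_max ord_max * wD Om ord_max (wD Om ord_max v) x))
   + ((cb D x).1 * wD Om ord0 v x + (cb D x).2 * wD Om ord_max v x) - cc D x * v x).
Proof. by rewrite /Lop /mdot !sum2E !mxE. Qed.

Lemma trial_side_L2 v : H2 Om v -> L2 Om (fun x => gamma D lam x * Lop Om D v x).
Proof.
move=> hv; under eq_fun do rewrite opE; apply: (ae_bounded_L2 ae_bounded_gamma).
have hA i j k l : L2 Om (fun x => cA D x i j * wD Om k (wD Om l v) x).
  by apply: (ae_bounded_L2 (ae_bounded_A i j)); exact: hess_L2.
apply: (inLp2B mOm); last by apply: (ae_bounded_L2 ae_bounded_c); exact: hv.1.1.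
apply: (inLp2D mOm).
  by apply: (inLp2D mOm); apply: (inLp2D mOm); exact: hA.
apply: (inLp2D mOm); [apply: (ae_bounded_L2 ae_bounded_b1)|apply: (ae_bounded_L2 ae_bounded_b2)];
  exact: wD_L2.
Qed.

Lemma trial_side_lin (c : R) u v : H2 Om u -> H2 Om v ->
  aeq (fun x => gamma D lam x * Lop Om D (c *: u + v) x)
    (fun x => c * (gamma D lam x * Lop Om D u x) + gamma D lam x * Lop Om D v x).
Proof.
move=> hu hv; have HB := sobolev_base_L2 oOm.
have hu1 : sobolev_step Om (L2 Om) u by rewrite -H1E //; exact: hu.1.
have hv1 : sobolev_step Om (L2 Om) v by rewrite -H1E //; exact: hv.1.
have g0 := wD_lin oOm bOm ord0 c hu1 hv1; have g1 := wD_lin oOm bOm ord_max c hu1 hv1.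
have h00 := hess_lin ord0 ord0 c hu hv; have h01 := hess_lin ord0 ord_max c hu hv.
have h10 := hess_lin ord_max ord0 c hu hv; have h11 := hess_lin ord_max ord_max c hu hv.
have g01 := ae_mono2 g0 g1 (fun x a b => conj a b).
have h0 := ae_mono2 h00 h01 (fun x a b => conj a b).
have h1 := ae_mono2 h10 h11 (fun x a b => conj a b).
have h := ae_mono2 h0 h1 (fun x a b => conj a b).
apply: (ae_mono2 g01 h) => x [a b] [[d e] [f k]] Ox.
have alg (g A1 A2 A3 A4 b1 b2 cx u1 u2 u3 u4 u5 u6 u7 v1 v2 v3 v4 v5 v6 v7 w1 w2 w3 w4 w5 w6 w7 : R) :
  w1 = c * u1 + v1 -> w2 = c * u2 + v2 -> w3 = c * u3 + v3 -> w4 = c * u4 + v4 ->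
  w5 = c * u5 + v5 -> w6 = c * u6 + v6 -> w7 = c * u7 + v7 ->
  g * (A1 * w1 + A2 * w2 + (A3 * w3 + A4 * w4) + (b1 * w5 + b2 * w6) - cx * w7)
  = c * (g * (A1 * u1 + A2 * u2 + (A3 * u3 + A4 * u4) + (b1 * u5 + b2 * u6) - cx * u7))
    + g * (A1 * v1 + A2 * v2 + (A3 * v3 + A4 * v4) + (b1 * v5 + b2 * v6) - cx * v7).
  by move=> -> -> -> -> -> -> ->; ring.
have E7 : (c *: u + v) x = c * u x + v x by [].
exact: (etrans (opE _ _) (etrans (alg _ _ _ _ _ _ _ _ _ _ _ _ _ _ _ _ _ _ _ _ _ _ _ _ _ _ _ _ _
  (d Ox) (e Ox) (f Ox) (k Ox) (a Ox) (b Ox) E7)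
  (congr2 (fun a b => c * a + b) (esym (opE u x)) (esym (opE v x))))).
Qed.

Lemma V_H2 v : V Om v -> H2 Om v. Proof. by case. Qed.

(** Weak derivatives are linear only a.e., but integrals do not see null sets, so the form is
    bilinear without exception. *)
Lemma a_form_bilinear : bilinear_on (V Om) (a_form Om D lam).
Proof.
have HV := semi_hilbert_V oOm bOm; have HL := semi_hilbert_L2 oOm.
split=> z /V_H2 hz c u v Vu Vv; have [hu hv] := (V_H2 Vu, V_H2 Vv);
  have hw := V_H2 (semi_hilbert_lin HV c Vu Vv).
  have tz := trial_side_L2 hz; have tu := test_side_L2 hu; have tv := test_side_L2 hv.
  have tw := test_side_L2 hw; have E := test_side_lin c hu hv.
  have tl := inLp2_lin mOm c tu tv.
  transitivity (L2ip Om (fun x => c * (lapl Om u x - lam * u x) + (lapl Om v x - lam * v x))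
      (fun x => gamma D lam x * Lop Om D z x)).
    rewrite /a_form (semi_hilbert_sym HL); exact: (L2ip_ae oOm tw tl tz E).
  rewrite (L2ip_linl oOm c tu tv tz) /a_form.
  exact: (congr2 (fun a b => c * a + b) (semi_hilbert_sym HL _ _) (semi_hilbert_sym HL _ _)).
have tz := test_side_L2 hz; have tu := trial_side_L2 hu; have tv := trial_side_L2 hv.
have tw := trial_side_L2 hw; have E := trial_side_lin c hu hv.
have tl := inLp2_lin mOm c tu tv.
exact: (etrans (L2ip_ae oOm tw tl tz E) (L2ip_linl oOm c tu tv tz)).
Qed.

Lemma F_form_linear f : L2 Om f -> linear_on (V Om) (F_form Om D lam f).
Proof.
move=> hf; have HV := semi_hilbert_V oOm bOm; have HL := semi_hilbert_L2 oOm.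
move=> c u v Vu Vv; have [hu hv] := (V_H2 Vu, V_H2 Vv).
have hw := V_H2 (semi_hilbert_lin HV c Vu Vv).
have tz := ae_bounded_L2 ae_bounded_gamma hf.
have tu := test_side_L2 hu; have tv := test_side_L2 hv.
have tw := test_side_L2 hw; have E := test_side_lin c hu hv.
have tl := inLp2_lin mOm c tu tv.
transitivity (L2ip Om (fun x => c * (lapl Om u x - lam * u x) + (lapl Om v x - lam * v x))
    (fun x => gamma D lam x * f x)).
  rewrite /F_form (semi_hilbert_sym HL); exact: (L2ip_ae oOm tw tl tz E).
rewrite (L2ip_linl oOm c tu tv tz) /F_form.
exact: (congr2 (fun a b => c * a + b) (semi_hilbert_sym HL _ _) (semi_hilbert_sym HL _ _)).
Qed.

Lemma strong_solution_weak f u v : L2 Om f -> strong_solution Om D f u -> V Om v ->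
  a_form Om D lam u v = F_form Om D lam f v.
Proof.
move=> hf [Vu uf] Vv; have tz := test_side_L2 (V_H2 Vv).
have tu := trial_side_L2 (V_H2 Vu); have tf := ae_bounded_L2 ae_bounded_gamma hf.
apply: (L2ip_ae oOm tu tf tz); have uf' : aeq (Lop Om D u) f := uf.
by apply: (ae_mono uf') => x E Ox; rewrite (E Ox).
Qed.
End coefficients.
End operator.

(** * The multiscale method *)

Section petrov_galerkin.
Context {R : realType} {E : lmodType R}.
Variables (ip : E -> E -> R) (V W : set E) (a : E -> E -> R) (F : E -> R) (al ca K : R).
Variables (C C' : E -> E).
Hypotheses (HV : semi_hilbert ip V) (HW : semi_hilbert ip W) (WV : W `<=` V).
Hypotheses (abil : bilinear_on V a) (Flin : linear_on V F) (al0 : 0 < al) (ca0 : 0 < ca) (K0 : 0 <= K).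
Hypothesis abnd : forall x y, V x -> V y -> `|a x y| <= ca * ipnorm ip x * ipnorm ip y.
Hypothesis acoer : forall x, V x -> al * ipnorm ip x ^+ 2 <= a x x.
Hypothesis Fbnd : forall x, V x -> `|F x| <= K * ipnorm ip x.
Local Notation norm := (ipnorm ip).

Lemma corrector_exists v : V v -> exists c, W c /\ forall w, W w -> a c w = a v w.
Proof.
move=> Vv.
have bil : bilinear_on W a.
  by split=> z Wz c x y Wx Wy; [apply: abil.1|apply: abil.2]; exact: WV.
have lin : linear_on W (a v) by move=> c x y Wx Wy; apply: abil.1 => //; exact: WV.
have [c Wc hc] := lax_milgram HW bil lin al0 (fun x y Wx Wy => abnd (WV Wx) (WV Wy))
  (fun x Wx => acoer (WV Wx)) (fun x Wx => abnd Vv (WV Wx)).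
by exists c.
Qed.

Lemma adjoint_corrector_exists v : V v -> exists c, W c /\ forall w, W w -> a w c = a w v.
Proof.
move=> Vv.
have bil : bilinear_on W (fun x y => a y x).
  by split=> z Wz c x y Wx Wy; [apply: abil.2|apply: abil.1]; exact: WV.
have lin : linear_on W (a^~ v) by move=> c x y Wx Wy; apply: abil.2 => //; exact: WV.
have bnd x y : W x -> W y -> `|a y x| <= ca * norm x * norm y.
  by move=> Wx Wy; rewrite mulrAC; apply: abnd; exact: WV.
have bnd' x : W x -> `|a x v| <= ca * norm v * norm x.
  by move=> Wx; rewrite mulrAC; apply: abnd => //; exact: WV.
have [c Wc hc] := lax_milgram HW bil lin al0 bnd (fun x Wx => acoer (WV Wx)) bnd'.
by exists c.
Qed.

Hypothesis hC : forall v, V v -> W (C v) /\ forall w, W w -> a (C v) w = a v w.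
Hypothesis hC' : forall v, V v -> W (C' v) /\ forall w, W w -> a w (C' v) = a w v.

(** A difference of norm zero replaces equality; for functions it becomes the a.e. equality in
    [UH]. *)
Definition trial x := V x /\ exists2 v, V v & norm (x - (v - C v)) = 0.
Definition test y := V y /\ exists2 v, V v & norm (y - (v - C' v)) = 0.

Lemma form_Bl x y z : V x -> V y -> V z -> a (x - y) z = a x z - a y z.
Proof. by move=> Vx Vy Vz; exact: (linear_onB (abil.2 _ Vz)). Qed.

Lemma form_Br x y z : V x -> V y -> V z -> a z (x - y) = a z x - a z y.
Proof. by move=> Vx Vy Vz; exact: (linear_onB (abil.1 _ Vz)). Qed.

Lemma coercive_null x : V x -> a x x <= 0 -> norm x = 0.
Proof.
move=> Vx h; apply/eqP; rewrite -sqrf_eq0 eq_le sqr_ge0 andbT.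
by rewrite -(pmulr_rle0 _ al0); exact: le_trans (acoer Vx) h.
Qed.

Lemma form_null_l x y : V x -> V y -> norm x = 0 -> a x y = 0.
Proof.
by move=> Vx Vy n0; apply/eqP; have := abnd Vx Vy; rewrite n0 mulr0 mul0r normr_le0.
Qed.

Lemma form_null_r x y : V x -> V y -> norm y = 0 -> a x y = 0.
Proof. by move=> Vx Vy n0; apply/eqP; have := abnd Vx Vy; rewrite n0 mulr0 normr_le0. Qed.

(** Trial vectors form the left orthogonal complement of [W]. Conversely, if [x] is orthogonal to
    [W] then a(C x, C x) = a(x, C x) = 0, so [C x] has norm zero by coercivity and [x] differs from
    [x - C x] by a null vector. *)
Lemma trialP x : V x -> trial x <-> forall w, W w -> a x w = 0.
Proof.
move=> Vx; split=> [[_ [v Vv n0]] w Ww|h].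
  have [WC hc] := hC Vv; have Vw := WV Ww; have VC := WV WC.
  have Vd := semi_hilbertB HV Vv VC.
  have := form_null_l (semi_hilbertB HV Vx Vd) Vw n0.
  by rewrite form_Bl // (form_Bl Vv VC Vw) hc // subrr subr0.
split=> //; exists x => //; have [WC hc] := hC Vx; rewrite subKr.
by apply: coercive_null (WV WC) _; rewrite hc // h.
Qed.

Lemma testP y : V y -> test y <-> forall w, W w -> a w y = 0.
Proof.
move=> Vy; split=> [[_ [v Vv n0]] w Ww|h].
  have [WC hc] := hC' Vv; have Vw := WV Ww; have VC := WV WC.
  have Vd := semi_hilbertB HV Vv VC.
  have := form_null_r Vw (semi_hilbertB HV Vy Vd) n0.
  by rewrite form_Br // (form_Br Vv VC Vw) hc // subrr subr0.
split=> //; exists y => //; have [WC hc] := hC' Vy; rewrite subKr.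
by apply: coercive_null (WV WC) _; rewrite hc // h.
Qed.

Lemma trial_corrected v : V v -> trial (v - C v).
Proof.
move=> Vv; have [WC _] := hC Vv; split; first exact: (semi_hilbertB HV Vv (WV WC)).
by exists v => //; rewrite subrr (ipnorm0 HV).
Qed.

Lemma test_corrected v : V v -> test (v - C' v).
Proof.
move=> Vv; have [WC _] := hC' Vv; split; first exact: (semi_hilbertB HV Vv (WV WC)).
by exists v => //; rewrite subrr (ipnorm0 HV).
Qed.

Lemma testZ (c : R) y : test y -> test (c *: y).
Proof.
move=> ty; have Vy := ty.1; have Vc := semi_hilbertZ HV c Vy.
apply/(testP Vc) => w Ww; have := abil.1 _ (WV Ww) c _ _ Vy (semi_hilbert0 HV).
rewrite addr0 => ->; rewrite ((testP Vy).1 ty w Ww) mulr0 add0r.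
by apply: form_null_r (WV Ww) (semi_hilbert0 HV) _; exact: (ipnorm0 HV).
Qed.

Lemma test0 : test 0.
Proof. by rewrite -(scale0r (0 - C' 0)); apply/testZ/test_corrected; exact: (semi_hilbert0 HV). Qed.

Definition galerkin x := trial x /\ forall y, test y -> a x y = F y.

(** [C u] lies in [W], to which test vectors are orthogonal on the right, so subtracting it does not
    change the values of the form on test vectors. *)
Lemma galerkin_corrected u : V u -> (forall v, V v -> a u v = F v) -> galerkin (u - C u).
Proof.
move=> Vu hu; split; first exact: trial_corrected.
move=> y ty; have Vy := ty.1; have [WC _] := hC Vu.
by rewrite (form_Bl Vu (WV WC) Vy) ((testP Vy).1 ty _ WC) subr0 hu.
Qed.

Lemma galerkin_exists : exists x, galerkin x.
Proof.
have [u Vu hu] := lax_milgram HV abil Flin al0 abnd acoer Fbnd.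
by exists (u - C u); exact: galerkin_corrected.
Qed.

(** The difference d of two solutions is tested with [d - C' d]; orthogonality of trial vectors to
    [W] removes the correction, and a(d, d) = 0 remains. *)
Lemma galerkin_unique x y : galerkin x -> galerkin y -> norm (x - y) = 0.
Proof.
move=> [tx hx] [ty hy]; have [Vx Vy] := (tx.1, ty.1); have Vd := semi_hilbertB HV Vx Vy.
have [WC _] := hC' Vd; have VC := WV WC; have td := test_corrected Vd.
have e1 : a (x - y) (x - y - C' (x - y)) = 0 by rewrite (form_Bl Vx Vy td.1) hx // hy // subrr.
have e2 : a (x - y) (C' (x - y)) = 0.
  by rewrite (form_Bl Vx Vy VC) ((trialP Vx).1 tx _ WC) ((trialP Vy).1 ty _ WC) subrr.
apply: coercive_null => //; move: e1; rewrite (form_Br Vd VC Vd) e2 subr0 => ->.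
exact: lexx.
Qed.

(** With y = x - C' x, orthogonality gives a(y, y) = a(x, y) = a(x, x) = F y. The first equality
    bounds |y| by ca / al |x|, the others give al |x|^2 <= S |y|; together they produce the factor
    al^-2 ca. *)
Lemma galerkin_stable x (S : R) : galerkin x ->
  (forall y, test y -> norm y <= 1 -> `|F y| <= S) -> norm x <= al ^- 2 * ca * S.
Proof.
move=> [tx hx] hS; have Vx := tx.1; have [WC hc] := hC' Vx; have VC := WV WC.
have ty := test_corrected Vx; set y := x - C' x in ty; have Vy := ty.1.
have [n0 m0] : 0 <= norm x /\ 0 <= norm y by rewrite !ipnorm_ge0.
have S0 : 0 <= S.
  by apply: le_trans (hS 0 test0 _); [exact: normr_ge0|rewrite (ipnorm0 HV)].
have ny : al * norm y <= ca * norm x.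
  have [->|ne] := eqVneq (norm y) 0; first by rewrite mulr0 mulr_ge0 // ltW.
  have y0 : 0 < norm y by rewrite lt_def ne.
  rewrite -(ler_pM2r y0) -mulrA -expr2; apply: le_trans (acoer Vy) _.
  have -> : a y y = a x y by rewrite {1}/y (form_Bl Vx VC Vy) ((testP Vy).1 ty _ WC) subr0.
  exact: le_trans (ler_norm _) (abnd Vx Vy).
have Fy : F y <= S * norm y.
  have [e|ne] := eqVneq (norm y) 0.
    by apply: le_trans (ler_norm _) _; apply: le_trans (Fbnd Vy) _; rewrite e !mulr0.
  have y0 : 0 < norm y by rewrite lt_def ne.
  have := hS _ (testZ (norm y)^-1 ty); rewrite (ipnormZ HV _ Vy) normfV ger0_norm // mulVf // => /(_ (lexx _)).
  have := Flin (norm y)^-1 Vy (semi_hilbert0 HV); rewrite addr0 => ->.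
  have -> : F 0 = 0.
    by apply/eqP; have := Fbnd (semi_hilbert0 HV); rewrite (ipnorm0 HV) mulr0 normr_le0.
  rewrite addr0 => h; have := le_trans (ler_norm _) h.
  by rewrite ler_pdivrMl // mulrC.
have E2 : a x x = F y.
  rewrite -hx // /y (form_Br Vx VC Vx) ((trialP Vx).1 tx _ WC) subr0 //.
have h1 : al * norm x ^+ 2 <= S * norm y by rewrite (le_trans (acoer Vx)) // E2.
have [->|ne] := eqVneq (norm x) 0.
  by rewrite !mulr_ge0 // ?invr_ge0 ?sqr_ge0 // ltW.
have x0 : 0 < norm x by rewrite lt_def ne.
have h2 : al * (S * norm y) <= S * (ca * norm x) by rewrite mulrCA; apply: ler_wpM2l.
have h3 : al ^+ 2 * norm x * norm x <= ca * S * norm x.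
  apply: (@le_trans _ _ (al * (S * norm y))).
    have -> : al ^+ 2 * norm x * norm x = al * (al * norm x ^+ 2) by ring.
    by apply: ler_wpM2l => //; exact: ltW.
  by apply: le_trans h2 _; rewrite mulrA [S * ca]mulrC.
rewrite ler_pM2r // in h3.
by rewrite -mulrA ler_pdivlMl ?exprn_gt0.
Qed.

Lemma galerkin_error u x : V u -> (forall v, V v -> a u v = F v) -> galerkin x ->
  norm (u - x - C u) = 0.
Proof.
move=> Vu hu gx; have Vx := gx.1.1; have [WC _] := hC Vu.
have gu := galerkin_corrected Vu hu.
have -> : u - x - C u = u - C u - x by rewrite addrAC.
exact: galerkin_unique.
Qed.

(** The error is [C u] up to a null vector, and al |C u|^2 <= a(C u, C u) = a(u, C u) = F (C u) <= K
    |C u|. *)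
Lemma galerkin_error_le u x : V u -> (forall v, V v -> a u v = F v) -> galerkin x ->
  norm (u - x) <= K / al.
Proof.
move=> Vu hu gx; have Vx := gx.1.1; have [WC hc] := hC Vu; have VC := WV WC.
have n0 := galerkin_error Vu hu gx; have Vd := semi_hilbertB HV Vu Vx.
have le1 : norm (u - x) <= norm (C u).
  have := ipnormD HV (semi_hilbertB HV Vd VC) VC; rewrite subrK n0 add0r; exact.
apply: (le_trans le1); rewrite ler_pdivlMr // mulrC.
have h : al * norm (C u) ^+ 2 <= K * norm (C u).
  apply: le_trans (acoer VC) _; rewrite hc // hu //.
  exact: le_trans (ler_norm _) (Fbnd VC).
have [e|ne] := eqVneq (norm (C u)) 0; last first.
  have c0 : 0 < norm (C u) by rewrite lt_def ne ipnorm_ge0.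
  by move: h; rewrite expr2 mulrA ler_pM2r.
by rewrite e mulr0.
Qed.

End petrov_galerkin.

(** * The multiscale method for the operator in nondivergence form *)

Section multiscale.
Context {R : realType}.
Local Notation pt := (R * R)%type.
Local Notation mR := (measurableTypeR R).
Local Notation pl := (mR * mR)%type.
Implicit Types (f g u v w x y : pt -> R).

Variables (Om : set pt) (alpha : R -> R -> R) (Ca mu : R -> R -> R -> R -> R -> R).
Hypothesis estimates : known_estimates Om alpha Ca mu.
Hypothesis oOm : open Om.
Hypothesis bOm : exists L : R, forall x : pt, Om x -> `|x.1| <= L /\ `|x.2| <= L.
Hypothesis cOm : forall (x y : pt) (t : R), Om x -> Om y -> 0 <= t <= 1 -> Om ((1 - t) *: x + t *: y).
Variables (x0 : pt) (r : R).
Hypothesis r0 : 0 < r.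
Hypothesis boxr : box (x0.1 - r) (x0.1 + r) (x0.2 - r) (x0.2 + r) `<=` Om.
Local Notation aeq := (ae_eq leb2 (Om : set pl)).
Local Notation normH2 := (ipnorm (ipH2 Om)).

(** The boundedness estimate is stated for pairs of subdomains; its global form takes both equal to
    [Om], which is connected as a union of segments issuing from [x0]. *)
Lemma domain_subdomain : subdomain Om Om.
Proof.
split=> //; have c0 : Om x0 by exact: (center_in r0 boxr).
pose seg (y : pt) := (fun t : R => (1 - t) *: x0 + t *: y) @` `[0, 1]%classic.
have -> : Om = \bigcup_(y in Om) seg y.
  apply/seteqP; split=> [y Oy|y [z Oz [t]]].
    by exists y => //; exists 1; rewrite ?subrr ?scale0r ?add0r ?scale1r //= in_itv /= ler01 lexx.
  by rewrite /= in_itv /= => t01 <-; exact: cOm.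
apply: bigcup_connected.
  by exists x0 => y _; exists 0; rewrite ?subr0 ?scale1r ?scale0r ?addr0 //= in_itv /= lexx ler01.
move=> y Oy; apply: connected_continuous_connected.
  exact: segment_connected.
apply: continuous_subspaceT => t; apply: cvgD; apply: cvgZ; try exact: cvg_cst; last exact: cvg_id.
by apply: cvgB; [exact: cvg_cst|exact: cvg_id].
Qed.

(** The dictionary between a.e. equality in the definitions of the spaces and norm zero in the
    abstract Petrov-Galerkin argument. *)
Lemma aeq_normH2 x y : V Om x -> V Om y -> aeq x y <-> normH2 (x - y) = 0.
Proof.
move=> Vx Vy; have HH := sobolev_base_H2 oOm bOm; have Vd := semi_hilbertB (semi_hilbert_V oOm bOm) Vx Vy.
split=> [e|n0].
  by have [_ ->] := sb_ae HH Vy.1 Vx.1.1.1 (aeq_sym e).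
have l0 : L2norm Om (x - y) = 0.
  by apply/eqP; rewrite eq_le L2norm_ge0 andbT -n0; exact: (L2norm_le_H2 oOm bOm).
have d0 := aeq_L2norm0 oOm Vd.1.1.1 l0.
by apply: (ae_mono d0) => z h Oz; apply/eqP; rewrite -subr_eq0; apply/eqP; exact: h Oz.
Qed.

Variables (D : @coeffs R) (zeta1 zeta2 delta lam : R) (f : pt -> R) (M : mesh Om).
Hypotheses (adm : admissible Om D zeta1 zeta2 delta lam) (hf : L2 Om f).
Let al := alpha (diam Om) delta.
Let ca := Ca zeta1 zeta2 lam (normb Om D) (normc Om D).
Let m := mu zeta1 zeta2 lam (normb Om D) (normc Om D).
Let H := meshsize M.
Local Notation a := (a_form Om D lam).
Local Notation F := (F_form Om D lam f).
Let HV := semi_hilbert_V oOm bOm.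
Let HW := semi_hilbert_W oOm bOm cOm r0 boxr M.
Let abil := a_form_bilinear oOm bOm adm.
Let Flin := F_form_linear oOm bOm adm hf.
Let WV : W M `<=` V Om. Proof. by move=> v []. Qed.
Let pos := estimates_pos estimates adm.
Let al0 : 0 < al. Proof. by case: pos. Qed.
Let ca0 : 0 < ca. Proof. by case: pos. Qed.
Let m0 : 0 < m. Proof. by case: pos. Qed.

Let abnd x y : V Om x -> V Om y -> `|a x y| <= ca * normH2 x * normH2 y.
Proof.
move=> Vx Vy; have sub := domain_subdomain.
have h := estimate_bounded estimates adm sub sub Vx Vy (fun z Oz nOz => False_ind _ (nOz Oz))
  (fun z Oz nOz => False_ind _ (nOz Oz)).
by rewrite -!(VnormE oOm bOm); move: h; rewrite setIid.
Qed.

Let acoer x : V Om x -> al * normH2 x ^+ 2 <= a x x.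
Proof. by move=> Vx; have h := estimate_coercive estimates adm Vx; rewrite (VnormE oOm bOm) in h; exact: h. Qed.

Let Fbnd x : V Om x -> `|F x| <= m * L2norm Om f * normH2 x.
Proof. by move=> Vx; have h := estimate_F estimates adm hf Vx; rewrite (VnormE oOm bOm) in h; exact: h. Qed.

Let K0 : 0 <= m * L2norm Om f. Proof. by apply: mulr_ge0; [exact: ltW|exact: L2norm_ge0]. Qed.

Let hC v : V Om v -> W M (corr M D lam v) /\ forall w, W M w -> a (corr M D lam v) w = a v w.
Proof.
move=> Vv; have [c hc] := corrector_exists HW WV abil al0 abnd acoer Vv.
by rewrite /corr; case: xgetP => [c' _|/(_ c)/(_ hc)].
Qed.

Let hC' v : V Om v -> W M (corr_adj M D lam v) /\ forall w, W M w -> a w (corr_adj M D lam v) = a w v.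
Proof.
move=> Vv; have [c hc] := adjoint_corrector_exists HW WV abil al0 abnd acoer Vv.
by rewrite /corr_adj; case: xgetP => [c' _|/(_ c)/(_ hc)].
Qed.

Lemma UHP x : UH M D lam x <-> trial (ipH2 Om) (V Om) (corr M D lam) x.
Proof.
by split=> -[Vx [v Vv h]]; split=> //; exists v => //;
  apply/(aeq_normH2 Vx (semi_hilbertB HV Vv (WV (hC Vv).1))).
Qed.

Lemma VHP x : VH M D lam x <-> test (ipH2 Om) (V Om) (corr_adj M D lam) x.
Proof.
by split=> -[Vx [v Vv h]]; split=> //; exists v => //;
  apply/(aeq_normH2 Vx (semi_hilbertB HV Vv (WV (hC' Vv).1))).
Qed.

Lemma multiscaleP x : multiscale_solution M D lam f x <->
  galerkin (ipH2 Om) (V Om) a F (corr M D lam) (corr_adj M D lam) x.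
Proof.
split=> -[tx hx]; split; try exact/UHP; move=> y /VHP; exact: hx.
Qed.

(** [sup] is a genuine supremum only for nonempty sets bounded above: 0 provides an element, the
    bound on [F] an upper bound. The latter is the second inequality of (i). *)
Lemma dual_norm_sup : has_sup [set k | exists v, [/\ VH M D lam v, Vnorm Om v <= 1 & k = `|F v|]] /\
  ubound [set k | exists v, [/\ VH M D lam v, Vnorm Om v <= 1 & k = `|F v|]] (m * L2norm Om f).
Proof.
have ub : ubound [set k | exists v, [/\ VH M D lam v, Vnorm Om v <= 1 & k = `|F v|]] (m * L2norm Om f).
  move=> _ [v [tv nv ->]]; apply: le_trans (Fbnd tv.1) _.
  by rewrite (VnormE oOm bOm) in nv; exact: (ler_piMr K0 nv).
split=> //; split; last by exists (m * L2norm Om f).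
exists `|F 0|, 0; split=> //; last by rewrite (VnormE oOm bOm) (ipnorm0 HV) ler01.
exact/VHP/(test0 HV WV abil al0 abnd acoer hC').
Qed.

Lemma error_estimate u x : V Om u -> (forall v, V Om v -> a u v = F v) ->
  multiscale_solution M D lam f x -> [/\ u \- x = corr M D lam u %[ae leb2 in Om],
    W M (corr M D lam u) /\ W M (u \- x), forall i : 'I_(nqoi M), qoi i x = qoi i u &
    L2norm Om (u \- x) + H * L2norm Om (enorm \o grad Om (u \- x))
      <= 6 * (1 + `|m / al|) * H ^+ 2 * L2norm Om f].
Proof.
move=> Vu hu /multiscaleP gx; have Vx : V Om x := gx.1.1.
have [WC _] := hC Vu; have VC := WV WC; have Vd : V Om (u \- x) := semi_hilbertB HV Vu Vx.
have n0 : normH2 (u \- x - corr M D lam u) = 0.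
  exact: (galerkin_error HV WV abil al0 abnd acoer hC hC' Vu hu gx).
(* The error is known to be [corr M D lam u] only up to H^2 norm zero; boundedness of the quantities
   of interest makes this harmless. *)
have q0 (i : 'I_(nqoi M)) : qoi i (u \- x) = 0.
  have [C [lin bnd]] := qoi_bounded oOm bOm cOm r0 boxr i.
  have := linear_onB lin Vd.1 VC.1; rewrite WC.2 subr0 => <-.
  apply/eqP; rewrite -normr_le0; apply: le_trans (bnd _ _) _; first exact: (semi_hilbertB HV Vd VC).1.
  by rewrite n0 mulr0.
have Wd : W M (u \- x) by split.
split=> //.
- exact/(aeq_normH2 Vd VC).
- move=> i; have [C [lin _]] := qoi_bounded oOm bOm cOm r0 boxr i.
  by have := linear_onB lin Vu.1 Vx.1; rewrite [X in X = _](q0 i) => /esym/eqP; rewrite subr_eq0 => /eqP.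
have nodes k : ptval Om (u \- x) (node (m := M) k) = 0.
  have := q0 (unsplit (inr k)); rewrite /qoi unsplitK; exact.
apply: le_trans (fine_scale_interpolation oOm bOm cOm r0 boxr Vd nodes) _.
have h := galerkin_error_le HV WV abil al0 K0 abnd acoer Fbnd hC hC' Vu hu gx.
rewrite (VnormE oOm bOm) -/H; have f0 : 0 <= L2norm Om f by exact: L2norm_ge0.
apply: le_trans (ler_wpM2l _ h) _; first by rewrite mulr_ge0 ?sqr_ge0.
have e : `|m / al| = m / al by rewrite ger0_norm // divr_ge0 // ltW.
have -> : 6 * H ^+ 2 * (m * L2norm Om f / al) = 6 * (m / al) * H ^+ 2 * L2norm Om f by ring.
apply: ler_wpM2r => //; apply: ler_wpM2r; first exact: sqr_ge0.
by rewrite e; apply: ler_wpM2l => //; rewrite lerDr.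
Qed.

Lemma multiscale_main : exists uH, [/\ multiscale_solution M D lam f uH,
    forall w, multiscale_solution M D lam f w -> w = uH %[ae leb2 in Om] &
    Vnorm Om uH <= al ^- 2 * ca * F_dual_norm M D lam f /\
    al ^- 2 * ca * F_dual_norm M D lam f <= al ^- 2 * m * ca * L2norm Om f].
Proof.
have [uH gH] := galerkin_exists HV WV abil Flin al0 abnd acoer Fbnd hC hC'.
have [hs ub] := dual_norm_sup.
have k0 : 0 <= al ^- 2 * ca by rewrite mulr_ge0 ?invr_ge0 ?sqr_ge0 // ltW.
exists uH; split; first exact/multiscaleP.
- move=> w /multiscaleP gw; apply/(aeq_normH2 gw.1.1 gH.1.1).
  exact: (galerkin_unique HV WV abil al0 abnd acoer hC hC' gw gH).
split.
  rewrite (VnormE oOm bOm); apply: (galerkin_stable HV WV abil Flin al0 ca0 abnd acoer Fbnd hC hC' gH).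
  move=> y /VHP ty ny; apply: (sup_upper_bound hs); exists y; split=> //.
  by rewrite (VnormE oOm bOm).
have -> : al ^- 2 * m * ca * L2norm Om f = al ^- 2 * ca * (m * L2norm Om f) by ring.
by apply: ler_wpM2l => //; apply: ge_sup => //; exact: hs.1.
Qed.

End multiscale.

Theorem theorem3p1 (R : realType) (Om : set (R * R))
    (alpha : R -> R -> R) (Ca mu : R -> R -> R -> R -> R -> R)
    (polygonal : convex_polygon Om)
    (estimates : known_estimates Om alpha Ca mu) :
  exists C : R -> R -> R -> R -> R -> R -> R -> R,
    (forall rho zeta1 zeta2 delta lam nb nc,
       0 < C rho zeta1 zeta2 delta lam nb nc) /\
    forall (D : @coeffs R) (zeta1 zeta2 delta lam : R) (f : R * R -> R)
      (M : mesh Om),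
    admissible Om D zeta1 zeta2 delta lam ->
    L2 Om f ->
    let al := alpha (diam Om) delta in
    let ca := Ca zeta1 zeta2 lam (normb Om D) (normc Om D) in
    let m := mu zeta1 zeta2 lam (normb Om D) (normc Om D) in
    let H := meshsize M in
    exists uH : R * R -> R,
      [/\ multiscale_solution M D lam f uH,
          forall w, multiscale_solution M D lam f w -> w = uH %[ae leb2 in Om],
          Vnorm Om uH <= al ^- 2 * ca * F_dual_norm M D lam f /\
          al ^- 2 * ca * F_dual_norm M D lam f
            <= al ^- 2 * m * ca * L2norm Om f &
          forall u, strong_solution Om D f u ->
            [/\ u \- uH = corr M D lam u %[ae leb2 in Om],
                W M (corr M D lam u) /\ W M (u \- uH),
                forall i : 'I_(nqoi M), qoi i uH = qoi i u &
                L2norm Om (u \- uH) + H * L2norm Om (enorm \o grad Om (u \- uH))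
                  <= C (meshrho M) zeta1 zeta2 delta lam (normb Om D) (normc Om D)
                     * H ^+ 2 * L2norm Om f]].
Proof.
have [oOm bOm cOm [x0 [r r0 boxr]]] := convex_polygon_domain polygonal.
(* The absolute value and the 1 only make the constant positive for parameters
   to which no admissible coefficients correspond. *)
exists (fun _ zeta1 zeta2 delta lam nb nc => 6 * (1 + `|mu zeta1 zeta2 lam nb nc / alpha (diam Om) delta|)).
split=> [rho zeta1 zeta2 delta lam nb nc|D zeta1 zeta2 delta lam f M adm hf al ca m H].
  by rewrite mulr_gt0 // ltr_pwDl.
have [uH [sol uniq stab]] := multiscale_main estimates oOm bOm cOm r0 boxr M adm hf.
exists uH; split=> // u su; have Vu := su.1.
apply: (error_estimate estimates oOm bOm cOm r0 boxr adm hf Vu _ sol) => v Vv.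
exact: (strong_solution_weak oOm adm hf su Vv).
Qed.
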